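(* Let $n\ge 1$ and $\gamma\in\left(\frac{n}{2},\frac{n}{2}+1\right)\cup\left(\frac{n}{2}+1,\frac{n}{2}+2\right)$. For every function $f\in H^{\gamma}(\mathbb{S}^n)$ with $f>0$ on $\mathbb{S}^n$, $$a_{2\gamma}(f)\ \ge\ \frac{\Gamma\left(\frac{n}{2}+\gamma\right)}{\Gamma\left(\frac{n}{2}-\gamma\right)}\,|\mathbb{S}^n|^{\frac{2\gamma}{n}}\,\|f\|^2_{L^{\frac{2n}{n-2\gamma}}(\mathbb{S}^n)}.$$ Equality holds if and only if there exist a conformal transformation $\varphi:\mathbb{S}^n\to\mathbb{S}^n$ and a constant $c>0$ such that $f=c\,(\det \mathrm{d}\varphi)^{\frac{n-2\gamma}{2n}}$.
   Context: $\mathbb{S}^n=\{x\in\mathbb{R}^{n+1}:|x|=1\}$ with its round metric, volume measure $dV_{\mathbb{S}^n}$ and total volume $|\mathbb{S}^n|$. Let $\mathscr{H}_l$ be the space of spherical harmonics of degree $l$. For $\gamma>0$ the operator $P_{2\gamma}$ is defined on $f=\sum_{l\ge0}Y_l$, $Y_l\in\mathscr H_l$, by $P_{2\gamma}f=\sum_{l\ge 0}\frac{\Gamma(l+\frac n2+\gamma)}{\Gamma(l+\frac n2-\gamma)}Y_l$, with the convention $\frac{1}{\Gamma(m)}=0$ for $m\in\{0,-1,-2,\dots\}$. Set $a_{2\gamma}(f)=\int_{\mathbb{S}^n}fP_{2\gamma}f\,dV_{\mathbb{S}^n}$. For an exponent $p<0$ (here $p=\frac{2n}{n-2\gamma}<0$)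 and $f>0$, $\|f\|_{L^p(\mathbb S^n)}=\left(\int_{\mathbb S^n}f^p\,dV_{\mathbb S^n}\right)^{1/p}$. For a conformal transformation $\varphi$ of $\mathbb S^n$, $\det\mathrm d\varphi$ denotes its Jacobian determinant with respect to the round metric, i.e. $\varphi^*g_{\mathbb S^n}=(\det\mathrm d\varphi)^{2/n}g_{\mathbb S^n}$.
   Formalization: ''Conformal transformation'' is taken to mean an element of the Möbius group of the sphere; for n≥2 this is every conformal diffeomorphism (Liouville), while for n=1, where every diffeomorphism is conformal, the equality claim would otherwise be false. *)

(* Defs.v *)
From mathcomp Require Import all_boot all_order all_algebra.
From mathcomp Require Import all_classical all_reals all_analysis.
From mathcomp Require mpoly.

Set Implicit Arguments.
Unset Strict Implicit.
Unset Printing Implicit Defensive.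

Import Order.TTheory GRing.Theory Num.Theory.
Local Open Scope classical_set_scope.
Local Open Scope ring_scope.

Section Defs.
Variable R : realType.

Definition dotv (m : nat) (u v : 'rV[R]_m) : R := \sum_(i < m) u ord0 i * v ord0 i.

Definition sphere (n : nat) : set 'rV[R]_n.+1 := [set x | dotv x x = 1].

Definition sph_lift (k : nat) (t : R) (y : 'rV[R]_k.+1) : 'rV[R]_k.+2 :=
  \row_(i < k.+2) match unlift ord0 i with
                  | Some j => Num.sqrt (1 - t ^+ 2) * y ord0 j
                  | None => t
                  end.

(* Integral over S^k with respect to the round volume measure dV_{S^k},
   defined by the standard slicing formula
     dV_{S^{k+1}} = (1-t^2)^{(k-1)/2} dt dV_{S^k},   S^0 = {1,-1} (counting). *)
Fixpoint sphere_int (k : nat) : ('rV[R]_k.+1 -> R) -> R :=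
  match k return ('rV[R]_k.+1 -> R) -> R with
  | 0 => fun g => g (const_mx 1) + g (const_mx (-1))
  | k'.+1 => fun g =>
      Rintegral (@lebesgue_measure R) `]-1, 1[%classic
        (fun t => powR (1 - t ^+ 2) ((k'%:R - 1) / 2)
                  * sphere_int (fun y => g (sph_lift t y)))
  end.

Definition sphere_vol (n : nat) : R := sphere_int (fun _ : 'rV[R]_n.+1 => 1).

(* Euler Gamma function: the Euler integral for x > 0, extended to all
   real x by the functional equation Gamma(x) = Gamma(x+k)/(x(x+1)...(x+k-1)). *)
Definition EulerGamma (x : R) : R :=
  Rintegral (@lebesgue_measure R) `]0, +oo[%classic
    (fun t => powR t (x - 1) * expR (- t)).

Definition Gamma (x : R) : R :=
  let k := (`|Num.floor x|%N).+1 in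
  EulerGamma (x + k%:R) / \prod_(j < k) (x + j%:R).

Definition recipGamma (x : R) : R :=
  if (x \is a Num.int) && (x <= 0) then 0 else (Gamma x)^-1.

Definition peval (n : nat) (p : mpoly.mpoly n.+1 R) (x : 'rV[R]_n.+1) : R :=
  mpoly.meval (fun i => x ord0 i) p.

Definition harm_hom (n l : nat) (p : mpoly.mpoly n.+1 R) : Prop :=
  all [pred m | mpoly.mdeg m == l] (mpoly.msupp p) /\
  \sum_(i < n.+1) mpoly.mderiv i (mpoly.mderiv i p) = 0.

Definition is_sph_harm (n l : nat) (Y : 'rV[R]_n.+1 -> R) : Prop :=
  exists p, harm_hom l p /\ Y = peval p.

Definition sph_proj (n l : nat) (f : 'rV[R]_n.+1 -> R) : 'rV[R]_n.+1 -> R :=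
  xget (fun _ => 0)
    [set Y : 'rV[R]_n.+1 -> R | is_sph_harm l Y /\
       forall Z : 'rV[R]_n.+1 -> R, is_sph_harm l Z ->
         sphere_int (fun x => (f x - Y x) * Z x) = 0].

Definition proj_sqnorm (n l : nat) (f : 'rV[R]_n.+1 -> R) : R :=
  sphere_int (fun x => sph_proj l f x ^+ 2).

(* eigenvalue of P_{2 gamma} on H_l *)
Definition Pcoef (n : nat) (gam : R) (l : nat) : R :=
  Gamma (l%:R + n%:R / 2 + gam) * recipGamma (l%:R + n%:R / 2 - gam).

Definition in_H (n : nat) (gam : R) (f : 'rV[R]_n.+1 -> R) : Prop :=
  cvgn (fun N => \sum_(l < N) powR (1 + l%:R) (2 * gam) * proj_sqnorm l f).

(* a_{2 gamma}(f) = int f P_{2 gamma} f = sum_l Pcoef l * ||Y_l||^2 *)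
Definition a2g (n : nat) (gam : R) (f : 'rV[R]_n.+1 -> R) : R :=
  limn (fun N => \sum_(l < N) Pcoef n gam l * proj_sqnorm l f).

(* || f ||_{L^p(S^n)} for f > 0 (used with p < 0) *)
Definition Lpnorm (n : nat) (p : R) (f : 'rV[R]_n.+1 -> R) : R :=
  powR (sphere_int (fun x => powR (f x) p)) p^-1.

(* Conformal transformations of S^n: the Moebius group of S^n, generated by
   reflections in hyperplanes through 0 and inversions in spheres orthogonal
   to S^n (as maps of R^{n+1}, smooth near S^n). *)
Definition hrefl (m : nat) (u : 'rV[R]_m) (x : 'rV[R]_m) : 'rV[R]_m :=
  x - (2 * dotv x u) *: u.

Definition sinv (m : nat) (a : 'rV[R]_m) (x : 'rV[R]_m) : 'rV[R]_m :=
  a + ((dotv a a - 1) / dotv (x - a) (x - a)) *: (x - a).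

Inductive conformal (n : nat) : ('rV[R]_n.+1 -> 'rV[R]_n.+1) -> Prop :=
| conf_id : @conformal n id
| conf_refl (u : 'rV[R]_n.+1) phi :
    dotv u u = 1 -> @conformal n phi -> @conformal n (hrefl u \o phi)
| conf_inv (a : 'rV[R]_n.+1) phi :
    1 < dotv a a -> @conformal n phi -> @conformal n (sinv a \o phi).

(* J = det d(phi) on S^n, characterized by phi^* g = J^{2/n} g:
   |d phi_x v|^2 = J(x)^{2/n} |v|^2 for every tangent vector v at x. *)
Definition is_det_dphi (n : nat) (phi : 'rV[R]_n.+1 -> 'rV[R]_n.+1)
  (J : 'rV[R]_n.+1 -> R) : Prop :=
  forall x, @sphere n x ->
    0 < J x /\
    forall v : 'rV[R]_n.+1, dotv x v = 0 ->
      derivable phi x v /\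
      dotv ('D_v phi x) ('D_v phi x) = powR (J x) (2 / n%:R) * dotv v v.

End Defs.

Arguments sphere {R} n.
Arguments sphere_vol R n.
Arguments in_H {R} n gam f.
Arguments a2g {R} n gam f.
Arguments Lpnorm {R} n p f.
Arguments conformal {R} n _.
Arguments is_det_dphi {R} n phi J.
Arguments proj_sqnorm {R} n l f.
Arguments sph_proj {R} n l f.
Arguments is_sph_harm {R} n l Y.
Arguments sphere_int {R} k _.
Arguments Pcoef {R} n gam l.

(* Main.v *)
Require Import Defs.
From mathcomp Require Import all_boot all_order all_algebra.
From mathcomp Require Import all_classical all_reals all_analysis.
From mathcomp Require mpoly.
From mathcomp Require Import measurable_realfun.
From mathcomp Require Import ring lra zify.
Import Order.TTheory GRing.Theory Num.Theory.
Import numFieldNormedType.Exports.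
Set Implicit Arguments.
Unset Strict Implicit.
Unset Printing Implicit Defensive.
Local Open Scope classical_set_scope.
Local Open Scope ring_scope.
Import -(notations) mpoly.

(* Put s = gamma - n/2. The kernel (1 - x.y)^s has Funk-Hecke eigenvalues proportional to the inverses of
   the eigenvalues of P_{2 gamma}; as it transforms by factors j(x)^s j(y)^s under conformal maps, the action
   u -> j^(-s) (u o phi) preserves the energy a_{2 gamma} as well as the integral of u^(-n/s). Each positive u
   can be moved by this action so that b -> int u w_b^(n+s), with w_b the conformal factors of the Moebius maps
   indexed by the open ball, is minimal at b = 0; then u is orthogonal to H_1.
   If 1 < s < 2, only the coefficient of H_1 is negative, so that a_{2 gamma}(u) is at least the energy of the
   mean of u, and Jensen's inequality concludes.
   If 0 < s < 1, only the coefficient of H_0 is negative. A bound on the energy then gives a Hoelder modulus,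
   whence compactness of the centered functions of mean 1 and nonpositive energy; these have no zeros, since an
   inversion concentrated near a zero would violate the centering. Testing a maximizer u with u + t and
   u + t x_i gives two inequalities between the integrals of u^(-n/s-1) and u^(-n/s-2) which, compared by
   Chebyshev's inequality, force u to be constant. *)

(** * Continuous functions on the sphere *)

(** The conformal covariance of P_{2 gamma} enters through the inverse operator: P_{2 gamma} has
    order n + 2 s, but for s > 0 its Green kernel, a multiple of (1 - x.y)^s, has no singularity. At
    the excluded value s = 1 this kernel is a polynomial in x.y, and its eigenvalues vanish from
    degree 2 on. Jensen's inequality bounds the mean of u^(-n/s) from below. This is the useful
    direction when the coefficient of H_0 is positive, and the wrong one when it is negative; hence
    the compactness argument for 0 < s < 1. The obstacle there is the noncompact conformal group,
    along which a maximizing sequence may degenerate; the centering rules this out. Integrals over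
    the sphere are iterated one-dimensional integrals, so rotation invariance is not visible from
    the definition. It is obtained from polynomial kernels in x.y, which separate into finite sums
    and so also take the place of Fubini's theorem. Energies are handled as upper bounds on partial
    sums, a notion stable under uniform limits, so that no convergence question arises for the
    transformed functions. *)

Section Dot.
Context {R : realType}.
Implicit Types (m : nat).

Lemma dotvC m (x y : 'rV[R]_m) : dotv x y = dotv y x.
Proof. by apply: eq_bigr => i _; rewrite mulrC. Qed.

Lemma dotvDl m (x y z : 'rV[R]_m) : dotv (x + y) z = dotv x z + dotv y z.
Proof. by rewrite -big_split; apply: eq_bigr => i _ /=; rewrite mxE mulrDl. Qed.

Lemma dotvZl m c (x z : 'rV[R]_m) : dotv (c *: x) z = c * dotv x z.
Proof. by rewrite mulr_sumr; apply: eq_bigr => i _ /=; rewrite mxE mulrA. Qed.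

Lemma dotvNl m (x z : 'rV[R]_m) : dotv (- x) z = - dotv x z.
Proof. by rewrite -scaleN1r dotvZl mulN1r. Qed.

Lemma dotvDr m (x y z : 'rV[R]_m) : dotv z (x + y) = dotv z x + dotv z y.
Proof. by rewrite dotvC dotvDl !(dotvC z). Qed.

Lemma dotvZr m c (x z : 'rV[R]_m) : dotv z (c *: x) = c * dotv z x.
Proof. by rewrite dotvC dotvZl dotvC. Qed.

Lemma dotvNr m (x z : 'rV[R]_m) : dotv z (- x) = - dotv z x.
Proof. by rewrite dotvC dotvNl dotvC. Qed.

Lemma dotvBr m (x y z : 'rV[R]_m) : dotv z (x - y) = dotv z x - dotv z y.
Proof. by rewrite dotvDr dotvNr. Qed.

Lemma dotv0l m (z : 'rV[R]_m) : dotv 0 z = 0.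
Proof. by rewrite -(scale0r 0) dotvZl mul0r. Qed.

Definition dotvE := (dotvDl, dotvDr, dotvNl, dotvNr, dotvZl, dotvZr).

Lemma dotv_ge0 m (x : 'rV[R]_m) : 0 <= dotv x x.
Proof. by apply: sumr_ge0 => i _; rewrite -expr2 sqr_ge0. Qed.

Lemma sqr_coord_le m (x : 'rV[R]_m) i : x ord0 i ^+ 2 <= dotv x x.
Proof.
rewrite /dotv (bigD1 i) //= -expr2 lerDl.
by apply: sumr_ge0 => j _; rewrite -expr2 sqr_ge0.
Qed.

Lemma dotv_eq0 m (x : 'rV[R]_m) : dotv x x = 0 -> x = 0.
Proof.
move=> x0; apply/rowP => i; rewrite mxE; apply/eqP.
by rewrite -sqrf_eq0 eq_le sqr_ge0 -x0 sqr_coord_le.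
Qed.

Lemma dotv_gt0 m (x : 'rV[R]_m) : x != 0 -> 0 < dotv x x.
Proof.
by move=> x0; rewrite lt_def dotv_ge0 andbT; apply: contraNneq x0 => /dotv_eq0 ->.
Qed.

Lemma dist_sphere n (x y : 'rV[R]_n.+1) : sphere n x -> sphere n y ->
  dotv (x - y) (x - y) = 2 * (1 - dotv x y).
Proof.
rewrite /sphere /= => x1 y1.
rewrite !dotvE x1 y1 (dotvC y x); ring.
Qed.

Lemma dotv_le1 n (x y : 'rV[R]_n.+1) : sphere n x -> sphere n y -> dotv x y <= 1.
Proof.
by move=> x1 y1; have := dotv_ge0 (x - y); rewrite dist_sphere//; lra.
Qed.

Lemma sphereN n (x : 'rV[R]_n.+1) : sphere n x -> sphere n (- x).
Proof. by rewrite /sphere /= dotvNl dotvNr opprK. Qed.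

Lemma dotv_geN1 n (x y : 'rV[R]_n.+1) : sphere n x -> sphere n y -> - 1 <= dotv x y.
Proof.
by move=> x1 y1; rewrite -[leRHS]opprK lerN2 -dotvNr dotv_le1//; exact: sphereN.
Qed.

Lemma ler_coord_norm m (x : 'rV[R]_m) i : `|x ord0 i| <= `|x|.
Proof.
rewrite [leRHS]/Num.Def.normr /= mx_normrE.
by have := @le_bigmax _ R _ 0 (fun j => `|x j.1 j.2|) (ord0, i).
Qed.

Lemma norm_le_coord m (x : 'rV[R]_m) e : 0 <= e ->
  (forall i, `|x ord0 i| <= e) -> `|x| <= e.
Proof.
move=> e0 h; rewrite [leLHS]/Num.Def.normr /= mx_normrE.
by apply/bigmax_leP; split=> // -[i j] _ /=; rewrite (ord1 i) h.
Qed.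

Lemma norm2_le_dotv m (x : 'rV[R]_m) : `|x| ^+ 2 <= dotv x x.
Proof.
rewrite -(sqr_sqrtr (dotv_ge0 x)) ler_sqr ?nnegrE ?sqrtr_ge0//.
apply: norm_le_coord; first exact: sqrtr_ge0.
by move=> i; rewrite -sqrtr_sqr ler_wsqrtr// sqr_coord_le.
Qed.

Lemma dotv_continuous (T : topologicalType) m (f g : T -> 'rV[R]_m) :
  continuous f -> continuous g -> continuous (fun x => dotv (f x) (g x)).
Proof.
move=> cf cg; rewrite /dotv.
apply: continuous_big => [|i _ x]; first exact: add_continuous.
have h (k : T -> 'rV[R]_m) : continuous k -> {for x, continuous (fun y => k y ord0 i)}.
  move=> ck; apply: (@continuous_comp _ _ _ k (fun M : 'rV[R]_m => M ord0 i)).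
    exact: ck.
  exact: coord_continuous.
exact: (cvgM (h f cf) (h g cg)).
Qed.

Lemma sphere_closed n : closed (@sphere R n).
Proof.
rewrite (_ : sphere n = (fun x : 'rV[R]_n.+1 => dotv x x) @^-1` [set 1])//.
apply: preimage_closed; last exact: closed_eq.
by move=> x _; apply: dotv_continuous => y; exact: cvg_id.
Qed.

Lemma sphere_norm_le1 n (x : 'rV[R]_n.+1) : sphere n x -> `|x| <= 1.
Proof.
move=> x1; rewrite -(ler_sqr)?nnegrE// expr1n; apply: le_trans (norm2_le_dotv x) _.
by rewrite x1.
Qed.

Lemma sphere_compact n : compact (@sphere R n).
Proof.
apply: bounded_closed_compact; last exact: sphere_closed.
exists 1; split; first exact: num_real.
by move=> M M1 x /sphere_norm_le1 h; apply: le_trans h _; exact: ltW.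
Qed.

Lemma sphere_delta n i : sphere n (delta_mx ord0 i : 'rV[R]_n.+1).
Proof.
rewrite /sphere /= /dotv (bigD1 i) //= big1 ?addr0 ?mxE ?eqxx ?mulr1// => j ji.
by rewrite !mxE (negbTE ji) andbF mulr0.
Qed.

Lemma sphere_neq0 n : exists x : 'rV[R]_n.+1, sphere n x.
Proof. by exists (delta_mx ord0 ord0); exact: sphere_delta. Qed.

End Dot.

Lemma continuous_powRl {R : realType} (p x : R) : 0 < x -> {for x, continuous (fun t => t `^ p)}.
Proof.
move=> x0; rewrite /prop_for /continuous_at {2}/powR gt_eqF//.
apply: (@cvg_trans _ ((fun t : R => expR (p * ln t)) @ nbhs x)).
  apply: near_eq_cvg; near=> t; rewrite /powR gt_eqF//.
  by near: t; exact: lt_nbhsr.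
apply: (@continuous_comp _ _ _ (fun t => p * ln t) expR); last exact: continuous_expR.
by apply: cvgM; [exact: cvg_cst|exact: continuous_ln].
Unshelve. all: by end_near. Qed.

Lemma continuous_withinP {V U : topologicalType} (A : set V) (g : V -> U) :
  {within A, continuous g} <-> forall x, A x -> g y @[y --> within A (nbhs x)] --> g x.
Proof.
split=> [h x Sx|h].
  by rewrite (nbhs_subspace_in Sx); exact: h.
move=> x; suff H (z : V) B : nbhs (g z) B -> @nbhs_subspace V A z (g @^-1` B) by move=> B; exact: H.
move=> HB; case: (pselect (A z)) => Sz.
  by have E := @nbhs_subspace_in V A z Sz; rewrite -E; exact: h.
by have E := @nbhs_subspace_out V A z Sz; rewrite -E => y /= ->; exact: nbhs_singleton HB.
Qed.

Section Cts.
Context {R : realType} (n : nat).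
Local Notation V := 'rV[R]_n.+1.
Local Notation S := (@sphere R n).

(** A wrapper with one constructor, so that unification does not unfold the subspace topology;
    [ctsP] is the form in terms of filters. *)
Variant cts {U : topologicalType} (g : V -> U) : Prop := Cts of {within S, continuous g}.

Lemma ctsP {U : topologicalType} (g : V -> U) :
  cts g <-> forall x, S x -> g y @[y --> within S (nbhs x)] --> g x.
Proof. by split=> [[/continuous_withinP//]|h]; split; apply/continuous_withinP. Qed.

Lemma cts_eq {U : topologicalType} (f g : V -> U) :
  (forall x, S x -> f x = g x) -> cts f -> cts g.
Proof.
move=> fg /ctsP cf; apply/ctsP => x Sx; rewrite -fg//.
apply: cvg_trans (cf x Sx); apply: near_eq_cvg.
by rewrite near_withinE; near=> y => Sy; rewrite fg.
Unshelve. all: by end_near.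
Qed.

Lemma ctsT {U : topologicalType} (f : V -> U) : continuous f -> cts f.
Proof. by move=> cf; split; exact: continuous_subspaceT. Qed.

Lemma cts_cst {U : topologicalType} (c : U) : cts (fun _ => c).
Proof. by apply: ctsT; exact: cst_continuous. Qed.

Arguments cts_cst {U}.

Lemma ctsD (f g : V -> R) : cts f -> cts g -> cts (fun x => f x + g x).
Proof.
by move=> /ctsP cf /ctsP cg; apply/ctsP => x Sx; apply: cvgD; [exact: cf|exact: cg].
Qed.

Lemma ctsM (f g : V -> R) : cts f -> cts g -> cts (fun x => f x * g x).
Proof.
by move=> /ctsP cf /ctsP cg; apply/ctsP => x Sx; apply: cvgM; [exact: cf|exact: cg].
Qed.

Lemma ctsZ c (f : V -> R) : cts f -> cts (fun x => c * f x).
Proof. by move=> cf; apply: ctsM => //; exact: cts_cst. Qed.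

Lemma ctsN (f : V -> R) : cts f -> cts (fun x => - f x).
Proof. by move=> cf; apply: (@cts_eq _ (fun x => -1 * f x)) => [x _|]; [rewrite mulN1r|exact: ctsZ]. Qed.

Lemma ctsB (f g : V -> R) : cts f -> cts g -> cts (fun x => f x - g x).
Proof. by move=> cf cg; apply: ctsD => //; exact: ctsN. Qed.

Lemma ctsX k (f : V -> R) : cts f -> cts (fun x => f x ^+ k).
Proof.
move=> cf; elim: k => [|k IH]; first by under eq_fun do rewrite expr0; exact: cts_cst.
by under eq_fun do rewrite exprS; exact: ctsM.
Qed.

Lemma cts_sum I (r : seq I) (P : pred I) (F : I -> V -> R) :
  (forall i, P i -> cts (F i)) -> cts (fun x => \sum_(i <- r | P i) F i x).
Proof.
move=> h; rewrite (_ : (fun x => _) = \sum_(i <- r | P i) F i); last first.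
  by apply/funext => x; rewrite fct_sumE.
apply: big_ind => //; first exact: cts_cst.
by move=> f g cf cg; exact: ctsD.
Qed.

Lemma cts_comp {U W : topologicalType} (g : V -> U) (h : U -> W) :
  cts g -> (forall x, S x -> {for g x, continuous h}) -> cts (fun x => h (g x)).
Proof.
move=> /ctsP cg ch; apply/ctsP => x Sx.
by apply: continuous_cvg; [exact: ch|exact: cg].
Qed.

Lemma cts_norm (f : V -> R) : cts f -> cts (fun x => `|f x|).
Proof. by move=> cf; apply: (cts_comp cf) => x _; exact: norm_continuous. Qed.

Lemma cts_inv (f : V -> R) : cts f -> (forall x, S x -> f x != 0) ->
  cts (fun x => (f x)^-1).
Proof. by move=> cf f0; apply: (cts_comp cf) => x Sx; apply: inv_continuous; exact: f0. Qed.

Lemma cts_powR (f : V -> R) p : cts f -> (forall x, S x -> 0 < f x) ->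
  cts (fun x => f x `^ p).
Proof.
by move=> cf f0; apply: (cts_comp (h := fun t => t `^ p) cf) => x Sx;
  apply: continuous_powRl; exact: f0.
Qed.

Lemma cts_sphere_comp {U : topologicalType} (g : V -> U) (phi : V -> V) :
  cts g -> cts phi -> (forall x, S x -> S (phi x)) -> cts (fun x => g (phi x)).
Proof.
move=> /ctsP cg /ctsP cphi h; apply/ctsP => x Sx.
apply: (@cvg_comp _ _ _ phi g _ (within S (nbhs (phi x)))); last exact: (cg _ (h _ Sx)).
move=> A /= /(cphi x Sx); rewrite /nbhs /= /within /= => H.
by apply: filterS H => y Hy Sy; apply: Hy => //; exact: h.
Qed.

Lemma cts_dotv (f g : V -> V) : cts f -> cts g -> cts (fun x => dotv (f x) (g x)).
Proof.
move=> cf cg; apply: cts_sum => i _; apply: ctsM.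
  by apply: (cts_comp (h := fun M : V => M ord0 i) cf) => x _; exact: coord_continuous.
by apply: (cts_comp (h := fun M : V => M ord0 i) cg) => x _; exact: coord_continuous.
Qed.

Lemma cts_id : cts (fun x : V => x).
Proof. by apply: ctsT => x; exact: cvg_id. Qed.

Lemma cts_dotr (a : V) : cts (fun x => dotv a x).
Proof. by apply: cts_dotv; [exact: cts_cst|exact: cts_id]. Qed.

Lemma cts_dist2 (a : V) : cts (fun x => dotv (x - a) (x - a)).
Proof.
apply: ctsT; have h : continuous (fun y : V => y - a).
  by move=> y; exact: (@cvgB _ _ _ (nbhs y) _ id (fun=> a) y a cvg_id (cvg_cst _)).
exact: dotv_continuous.
Qed.

Lemma cts_powR_comp (f : V -> R) p : cts f -> 0 < p -> (forall x, S x -> 0 <= f x) ->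
  cts (fun x => f x `^ p).
Proof.
move=> cf p0 f0; apply/ctsP => x Sx; have := f0 x Sx; rewrite le_eqVlt => /predU1P[fx|fx].
  rewrite -fx powR0 ?gt_eqF//; apply/cvgrPdist_lt => e e0 /=.
  have e1 : 0 < e `^ p^-1 by rewrite powR_gt0.
  move/ctsP: cf => /(_ x Sx) /cvgrPdist_lt /(_ _ e1); rewrite -fx => H.
  rewrite !near_withinE in H *; apply: filterS H => y Hy Sy.
  have := Hy Sy; rewrite !sub0r !normrN (ger0_norm (f0 _ Sy)) ger0_norm ?powR_ge0// => {}Hy.
  rewrite -(powRr1 (ltW e0)) -(mulVf (lt0r_neq0 p0)) powRrM.
  by rewrite gt0_ltr_powR// nnegrE ?powR_ge0// f0.
have cf' := cf; move/ctsP : cf => /(_ x Sx) cf.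
by apply: (continuous_cvg _ (h := fun t => t `^ p)); [exact: continuous_powRl|exact: cf].
Qed.

(** Heine-Cantor. Compactness is used in its near-covering form, with the right neighbourhoods of 0
    as parameter filter, which yields a single [d] for all points. *)
Lemma cts_unif (g : V -> R) : cts g -> forall e, 0 < e ->
  exists2 d, 0 < d & forall x y, S x -> S y -> `|x - y| < d -> `|g x - g y| < e.
Proof.
move=> /ctsP cg e e0.
have /compact_near_coveringP H := @sphere_compact R n.
have {}H := H R (0^'+) (fun d x => S x -> forall y, S y -> `|x - y| < d -> `|g x - g y| < e) _.
have /H K : forall x, S x -> \forall x' \near x & i \near 0^'+,
    (S x' -> forall y, S y -> `|x' - y| < i -> `|g x' - g y| < e).
  move=> x Sx.
  have e2 : 0 < e / 2 by rewrite divr_gt0.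
  have := cg x Sx; move/cvgrPdist_lt => /(_ _ e2); rewrite near_withinE.
  move=> /nbhs_ballP[d /= d0 hd].
  exists (ball x (d / 2), [set t | t < d / 2]).
    split => /=; first by apply: nbhsx_ballx; rewrite divr_gt0.
    by apply: nbhs_right_lt; rewrite divr_gt0.
  move=> [x' t] /= [bx tl] Sx' y Sy xy.
  have hx : `|g x - g x'| < e / 2.
    by apply: hd => //; apply: le_ball bx; lra.
  have hy : `|g x - g y| < e / 2.
    apply: hd => //; rewrite [d]splitr; apply: (ball_triangle bx).
    by rewrite -ball_normE /=; apply: lt_trans xy tl.
  rewrite (_ : g x' - g y = (g x - g y) - (g x - g x')); last by ring.
  by apply: le_lt_trans (ler_normB _ _) _; lra.
have /filter_ex[d [d0 hd]] : \forall d \near 0^'+, 0 < d /\ S `<=` (fun x => S x ->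
    forall y, S y -> `|x - y| < d -> `|g x - g y| < e).
  by near=> d; split; [near: d; exact: nbhs_right_gt|near: d; exact: K].
by exists d => // x y Sx Sy xy; exact: hd.
Unshelve. all: by end_near. Qed.

Lemma cts_max (g : V -> R) : cts g -> exists2 x, S x & forall y, S y -> g y <= g x.
Proof.
move=> [cg]; have [x Sx hx] := EVT_max_rV (@sphere_neq0 R n) (@sphere_compact R n) cg.
by exists x => [|y Sy]; [exact: set_mem|exact/hx/mem_set].
Qed.

Lemma cts_min (g : V -> R) : cts g -> exists2 x, S x & forall y, S y -> g x <= g y.
Proof.
move=> cg; have [x Sx h] := cts_max (ctsN cg).
by exists x => // y Sy; rewrite -lerN2 h.
Qed.

Lemma cts_bounded (g : V -> R) : cts g ->
  exists2 M, 0 < M & forall x, S x -> `|g x| <= M.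
Proof.
move=> cg; have [x Sx h] := cts_max (cts_norm cg).
by exists (`|g x| + 1) => [|y Sy]; [rewrite ltr_wpDl|apply: le_trans (h y Sy) _; rewrite lerDl].
Qed.

Lemma cts_gt0_min (g : V -> R) : cts g -> (forall x, S x -> 0 < g x) ->
  exists2 m, 0 < m & forall x, S x -> m <= g x.
Proof. by move=> /cts_min[x Sx h] g0; exists (g x); first exact: g0. Qed.

Lemma ctsE (g : V -> R) :
  (forall x, S x -> forall e, 0 < e ->
    exists2 d, 0 < d & forall y, S y -> `|x - y| < d -> `|g x - g y| < e) -> cts g.
Proof.
move=> h; apply/ctsP => x Sx; apply/cvgrPdist_lt => e e0.
have [d d0 hd] := h x Sx e e0.
rewrite near_withinE; apply/nbhs_ballP; exists d => //= y; rewrite -ball_normE /= => xy Sy.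
exact: hd.
Qed.

Lemma cts_ulim (g : V -> R) :
  (forall e, 0 < e -> exists h, cts h /\ forall x, S x -> `|g x - h x| <= e) -> cts g.
Proof.
move=> H; apply: ctsE => x Sx e e0.
have e4 : 0 < e / 4 by rewrite divr_gt0.
have [h [ch gh]] := H _ e4; have [d d0 hd] := cts_unif ch e4.
exists d => // y Sy xy; have := gh x Sx; have := gh y Sy; have := hd x y Sx Sy xy.
rewrite !ltr_norml !ler_norml; lra.
Qed.

End Cts.

Arguments cts_cst {R n U} c.

(** * The integral over the sphere *)

Section Exhaustion.
Context {R : realType}.
Notation mu := (@lebesgue_measure R).
Notation D := (`]-1, 1[%classic : set R).

(** The shift by 2 keeps [e k] at most 1/2, so that the segments [A k] exhausting the open interval
    are nondegenerate from the start. *)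
Let e (k : nat) : R := k.+2%:R^-1.

Let A (k : nat) : set R := `[- 1 + e k, 1 - e k]%classic.

Let inv2 (k : nat) : 0 < e k /\ e k <= 1 / 2.
Proof. by rewrite /e invr_gt0 ltr0n div1r lef_pV2 ?posrE ?ltr0n// ler_nat. Qed.

Let AD k : A k `<=` D.
Proof.
by move=> x; rewrite /A /= !in_itv /=; have [i1 i2] := inv2 k => /andP[a b]; apply/andP; split; lra.
Qed.

Let DA x : D x -> \forall k \near \oo, A k x.
Proof.
rewrite /= in_itv /= => /andP[x1 x2].
have e0 : 0 < Num.min (1 - x) (1 + x) by rewrite lt_min; apply/andP; split; lra.
have := near_infty_natSinv_lt (PosNum e0); apply: filterS => k /=.
rewrite lt_min => /andP[h1 h2]; rewrite /A /= in_itv /=.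
have : e k <= k.+1%:R^-1 by rewrite /e lef_pV2 ?posrE ?ltr0n// ler_nat.
by move: h1 h2; set b := k.+1%:R^-1 => *; apply/andP; split; lra.
Qed.

Lemma exh_integral (f : R -> R) : mu.-integrable D (EFin \o f) ->
  (fun k => Rintegral mu (A k) f) @ \oo --> Rintegral mu D f.
Proof.
move=> fi; have mf := measurable_int _ fi.
have mA k : measurable (A k) by exact: measurable_itv.
have [] := @dominated_convergence _ _ R mu D (measurable_itv _)
  (fun k => (EFin \o f) \_ (A k)) (EFin \o f) (abse \o (EFin \o f)).
- move=> k; apply: (measurable_restrict (EFin \o f) (mA k) (measurable_itv _)).1.
  by apply: measurable_funS mf; [exact: measurable_itv|exact: subIsetl].
- exact: mf.
- apply: aeW => x Dx; apply: (@cvg_trans _ (cst (f x)%:E @ \oo)); last exact: cvg_cst.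
  apply: near_eq_cvg; have := DA Dx; apply: filterS => k Ak.
  by rewrite patchE mem_set.
- exact: integrable_abse.
- apply: aeW => x k Dx; rewrite patchE; case: ifP => _ //=.
  by rewrite normr0 lee_fin.
move=> _ _ h.
have E k : (\int[mu]_(x in D) ((EFin \o f) \_ (A k)) x = \int[mu]_(x in A k) (f x)%:E)%E.
  by rewrite -integral_mkcondr setIidr//; exact: AD.
move: h; under eq_fun do rewrite E.
rewrite /Rintegral => h; apply: fine_cvg; rewrite fineK//.
exact: integrable_fin_num.
Qed.

Lemma FTC_compact (f F : R -> R) k :
  {in D, forall x, {for x, continuous f}} -> (forall x, D x -> is_derive x 1 F (f x)) ->
  (\int[mu]_(x in A k) (f x)%:E = (F (1 - e k) - F (- 1 + e k))%:E)%E.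
Proof.
move=> cf dF.
have ab : - 1 + e k < (1 - e k) by have [] := inv2 k; lra.
have cF x : D x -> {for x, continuous F}.
  by move=> Dx; have [dFx _] := dF x Dx; apply: differentiable_continuous; apply/derivable1_diffP.
rewrite (@continuous_FTC2 _ f F)//.
- by apply: continuous_in_subspaceT => x /[!inE] Ax; apply: cf; rewrite inE; exact: (AD Ax).
- split.
  + move=> x xA; have Ax : D x by apply: (@AD k); rewrite /A /=; exact: subset_itv_oo_cc xA.
    by have [] := dF x Ax.
  + apply: cvg_at_right_filter; apply: cF; apply: (@AD k).
    by rewrite /A /= in_itv /=; have [? ?] := inv2 k; apply/andP; split; lra.
  + apply: cvg_at_left_filter; apply: cF; apply: (@AD k).
    by rewrite /A /= in_itv /=; have [? ?] := inv2 k; apply/andP; split; lra.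
- move=> x xA; have Ax : D x by apply: (@AD k); rewrite /A /=; exact: subset_itv_oo_cc xA.
  by rewrite derive1E; have [_ ->] := dF x Ax.
Qed.

(** Meant for the weight (1 - t^2)^(-1/2), which is unbounded but has a bounded primitive: by
    monotone convergence over the segments [A k], the integral is at most 2 M. *)
Lemma integrable_of_primitive (f F : R -> R) M :
  {in D, forall x, {for x, continuous f}} -> (forall x, D x -> 0 <= f x) ->
  (forall x, D x -> is_derive x 1 F (f x)) -> (forall x, D x -> `|F x| <= M) ->
  mu.-integrable D (EFin \o f).
Proof.
move=> cf f0 dF FM.
have mf : measurable_fun D f.
  apply: measurable_realfun.open_continuous_measurable_fun; first exact: itv_open.
  by move=> x xD; exact: cf.
apply/integrableP; split; first exact/measurable_EFinP.
have -> : (\int[mu]_(x in D) `|(EFin \o f) x| = \int[mu]_(x in D) (f x)%:E)%E.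
  by apply: eq_integral => x; rewrite inE => Dx /=; rewrite ger0_norm// f0.
have UA : \bigcup_k A k = D.
  apply/seteqP; split => [x [k _] /AD//|x Dx].
  by have /filter_ex[k Ak] := DA Dx; exists k.
have : (\int[mu]_(x in A i) (EFin \o f) x)%E @[i --> \oo] --> (\int[mu]_(x in D) (EFin \o f) x)%E.
  rewrite -[X in _ --> integral _ X _]UA; apply: ge0_nondecreasing_set_cvg_integral.
  - move=> m n mn; apply/subsetPset => x; rewrite /A /= !in_itv /= => /andP[].
    have : e n <= e m by rewrite /e lef_pV2 ?posrE ?ltr0n// ler_nat.
    by move=> ? ? ?; apply/andP; split; lra.
  - by move=> i; exact: measurable_itv.
  - move=> i; apply: measurable_funS (AD (k := i)) _; first exact: measurable_itv.
    exact/measurable_EFinP.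
  - by move=> i x /AD Dx /=; rewrite lee_fin f0.
move=> {}h; apply: (@le_lt_trans _ _ (2 * M)%:E); last exact: ltry.
apply: (cvge_to_le h); near=> k.
rewrite /comp (FTC_compact _ cf dF) lee_fin.
have [i1 i2] := inv2 k.
have D1 : D (1 - e k) by rewrite /= in_itv /=; apply/andP; split; lra.
have D2 : D (- 1 + e k) by rewrite /= in_itv /=; apply/andP; split; lra.
by have := FM _ D1; have := FM _ D2; rewrite !ler_norml => /andP[? ?] /andP[? ?]; lra.
Unshelve. all: by end_near. Qed.

(** The integrand may blow up at the endpoints, so the fundamental theorem is applied on the
    segments [A k]; dominated convergence and the continuity of the primitive give the limit. *)
Lemma FTC_open (f F : R -> R) : {in D, forall x, {for x, continuous f}} ->
  mu.-integrable D (EFin \o f) ->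
  (forall x, D x -> is_derive x 1 F (f x)) -> {within `[-1, 1], continuous F} ->
  Rintegral mu D f = F 1 - F (- 1).
Proof.
move=> cf fi dF cF.
have h := exh_integral fi.
have E k : Rintegral mu (A k) f = F (1 - e k) - F (- 1 + e k).
  by rewrite /Rintegral FTC_compact.
apply: (cvg_unique _ h) => //; rewrite (_ : (fun k => _) = (fun k => F (1 - e k) - F (- 1 + e k))); last exact/funext.
have N11 : (-1 : R) < 1 by rewrite gtrN.
have [_ cr cl] := (continuous_within_itvP F N11).1 cF.
have inv0 : (fun k => e k) @ \oo --> 0.
  by have := @cvg_harmonic R; rewrite -cvg_shiftS.
apply: cvgB.
- move/cvg_at_leftP : cl; apply; split => [k|]; first by have [] := inv2 k; lra.
  by rewrite -[X in _ --> X]subr0; apply: cvgB => //; exact: cvg_cst.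
- move/cvg_at_rightP : cr; apply; split => [k|]; first by have [] := inv2 k; lra.
  by rewrite -[X in _ --> X]addr0; apply: cvgD => //; exact: cvg_cst.
Qed.
End Exhaustion.

Section Weight.
Context {R : realType}.
Notation mu := (@lebesgue_measure R).
Notation D := (`]-1, 1[%classic : set R).

Definition slice_wt (k : nat) (t : R) : R := (1 - t ^+ 2) `^ ((k%:R - 1) / 2).

Lemma itv_onem_sqr_gt0 (t : R) : D t -> 0 < 1 - t ^+ 2.
Proof. by rewrite /= in_itv /= => /andP[? ?]; rewrite subr_gt0; nra. Qed.

Lemma slice_wt_ge0 k t : 0 <= slice_wt k t.
Proof. exact: powR_ge0. Qed.

Lemma onem_sqr_powR_continuous p t : D t -> {for t, continuous (fun t : R => (1 - t ^+ 2) `^ p)}.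
Proof.
move=> /itv_onem_sqr_gt0 h.
apply: (@continuous_comp _ _ _ (fun t : R => 1 - t ^+ 2) (fun u => u `^ p)).
  apply: cvgB; first exact: cvg_cst.
  by apply: exprn_continuous.
exact: continuous_powRl.
Qed.

Lemma slice_wt_continuous k t : D t -> {for t, continuous (slice_wt k)}.
Proof. exact: onem_sqr_powR_continuous. Qed.

(** For k = 0 the exponent is -1/2 and the arcsine is a bounded primitive; for k > 0 the weight is
    at most 1. *)
Lemma slice_wt_integrable k : mu.-integrable D (EFin \o slice_wt k).
Proof.
case: k => [|k].
  apply: (@integrable_of_primitive _ _ asin (pi / 2)).
  - by move=> x; rewrite inE => /slice_wt_continuous.
  - by move=> x _; exact: slice_wt_ge0.
  - move=> x Dx; have h := itv_onem_sqr_gt0 Dx.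
    rewrite /slice_wt sub0r mulNr powRN mul1r powR12_sqrt ?ltW//.
    exact: is_derive1_asin.
  - move=> x; rewrite /= in_itv /= => /andP[x1 x2].
    by rewrite ler_norml asin_geNpi2 ?asin_lepi2// ?ltW.
apply: measurable_bounded_integrable; first exact: measurable_itv.
- rewrite /= lebesgue_measure_itv /= lte_fin gtrN//; exact: ltry.
- apply: open_continuous_measurable_fun; first exact: itv_open.
  by move=> x; rewrite inE; exact: slice_wt_continuous.
- exists 1; split; first exact: num_real.
  move=> M M1 x /= Dx; rewrite ger0_norm ?slice_wt_ge0//; apply: le_trans (ltW M1).
  have h := itv_onem_sqr_gt0 Dx.
  have e1 : (1 : R) `^ ((k.+1%:R - 1) / 2) = 1 by rewrite powR1.
  rewrite -[leRHS]e1; apply: ge0_ler_powR.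
  + by rewrite divr_ge0// subr_ge0 ler1n.
  + by rewrite nnegrE ltW.
  + by rewrite nnegrE.
  + by rewrite gerBl sqr_ge0.
Qed.

Lemma slice_wtM_integrable k (G : R -> R) M : (forall t, D t -> {for t, continuous G}) ->
  (forall t, D t -> `|G t| <= M) -> mu.-integrable D (EFin \o (fun t => slice_wt k t * G t)).
Proof.
move=> cG GM; have := @integrableMl _ _ R mu D (measurable_itv _) (EFin \o slice_wt k) G; apply.
- exact: slice_wt_integrable.
- apply: open_continuous_measurable_fun; first exact: itv_open.
  by move=> x; rewrite inE => /cG.
- exists M; split; first exact: num_real.
  by move=> N MN x /= Dx; apply: le_trans (GM x Dx) (ltW MN).
Qed.

End Weight.

Section Slices.
Context {R : realType}.
Notation mu := (@lebesgue_measure R).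
Notation D := (`]-1, 1[%classic : set R).

Lemma onem_sqr_ge0 (t : R) : -1 <= t <= 1 -> 0 <= 1 - t ^+ 2.
Proof. by move=> /andP[? ?]; rewrite subr_ge0; nra. Qed.

Lemma sph_lift0 k t (y : 'rV[R]_k.+1) : sph_lift t y ord0 ord0 = t.
Proof. by rewrite mxE unlift_none. Qed.

Lemma sph_liftS k t (y : 'rV[R]_k.+1) j :
  sph_lift t y ord0 (lift ord0 j) = Num.sqrt (1 - t ^+ 2) * y ord0 j.
Proof. by rewrite mxE liftK. Qed.

Lemma dotv_lift k t (x y : 'rV[R]_k.+1) t' : dotv (sph_lift t x) (sph_lift t' y) =
  t * t' + Num.sqrt (1 - t ^+ 2) * Num.sqrt (1 - t' ^+ 2) * dotv x y.
Proof.
rewrite {1}/dotv big_ord_recl !sph_lift0 mulr_sumr; congr (_ + _).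
by apply: eq_bigr => i _; rewrite !sph_liftS; ring.
Qed.

Lemma sphere_lift k t (y : 'rV[R]_k.+1) : -1 <= t <= 1 -> sphere k y -> sphere k.+1 (sph_lift t y).
Proof.
move=> /onem_sqr_ge0 t1; rewrite /sphere /= dotv_lift => ->.
by rewrite -expr2 -expr2 sqr_sqrtr// mulr1; ring.
Qed.

Lemma cts_slice k (g : 'rV[R]_k.+2 -> R) t : -1 <= t <= 1 -> cts g ->
  cts (fun y : 'rV[R]_k.+1 => g (sph_lift t y)).
Proof.
move=> t1 cg; apply: ctsE => x Sx e e0; have [d d0 hd] := cts_unif cg e0.
exists d => // y Sy xy; apply: hd; try exact: sphere_lift.
apply: le_lt_trans xy; apply: norm_le_coord => // i; rewrite mxE [in X in _ + X]mxE.
case: (unliftP ord0 i) => [j|] ->; last by rewrite !sph_lift0 subrr normr0.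
rewrite !sph_liftS -mulrBr normrM; have := ler_coord_norm (x - y) j; rewrite !mxE.
apply: le_trans; rewrite ler_piMl// ger0_norm ?sqrtr_ge0//.
by rewrite -[leRHS]sqrtr1 ler_wsqrtr// gerBl sqr_ge0.
Qed.

Lemma slice_unif k (g : 'rV[R]_k.+2 -> R) t0 e : -1 <= t0 <= 1 -> cts g -> 0 < e ->
  exists2 d, 0 < d & forall t, -1 <= t <= 1 -> `|t - t0| < d -> forall y, sphere k y ->
   `|g (sph_lift t y) - g (sph_lift t0 y)| < e.
Proof.
move=> t01 cg e0; have [d d0 hd] := cts_unif cg e0.
have ct : {for t0, continuous (fun t : R => Num.sqrt (1 - t ^+ 2))}.
  apply: (@continuous_comp _ _ _ (fun t : R => 1 - t ^+ 2) Num.sqrt).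
    by apply: cvgB; [exact: cvg_cst|exact: exprn_continuous].
  exact: sqrt_continuous.
move/cvgrPdist_lt : ct => /(_ _ d0) /nbhs_ballP[d' /= d'0 hd'].
exists (Num.min d d'); first by rewrite lt_min d0.
move=> t t1; rewrite lt_min => /andP[td td'] y Sy.
apply: hd; try exact: sphere_lift.
have h : `|Num.sqrt (1 - t0 ^+ 2) - Num.sqrt (1 - t ^+ 2)| < d.
  by apply: hd'; rewrite -ball_normE /= distrC.
apply: (@le_lt_trans _ _ (Num.max `|t - t0| `|Num.sqrt (1 - t0 ^+ 2) - Num.sqrt (1 - t ^+ 2)|)).
  apply: norm_le_coord => [|i]; first by rewrite le_max normr_ge0.
  rewrite mxE [in X in _ + X]mxE le_max; case: (unliftP ord0 i) => [j|] ->.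
    rewrite !sph_liftS -mulrBl normrM distrC ler_piMr ?orbT//.
    by apply: le_trans (ler_coord_norm y j) (sphere_norm_le1 Sy).
  by rewrite !sph_lift0 lexx.
by rewrite gt_max td h.
Qed.

(** Linearity and monotonicity travel together through the induction on the dimension: on S^k they
    imply that slice integrals depend continuously on t, whence the integrability needed on
    S^(k+1). *)
Definition linear_monotone k := (forall (f g : 'rV[R]_k.+1 -> R) a, cts f -> cts g ->
    sphere_int k (fun x => f x + a * g x) = sphere_int k f + a * sphere_int k g) /\
  (forall f g : 'rV[R]_k.+1 -> R, cts f -> cts g -> (forall x, sphere k x -> f x <= g x) ->
    sphere_int k f <= sphere_int k g).

Section Step.
Variable k : nat.
Hypothesis H : linear_monotone k.
Implicit Types f g : 'rV[R]_k.+1 -> R.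

Let icst a : sphere_int k (fun=> a) = a * sphere_int k (fun _ : 'rV[R]_k.+1 => 1).
Proof.
have h := H.1 (fun=> 0) (fun=> 1) a (cts_cst _) (cts_cst _).
have h0 := H.1 (fun=> 0) (fun=> 0) 1 (cts_cst _) (cts_cst _).
rewrite mul1r addr0 in h0.
have {}h0 : sphere_int k (fun _ : 'rV[R]_k.+1 => 0) = 0 by lra.
by rewrite h0 !add0r mulr1 in h.
Qed.

Let idist f g e : cts f -> cts g -> (forall x, sphere k x -> `|f x - g x| <= e) ->
  `|sphere_int k f - sphere_int k g| <= e * sphere_int k (fun _ : 'rV[R]_k.+1 => 1).
Proof.
move=> cf cg h.
have h1 : sphere_int k f <= sphere_int k (fun x => g x + e * 1).
  apply: H.2 => //; first by apply: ctsD => //; exact: cts_cst.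
  by move=> x /h; rewrite ler_norml mulr1; lra.
have h2 : sphere_int k g <= sphere_int k (fun x => f x + e * 1).
  apply: H.2 => //; first by apply: ctsD => //; exact: cts_cst.
  by move=> x /h; rewrite ler_norml mulr1; lra.
have cc : cts (fun _ : 'rV[R]_k.+1 => 1 : R) by exact: cts_cst.
move: h1 h2; rewrite (H.1 g _ e cg cc) (H.1 f _ e cf cc) ler_norml; lra.
Qed.

Let int1_ge0 : 0 <= sphere_int k (fun _ : 'rV[R]_k.+1 => 1 : R).
Proof.
rewrite -[leLHS](mul0r (sphere_int k (fun _ : 'rV[R]_k.+1 => 1 : R))) -icst.
by apply: H.2 => //; exact: cts_cst.
Qed.

Lemma slice_int_continuous (g : 'rV[R]_k.+2 -> R) t : cts g -> D t ->
  {for t, continuous (fun t => sphere_int k (fun y => g (sph_lift t y)))}.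
Proof.
move=> cg; rewrite /= in_itv /= => /andP[t1 t2].
have t12 : -1 <= t <= 1 by rewrite !ltW.
apply/cvgrPdist_lt => e e0 /=.
set V := sphere_int k (fun _ : 'rV[R]_k.+1 => 1 : R).
have eV : 0 < e / (V + 1) by rewrite divr_gt0// ltr_wpDl.
have [d d0 hd] := slice_unif t12 cg eV.
near=> s.
have s1 : -1 <= s <= 1.
  have s1 : -1 < s by near: s; exact: lt_nbhsr.
  have s2 : s < 1 by near: s; exact: lt_nbhsl.
  by rewrite !ltW.
have sd : `|s - t| < d by rewrite distrC; near: s; apply/nbhs_ballP; exists d => // s; rewrite -ball_normE.
rewrite distrC; apply: (@le_lt_trans _ _ (e / (V + 1) * V)).
  apply: idist; try exact: cts_slice.
  by move=> y Sy; apply: ltW; exact: hd.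
rewrite mulrAC ltr_pdivrMr ?ltr_wpDl// ltr_pM2l//; lra.
Unshelve. all: by end_near. Qed.

Lemma slice_int_integrable (g : 'rV[R]_k.+2 -> R) : cts g ->
  mu.-integrable D (EFin \o (fun t => slice_wt k t * sphere_int k (fun y => g (sph_lift t y)))).
Proof.
move=> cg; have [M M0 hM] := cts_bounded cg.
apply: (@slice_wtM_integrable _ _ _ (M * sphere_int k (fun _ : 'rV[R]_k.+1 => 1 : R))).
  by move=> t Dt; exact: slice_int_continuous.
move=> t; rewrite /= in_itv /= => /andP[t1 t2].
have t12 : -1 <= t <= 1 by rewrite !ltW.
have h0 : sphere_int k (fun _ : 'rV[R]_k.+1 => 0) = 0 by rewrite icst mul0r.
have := @idist (fun y => g (sph_lift t y)) (fun=> 0) M.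
rewrite h0 subr0; apply; [exact: cts_slice|exact: cts_cst|].
by move=> x Sx; rewrite subr0; apply: hM; exact: sphere_lift.
Qed.

Lemma linear_monotone_step : linear_monotone k.+1.
Proof.
split=> [f g a cf cg|f g cf cg fg] /=.
  have If := slice_int_integrable cf; have Ig := slice_int_integrable cg.
  rewrite -(@RintegralZl _ _ R mu D _ a (measurable_itv _) Ig).
  rewrite -(@RintegralD _ _ R mu D _ _ (measurable_itv _) If); last first.
    exact: (@integrableZl _ _ R mu D (measurable_itv _) a _ Ig).
  apply: eq_Rintegral => t; rewrite inE /= in_itv /= => /andP[t1 t2].
  have t12 : -1 <= t <= 1 by rewrite !ltW.
  rewrite (H.1 (fun y => f (sph_lift t y)) (fun y => g (sph_lift t y)) a);
    [rewrite /slice_wt; ring|exact: cts_slice|exact: cts_slice].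
apply: le_Rintegral; [exact: measurable_itv|exact: slice_int_integrable|exact: slice_int_integrable|].
move=> t; rewrite /= in_itv /= => /andP[t1 t2].
have t12 : -1 <= t <= 1 by rewrite !ltW.
apply: ler_wpM2l; first exact: powR_ge0.
by apply: H.2; try exact: cts_slice; move=> y Sy; apply: fg; exact: sphere_lift.
Qed.
End Step.

Lemma sphere0_const (c : R) : c ^+ 2 = 1 -> sphere 0 (const_mx c : 'rV[R]_1).
Proof. by move=> c1; rewrite /sphere /= /dotv big_ord1 !mxE -expr2. Qed.

Lemma sphere_int_linear_monotone k : linear_monotone k.
Proof.
elim: k => [|k IH]; last exact: linear_monotone_step.
split=> [f g a _ _|f g _ _ fg] /=; first by ring.
by apply: lerD; apply: fg; apply: sphere0_const; rewrite ?sqrrN expr1n.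
Qed.

End Slices.

Section SphereInt.
Context {R : realType} (n : nat).
Local Notation V := 'rV[R]_n.+1.
Local Notation S := (@sphere R n).
Local Notation I := (@sphere_int R n).
Implicit Types f g : V -> R.

Lemma intDZ f g a : cts f -> cts g -> I (fun x => f x + a * g x) = I f + a * I g.
Proof. exact: (sphere_int_linear_monotone n).1. Qed.

Lemma int_le f g : cts f -> cts g -> (forall x, S x -> f x <= g x) -> I f <= I g.
Proof. exact: (sphere_int_linear_monotone n).2. Qed.

Lemma int_eq f g : cts f -> (forall x, S x -> f x = g x) -> I f = I g.
Proof.
move=> cf fg; have cg := cts_eq fg cf.
by apply/eqP; rewrite eq_le !int_le// => x Sx; rewrite fg.
Qed.

Lemma intD f g : cts f -> cts g -> I (fun x => f x + g x) = I f + I g.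
Proof.
move=> cf cg; rewrite -[I g]mul1r -intDZ//.
by congr I; apply/funext => x; rewrite mul1r.
Qed.

Lemma int0 : I (fun=> 0) = 0.
Proof.
have := @intDZ (fun=> 0) (fun=> 0) 1 (cts_cst _) (cts_cst _).
rewrite mul1r addr0; lra.
Qed.

Lemma intZ a f : cts f -> I (fun x => a * f x) = a * I f.
Proof.
move=> cf; rewrite -[RHS]add0r -int0 -intDZ//; last exact: cts_cst.
by congr I; apply/funext => x; rewrite add0r.
Qed.

Lemma intN f : cts f -> I (fun x => - f x) = - I f.
Proof. by move=> cf; rewrite -mulN1r -intZ//; congr I; apply/funext => x; rewrite mulN1r. Qed.

Lemma intB f g : cts f -> cts g -> I (fun x => f x - g x) = I f - I g.
Proof. by move=> cf cg; rewrite intD//; [rewrite intN|exact: ctsN]. Qed.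

Lemma int_sum J (r : seq J) (P : pred J) (F : J -> V -> R) : (forall i, P i -> cts (F i)) ->
  I (fun x => \sum_(i <- r | P i) F i x) = \sum_(i <- r | P i) I (F i).
Proof.
move=> h; elim: r => [|i r IH].
  by rewrite big_nil -[RHS]int0; congr sphere_int; apply/funext => x; rewrite big_nil.
rewrite big_cons -IH.
rewrite (_ : (fun x => _) = (fun x => if P i then F i x + \sum_(i <- r | P i) F i x else
  \sum_(i <- r | P i) F i x)); last by apply/funext => x; rewrite big_cons.
by case: ifP => // Pi; rewrite intD//; [exact: h|exact: cts_sum].
Qed.

Lemma int_ge0 f : cts f -> (forall x, S x -> 0 <= f x) -> 0 <= I f.
Proof. by move=> cf f0; rewrite -int0; apply: int_le => //; exact: cts_cst. Qed.

Lemma int_norm f : cts f -> `|I f| <= I (fun x => `|f x|).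
Proof.
move=> cf; rewrite ler_norml -intN; last exact: cts_norm.
have cn := cts_norm cf.
by rewrite !int_le//; [move=> x _; exact: ler_norm|exact: ctsN|move=> x _; rewrite lerNl -normrN ler_norm].
Qed.

Lemma int_cst a : I (fun=> a) = a * sphere_vol R n.
Proof.
by rewrite /sphere_vol -intZ; [congr I; apply/funext => x; rewrite mulr1|exact: cts_cst].
Qed.

Lemma int_dist f g e : cts f -> cts g -> (forall x, S x -> `|f x - g x| <= e) ->
  `|I f - I g| <= e * sphere_vol R n.
Proof.
move=> cf cg h; rewrite -int_cst -intB//; apply: le_trans (int_norm _) _; first exact: ctsB.
by apply: int_le => //; [apply: cts_norm; exact: ctsB|exact: cts_cst].
Qed.

End SphereInt.

(** * Polynomials and spherical harmonics *)

Section BetaMoments.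
Context {R : realType}.
Notation mu := (@lebesgue_measure R).
Notation D := (`]-1, 1[%classic : set R).

Definition beta_moment (a m : nat) : R := Rintegral mu D (fun t => slice_wt m t * t ^+ a).

Lemma slice_wtE m (t : R) : D t -> slice_wt m t = Num.sqrt (1 - t ^+ 2) ^+ m / Num.sqrt (1 - t ^+ 2).
Proof.
move=> /itv_onem_sqr_gt0 h; have s0 : Num.sqrt (1 - t ^+ 2) != 0 by rewrite gt_eqF// sqrtr_gt0.
rewrite /slice_wt mulrC powRrM powR12_sqrt ?ltW// powRB; last by rewrite s0 implybT.
by rewrite powR_mulrn ?sqrtr_ge0// powRr1 ?sqrtr_ge0.
Qed.

Lemma slice_wtD m b (t : R) : D t -> slice_wt (m + b) t = slice_wt m t * Num.sqrt (1 - t ^+ 2) ^+ b.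
Proof. by move=> Dt; rewrite !slice_wtE// exprD mulrAC. Qed.

Lemma slice_wtSS m (t : R) : D t -> slice_wt m.+2 t = slice_wt m t * (1 - t ^+ 2).
Proof.
by move=> Dt; rewrite -addn2 slice_wtD// sqr_sqrtr// ltW// itv_onem_sqr_gt0.
Qed.

Lemma onem_sqr_is_derive (t : R) : is_derive t 1 (fun t : R => 1 - t ^+ 2) (- (2 * t)).
Proof.
have -> : (fun t : R => 1 - t ^+ 2) = (cst 1 - (id ^+ 2)) by apply/funext => x; rewrite !fctE.
have h1 := is_derive_cst (1 : R) t (1 : R).
have h2 : is_derive t (1 : R) ((id : R -> R) ^+ 2) ((2%:R * id t ^+ 1) *: (1 : R)) by exact: is_deriveX.
have h3 := is_deriveB h1 h2.
have e : 0 - (2%:R * id t ^+ 1) *: (1 : R) = - (2 * t).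
  by rewrite sub0r /= expr1 /GRing.scale /= mulr1.
by rewrite -e; exact: h3.
Qed.

Lemma is_derive_XMX (f g : R -> R) (t : R) df dg b m :
  is_derive t 1 f df -> is_derive t 1 g dg ->
  is_derive t 1 (fun t => f t ^+ b * g t ^+ m)
   (f t ^+ b * (m%:R * g t ^+ m.-1 * dg) + g t ^+ m * (b%:R * f t ^+ b.-1 * df)).
Proof.
move=> hf hg; have := is_deriveM (is_deriveX b hf) (is_deriveX m hg).
rewrite (_ : (fun t => _) = f ^+ b * g ^+ m); last by apply/funext => x; rewrite !fctE.
by rewrite !fctE.
Qed.

Lemma sqrt_onem_sqr_is_derive (t : R) : D t ->
  is_derive t 1 (fun t : R => Num.sqrt (1 - t ^+ 2)) (- t / Num.sqrt (1 - t ^+ 2)).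
Proof.
move=> /itv_onem_sqr_gt0 h.
have d1 := onem_sqr_is_derive t.
have d2 := is_derive1_sqrt h.
have := @is_derive1_comp _ Num.sqrt (fun t : R => 1 - t ^+ 2) t _ _ d2 d1.
rewrite (_ : _ * _ = - t / Num.sqrt (1 - t ^+ 2))//.
by rewrite invfM; field; rewrite gt_eqF// sqrtr_gt0.
Qed.

Let moment_integrable m a : mu.-integrable D (EFin \o (fun t => slice_wt m t * t ^+ a)).
Proof.
apply: (@slice_wtM_integrable _ _ _ 1) => [t _|t]; first exact: exprn_continuous.
rewrite /= in_itv /= => /andP[t1 t2]; rewrite normrX exprn_ile1//.
by rewrite ler_norml !ltW.
Qed.

(** The function t^b (1 - t^2)^((m+1)/2) takes equal values (zero) at both endpoints, and its
    derivative is the difference of the two integrands. For b = 0 the truncated [b.-1] is multiplied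
    by 0. *)
Lemma beta_moment_ibp b m :
  b%:R * Rintegral mu D (fun t => slice_wt m.+2 t * t ^+ b.-1) = m.+1%:R * beta_moment b.+1 m.
Proof.
have i1 := moment_integrable m.+2 b.-1; have i2 := moment_integrable m b.+1.
rewrite /beta_moment -(@RintegralZl _ _ R mu D _ _ (measurable_itv _) i1).
rewrite -(@RintegralZl _ _ R mu D _ _ (measurable_itv _) i2); apply/eqP; rewrite -subr_eq0.
have j1 := @integrableZl _ _ R mu D (measurable_itv _) b%:R _ i1.
have j2 := @integrableZl _ _ R mu D (measurable_itv _) m.+1%:R _ i2.
rewrite -(@RintegralB _ _ R mu D _ _ (measurable_itv _) j1 j2).
apply/eqP; apply: etrans (@FTC_open _ _ (fun t => t ^+ b * Num.sqrt (1 - t ^+ 2) ^+ m.+1) _ _ _ _) _; last first.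
- by rewrite expr1n sqrrN expr1n subrr sqrtr0 expr0n /= !mulr0 subrr.
- apply: continuous_subspaceT => t; apply: cvgM; first exact: exprn_continuous.
  apply: (@continuous_comp _ _ _ (fun t : R => Num.sqrt (1 - t ^+ 2)) (fun u => u ^+ m.+1)).
    apply: (@continuous_comp _ _ _ (fun t : R => 1 - t ^+ 2) Num.sqrt).
      by apply: cvgB; [exact: cvg_cst|exact: exprn_continuous].
    exact: sqrt_continuous.
  exact: exprn_continuous.
- move=> t Dt.
  have ds := sqrt_onem_sqr_is_derive Dt.
  have h := is_derive_XMX b m.+1 (is_derive_id t (1 : R)) ds.
  move: h; rewrite (_ : _ + _ = b%:R * (slice_wt m.+2 t * t ^+ b.-1) - m.+1%:R * (slice_wt m t * t ^+ b.+1)) //.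
  rewrite /= slice_wtSS// slice_wtE//.
  have s0 : Num.sqrt (1 - t ^+ 2) != 0 by rewrite gt_eqF// sqrtr_gt0; exact: itv_onem_sqr_gt0.
  have e : 1 - t ^+ 2 = Num.sqrt (1 - t ^+ 2) ^+ 2.
    by rewrite sqr_sqrtr// ltW//; exact: itv_onem_sqr_gt0.
  move: s0 e; set s := Num.sqrt _ => s0 ->.
  rewrite !exprS; clear -s0; case: b => [|b]; last by rewrite /= exprS; field.
  by rewrite /= expr0; field.
- exact: (@integrableB _ _ _ mu D (measurable_itv _) _ _ j1 j2).
- move=> t; rewrite inE => Dt; apply: cvgB.
  + apply: cvgM; first exact: cvg_cst.
    by apply: cvgM; [exact: slice_wt_continuous|exact: exprn_continuous].
  + apply: cvgM; first exact: cvg_cst.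
    by apply: cvgM; [exact: slice_wt_continuous|exact: exprn_continuous].
Qed.

Lemma beta_momentSS a m : beta_moment a m.+2 = beta_moment a m - beta_moment a.+2 m.
Proof.
rewrite /beta_moment -(@RintegralB _ _ R mu D _ _ (measurable_itv _) (moment_integrable _ _) (moment_integrable _ _)).
by apply: eq_Rintegral => t; rewrite inE => Dt; rewrite slice_wtSS// !exprS; ring.
Qed.

Lemma beta_moment_rec a m : (a + m + 2)%:R * beta_moment a.+2 m = a.+1%:R * beta_moment a m.
Proof.
have := beta_moment_ibp a.+1 m; rewrite /= -/(beta_moment a m.+2) beta_momentSS.
rewrite !natrD -!natr1; lra.
Qed.

Lemma beta_moment1 m : beta_moment 1 m = 0.
Proof.
have := beta_moment_ibp 0 m; rewrite mul0r => /esym/eqP.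
by rewrite mulf_eq0 pnatr_eq0 /= => /eqP.
Qed.

Lemma beta_moment_recr a m : (a + m + 2)%:R * beta_moment a m.+2 = m.+1%:R * beta_moment a m.
Proof. by rewrite beta_momentSS mulrBr beta_moment_rec !natrD -!natr1; ring. Qed.

End BetaMoments.

Section Monomials.
Context {R : realType}.

Definition monf n (e : 'I_n.+1 -> nat) (x : 'rV[R]_n.+1) : R := \prod_i x ord0 i ^+ e i.

Definition moment n (e : 'I_n.+1 -> nat) : R := sphere_int n (monf e).

Lemma moment_eq n (e f : 'I_n.+1 -> nat) : e =1 f -> moment e = moment f.
Proof. by move=> ef; congr sphere_int; apply/funext => x; apply: eq_bigr => i _; rewrite ef. Qed.

Lemma cts_monf n (e : 'I_n.+1 -> nat) : cts (monf e).
Proof.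
rewrite (_ : monf e = \prod_i (fun x : 'rV[R]_n.+1 => x ord0 i ^+ e i)); last first.
  by apply/funext => x; rewrite /monf; elim/big_rec2 : _ => // i y1 y2 _ ->.
apply: big_ind => //; first exact: cts_cst.
  by move=> f g cf cg; exact: ctsM.
by move=> i _; apply: ctsX; apply: ctsT => x; exact: coord_continuous.
Qed.

(** By homogeneity a slice contributes a power of sqrt(1 - t^2), with the sum of the remaining
    exponents, and this only raises the index of the weight. *)
Lemma momentS n (e : 'I_n.+2 -> nat) : moment e =
  beta_moment (e ord0) (n + \sum_j e (lift ord0 j)) * moment (fun j => e (lift ord0 j)).
Proof.
rewrite /moment /= /beta_moment [RHS]mulrC.
have i : (@lebesgue_measure R).-integrable `]-1, 1[%classic
    (EFin \o (fun t => slice_wt (n + \sum_j e (lift ord0 j)) t * t ^+ e ord0)).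
  apply: (@slice_wtM_integrable _ _ _ 1) => [t _|t]; first exact: exprn_continuous.
  rewrite /= in_itv /= => /andP[t1 t2]; rewrite normrX exprn_ile1//.
  by rewrite ler_norml !ltW.
rewrite -(@RintegralZl _ _ R (@lebesgue_measure R) _ _ _ (measurable_itv _) i).
apply: eq_Rintegral => t; rewrite inE => Dt; rewrite -/(slice_wt _ _) slice_wtD//.
set s := Num.sqrt _.
have -> : (fun y : 'rV[R]_n.+1 => monf e (sph_lift t y)) =
    (fun y => (t ^+ e ord0 * s ^+ (\sum_j e (lift ord0 j))) * monf (fun j => e (lift ord0 j)) y).
  apply/funext => y; rewrite /monf big_ord_recl sph_lift0 -mulrA; congr (_ * _).
  rewrite -prodrXr -big_split /=; apply: eq_bigr => j _.
  by rewrite sph_liftS exprMn.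
by rewrite intZ; [ring|exact: cts_monf].
Qed.

Definition expup n (i : 'I_n.+1) (e : 'I_n.+1 -> nat) j := (e j + (j == i))%N.
Definition expdn n (i : 'I_n.+1) (e : 'I_n.+1 -> nat) j := (e j - (j == i))%N.

Lemma sum_expup n i (e : 'I_n.+1 -> nat) : (\sum_j expup i e j = (\sum_j e j).+1)%N.
Proof.
rewrite /expup big_split /= [X in (_ + X)%N](bigD1 i) //= eqxx [X in (_ + (_ + X))%N]big1 ?addn1// => // j /negbTE -> //.
Qed.

Lemma moment_expup0 n (e : 'I_n.+1 -> nat) i : n = 0%N -> e =1 (fun=> 0%N) ->
  moment (expup i e) = 0.
Proof.
move=> n0; subst n => e0.
by rewrite /moment /= /monf !big_ord1 !mxE /expup e0 (ord1 i) eqxx expr1 expr1 subrr.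
Qed.

(** The monomial case of the divergence theorem, by induction on the dimension. The first coordinate
    is a recursion of [beta_moment] in the power of t; the others combine the induction hypothesis
    with the recursion in the weight. *)
Lemma moment_ibp n (e : 'I_n.+1 -> nat) i :
  (\sum_j e j + n)%:R * moment (expup i e) = (e i)%:R * moment (expdn i e).
Proof.
elim: n e i => [|n IH] e i.
  rewrite (ord1 i) big_ord1 addn0 /moment /= /monf !big_ord1 !mxE /expup /expdn eqxx.
  case: (e ord0) => [|k]; first by rewrite !mul0r.
  by rewrite subn1 addn1 /= !exprS; ring.
case: (unliftP ord0 i) => [j|] ->; last first.
  rewrite !momentS big_ord_recl.
  have h1 j : expup ord0 e (lift ord0 j) = e (lift ord0 j) by rewrite /expup addn0.
  have h2 j : expdn ord0 e (lift ord0 j) = e (lift ord0 j) by rewrite /expdn subn0.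
  rewrite (eq_bigr _ (fun j _ => h1 j)) [X in _ = _ * (beta_moment _ (_ + X) * _)](eq_bigr _ (fun j _ => h2 j)).
  rewrite (moment_eq h1) (moment_eq h2) /expup /expdn eqxx addn1 subn1.
  case: (e ord0) => [|a]; first by rewrite beta_moment1 !mul0r mulr0.
  rewrite !mulrA /=; congr (_ * _); set b := (\sum_(_ < _) _)%N.
  by rewrite -beta_moment_rec; congr (_%:R * _); lia.
rewrite !momentS big_ord_recl.
have h1 k : expup (lift ord0 j) e (lift ord0 k) = expup j (fun k => e (lift ord0 k)) k.
  by rewrite /expup (inj_eq lift_inj).
have h2 k : expdn (lift ord0 j) e (lift ord0 k) = expdn j (fun k => e (lift ord0 k)) k.
  by rewrite /expdn (inj_eq lift_inj).
rewrite (eq_bigr _ (fun j _ => h1 j)) [X in _ = _ * (beta_moment _ (_ + X) * _)](eq_bigr _ (fun j _ => h2 j)).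
rewrite (moment_eq h1) (moment_eq h2) sum_expup.
have -> : expup (lift ord0 j) e ord0 = e ord0 by rewrite /expup addn0.
have -> : expdn (lift ord0 j) e ord0 = e ord0 by rewrite /expdn subn0.
have := IH (fun k => e (lift ord0 k)) j.
set a := e ord0; set f := (fun k : 'I_n.+1 => e (lift ord0 k)).
rewrite -[e (lift ord0 j)]/(f j) -[(\sum_j0 e (lift ord0 j0))%N]/(\sum_k f k)%N; set b := (\sum_k f k)%N => {}IH.
(* If the exponent is 0, the induction hypothesis gives a zero moment unless its left factor
   vanishes as well; then the lower sphere is S^0 and the coordinate sums to 0 over its two
   points. *)
have [f0|f0] := posnP (f j).
  rewrite f0 mul0r in IH *.
  move/eqP: IH; rewrite mulf_eq0 pnatr_eq0 addn_eq0 => /orP[/andP[b0 n0]|/eqP ->]; last by rewrite !(mulr0, mul0r).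
  have {}b0 : forall k, f k = 0%N.
    by move=> k; move: b0; rewrite sum_nat_eq0 => /forallP/(_ k)/eqP.
  have -> : moment (expup j f) = 0; last by rewrite !(mulr0, mul0r).
  by apply: moment_expup0 => //; apply/eqP.
have bd : (\sum_k expdn j f k = b.-1)%N.
  rewrite /b (bigD1 j) //= [in RHS](bigD1 j) //= {1}/expdn eqxx.
  have -> : (\sum_(i0 < n.+1 | i0 != j) expdn j f i0 = \sum_(i0 < n.+1 | i0 != j) f i0)%N.
    by apply: eq_bigr => k /negbTE kj; rewrite /expdn kj subn0.
  by move: f0; case: (f j) => // c _; rewrite subn1.
have b1 : (0 < b)%N by rewrite /b (bigD1 j) //= ltn_addr.
rewrite bd [RHS]mulrCA -IH.
have -> : (n + b.+1 = (n + b.-1).+2)%N by lia.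
have := @beta_moment_recr R a (n + b.-1).
rewrite (_ : (a + (n + b.-1) + 2 = a + b + n.+1)%N); last lia.
rewrite (_ : (n + b.-1).+1 = (b + n)%N); last lia.
by rewrite mulrA => ->; ring.
Qed.

End Monomials.

Section PolyInt.
Context {R : realType} (n : nat).
Local Notation V := 'rV[R]_n.+1.
Local Notation S := (@sphere R n).
Local Notation I := (@sphere_int R n).
Local Notation P := (mpoly n.+1 R).
Implicit Types p q : P.

Lemma pevalD p q x : peval (p + q) x = peval p x + peval q x.
Proof. exact: mevalD. Qed.
Lemma pevalZ c p x : peval (c *: p) x = c * peval p x.
Proof. exact: mevalZ. Qed.
Lemma pevalM p q x : peval (p * q) x = peval p x * peval q x.
Proof. exact: mevalM. Qed.
Lemma pevalB p q x : peval (p - q) x = peval p x - peval q x.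
Proof. exact: mevalB. Qed.
Lemma peval0 x : peval (0 : P) x = 0.
Proof. exact: meval0. Qed.
Lemma peval1 x : peval (1 : P) x = 1.
Proof. exact: meval1. Qed.
Lemma pevalC c x : peval (mpolyC n.+1 c : P) x = c.
Proof. exact: mevalC. Qed.
Lemma pevalX i x : peval (mpolyX R (mnm1 i) : P) x = x ord0 i.
Proof. exact: mevalXU. Qed.
Lemma peval_sum J (r : seq J) (Q : pred J) (F : J -> P) x :
  peval (\sum_(i <- r | Q i) F i) x = \sum_(i <- r | Q i) peval (F i) x.
Proof. exact: raddf_sum. Qed.
Lemma pevalXn p k x : peval (p ^+ k) x = peval p x ^+ k.
Proof. exact: rmorphXn. Qed.

Lemma peval_monf (m : multinom n.+1) x : peval (mpolyX R m : P) x = monf m x.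
Proof. exact: mevalX. Qed.

Lemma cts_peval p : cts (peval p).
Proof.
rewrite (_ : peval p = (fun x => \sum_(m <- msupp p) mcoeff m p * monf m x)).
  by apply: cts_sum => m _; apply: ctsZ; exact: cts_monf.
by apply/funext => x; rewrite /peval mevalE.
Qed.

Definition dhom (d : nat) p := all [pred m | mdeg m == d] (msupp p).

(* The divergence theorem on the ball for homogeneous vector fields. *)
Lemma int_mderiv d p i : dhom d p ->
  (d + n)%:R * I (peval (mpolyX R (mnm1 i) * p)) = I (peval (mderiv i p)).
Proof.
move=> /allP hp.
have -> : peval (mpolyX R (mnm1 i) * p) =
    (fun x => \sum_(m <- msupp p) mcoeff m p * monf (expup i m) x).
  apply/funext => x; rewrite {1}[p]mpolyE mulr_sumr peval_sum; apply: eq_bigr => m _.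
  rewrite -scalerAr pevalZ -mpolyXD peval_monf; congr (_ * _).
  by apply: eq_bigr => j _; rewrite mnmDE mnm1E addnC /expup eq_sym.
have -> : peval (mderiv i p) =
    (fun x => \sum_(m <- msupp p) (mcoeff m p * (m i)%:R) * monf (expdn i m) x).
  apply/funext => x; rewrite {1}[p]mpolyE linear_sum peval_sum; apply: eq_bigr => m _.
  rewrite [X in peval X]mderivZ mderivX !pevalZ peval_monf mulrA; congr (_ * _).
  by apply: eq_bigr => j _; rewrite mnmBE mnm1E /expdn eq_sym.
rewrite !int_sum; last 2 first.
- by move=> m _; apply: ctsZ; exact: cts_monf.
- by move=> m _; apply: ctsZ; exact: cts_monf.
rewrite mulr_sumr; apply: eq_big_seq => m /hp /eqP hm.
rewrite !intZ; [|exact: cts_monf|exact: cts_monf].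
rewrite -mulrA -[_ * I _]/(_ * moment _) -[(m i)%:R * _]/(_ * moment (expdn i m)) -moment_ibp.
have -> : (\sum_j m j)%N = d by rewrite -hm mdegE.
by rewrite mulrCA.
Qed.

End PolyInt.

Section HomAlg.
Context {R : realType} (n : nat).
Local Notation V := 'rV[R]_n.+1.
Local Notation S := (@sphere R n).
Local Notation P := (mpoly n.+1 R).
Local Notation X_ i := (mpolyX R (mnm1 i) : P).
Local Notation d_ i p := (mderiv i p : P).
Implicit Types p q : P.

Lemma homE d p : dhom d p = (p \is ishomog1 d mdeg).
Proof. by rewrite dhomogE. Qed.

Lemma hom0 d : dhom d (0 : P).
Proof. by rewrite homE; exact: dhomog0. Qed.

Lemma homD d p q : dhom d p -> dhom d q -> dhom d (p + q).
Proof. by rewrite !homE; exact: dhomogD. Qed.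

Lemma homZ d c p : dhom d p -> dhom d (c *: p).
Proof. by rewrite !homE; exact: dhomogZ. Qed.

Lemma homB d p q : dhom d p -> dhom d q -> dhom d (p - q).
Proof. by move=> hp hq; rewrite -scaleN1r; apply: homD => //; exact: homZ. Qed.

Lemma homM d e p q : dhom d p -> dhom e q -> dhom (d + e) (p * q).
Proof. by rewrite !homE; exact: dhomogM. Qed.

Lemma homXm (m : multinom n.+1) : dhom (mdeg m) (mpolyX R m : P).
Proof. by rewrite homE dhomogX. Qed.

Lemma homX i : dhom 1 (X_ i).
Proof. by rewrite homE dhomogX; apply/eqP; exact: mdeg1. Qed.

Lemma homC c : dhom 0 (mpolyC n.+1 c : P).
Proof. by rewrite -[mpolyC _ _]mulr1 mul_mpolyC; apply: homZ; rewrite homE; exact: dhomog1. Qed.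

Lemma hom_sum d J (r : seq J) (Q : pred J) (F : J -> P) :
  (forall i, Q i -> dhom d (F i)) -> dhom d (\sum_(i <- r | Q i) F i).
Proof. by move=> h; apply: (big_ind (dhom d)) => //; [exact: hom0|move=> ? ?; exact: homD]. Qed.

Lemma homXn k d p : dhom d p -> dhom (d * k) (p ^+ k).
Proof.
move=> hp; elim: k => [|k IH]; first by rewrite expr0 muln0 homE; exact: dhomog1.
by rewrite exprS mulnS; exact: homM.
Qed.

Lemma hom_expand d p : dhom d p ->
  p = \sum_(m <- msupp p | mdeg m == d) mcoeff m p *: (mpolyX R m : P).
Proof.
move=> /allP hp; rewrite {1}[p]mpolyE big_seq_cond [RHS]big_seq_cond.
apply: eq_bigl => m; rewrite andbT; case mp : (m \in msupp p) => //=.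
by have /= -> := hp m mp.
Qed.

Lemma hom_ind d (Q : P -> Prop) : Q 0 -> (forall p q, Q p -> Q q -> Q (p + q)) ->
  (forall c p, Q p -> Q (c *: p)) -> (forall m, mdeg m = d -> Q (mpolyX R m)) ->
  forall p, dhom d p -> Q p.
Proof.
move=> Q0 QD QZ QX p /hom_expand ->; apply: big_ind => // m /eqP hm.
by apply: QZ; exact: QX.
Qed.

Lemma mderiv_sum i J (r : seq J) (Q : pred J) (F : J -> P) :
  mderiv i (\sum_(j <- r | Q j) F j) = \sum_(j <- r | Q j) d_ i (F j).
Proof. exact: raddf_sum. Qed.

Lemma hom_mderiv d p i : dhom d.+1 p -> dhom d (d_ i p).
Proof.
move: p; apply: hom_ind => [||c q|m hm].
- by rewrite mderiv0; exact: hom0.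
- by move=> q r hq hr; rewrite mderivD; exact: homD.
- by rewrite mderivZ; exact: homZ.
- rewrite mderivX; have [->|mi] := posnP (m i); first by rewrite scale0r; exact: hom0.
  apply: homZ; have -> : d = mdeg (mnm_sub m (mnm1 i)); last exact: homXm.
  have e : m = mnm_add (mnm_sub m (mnm1 i)) (mnm1 i).
    apply/mnmP => j; rewrite mnmDE mnmBE mnm1E subnK//.
    by case: eqP => // <-.
  by have := hm; rewrite {1}e mdegD mdeg1 addn1 => -[].
Qed.

Lemma hom_mderiv0 p i : dhom 0 p -> d_ i p = 0.
Proof.
move: p; apply: hom_ind => [||c q|m].
- exact: mderiv0.
- by move=> q r hq hr; rewrite mderivD hq hr addr0.
- by rewrite mderivZ => ->; rewrite scaler0.
- by move=> /eqP; rewrite mdeg_eq0 => /eqP ->; rewrite mderivX mnm0E scale0r.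
Qed.

Lemma hom_euler d p : dhom d p -> \sum_i X_ i * d_ i p = d%:R *: p.
Proof.
move: p; apply: hom_ind => [||c q|m hm].
- by rewrite scaler0 big1// => i _; rewrite mderiv0 mulr0.
- move=> q r hq hr; rewrite scalerDr -hq -hr -big_split; apply: eq_bigr => i _ /=.
  by rewrite mderivD mulrDr.
- move=> h; rewrite scalerA mulrC -scalerA -h scaler_sumr; apply: eq_bigr => i _ /=.
  by rewrite mderivZ scalerAr.
- rewrite -hm mdegE natr_sum scaler_suml; apply: eq_bigr => i _.
  rewrite mderivX -scalerAr -mpolyXD.
  have [->|mi] := posnP (m i); first by rewrite !scale0r.
  congr (_ *: mpolyX _ _); apply/mnmP => j; rewrite mnmDE mnmBE mnm1E addnC subnK//.
  by case: eqP => // <-.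
Qed.

Lemma hom_euler_eval d p (x : V) : dhom d p -> \sum_i x ord0 i * peval (d_ i p) x = d%:R * peval p x.
Proof.
move=> /hom_euler h; rewrite -pevalZ -h peval_sum; apply: eq_bigr => i _.
by rewrite pevalM pevalX.
Qed.

Definition lap p : P := \sum_i mderiv i (mderiv i p).

Lemma lapD p q : lap (p + q) = lap p + lap q.
Proof. by rewrite -big_split; apply: eq_bigr => i _; rewrite !mderivD. Qed.

Lemma lapZ c p : lap (c *: p) = c *: lap p.
Proof. by rewrite scaler_sumr; apply: eq_bigr => i _; rewrite !mderivZ. Qed.

Lemma lapB p q : lap (p - q) = lap p - lap q.
Proof. by rewrite -scaleN1r lapD lapZ scaleN1r. Qed.

Lemma lap_mderiv i p : lap (d_ i p) = d_ i (lap p).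
Proof.
rewrite /lap mderiv_sum; apply: eq_bigr => j _.
by rewrite (mderiv_comm i j p) (mderiv_comm i j (mderiv j p)).
Qed.

Lemma lapM p q : lap (p * q) = lap p * q + p * lap q + (\sum_i d_ i p * d_ i q) *+ 2.
Proof.
rewrite mulr_suml mulr_sumr -sumrMnl -!big_split; apply: eq_bigr => i _ /=.
by rewrite mderivM mderivD !mderivM; ring.
Qed.

Lemma hom_lap d p : dhom d.+2 p -> dhom d (lap p).
Proof. by move=> hp; apply: hom_sum => i _; do 2!apply: hom_mderiv. Qed.

Lemma lap_hom01 d p : (d < 2)%N -> dhom d p -> lap p = 0.
Proof.
move=> d2 hp; apply: big1 => i _; case: d d2 hp => [|[|//]] _ hp.
  by rewrite (hom_mderiv0 i hp) mderiv0.
by apply: hom_mderiv0; exact: hom_mderiv.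
Qed.

Definition r2 : P := \sum_i X_ i ^+ 2.

Lemma hom_r2 : dhom 2 r2.
Proof. by apply: hom_sum => i _; exact: (homXn 2 (homX i)). Qed.

Lemma peval_r2 x : peval r2 x = dotv x x.
Proof. by rewrite peval_sum; apply: eq_bigr => i _; rewrite pevalXn pevalX. Qed.

Lemma mderivXU i j : d_ i (X_ j) = (i == j)%:R.
Proof.
rewrite mderivX mnm1E eq_sym; case: eqP => [->|_]; last by rewrite scale0r.
rewrite scale1r (_ : mnm_sub _ _ = mnm0)//; first exact: mpolyX0.
by apply/mnmP => k; rewrite mnmBE mnm0E subnn.
Qed.

Lemma mderiv_r2 i : d_ i r2 = X_ i *+ 2.
Proof.
rewrite mderiv_sum (bigD1 i) //= big1 ?addr0 => [|j ji].
  by rewrite expr2 mderivM mderivXU eqxx mulr1 mul1r mulr2n.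
by rewrite expr2 mderivM mderivXU eq_sym (negbTE ji) mulr0 mul0r addr0.
Qed.

Lemma lap_r2 : lap r2 = (n.+1 * 2)%:R.
Proof.
rewrite /lap (eq_bigr (fun=> 2%:R)) => [|i _].
  by rewrite sumr_const card_ord -mulrnA mulnC.
by rewrite mderiv_r2 mderivMn mderivXU eqxx.
Qed.

Lemma lap_r2M d p : dhom d p -> lap (r2 * p) = (n.+1 * 2 + d * 4)%:R *: p + r2 * lap p.
Proof.
move=> hp; rewrite lapM lap_r2.
rewrite (eq_bigr (fun i => (X_ i * d_ i p) *+ 2)); last first.
  by move=> i _; rewrite mderiv_r2 mulrnAl.
rewrite sumrMnl (hom_euler hp) mulr_natl !scaler_nat -!mulrnA addrAC -mulrnDr.
by congr (_ *+ _ + _); lia.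
Qed.

End HomAlg.

Arguments r2 {R n}.
Arguments hom_r2 {R n}.
Arguments homC {R} n c.

Section SphericalHarmonics.
Context {R : realType} (n : nat).
Hypothesis n0 : (0 < n)%N.
Local Notation V := 'rV[R]_n.+1.
Local Notation S := (@sphere R n).
Local Notation P := (mpoly n.+1 R).
Local Notation X_ i := (mpolyX R (mnm1 i) : P).
Local Notation d_ i p := (mderiv i p : P).
Implicit Types p q w : P.

Definition pint p : R := sphere_int n (peval p).

Lemma pintD p q : pint (p + q) = pint p + pint q.
Proof.
rewrite /pint -intD; [|exact: cts_peval|exact: cts_peval].
by congr sphere_int; apply/funext => x; rewrite pevalD.
Qed.

Lemma pintZ c p : pint (c *: p) = c * pint p.
Proof.
rewrite /pint -intZ; last exact: cts_peval.
by congr sphere_int; apply/funext => x; rewrite pevalZ.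
Qed.

Lemma pint0 : pint 0 = 0.
Proof. by rewrite -(scale0r 0) pintZ mul0r. Qed.

Lemma pint_sum J (r : seq J) (Q : pred J) (F : J -> P) :
  pint (\sum_(i <- r | Q i) F i) = \sum_(i <- r | Q i) pint (F i).
Proof. by apply: (big_morph pint); [exact: pintD|exact: pint0]. Qed.

Lemma pintM p q : pint (p * q) = sphere_int n (fun x => peval p x * peval q x).
Proof. by congr sphere_int; apply/funext => x; rewrite pevalM. Qed.

Lemma pint_mderiv d p i : dhom d p -> (d + n)%:R * pint (X_ i * p) = pint (d_ i p).
Proof. exact: int_mderiv. Qed.

(** Green's identity: by Euler's relation and the divergence theorem, m (l + m - 1 + n) and l (l + m
    - 1 + n) times the integral of p q both equal the integral of the product of the gradients. The
    two factors differ for l != m. *)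
Lemma harm_orth l m p q : l != m -> harm_hom l p -> harm_hom m q -> pint (p * q) = 0.
Proof.
move=> lm [hp lp] [hq lq].
pose T := \sum_i pint (d_ i p * d_ i q).
have key a b (f g : P) : dhom a f -> dhom b g -> lap g = 0 ->
    (b * (a + b.-1 + n))%:R * pint (f * g) = \sum_i pint (d_ i f * d_ i g).
  case: b => [|b] hf hg lg.
    rewrite mul0n mul0r big1// => i _.
    by rewrite (hom_mderiv0 i hg) mulr0 pint0.
  have h : \sum_i (a + b + n)%:R * pint (X_ i * (f * d_ i g)) = \sum_i pint (d_ i f * d_ i g).
    transitivity (\sum_i (pint (d_ i f * d_ i g) + pint (f * d_ i (d_ i g)))).
      apply: eq_bigr => i _; rewrite (pint_mderiv i (homM hf (hom_mderiv i hg))).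
      by rewrite mderivM pintD.
    by rewrite big_split /= -[X in _ + X]pint_sum -mulr_sumr -/(lap g) lg mulr0 pint0 addr0.
  rewrite /= natrM mulrAC -pintZ scalerAr -(hom_euler hg) mulr_sumr pint_sum mulr_suml -h.
  by apply: eq_bigr => i _; rewrite mulrC mulrCA.
have h1 := key _ _ _ _ hp hq lq; have h2 := key _ _ _ _ hq hp lp.
rewrite [in LHS]mulrC in h2.
have e : \sum_i pint (d_ i q * d_ i p) = \sum_i pint (d_ i p * d_ i q).
  by apply: eq_bigr => i _; rewrite mulrC.
rewrite e -h1 (mulrC q) mulrC in h2.
apply/eqP; move/eqP: h2; rewrite -subr_eq0 -mulrBl mulf_eq0 => /orP[|//].
rewrite subr_eq0 eqr_nat => /eqP h; exfalso.
move: lm => /eqP; apply.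
case: l m h {hp hq key h1 lp lq} => [|l] [|m] //= h; first 2 [lia].
  by move: h; rewrite !mulSn; nia.
by move: h; nia.
Qed.

(* The eigenvalue on degree l harmonics of the convolution with the kernel (x.y)^d, see funk_hecke. *)
Fixpoint mu (l d : nat) : R :=
  match l, d with
  | 0, 0 => sphere_vol R n
  | 0, 1 => 0
  | 0, d'.+2 => (d'.+1)%:R / (d'.+1 + n)%:R * mu 0 d'
  | l'.+1, 0 => 0
  | l'.+1, d'.+1 => (d'.+1)%:R / (l' + d'.+1 + n)%:R * mu l' d'
  end.

Lemma muSS l d : mu l.+1 d.+1 = (d.+1)%:R / (l + d.+1 + n)%:R * mu l d.
Proof. by []. Qed.

Definition lin (x : V) : P := \sum_i x ord0 i *: X_ i.

Lemma peval_lin x y : peval (lin x) y = dotv x y.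
Proof. by rewrite peval_sum; apply: eq_bigr => i _; rewrite pevalZ pevalX. Qed.

Lemma hom_lin x : dhom 1 (lin x).
Proof. by apply: hom_sum => i _; apply: homZ; exact: homX. Qed.

Lemma hom_linX x d : dhom d (lin x ^+ d).
Proof. by have := homXn d (hom_lin x); rewrite mul1n. Qed.

Lemma mderiv_lin x i : d_ i (lin x) = x ord0 i *: 1.
Proof.
rewrite mderiv_sum (bigD1 i) //= big1 ?addr0 => [|j ji].
  by rewrite mderivZ mderivXU eqxx.
by rewrite mderivZ mderivXU eq_sym (negbTE ji) scaler0.
Qed.

Lemma mderiv_linX x i d : d_ i (lin x ^+ d.+1) = (x ord0 i * d.+1%:R) *: lin x ^+ d.
Proof.
elim: d => [|d IH]; first by rewrite expr1 expr0 mderiv_lin mulr1.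
rewrite exprS mderivM IH mderiv_lin -scalerAl mul1r -scalerAr -exprS -scalerDl.
by congr (_ *: _); rewrite -[in RHS]natr1; ring.
Qed.

Lemma mu_ge0 l d : 0 <= mu l d.
Proof.
elim: l d => [|l IH] [|d] //; last by rewrite muSS; apply: mulr_ge0 => //; exact: divr_ge0.
  by apply: int_ge0 => //; exact: cts_cst.
elim: d.+2 {-2}d.+1 (leqnn d.+2) => // m IHm [|[|k]] hk //.
- by apply: int_ge0 => //; exact: cts_cst.
- by apply: mulr_ge0; [exact: divr_ge0|apply: IHm; exact: ltnW].
Qed.

Lemma natn_neq0 k : (k + n)%:R != 0 :> R.
Proof. by rewrite pnatr_eq0 -lt0n addn_gt0 n0 orbT. Qed.

(** The divergence theorem applied to one factor x.y lowers the power by two, since the squared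
    coordinates of x sum to 1. *)
Lemma mu0_pint x d : S x -> pint (lin x ^+ d) = mu 0 d.
Proof.
move=> Sx; elim: d.+1 {-2}d (leqnn d.+1) => // m IHm [|[|k]] hk.
- by rewrite expr0 /pint /= /sphere_vol; congr sphere_int; apply/funext => y; rewrite peval1.
- rewrite expr1 pint_sum big1// => i _; rewrite pintZ.
  have := pint_mderiv i (homC n 1 : dhom 0 (mpolyC n.+1 1 : P)).
  rewrite mderivC pint0 mpolyC1 mulr1 => /eqP; rewrite mulf_eq0 (negbTE (natn_neq0 0)) /=.
  by move=> /eqP ->; rewrite mulr0.
rewrite /= mulrAC -(IHm k); last by apply: ltnW.
apply: (mulfI (natn_neq0 k.+1)); rewrite [RHS]mulrC mulfVK ?natn_neq0//.
rewrite exprS {1}/lin mulr_suml pint_sum mulr_sumr.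
transitivity (\sum_i x ord0 i ^+ 2 * (k.+1%:R * pint (lin x ^+ k))).
  apply: eq_bigr => i _; rewrite -scalerAl pintZ mulrCA (pint_mderiv i (hom_linX x k.+1)).
  by rewrite mderiv_linX pintZ; ring.
rewrite -mulr_suml (_ : \sum_i _ = 1) ?mul1r//.
Qed.

(** Euler's relation writes (l + 1) Y as the sum of the X_i d_i Y, and the divergence theorem
    removes the X_i. Derivatives falling on d_i Y add up to the Laplacian of Y, which is 0; the
    remaining term lowers both the power of x.y and the degree of Y by one. *)
Theorem funk_hecke x l d Y : S x -> harm_hom l Y -> pint (lin x ^+ d * Y) = mu l d * peval Y x.
Proof.
move=> Sx; elim: l d Y => [|l IH] d Y [hY lY].
  have -> : Y = (mcoeff mnm0 Y) *: 1.
    rewrite {1}(hom_expand hY) (eq_bigr (fun=> mcoeff mnm0 Y *: 1)); last first.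
      by move=> m; rewrite mdeg_eq0 => /eqP ->; rewrite mpolyX0.
    have [Y0|Y0] := eqVneq (mcoeff mnm0 Y) 0.
      by rewrite Y0 scale0r big1.
    rewrite -big_filter; have -> : [seq m <- msupp Y | mdeg m == 0%N] = [:: mnm0].
      apply: perm_small_eq => //; apply: uniq_perm => //.
        by apply: filter_uniq; exact: msupp_uniq.
      move=> m; rewrite mem_filter inE mdeg_eq0; case: eqP => //= ->.
      by rewrite mcoeff_msupp.
    by rewrite big_seq1.
  by rewrite -scalerAr mulr1 !pintZ pevalZ peval1 mulr1 mu0_pint// mulrC.
have hd i : harm_hom l (d_ i Y).
  split; first exact: hom_mderiv.
  by rewrite -[LHS]/(lap _) lap_mderiv /lap lY mderiv0.
have l0 : l.+1%:R != 0 :> R by rewrite pnatr_eq0.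
have eY : l.+1%:R *: Y = \sum_i X_ i * d_ i Y by rewrite (hom_euler hY).
apply: (mulfI l0); rewrite -pintZ scalerAr eY mulr_sumr pint_sum.
have h i : (l + d + n)%:R * pint (lin x ^+ d * (X_ i * d_ i Y)) =
    pint (d_ i (lin x ^+ d) * d_ i Y) + pint (lin x ^+ d * d_ i (d_ i Y)).
  rewrite mulrCA (addnC l) (pint_mderiv i (homM (hom_linX x d) (hd i).1)).
  by rewrite mderivM pintD.
apply: (mulfI (natn_neq0 (l + d))); rewrite mulr_sumr (eq_bigr _ (fun i _ => h i)) big_split /=.
rewrite -[X in _ + X]pint_sum -mulr_sumr lY mulr0 pint0 addr0.
case: d {h} => [|d].
  rewrite big1 /= ?mul0r ?mulr0// => i _.
  by rewrite expr0 (hom_mderiv0 i (homC n 1 : dhom 0 (mpolyC n.+1 1))) mul0r pint0.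
rewrite muSS (eq_bigr (fun i => (d.+1%:R * mu l d) * (x ord0 i * peval (d_ i Y) x))); last first.
  by move=> i _; rewrite mderiv_linX -scalerAl pintZ IH//; ring.
rewrite -mulr_sumr (hom_euler_eval x hY).
by have := natn_neq0 (l + d.+1); set c := (l + d.+1 + n)%:R => c0; field.
Qed.

(** Taking the Laplacian of the equation shows that v = lap z solves an equation of the same form,
    with a + b in place of a, where b comes from [lap_r2M]; conversely v determines z. For a equal
    to the constant of [lap_r2M], this is the surjectivity of z -> lap (r2 z). *)
Lemma lap_solve d a w : 0 < a -> dhom d w ->
  exists2 z, dhom d z & a *: z + (r2) * lap z = w.
Proof.
elim: d.+1 {-2}d (leqnn d.+1) a w => // m IHm {}d hd a w a0 hw.
have [d2|d2] := ltnP d 2.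
  exists (a^-1 *: w); first exact: homZ.
  rewrite lapZ (lap_hom01 d2 hw) scaler0 mulr0 addr0 scalerA divff ?scale1r//; exact: lt0r_neq0.
case: d d2 hd hw => [|[|d]] // _ hd hw.
pose b : R := (n.+1 * 2 + d * 4)%:R.
have ab : 0 < a + b by rewrite ltr_wpDr.
have [v hv ev] := IHm d (ltnW hd) (a + b) (lap w) ab (hom_lap hw).
exists (a^-1 *: (w - r2 * v)).
  by apply: homZ; apply: homB => //; have := homM hom_r2 hv.
rewrite lapZ lapB (lap_r2M hv) -/b -ev scalerDl.
rewrite (_ : a *: v + b *: v + r2 * lap v - (b *: v + r2 * lap v) = a *: v); last first.
  by rewrite -[a *: v + b *: v + _]addrA addrK.
rewrite !scalerA divff ?mulVf ?lt0r_neq0// !scale1r.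
by rewrite subrK.
Qed.

Lemma harm_split d w : dhom d.+2 w -> exists z, dhom d z /\ harm_hom d.+2 (w - r2 * z).
Proof.
move=> hw; have b0 : 0 < (n.+1 * 2 + d * 4)%:R :> R by rewrite ltr0n.
have [z hz ez] := lap_solve b0 (hom_lap hw).
exists z; split => //; split.
  by apply: homB => //; have := homM hom_r2 hz.
by rewrite -[LHS]/(lap _) lapB (lap_r2M hz) ez subrr.
Qed.

Lemma harm0 l : harm_hom l (0 : P).
Proof. by split; [exact: hom0|rewrite big1// => i _; rewrite !mderiv0]. Qed.

Lemma harmD l p q : harm_hom l p -> harm_hom l q -> harm_hom l (p + q).
Proof.
by move=> [hp lp] [hq lq]; split; [exact: homD|rewrite -[LHS]/(lap _) lapD /lap lp lq addr0].
Qed.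

Lemma harmZ l c p : harm_hom l p -> harm_hom l (c *: p).
Proof.
by move=> [hp lp]; split; [exact: homZ|rewrite -[LHS]/(lap _) lapZ /lap lp scaler0].
Qed.

Lemma dhom_harm d w : (d < 2)%N -> dhom d w -> harm_hom d w.
Proof. by move=> d2 hw; split=> //; exact: (lap_hom01 d2 hw). Qed.

Lemma hom_decomp d w : dhom d w -> exists h : nat -> P,
  [/\ forall l, harm_hom l (h l), forall l, (d < l)%N -> h l = 0 &
    forall N x, (d < N)%N -> S x -> peval w x = \sum_(l < N) peval (h l) x].
Proof.
elim: d.+1 {-2}d (leqnn d.+1) w => // m IHm {}d hd w hw.
have one (q : P) e : harm_hom e q -> [/\ forall l, harm_hom l (if l == e then q else 0),
   forall l, (e < l)%N -> (if l == e then q else 0) = 0 &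
   forall N x, (e < N)%N -> S x -> peval q x = \sum_(l < N) peval (if l == e :> nat then q else 0) x].
  move=> hq; split=> [l|l el|N x eN Sx].
  - by case: eqP => [->//|_]; exact: harm0.
  - by rewrite gtn_eqF.
  - rewrite (bigD1 (Ordinal eN)) //= eqxx big1 ?addr0// => i.
    by rewrite -val_eqE /= => /negbTE ->; rewrite peval0.
have [d2|d2] := ltnP d 2.
  by exists (fun l => if l == d then w else 0); apply: one; exact: dhom_harm.
case: d d2 hd hw => [|[|d]] // _ hd hw.
have [z [hz hwz]] := harm_split hw.
have [h [h1 h2 h3]] := IHm d (ltnW hd) z hz.
have [g1 g2 g3] := one _ _ hwz.
exists (fun l => h l + (if l == d.+2 then w - r2 * z else 0)); split=> [l|l dl|N x dN Sx].
- exact: harmD.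
- by rewrite g2// h2 ?addr0//; apply: leq_trans dl; rewrite ltnW.
- rewrite (eq_bigr (fun l : 'I_N => peval (h l) x + peval (if l == d.+2 :> nat then w - r2 * z else 0) x)).
    rewrite big_split /= -h3//; last by apply: leq_trans dN; rewrite ltnW.
    by rewrite -g3// pevalB pevalM peval_r2 Sx mul1r addrC subrK.
  by move=> l _; rewrite pevalD.
Qed.

Lemma poly_decomp w : exists (N0 : nat) (h : nat -> P),
  [/\ forall l, harm_hom l (h l), forall l, (N0 <= l)%N -> h l = 0 &
    forall N x, (N0 <= N)%N -> S x -> peval w x = \sum_(l < N) peval (h l) x].
Proof.
elim/mpolyind: w => [|c m p _ _ [N1 [h [h1 h2 h3]]]].
  exists 0%N, (fun=> 0); split=> // [l|N x _ _]; first exact: harm0.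
  by rewrite peval0 big1// => i _; rewrite peval0.
have [g [g1 g2 g3]] := hom_decomp (@homXm R n m).
exists (maxn N1 (mdeg m).+1), (fun l => c *: g l + h l); split=> [l|l|N x].
- by apply: harmD => //; exact: harmZ.
- by rewrite geq_max => /andP[l1 l2]; rewrite h2// g2// scaler0 addr0.
- rewrite geq_max => /andP[l1 l2] Sx; rewrite pevalD pevalZ (g3 N)// (h3 N)// mulr_sumr -big_split.
  by apply: eq_bigr => l _; rewrite /= pevalD pevalZ.
Qed.

End SphericalHarmonics.

(** * Zonal kernels and projections *)

Section ZonalPoly.
Context {R : realType} (n : nat).
Hypothesis n0 : (0 < n)%N.
Local Notation V := 'rV[R]_n.+1.
Local Notation S := (@sphere R n).
Local Notation I := (@sphere_int R n).
Local Notation P := (mpoly n.+1 R).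
Local Notation mu := (@mu R n).
Implicit Types (phi psi : {poly R}) (u v : V -> R).

Lemma cts_poly_dot phi (x : V) : cts (fun y => phi.[dotv x y]).
Proof.
rewrite (_ : (fun y => _) = (fun y => \sum_(i < size phi) phi`_i * dotv x y ^+ i)).
  by apply: cts_sum => i _; apply: ctsZ; apply: ctsX; exact: cts_dotr.
by apply/funext => y; rewrite horner_coef.
Qed.

(** The eigenvalue on degree l harmonics of the convolution with phi(x.y), see [lam_zonal]. *)
Definition lam l phi : R := \sum_(j < size phi) phi`_j * mu l j.

Lemma lamE l phi N : (size phi <= N)%N -> lam l phi = \sum_(j < N) phi`_j * mu l j.
Proof.
move=> sN; rewrite /lam (big_ord_widen _ (fun j => phi`_j * mu l j) sN) big_mkcond /=.
apply: eq_bigr => j _; case: ltnP => // h.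
by rewrite nth_default// mul0r.
Qed.

Lemma lamD l phi psi : lam l (phi + psi) = lam l phi + lam l psi.
Proof.
have s : (size (phi + psi)%R <= maxn (size phi) (size psi))%N by exact: size_polyD.
rewrite (lamE l s) (lamE l (leq_maxl (size phi) (size psi))) (lamE l (leq_maxr (size phi) (size psi))).
by rewrite -big_split; apply: eq_bigr => j _; rewrite coefD mulrDl.
Qed.

Lemma lamZ l c phi : lam l (c *: phi) = c * lam l phi.
Proof.
rewrite (lamE l (size_scale_leq c phi)) mulr_sumr.
by apply: eq_bigr => j _; rewrite coefZ mulrA.
Qed.

Lemma lam0 l : lam l 0 = 0.
Proof. by rewrite -(scale0r 0) lamZ mul0r. Qed.

Lemma lamB l phi psi : lam l (phi - psi) = lam l phi - lam l psi.
Proof. by rewrite -scaleN1r lamD lamZ mulN1r. Qed.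

Lemma lamXn l d : lam l 'X^d = mu l d.
Proof.
rewrite /lam size_polyXn big_ord_recr /= coefXn eqxx mul1r big1 ?add0r// => j _.
by rewrite coefXn (ltn_eqF (ltn_ord j)) mul0r.
Qed.

Lemma lam_zonal l phi Y x : S x -> harm_hom l Y ->
  I (fun y => phi.[dotv x y] * peval Y y) = lam l phi * peval Y x.
Proof.
move=> Sx hY.
rewrite (_ : (fun y => _) = (fun y => \sum_(i < size phi) phi`_i * peval (lin x ^+ i * Y) y)).
  rewrite int_sum; last by move=> i _; apply: ctsZ; exact: cts_peval.
  rewrite mulr_suml; apply: eq_bigr => i _; rewrite intZ; last exact: cts_peval.
  by rewrite -[I _]/(pint _) (funk_hecke n0 i Sx hY) mulrA.
apply/funext => y; rewrite horner_coef mulr_suml; apply: eq_bigr => i _.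
by rewrite pevalM pevalXn peval_lin mulrA.
Qed.

Lemma harm1 : harm_hom 0 (1 : P).
Proof. by apply: dhom_harm => //; have := homC n (1 : R); rewrite mpolyC1. Qed.

Lemma int_zonal phi x : S x -> I (fun y => phi.[dotv x y]) = lam 0 phi.
Proof.
move=> Sx; have := lam_zonal phi Sx harm1; rewrite peval1 mulr1 => <-.
by congr sphere_int; apply/funext => y; rewrite peval1 mulr1.
Qed.

Lemma sphere_vol_gt0 : 0 < sphere_vol R n.
Proof.
(* Two base cases: the weight is 1 for m = 1 and is larger for m = 0; [beta_moment_recr] then
   advances by two. *)
have B0 (m : nat) : 0 < beta_moment (R:=R) 0 m.
  have B1 : beta_moment (R:=R) 0 1 = 2.
    rewrite /beta_moment (@eq_Rintegral _ _ _ _ _ (cst 1)); last first.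
      move=> t _; rewrite /slice_wt subrr mul0r powRr0 expr0 mulr1//.
    rewrite Rintegral_cst; last exact: measurable_itv.
    have := @lebesgue_measure_itv R `]-1, 1[; rewrite /= lte_fin gtrN// => ->.
    by rewrite mul1r /= opprK.
  have B00 : beta_moment (R:=R) 0 1 <= beta_moment (R:=R) 0 0.
    apply: le_Rintegral; first exact: measurable_itv.
    - by apply: (@slice_wtM_integrable _ _ _ 1) => [t _|t _];
        [exact: exprn_continuous|rewrite expr0 normr1].
    - by apply: (@slice_wtM_integrable _ _ _ 1) => [t _|t _];
        [exact: exprn_continuous|rewrite expr0 normr1].
    - move=> t Dt; rewrite !expr0 !mulr1 !slice_wtE// expr1 expr0.
      have h := itv_onem_sqr_gt0 Dt.
      have s0 : 0 < Num.sqrt (1 - t ^+ 2) by rewrite sqrtr_gt0.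
      rewrite ler_pM2r ?invr_gt0//.
      by rewrite -[leRHS]sqrtr1 ler_wsqrtr// gerBl sqr_ge0.
  elim: m.+1 {-2}m (leqnn m.+1) => [[]//|k IH [|[|j]] hk].
  - by apply: lt_le_trans B00; rewrite B1.
  - by rewrite B1.
  - have := beta_moment_recr (R:=R) 0 j; have h := IH j (ltnW hk).
    move=> e; have : 0 < (0 + j + 2)%:R * beta_moment (R:=R) 0 j.+2.
      by rewrite e mulr_gt0// ltr0n.
    by rewrite pmulr_rgt0// ltr0n addn2.
have -> : sphere_vol R n = moment (R:=R) (fun _ : 'I_n.+1 => 0%N).
  congr sphere_int; apply/funext => x; rewrite /monf big1// => i _.
elim: (n) => [|m IH].
  by rewrite /moment /= /monf !big_ord1 !expr0 addr_gt0.
by rewrite momentS mulr_gt0.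
Qed.

Lemma mu_diag_gt0 l : 0 < mu l l.
Proof.
elim: l => [|l IH]; first exact: sphere_vol_gt0.
by rewrite muSS mulr_gt0// divr_gt0 ?ltr0n// addnS.
Qed.

Lemma mu_small l d : (d < l)%N -> mu l d = 0.
Proof. by elim: l d => [|l IH] [|d] // h; rewrite muSS IH ?mulr0. Qed.

Lemma lam_small l phi : (size phi <= l)%N -> lam l phi = 0.
Proof.
move=> h; rewrite /lam big1// => j _; rewrite mu_small ?mulr0//.
exact: leq_trans (ltn_ord j) h.
Qed.

(** Green's formula: as a function of y, x.y has spherical Laplacian -n x.y and a tangential
    gradient of squared length 1 - (x.y)^2. By linearity it reduces to the recursion of [mu 0]. *)
Lemma lam0_deriv phi : lam 0 (phi^`() * (1 - 'X^2)) = n%:R * lam 0 ('X * phi).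
Proof.
pose A p := lam 0 (p^`() * (1 - 'X^2)) - n%:R * lam 0 ('X * p).
have AD p q : A (p + q) = A p + A q.
  by rewrite /A derivD mulrDl (mulrDr 'X) !lamD; ring.
have A0 : A 0 = 0 by rewrite /A deriv0 mul0r mulr0 lam0 mulr0 subrr.
have AZ c p : A (c *: p) = c * A p.
  by rewrite /A derivZ -scalerAl -scalerAr !lamZ; ring.
suff : A phi = 0 by move=> /eqP; rewrite subr_eq0 => /eqP.
rewrite -(coefK phi) poly_def (big_morph A AD A0) big1// => i _.
rewrite AZ (_ : A 'X^i = 0) ?mulr0//.
rewrite /A -exprS lamXn derivXn; case: (val i) => [|d].
  by rewrite mulr0n mul0r lam0 mulr0 subrr.
rewrite -scaler_nat -scalerAl lamZ mulrBr mulr1 -exprD lamB !lamXn addn2 /=.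
have := natn_neq0 n0 d.+1; set c := (d.+1 + n)%:R => c0.
have -> : n%:R = c - d.+1%:R by rewrite /c natrD; ring.
by field.
Qed.

Definition hk N : {poly R} := (1 + 'X) ^+ N.

(** The derivative of (1 + t)^k times 1 - t^2 is k (1 + t)^k (1 - t), so [lam0_deriv] evaluates the
    mean of 1 - t exactly. Its decay like 1 / N is the concentration at t = 1. *)
Lemma lam_hk_gt0 N : 0 < lam 0 (hk N) /\
  lam 0 (hk N * (1 - 'X)) = n%:R / (N + n)%:R * lam 0 (hk N).
Proof.
have rec k : (k + n)%:R * lam 0 (hk k * (1 - 'X)) = n%:R * lam 0 (hk k).
  have := lam0_deriv (hk k).
  have -> : (hk k)^`() * (1 - 'X^2) = k%:R *: (hk k * (1 - 'X)).
    rewrite /hk deriv_exp derivD derivC derivX add0r mul1r scaler_nat.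
    case: k => [|k]; first by rewrite !mulr0n mul0r.
    rewrite mulrnAl /= (_ : 1 - 'X^2 = (1 + 'X) * (1 - 'X) :> {poly R}); last by ring.
    by rewrite mulrA -exprSr.
  have -> : 'X * hk k = hk k - hk k * (1 - 'X) by ring.
  by rewrite lamZ lamB natrD => h; lra.
have rec' k : lam 0 (hk k * (1 - 'X)) = n%:R / (k + n)%:R * lam 0 (hk k).
  by apply: (mulfI (natn_neq0 n0 k)); rewrite rec mulrA mulrCA divff ?mulr1// natn_neq0.
split=> //; elim: N => [|N IH].
  by rewrite /hk expr0 -(expr0 'X) (lamXn 0 0); exact: sphere_vol_gt0.
have -> : hk N.+1 = 2%:R *: hk N - hk N * (1 - 'X).
  by rewrite /hk exprSr -mul_polyC polyCMn; ring.
rewrite lamB lamZ rec' -mulrBl mulr_gt0// subr_gt0.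
apply: (@le_lt_trans _ _ 1); last by rewrite ltr1n.
by rewrite ler_pdivrMr ?mul1r ?ler_nat ?leq_addl// ltr0n addn_gt0 n0 orbT.
Qed.

(* A polynomial approximate identity: (1 + x.y)^N concentrates at y = x. *)
Definition delta_poly N : {poly R} := (lam 0 (hk N))^-1 *: hk N.

Lemma delta_poly_ge0 N t : -1 <= t -> 0 <= (delta_poly N).[t].
Proof.
move=> t1; rewrite /delta_poly hornerZ /hk horner_exp !hornerE.
apply: mulr_ge0; first by rewrite invr_ge0 ltW//; exact: (lam_hk_gt0 N).1.
by rewrite exprn_ge0// addrC -lerBlDr sub0r.
Qed.

Lemma lam_delta_poly N : lam 0 (delta_poly N) = 1.
Proof. by rewrite lamZ mulVf// gt_eqF//; exact: (lam_hk_gt0 N).1. Qed.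

Lemma lam_delta_poly1 N : lam 0 (delta_poly N * (1 - 'X)) = n%:R / (N + n)%:R.
Proof.
have [h1 h2] := lam_hk_gt0 N.
by rewrite /delta_poly -scalerAl lamZ h2 mulrC mulfK// gt_eqF.
Qed.

Definition zonal_op phi u (x : V) : R := I (fun y => phi.[dotv x y] * u y).

Lemma cts_zonal_op_integrand phi u x : cts u -> cts (fun y => phi.[dotv x y] * u y).
Proof. by move=> cu; apply: ctsM => //; exact: cts_poly_dot. Qed.

(** A modulus of continuity that is affine in 1 - x.y integrates exactly against the kernel, by
    [lam_delta_poly] and [lam_delta_poly1]. *)
Lemma zonal_op_delta_poly_approx_at u x N e C : cts u -> S x ->
  (forall y, S y -> `|u y - u x| <= e + C * (1 - dotv x y)) ->
  `|zonal_op (delta_poly N) u x - u x| <= e + C * (n%:R / (N + n)%:R).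
Proof.
move=> cu Sx h.
have cd := cts_poly_dot (delta_poly N) x.
have e1 : u x = I (fun y => (delta_poly N).[dotv x y] * u x).
  under eq_fun do rewrite mulrC.
  by rewrite intZ// (int_zonal _ Sx) lam_delta_poly mulr1.
rewrite [X in _ - X]e1 /zonal_op -intB; last 2 first.
- exact: ctsM.
- by apply: ctsM => //; exact: cts_cst.
apply: le_trans (int_norm _) _.
  by apply: ctsB; apply: ctsM => //; exact: cts_cst.
have cc : cts (fun y => (delta_poly N).[dotv x y] * (e + C * (1 - dotv x y))).
  apply: ctsM => //; apply: ctsD; first exact: cts_cst.
  by apply: ctsZ; apply: ctsB; [exact: cts_cst|exact: cts_dotr].
apply: (@le_trans _ _ (I (fun y => (delta_poly N).[dotv x y] * (e + C * (1 - dotv x y))))).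
  apply: int_le => //; first by apply: cts_norm; apply: ctsB; apply: ctsM => //; exact: cts_cst.
  move=> y Sy; rewrite -mulrBr normrM ger0_norm ?delta_poly_ge0 ?dotv_geN1//.
  by apply: ler_wpM2l; [rewrite delta_poly_ge0 ?dotv_geN1|exact: h].
have -> : (fun y => (delta_poly N).[dotv x y] * (e + C * (1 - dotv x y))) =
    (fun y => (e *: delta_poly N + C *: (delta_poly N * (1 - 'X))).[dotv x y]).
  apply/funext => y; have e2 t : (1 - 'X : {poly R}).[t] = 1 - t by rewrite !hornerE.
    by move: (delta_poly N) => D; rewrite hornerD !hornerZ hornerM e2; ring.
by rewrite (int_zonal _ Sx) lamD (lamZ 0 e (delta_poly N)) (lamZ 0 C (delta_poly N * _)) lam_delta_poly lam_delta_poly1 mulr1.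
Qed.

(** Beyond distance d one has 1 - x.y >= d^2 / 2, and the slope 4 M / d^2 then covers the
    oscillation 2 M. *)
Lemma modulus_dot u e : cts u -> 0 < e -> exists2 C, 0 <= C &
  forall x y, S x -> S y -> `|u y - u x| <= e + C * (1 - dotv x y).
Proof.
move=> cu e0; have [d d0 hd] := cts_unif cu e0; have [M M0 hM] := cts_bounded cu.
have d20 : 0 < d ^+ 2 by rewrite exprn_gt0.
exists (4 * M / d ^+ 2) => [|x y Sx Sy]; first by rewrite divr_ge0 ?mulr_ge0 ?ltW.
have h1 := dotv_le1 Sx Sy.
have [xy|xy] := ltP `|y - x| d.
  apply: le_trans (ltW (hd y x Sy Sx xy)) _; rewrite lerDl mulr_ge0 ?subr_ge0//.
  by rewrite divr_ge0 ?mulr_ge0 ?ltW.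
have : d ^+ 2 <= 2 * (1 - dotv x y).
  rewrite -dist_sphere//; apply: le_trans (norm2_le_dotv _).
  by rewrite (distrC x y) ler_sqr ?nnegrE ?(ltW d0).
move=> h2; apply: (@le_trans _ _ (2 * M)).
  have := hM y Sy; have := hM x Sx; rewrite !ler_norml; lra.
apply: (@le_trans _ _ (4 * M / d ^+ 2 * (1 - dotv x y))); last by rewrite lerDr ltW.
rewrite mulrAC ler_pdivlMr//; nra.
Qed.

Lemma zonal_op_delta_poly_approx u e : cts u -> 0 < e -> exists N0, forall N, (N0 <= N)%N ->
  forall x, S x -> `|zonal_op (delta_poly N) u x - u x| <= e.
Proof.
move=> cu e0; have e2 : 0 < e / 2 by rewrite divr_gt0.
have [C C0 hC] := modulus_dot cu e2.
have [N0 hN0] : exists N0 : nat, C * n%:R / (e / 2) < N0%:R.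
  exists (Num.bound (C * n%:R / (e / 2))); apply: archi_boundP.
  by rewrite divr_ge0 ?mulr_ge0// ltW.
exists N0 => N hN x Sx; apply: le_trans (zonal_op_delta_poly_approx_at N cu Sx (fun y Sy => hC x y Sx Sy)) _.
have Nn : 0 < (N + n)%:R :> R by rewrite ltr0n addn_gt0 n0 orbT.
suff : C * (n%:R / (N + n)%:R) <= e / 2 by lra.
rewrite mulrA ler_pdivrMr// [leRHS]mulrC -ler_pdivrMr//; apply: le_trans (ltW hN0) _.
by rewrite ler_nat; apply: leq_trans hN (leq_addr _ _).
Qed.

(** If the integral were 0, then so would be every average of u against a bounded nonnegative
    kernel, in particular its smoothing at [x0], which is close to [u x0]. *)
Lemma int_gt0 u x0 : cts u -> (forall x, S x -> 0 <= u x) -> S x0 -> 0 < u x0 -> 0 < I u.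
Proof.
move=> cu u0 Sx0 ux0; rewrite lt_def int_ge0// andbT; apply/eqP => I0.
have e0 : 0 < u x0 / 2 by rewrite divr_gt0.
have [N hN] := zonal_op_delta_poly_approx cu e0.
have := hN N (leqnn N) x0 Sx0.
suff -> : zonal_op (delta_poly N) u x0 = 0 by rewrite sub0r normrN gtr0_norm//; lra.
have [M M0 hM] := cts_bounded (cts_poly_dot (delta_poly N) x0).
apply/eqP; rewrite eq_le; apply/andP; split.
  rewrite -[leRHS](mulr0 M) -I0 -intZ//; apply: int_le.
  - exact: cts_zonal_op_integrand.
  - exact: ctsZ.
  - move=> y Sy; apply: ler_wpM2r; first exact: u0.
    by apply: le_trans (ler_norm _) (hM y Sy).
apply: int_ge0; first exact: cts_zonal_op_integrand.
by move=> y Sy; rewrite mulr_ge0 ?u0// delta_poly_ge0// dotv_geN1.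
Qed.

Lemma int_eq0 u : cts u -> (forall x, S x -> 0 <= u x) -> I u = 0 -> forall x, S x -> u x = 0.
Proof.
move=> cu u0 Iu x Sx; apply/eqP; rewrite eq_le u0// andbT leNgt; apply/negP => ux.
by have := int_gt0 cu u0 Sx ux; rewrite Iu ltxx.
Qed.

(** A polynomial in x.y is a finite sum of products of a function of x and a function of y. This
    turns every exchange of two integrals below into one with a finite sum. *)
Definition sep (J : seq (P * P)) (x y : V) : R := \sum_(ab <- J) peval ab.1 x * peval ab.2 y.

Lemma dot_sep d : exists2 J : seq (P * P), all (fun ab => dhom d ab.1) J &
  forall x y, dotv x y ^+ d = sep J x y.
Proof.
elim: d => [|d [J hJ eJ]].
  exists [:: (1, 1)]; last by move=> x y; rewrite /sep big_seq1 /= !peval1 mulr1 expr0.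
  by rewrite /= andbT; exact: harm1.1.
exists [seq (mpolyX R (mnm1 i) * ab.1, mpolyX R (mnm1 i) * ab.2) | i <- enum 'I_n.+1, ab <- J].
  apply/allP => _ /allpairsP[[i ab] /= [_ abJ ->]] /=.
  by apply: (homM (homX i)); exact: (allP hJ).
move=> x y; rewrite exprS eJ /sep big_allpairs_dep mulr_suml big_enum /=; apply: eq_bigr => i _.
by rewrite mulr_sumr; apply: eq_bigr => ab _; rewrite !pevalM !pevalX; ring.
Qed.

Lemma poly_sep phi : exists J, forall x y, phi.[dotv x y] = sep J x y.
Proof.
elim/poly_ind: phi => [|p c [J hJ]].
  by exists [::] => x y; rewrite horner0 /sep big_nil.
have [K _ hK] := dot_sep 1.
exists ((mpolyC n.+1 c, 1) :: [seq (ab.1 * cd.1, ab.2 * cd.2) | ab <- J, cd <- K]) => x y.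
rewrite hornerMXaddC hJ -[dotv x y]expr1 hK /sep big_cons /= pevalC peval1 mulr1 addrC; congr (_ + _).
rewrite big_allpairs_dep mulr_suml; apply: eq_bigr => ab _; rewrite mulr_sumr.
by apply: eq_bigr => cd _; rewrite !pevalM /=; ring.
Qed.

Lemma zonal_op_peval phi u : cts u -> exists p, forall x, zonal_op phi u x = peval p x.
Proof.
move=> cu; have [J hJ] := poly_sep phi.
exists (\sum_(ab <- J) I (fun y => peval ab.2 y * u y) *: ab.1) => x.
rewrite peval_sum /zonal_op (_ : (fun y => _) = (fun y => \sum_(ab <- J) peval ab.1 x * (peval ab.2 y * u y))).
  rewrite int_sum => [|ab _]; last by apply: ctsZ; apply: ctsM => //; exact: cts_peval.
  apply: eq_bigr => ab _; rewrite intZ; last by apply: ctsM => //; exact: cts_peval.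
  by rewrite pevalZ mulrC.
by apply/funext => y; rewrite hJ mulr_suml; apply: eq_bigr => ab _; rewrite mulrA.
Qed.

Lemma cts_zonal_op phi u : cts u -> cts (zonal_op phi u).
Proof.
move=> cu; have [p hp] := zonal_op_peval phi cu.
by rewrite (_ : zonal_op phi u = peval p); [exact: cts_peval|exact/funext].
Qed.

Lemma zonal_op_sym phi u v : cts u -> cts v ->
  I (fun x => v x * zonal_op phi u x) = I (fun x => u x * zonal_op phi v x).
Proof.
move=> cu cv; have [J hJ] := poly_sep phi.
have E w (cw : cts w) x : zonal_op phi w x = \sum_(ab <- J) peval ab.1 x * I (fun y => peval ab.2 y * w y).
  rewrite /zonal_op (_ : (fun y => _) = (fun y => \sum_(ab <- J) peval ab.1 x * (peval ab.2 y * w y))).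
    rewrite int_sum => [|ab _]; last by apply: ctsZ; apply: ctsM => //; exact: cts_peval.
    by apply: eq_bigr => ab _; rewrite intZ//; apply: ctsM => //; exact: cts_peval.
  by apply/funext => y; rewrite hJ mulr_suml; apply: eq_bigr => ab _; rewrite mulrA.
have E' w (cw : cts w) x : zonal_op phi w x = \sum_(ab <- J) peval ab.2 x * I (fun y => peval ab.1 y * w y).
  rewrite /zonal_op (_ : (fun y => _) = (fun y => \sum_(ab <- J) peval ab.2 x * (peval ab.1 y * w y))).
    rewrite int_sum => [|ab _]; last by apply: ctsZ; apply: ctsM => //; exact: cts_peval.
    by apply: eq_bigr => ab _; rewrite intZ//; apply: ctsM => //; exact: cts_peval.
  apply/funext => y; rewrite dotvC hJ mulr_suml; apply: eq_bigr => ab _; ring.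
have F (w : V -> R) (g : P * P -> P) (cw : cts w) (c : P * P -> R) :
    I (fun x => w x * \sum_(ab <- J) peval (g ab) x * c ab) =
    \sum_(ab <- J) c ab * I (fun x => peval (g ab) x * w x).
  rewrite (_ : (fun x => _) = (fun x => \sum_(ab <- J) c ab * (peval (g ab) x * w x))).
    rewrite int_sum => [|ab _]; last by apply: ctsZ; apply: ctsM => //; exact: cts_peval.
    by apply: eq_bigr => ab _; rewrite intZ//; apply: ctsM => //; exact: cts_peval.
  by apply/funext => x; rewrite mulr_sumr; apply: eq_bigr => ab _; ring.
rewrite (_ : (fun x => v x * _) = (fun x => v x * \sum_(ab <- J) peval ab.1 x * I (fun y => peval ab.2 y * u y))).
  rewrite (_ : (fun x => u x * _) = (fun x => u x * \sum_(ab <- J) peval ab.2 x * I (fun y => peval ab.1 y * v y))).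
    rewrite (F v fst)// (F u snd)//.
    by apply: eq_bigr => ab _; rewrite mulrC.
  by apply/funext => x; rewrite E'.
by apply/funext => x; rewrite E.
Qed.

(* Both integrals are limits of integrals against delta_poly, which only sees inner products. *)
Lemma int_isometry (A B : V -> V) u : cts A -> (forall x, S x -> S (A x)) ->
  (forall x, S x -> S (B x)) -> (forall x y, dotv (A x) y = dotv x (B y)) ->
  cts u -> I (fun x => u (A x)) = I u.
Proof.
move=> cA SA SB AB cu; have cuA := cts_sphere_comp cu cA SA.
apply/eqP; rewrite -subr_eq0 -normr_le0; apply/ler_addgt0Pr => e e0; rewrite add0r.
have v0 := sphere_vol_gt0.
have ev : 0 < e / sphere_vol R n by rewrite divr_gt0.
have [N hN] := zonal_op_delta_poly_approx cu ev.
suff E : I u = I (fun x => zonal_op (delta_poly N) u (A x)).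
  rewrite E -[leRHS](divfK (lt0r_neq0 v0)); apply: int_dist => //.
    exact: cts_sphere_comp (cts_zonal_op _ cu) cA SA.
  by move=> x Sx; rewrite distrC; apply: hN => //; exact: SA.
have [J hJ] := poly_sep (delta_poly N).
have cJ (ab : P * P) : cts (fun x => peval ab.1 (A x)) by exact: cts_sphere_comp (cts_peval _) cA SA.
transitivity (\sum_(ab <- J) I (fun x => peval ab.1 (A x)) * I (fun y => peval ab.2 y * u y)).
  transitivity (I (fun y => \sum_(ab <- J) I (fun x => peval ab.1 (A x)) * (peval ab.2 y * u y))); last first.
    rewrite int_sum => [|ab _]; last by apply: ctsZ; apply: ctsM => //; exact: cts_peval.
    by apply: eq_bigr => ab _; rewrite intZ//; apply: ctsM => //; exact: cts_peval.
  apply: int_eq => // y Sy.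
  transitivity (I (fun x => (delta_poly N).[dotv (B y) x]) * u y).
    by rewrite int_zonal ?lam_delta_poly ?mul1r//; exact: SB.
  rewrite (_ : (fun x => _) = (fun x => \sum_(ab <- J) peval ab.2 y * peval ab.1 (A x))).
    rewrite int_sum => [|ab _]; last exact: ctsZ.
    by rewrite mulr_suml; apply: eq_bigr => ab _; rewrite intZ//; ring.
  by apply/funext => x; rewrite dotvC -AB hJ; apply: eq_bigr => ab _; rewrite mulrC.
transitivity (I (fun x => \sum_(ab <- J) peval ab.1 (A x) * I (fun y => peval ab.2 y * u y))).
  rewrite int_sum => [|ab _]; last by apply: ctsM => //; exact: cts_cst.
  apply: eq_bigr => ab _; under [in RHS]eq_fun do rewrite mulrC.
  by rewrite intZ// mulrC.
congr sphere_int; apply/funext => x; rewrite /zonal_op.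
rewrite (_ : (fun y => _) = (fun y => \sum_(ab <- J) peval ab.1 (A x) * (peval ab.2 y * u y))).
  rewrite int_sum => [|ab _]; last by apply: ctsZ; apply: ctsM => //; exact: cts_peval.
  by apply: eq_bigr => ab _; rewrite intZ//; apply: ctsM => //; exact: cts_peval.
by apply/funext => y; rewrite hJ mulr_suml; apply: eq_bigr => ab _; rewrite mulrA.
Qed.

End ZonalPoly.

Section Projections.
Context {R : realType} (n : nat).
Hypothesis n0 : (0 < n)%N.
Local Notation V := 'rV[R]_n.+1.
Local Notation S := (@sphere R n).
Local Notation I := (@sphere_int R n).
Local Notation P := (mpoly n.+1 R).
Implicit Types (phi psi : {poly R}) (u v : V -> R) (p Y Z : P).

Lemma ctsMp u p : cts u -> cts (fun x => u x * peval p x).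
Proof. by move=> cu; apply: ctsM => //; exact: cts_peval. Qed.

Lemma pint_on_sphere p (N : nat) (h : nat -> P) Z :
  (forall x, S x -> peval p x = \sum_(l < N) peval (h l) x) ->
  pint (p * Z) = \sum_(l < N) pint (h l * Z).
Proof.
move=> hp; rewrite -pint_sum -mulr_suml; apply: int_eq; first exact: cts_peval.
by move=> x Sx; rewrite !pevalM hp// peval_sum.
Qed.

Lemma harm_component l a : dhom l a -> exists2 h, harm_hom l h &
  forall Z, harm_hom l Z -> pint (a * Z) = pint (h * Z).
Proof.
move=> ha; have [h [h1 h2 h3]] := hom_decomp ha.
exists (h l) => // Z hZ.
rewrite (pint_on_sphere Z (h3 l.+1 ^~ (leqnn _))) big_ord_recr /= big1 ?add0r// => i _.
by apply: (harm_orth n0 _ (h1 i) hZ); rewrite ltn_eqF.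
Qed.

(** An explicit Riesz representative. By [funk_hecke] with power l, a harmonic Z of degree l is 1 /
    mu l l times its convolution with (x.y)^l. Separating this kernel into homogeneous polynomials
    and replacing each by its harmonic component produces Y. *)
Lemma proj_exists l u : cts u -> exists2 Y, harm_hom l Y &
  forall Z, harm_hom l Z -> I (fun x => u x * peval Z x) = pint (Y * Z).
Proof.
move=> cu; have [J hJ eJ] := dot_sep (R := R) n l.
have [Y0 hY0 eY0] : exists2 Y, harm_hom l Y & forall Z, harm_hom l Z ->
    pint (Y * Z) = \sum_(ab <- J) I (fun y => u y * peval ab.2 y) * pint (ab.1 * Z).
  elim: J hJ {eJ} => [_|[a b] J IH /= /andP[ha /IH[Y hY eY]]].
    by exists 0 => [|Z _]; [exact: harm0|rewrite mul0r pint0 big_nil].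
  have [h hh eh] := harm_component ha.
  exists (I (fun y => u y * peval b y) *: h + Y); first by apply: harmD => //; exact: harmZ.
  move=> Z hZ; rewrite big_cons mulrDl pintD -scalerAl pintZ eY//=.
  by rewrite eh.
have c0 := @mu_diag_gt0 R n l.
exists ((mu n l l)^-1 *: Y0); first exact: harmZ.
move=> Z hZ; rewrite -scalerAl pintZ eY0//.
apply: (mulfI (lt0r_neq0 c0)); rewrite mulrA divff ?lt0r_neq0// mul1r.
rewrite -intZ; last exact: ctsMp.
transitivity (I (fun x => \sum_(ab <- J) pint (ab.1 * Z) * (u x * peval ab.2 x))).
  apply: int_eq => [|y Sy]; first by apply: ctsZ; exact: ctsMp.
  have := funk_hecke n0 l Sy hZ; rewrite mulrCA => <-.
  rewrite (_ : pint _ = \sum_(ab <- J) peval ab.2 y * pint (ab.1 * Z)).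
    by rewrite mulr_sumr; apply: eq_bigr => ab _; ring.
  rewrite pintM (_ : (fun x => _) = (fun x => \sum_(ab <- J) peval ab.2 y * peval (ab.1 * Z) x)).
    rewrite int_sum; last by move=> ab _; apply: ctsZ; exact: cts_peval.
    by apply: eq_bigr => ab _; rewrite intZ//; exact: cts_peval.
  apply/funext => x; rewrite pevalXn peval_lin dotvC eJ /sep mulr_suml.
  by apply: eq_bigr => ab _; rewrite pevalM; ring.
rewrite int_sum; last by move=> ab _; apply: ctsZ; exact: ctsMp.
by apply: eq_bigr => ab _; rewrite intZ; [exact: mulrC|exact: ctsMp].
Qed.

(* A polynomial representing sph_proj l u on the sphere; it is only meaningful for continuous u. *)
Definition hproj l u : P := xget 0 [set Y | harm_hom l Y /\
  forall Z, harm_hom l Z -> I (fun x => u x * peval Z x) = pint (Y * Z)].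

Lemma hproj_spec l u : cts u -> harm_hom l (hproj l u) /\
  forall Z, harm_hom l Z -> I (fun x => u x * peval Z x) = pint (hproj l u * Z).
Proof.
move=> cu; rewrite /hproj; case: xgetP => [Y -> []//|nY].
by have [Y hY eY] := proj_exists l cu; case: (nY Y).
Qed.

Definition hsqnorm l u : R := pint (hproj l u * hproj l u).

Lemma hsqnorm_ge0 l u : 0 <= hsqnorm l u.
Proof.
rewrite /hsqnorm pintM; apply: int_ge0; first by apply: ctsM; exact: cts_peval.
by move=> x _; rewrite -expr2 sqr_ge0.
Qed.

(** Two representatives of the same functional are tested against each other, so the norm does not
    depend on the choice made in [hproj]. *)
Lemma hsqnorm_uniq l u Y : cts u -> harm_hom l Y ->
  (forall Z, harm_hom l Z -> I (fun x => u x * peval Z x) = pint (Y * Z)) ->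
  hsqnorm l u = pint (Y * Y).
Proof.
move=> cu hY eY; have [hp ep] := hproj_spec l cu.
by rewrite /hsqnorm -ep// eY// mulrC -ep// eY.
Qed.

Lemma hsqnormE l u : cts u -> hsqnorm l u = I (fun x => u x * peval (hproj l u) x).
Proof. by move=> cu; have [hp ep] := hproj_spec l cu; rewrite ep. Qed.

Lemma hsqnorm_eq l u v : cts u -> (forall x, S x -> u x = v x) -> hsqnorm l u = hsqnorm l v.
Proof.
move=> cu uv; have cv := cts_eq uv cu; have [hp ep] := hproj_spec l cv.
apply: (hsqnorm_uniq cu hp) => Z hZ; rewrite -ep//; apply: int_eq; first exact: ctsMp.
by move=> x Sx; rewrite uv.
Qed.

Lemma proj_sqnormE l u : cts u -> proj_sqnorm n l u = hsqnorm l u.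
Proof.
move=> cu; rewrite /proj_sqnorm /sph_proj; case: xgetP => [Y -> [[p [hp ->]] eY]|nY]; last first.
  have [hp ep] := hproj_spec l cu; case: (nY (peval (hproj l u))); split.
    by exists (hproj l u).
  move=> _ [q [hq ->]]; under eq_fun do rewrite mulrBl.
  rewrite intB; [|exact: ctsMp|by apply: ctsM; exact: cts_peval].
  by rewrite ep// pintM subrr.
rewrite (hsqnorm_uniq cu hp); first by rewrite pintM; under eq_fun do rewrite expr2.
move=> Z hZ; have := eY (peval Z) (ex_intro _ Z (conj hZ erefl)).
under eq_fun do rewrite mulrBl.
rewrite intB; [|exact: ctsMp|by apply: ctsM; exact: cts_peval].
by move=> /eqP; rewrite subr_eq0 => /eqP ->; rewrite pintM.
Qed.

Lemma hsqnormZ l c u : cts u -> hsqnorm l (fun x => c * u x) = c ^+ 2 * hsqnorm l u.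
Proof.
move=> cu; have [hp ep] := hproj_spec l cu.
rewrite (@hsqnorm_uniq _ _ (c *: hproj l u) (ctsZ c cu) (harmZ c hp)).
  by rewrite -scalerAl -scalerAr scalerA pintZ expr2.
move=> Z hZ; rewrite -scalerAl pintZ -ep// -intZ; last exact: ctsMp.
by congr sphere_int; apply/funext => x; rewrite mulrA.
Qed.

Lemma hsqnormD l u v : cts u -> cts v -> hsqnorm l (fun x => u x + v x) =
  hsqnorm l u + 2 * I (fun x => v x * peval (hproj l u) x) + hsqnorm l v.
Proof.
move=> cu cv; have [hp ep] := hproj_spec l cu; have [hq eq] := hproj_spec l cv.
rewrite (@hsqnorm_uniq _ _ (hproj l u + hproj l v) (ctsD cu cv) (harmD hp hq)).
  by rewrite eq// /hsqnorm !mulrDl !mulrDr !pintD (mulrC (hproj l u) (hproj l v)); ring.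
move=> Z hZ; rewrite mulrDl pintD -ep// -eq// -intD; [|exact: ctsMp|exact: ctsMp].
by congr sphere_int; apply/funext => x; rewrite mulrDl.
Qed.

Lemma hsqnorm_poly u (N : nat) (h : nat -> P) l : (forall i, harm_hom i (h i)) ->
  (forall x, S x -> u x = \sum_(i < N) peval (h i) x) ->
  hsqnorm l u = if (l < N)%N then pint (h l * h l) else 0.
Proof.
move=> hh hu.
have cu : cts u.
  apply: (@cts_eq _ _ _ (fun x => \sum_(i < N) peval (h i) x)) => [x Sx|]; first by rewrite hu.
  by apply: cts_sum => i _; exact: cts_peval.
have key Z : harm_hom l Z -> I (fun x => u x * peval Z x) =
    pint ((if (l < N)%N then h l else 0) * Z).
  move=> hZ; transitivity (I (fun x => \sum_(i < N) peval (h i * Z) x)).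
    apply: int_eq; first exact: ctsMp.
    by move=> x Sx; rewrite hu// mulr_suml; apply: eq_bigr => i _; rewrite pevalM.
  rewrite int_sum; last by move=> i _; exact: cts_peval.
  have o (i : 'I_N) : i != l :> nat -> I (peval (h i * Z)) = 0.
    by move=> il; exact: (harm_orth n0 il (hh i) hZ).
  case: ltnP => lN.
    rewrite (bigD1 (Ordinal lN)) //= big1 ?addr0// => i il; exact: o.
  rewrite big1 ?mul0r ?pint0// => i _; apply: o.
  by rewrite ltn_eqF// (leq_trans (ltn_ord i)).
have hY : harm_hom l (if (l < N)%N then h l else 0) by case: ifP => _; [|exact: harm0].
by rewrite (hsqnorm_uniq cu hY key); case: ifP => // _; rewrite mul0r pint0.
Qed.

Lemma int_zonal_op_harm l phi u Z : cts u -> harm_hom l Z ->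
  I (fun x => zonal_op phi u x * peval Z x) = lam n l phi * I (fun x => u x * peval Z x).
Proof.
move=> cu hZ; under eq_fun do rewrite mulrC.
rewrite (zonal_op_sym phi cu (cts_peval Z)) -intZ; last exact: ctsMp.
apply: int_eq; first by apply: ctsM => //; apply: cts_zonal_op; exact: cts_peval.
by move=> x Sx; rewrite /zonal_op (lam_zonal n0 _ Sx hZ) mulrCA.
Qed.

Lemma hsqnorm_zonal_op l phi u : cts u -> hsqnorm l (zonal_op phi u) = lam n l phi ^+ 2 * hsqnorm l u.
Proof.
move=> cu; have [hp ep] := hproj_spec l cu.
rewrite (@hsqnorm_uniq _ _ (lam n l phi *: hproj l u) (cts_zonal_op phi cu) (harmZ _ hp)).
  by rewrite -scalerAl -scalerAr scalerA pintZ expr2.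
by move=> Z hZ; rewrite (int_zonal_op_harm _ cu hZ) ep// -scalerAl pintZ.
Qed.

(** The eigenvalue has absolute value at most 1: the kernel is nonnegative of mass 1, and the
    eigenvalue equation is read at a point where the harmonic has maximal modulus. *)
Lemma hsqnorm_zonal_op_delta_poly_le l N u : cts u -> hsqnorm l (zonal_op (delta_poly n N) u) <= hsqnorm l u.
Proof.
move=> cu; rewrite hsqnorm_zonal_op//; have [hp ep] := hproj_spec l cu.
set Y := hproj l u in hp *; have cY := cts_norm (cts_peval Y).
have [x Sx hx] := cts_max cY.
have [Y0|Y0] := eqVneq (peval Y x) 0.
  have -> : hsqnorm l u = 0; last by rewrite mulr0.
  rewrite /hsqnorm -/Y pintM -[RHS](int0 (R:=R) n); apply: int_eq.
    by apply: ctsM; exact: cts_peval.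
  move=> y Sy; have := hx y Sy; rewrite Y0 normr0 normr_le0 => /eqP ->.
  by rewrite mul0r.
apply: ler_piMl; first exact: hsqnorm_ge0.
rewrite -real_normK ?num_real// exprn_ile1//.
have Yp : 0 < `|peval Y x| by rewrite normr_gt0.
rewrite -(ler_pM2r Yp) mul1r -normrM -(lam_zonal n0 (delta_poly n N) Sx hp).
have cD := cts_poly_dot (delta_poly n N) x.
apply: le_trans (int_norm _) _; first by apply: ctsM => //; exact: cts_peval.
apply: (@le_trans _ _ (I (fun y => `|peval Y x| * (delta_poly n N).[dotv x y]))); last first.
  by rewrite intZ// int_zonal// lam_delta_poly// mulr1.
apply: int_le; [by apply: cts_norm; exact: ctsMp|exact: ctsZ|].
move=> y Sy; rewrite normrM mulrC (@ger0_norm _ (delta_poly n N).[_]) ?delta_poly_ge0 ?dotv_geN1//.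
by apply: ler_wpM2r; [rewrite delta_poly_ge0 ?dotv_geN1|exact: hx].
Qed.

Lemma hproj_orth l m u v : l != m -> cts u -> cts v -> pint (hproj l u * hproj m v) = 0.
Proof.
by move=> lm cu cv; apply: (harm_orth n0 lm); [exact: (hproj_spec l cu).1|exact: (hproj_spec m cv).1].
Qed.

Lemma bessel L u : cts u -> \sum_(l < L) hsqnorm l u <= I (fun x => u x ^+ 2).
Proof.
move=> cu; pose s : P := \sum_(l < L) hproj l u.
have e1 : I (fun x => u x * peval s x) = \sum_(l < L) hsqnorm l u.
  transitivity (I (fun x => \sum_(l < L) u x * peval (hproj l u) x)).
    by congr sphere_int; apply/funext => x; rewrite peval_sum mulr_sumr.
  rewrite int_sum; last by move=> l _; exact: ctsMp.
  by apply: eq_bigr => l _; rewrite hsqnormE.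
have e2 : pint (s * s) = \sum_(l < L) hsqnorm l u.
  rewrite {1}/s mulr_suml pint_sum; apply: eq_bigr => i _.
  rewrite /s mulr_sumr pint_sum (bigD1 i) //= big1 ?addr0// => j ji.
  by rewrite hproj_orth// eq_sym.
have : 0 <= I (fun x => u x ^+ 2 + (-2) * (u x * peval s x) + peval (s * s) x).
  apply: int_ge0 => [|x _]; last first.
    by rewrite pevalM (_ : _ + _ = (u x - peval s x) ^+ 2) ?sqr_ge0//; ring.
  apply: ctsD; last exact: cts_peval.
  by apply: ctsD; [exact: ctsX|apply: ctsZ; exact: ctsMp].
rewrite intD; last exact: cts_peval; last first.
  by apply: ctsD; [exact: ctsX|apply: ctsZ; exact: ctsMp].
rewrite intD; [|exact: ctsX|by apply: ctsZ; exact: ctsMp].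
rewrite intZ; last exact: ctsMp.
rewrite e1 -[I (peval _)]/(pint _) e2; lra.
Qed.

Lemma hsqnorm_le_int l u : cts u -> hsqnorm l u <= I (fun x => u x ^+ 2).
Proof.
move=> cu; apply: le_trans (bessel l.+1 cu); rewrite big_ord_recr /= lerDr.
by apply: sumr_ge0 => i _; exact: hsqnorm_ge0.
Qed.

Definition ucvg (U : nat -> V -> R) u := forall e, 0 < e ->
  exists N0, forall N, (N0 <= N)%N -> forall x, S x -> `|U N x - u x| <= e.

Lemma hsqnorm_dist l u v e : cts u -> cts v -> (forall x, S x -> `|v x - u x| <= e) ->
  `|hsqnorm l v - hsqnorm l u| <= 2 * e * I (fun x => `|peval (hproj l u) x|) + e ^+ 2 * sphere_vol R n.
Proof.
move=> cu cv h; have cd := ctsB cv cu.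
have e0 : 0 <= e by have [x Sx] := sphere_neq0 (R:=R) n; apply: le_trans (h x Sx).
have cp := cts_peval (hproj l u).
have -> : hsqnorm l v = hsqnorm l (fun x => u x + (v x - u x)).
  by congr hsqnorm; apply/funext => x; rewrite addrC subrK.
have H (a b c : R) : a + b + c - a = b + c by ring.
rewrite hsqnormD// H.
apply: le_trans (ler_normD _ _) _; apply: lerD.
  rewrite normrM ger0_norm// -mulrA ler_pM2l//.
  apply: le_trans (int_norm _) _; first exact: ctsMp.
  rewrite -intZ; last exact: cts_norm.
  apply: int_le; [by apply: cts_norm; exact: ctsMp|by apply: ctsZ; exact: cts_norm|].
  by move=> x Sx; rewrite normrM ler_wpM2r// h.
rewrite ger0_norm ?hsqnorm_ge0//; apply: le_trans (hsqnorm_le_int l cd) _.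
rewrite -int_cst; apply: int_le; [exact: ctsX|exact: cts_cst|].
move=> x Sx; rewrite -real_normK ?num_real// ler_sqr ?nnegrE//.
exact: h.
Qed.

Lemma hsqnorm_cvg l (U : nat -> V -> R) u : cts u -> (forall N, cts (U N)) -> ucvg U u ->
  (fun N => hsqnorm l (U N)) @ \oo --> hsqnorm l u.
Proof.
move=> cu cU hU; set A := I (fun x => `|peval (hproj l u) x|); set v := sphere_vol R n.
have A0 : 0 <= A by apply: int_ge0 => [|x _]; [apply: cts_norm; exact: cts_peval|exact: normr_ge0].
have v0 : 0 < v by exact: sphere_vol_gt0.
apply/cvgrPdist_le => e e0.
have d0 : 0 < Num.min 1 (e / (2 * A + v)).
  by rewrite lt_min ltr01 divr_gt0// ltr_wpDl// mulr_ge0.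
have [N0 hN0] := hU _ d0.
exists N0 => // N /= hN; rewrite distrC.
apply: le_trans (hsqnorm_dist l cu (cU N) (hN0 N hN)) _; rewrite -/A -/v.
move: d0; set d := Num.min _ _ => d0.
have d1 : d <= 1 by rewrite ge_min lexx.
have d2 : d * (2 * A + v) <= e.
  by rewrite -ler_pdivlMr ?ltr_wpDl ?mulr_ge0// /d ge_min lexx orbT.
apply: le_trans d2; rewrite mulrDr; apply: lerD; first by rewrite mulrA (mulrC 2).
by apply: ler_wpM2r; [exact: ltW|rewrite expr2 ler_piMl// ltW].
Qed.

Lemma zonal_op_delta_poly_ucvg u : cts u -> ucvg (fun N => zonal_op (delta_poly n N) u) u.
Proof. by move=> cu e e0; exact: zonal_op_delta_poly_approx. Qed.

(** The image of u under a polynomial kernel is a polynomial, so its expansion is finite;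
    [lam_small] removes the degrees from [size phi] on. *)
Lemma finite_parseval phi u N : cts u -> (size phi <= N)%N ->
  I (fun x => u x * zonal_op phi u x) = \sum_(l < N) lam n l phi * hsqnorm l u.
Proof.
move=> cu sN; have [p hp] := zonal_op_peval phi cu.
have [N0 [h [h1 h2 h3]]] := poly_decomp p.
pose M := maxn N0 N.
have eN : \sum_(l < N) lam n l phi * hsqnorm l u = \sum_(l < M) lam n l phi * hsqnorm l u.
  rewrite (big_ord_widen M (fun l => lam n l phi * hsqnorm l u)) ?leq_maxr// big_mkcond /=.
  apply: eq_bigr => l _; case: ltnP => // Nl.
  by rewrite lam_small ?mul0r//; exact: leq_trans sN Nl.
have hM x : S x -> zonal_op phi u x = \sum_(l < M) peval (h l) x.
  by move=> Sx; rewrite hp; apply: h3 => //; exact: leq_maxl.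
rewrite eN; transitivity (I (fun x => \sum_(l < M) u x * peval (h l) x)).
  apply: int_eq; first by apply: ctsM => //; exact: cts_zonal_op.
  by move=> x Sx; rewrite hM// mulr_sumr.
rewrite int_sum; last by move=> l _; exact: ctsMp.
apply: eq_bigr => l _; have [hj ej] := hproj_spec l cu.
rewrite ej// hsqnormE// -int_zonal_op_harm// mulrC.
transitivity (I (fun x => \sum_(i < M) peval (h i * hproj l u) x)); last first.
  apply: int_eq; first by apply: cts_sum => i _; exact: cts_peval.
  by move=> x Sx; rewrite hM// mulr_suml; apply: eq_bigr => i _; rewrite pevalM.
rewrite int_sum; last by move=> i _; exact: cts_peval.
rewrite (bigD1 l) //= big1 ?addr0// => i il.
exact: (harm_orth n0 _ (h1 i) hj).
Qed.

Lemma dhom0_const Y : dhom 0 Y -> exists c, Y = c *: 1.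
Proof.
move=> hY; exists (mcoeff mnm0 Y); rewrite {1}(hom_expand hY).
rewrite (eq_bigr (fun=> mcoeff mnm0 Y *: 1)); last first.
  by move=> m; rewrite mdeg_eq0 => /eqP ->; rewrite mpolyX0.
have [Y0|Y0] := eqVneq (mcoeff mnm0 Y) 0; first by rewrite Y0 scale0r big1.
rewrite -big_filter; have -> : [seq m <- msupp Y | mdeg m == 0%N] = [:: mnm0].
  apply: perm_small_eq => //; apply: uniq_perm => //.
    by apply: filter_uniq; exact: msupp_uniq.
  move=> m; rewrite mem_filter inE mdeg_eq0; case: eqP => //= ->.
  by rewrite mcoeff_msupp.
by rewrite big_seq1.
Qed.

Lemma dhom1_lin Y : dhom 1 Y -> exists c : V, Y = lin c.
Proof.
move=> hY; have h i : exists c, mderiv i Y = c *: 1 by apply: dhom0_const; exact: hom_mderiv.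
exists (\row_i xget 0 [set c | mderiv i Y = c *: 1]).
transitivity (\sum_i mpolyX R (mnm1 i) * mderiv i Y).
  by have := hom_euler hY; rewrite scale1r.
apply: eq_bigr => i _; rewrite mxE.
case: xgetP => [c _ /= hc|nc]; first by rewrite [in LHS]hc -scalerAr mulr1.
by have [c hc] := h i; case: (nc c).
Qed.

Lemma hsqnorm1_eq0 u : cts u -> (forall i, I (fun x => u x * x ord0 i) = 0) -> hsqnorm 1 u = 0.
Proof.
move=> cu h; have [[hp _] _] := hproj_spec 1 cu; have [c ec] := dhom1_lin hp.
rewrite hsqnormE// ec.
transitivity (I (fun x => \sum_i c ord0 i * (u x * peval (mpolyX R (mnm1 i) : P) x))).
  congr sphere_int; apply/funext => x; rewrite peval_lin mulr_sumr.
  by apply: eq_bigr => i _; rewrite pevalX; ring.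
rewrite int_sum; last by move=> i _; apply: ctsZ; exact: ctsMp.
rewrite big1// => i _; rewrite intZ; last exact: ctsMp.
by rewrite (_ : I _ = 0) ?mulr0// -[RHS](h i); congr sphere_int; apply/funext => x; rewrite pevalX.
Qed.

Lemma hsqnorm0E u : cts u -> hsqnorm 0 u = I u ^+ 2 / sphere_vol R n.
Proof.
move=> cu; have v0 := @sphere_vol_gt0 R n.
have h1 := harm1 (R:=R) n.
rewrite (@hsqnorm_uniq 0 u ((I u / sphere_vol R n) *: 1) cu (harmZ _ h1)).
  rewrite -scalerAl mul1r scalerA pintZ -[pint 1](_ : sphere_vol R n = _).
    by field; rewrite lt0r_neq0.
  by congr sphere_int; apply/funext => x; rewrite peval1.
move=> Z [hZ _]; have [c ->] := dhom0_const hZ.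
rewrite -scalerAl mul1r !pintZ -[pint 1](_ : sphere_vol R n = _); last first.
  by congr sphere_int; apply/funext => x; rewrite peval1.
transitivity (I (fun x => c * u x)).
  by congr sphere_int; apply/funext => x; rewrite pevalZ peval1 mulr1 mulrC.
by rewrite intZ//; field; rewrite lt0r_neq0.
Qed.

(** Completeness of the harmonics: each smoothing of u is a polynomial whose components of positive
    degree have norm 0, hence vanish on the sphere, so it is constant; u is the uniform limit of the
    smoothings. *)
Lemma hsqnorm_eq0_const u : cts u -> (forall l, (0 < l)%N -> hsqnorm l u = 0) ->
  forall x, S x -> u x = I u / sphere_vol R n.
Proof.
move=> cu h; have v0 := @sphere_vol_gt0 R n.
have key x y : S x -> S y -> u x = u y.
  move=> Sx Sy; apply/eqP; rewrite -subr_eq0 -normr_le0; apply/ler_addgt0Pr => e e0.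
  rewrite add0r; have e2 : 0 < e / 2 by rewrite divr_gt0.
  have [N hN] := zonal_op_delta_poly_approx n0 cu e2.
  have [p hp] := zonal_op_peval (delta_poly n N) cu.
  have [N0 [g [g1 g2 g3]]] := poly_decomp p.
  have E z : S z -> zonal_op (delta_poly n N) u z = \sum_(l < N0.+1) peval (g l) z.
    by move=> Sz; rewrite hp; exact: g3.
  have G l z : (0 < l)%N -> S z -> peval (g l) z = 0.
    move=> l0 Sz; have [lN|lN] := ltnP l N0.+1; last by rewrite g2 ?peval0// ltnW.
    have : hsqnorm l (zonal_op (delta_poly n N) u) = 0 by rewrite hsqnorm_zonal_op// h// mulr0.
    rewrite (hsqnorm_poly l g1 E) lN => e'.
    have := int_eq0 n0 (cts_peval (g l * g l)) _ e' Sz.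
    move=> e3; apply/eqP; rewrite -sqrf_eq0 expr2 -pevalM; apply/eqP; apply: e3 => w _.
    by rewrite pevalM -expr2 sqr_ge0.
  have [c ec] := dhom0_const (g1 0%N).1.
  have F z : S z -> zonal_op (delta_poly n N) u z = c.
    move=> Sz; rewrite E// big_ord_recl big1 ?addr0; first by rewrite /= ec pevalZ peval1 mulr1.
    by move=> i _; apply: G.
  have h1 := hN N (leqnn N) x Sx; have h2 := hN N (leqnn N) y Sy.
  rewrite !F// in h1 h2.
  rewrite (_ : u x - u y = (c - u y) - (c - u x)); last by ring.
  by apply: le_trans (ler_normB _ _) _; lra.
move=> x Sx; apply/eqP; rewrite eq_sym -(inj_eq (mulIf (lt0r_neq0 v0))) divfK ?lt0r_neq0//.
by rewrite -int_cst; apply/eqP; apply: int_eq => // y Sy; exact: key.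
Qed.

Lemma hsqnorm_addH l m u Z t : cts u -> harm_hom m Z ->
  hsqnorm l (fun x => u x + t * peval Z x) = hsqnorm l u +
    (if l == m then 2 * t * I (fun x => u x * peval Z x) + t ^+ 2 * pint (Z * Z) else 0).
Proof.
move=> cu hZ; have cZ := cts_peval Z.
rewrite (hsqnormD l cu (ctsZ t cZ)) hsqnormZ// -addrA; congr (_ + _).
have [hp ep] := hproj_spec l cu.
rewrite (_ : I _ = t * pint (Z * hproj l u)); last first.
  rewrite pintM -intZ; last by apply: ctsM => //; exact: cts_peval.
  by congr sphere_int; apply/funext => x; rewrite mulrA.
case: eqP => [e|/eqP lm].
  subst m; rewrite (mulrC Z) -ep// (@hsqnorm_uniq l (peval Z) Z)//; first by ring.
  by move=> W hW; rewrite pintM.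
rewrite (harm_orth n0 _ hZ hp) 1?eq_sym// (@hsqnorm_uniq l (peval Z) 0)//.
- by rewrite mul0r pint0; ring.
- exact: harm0.
- by move=> W hW; rewrite -pintM mul0r pint0; apply: (harm_orth n0 _ hZ hW); rewrite eq_sym.
Qed.

Lemma int_coord2 i : I (fun x => x ord0 i ^+ 2) = sphere_vol R n / n.+1%:R.
Proof.
have h := pint_mderiv i (homX i : dhom 1 (mpolyX R (mnm1 i) : P)).
rewrite mderivXU eqxx in h.
have e1 : pint (1 : P) = sphere_vol R n.
  by congr sphere_int; apply/funext => x; rewrite peval1.
rewrite e1 in h; rewrite -h add1n mulrC mulKf ?pnatr_eq0//.
by congr sphere_int; apply/funext => x; rewrite pevalM !pevalX expr2.
Qed.

End Projections.

(** * The kernel (1 - x.y)^s *)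

Section BinomialSeries.
Context {R : realType}.
Variable s : R.
Hypotheses (s0 : 0 < s) (s2 : s < 2).

Fixpoint binom_coef (j : nat) : R := if j is j'.+1 then binom_coef j' * (j'%:R - s) / (j'.+1)%:R else 1.

Lemma binom_coefS j : binom_coef j.+1 = binom_coef j * (j%:R - s) / (j.+1)%:R.
Proof. by []. Qed.

(* Truncated binomial series of (1 - t) ^ s. *)
Fixpoint binom_poly (m : nat) : {poly R} := if m is m'.+1 then binom_poly m' + binom_coef m *: 'X^m else 1.

Lemma binom_polyS m : binom_poly m.+1 = binom_poly m + binom_coef m.+1 *: 'X^(m.+1).
Proof. by []. Qed.

Lemma size_binom_poly m : (size (binom_poly m) <= m.+1)%N.
Proof.
elim: m => [|m IH]; first by rewrite /= size_poly1.
rewrite binom_polyS; apply: leq_trans (size_polyD _ _) _; rewrite geq_max.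
rewrite (leq_trans IH)//; apply: leq_trans (size_scale_leq _ _) _.
by rewrite size_polyXn.
Qed.

(** The defect of [binom_poly] in the equation (1 - t) y' + s y = 0 that (1 - t)^s satisfies, see
    [binom_poly_ode]. *)
Definition binom_poly_err m := (s - m%:R) * binom_coef m.

Lemma binom_poly_ode m : (1 - 'X) * (binom_poly m)^`() + s *: binom_poly m = binom_poly_err m *: 'X^m.
Proof.
elim: m => [|m IH]; first by rewrite /= /binom_poly_err derivC mulr0 add0r subr0 mulr1 expr0.
rewrite binom_polyS derivD derivZ derivXn mulrDr scalerDr addrACA IH /binom_poly_err binom_coefS.
have k0 : m.+1%:R != 0 :> R by rewrite pnatr_eq0.
set b := binom_coef m * _ / _; pose c := b * m.+1%:R.
have -> : (s - m%:R) * binom_coef m = - c by rewrite /c /b divfK//; ring.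
have -> : (s - m.+1%:R) * b = s * b - c by rewrite /c; ring.
rewrite -[_ *+ m.+1]scaler_nat !scalerA -/c /= -!mul_polyC exprS !(polyCN, polyCB); ring.
Qed.

Lemma binom_poly_errS m : binom_poly_err m.+1 = (1 - s / m.+1%:R) * binom_poly_err m.
Proof.
have k0 : m.+1%:R != 0 :> R by rewrite pnatr_eq0.
rewrite /binom_poly_err binom_coefS; move: k0; rewrite -natr1 => k0; field; exact: k0.
Qed.

(** The product of the factors 1 - s / m tends to 0 because the harmonic series diverges: with a
    positive limit c, each decrement would be at least s c / m, and their sum is bounded. *)
Lemma binom_poly_err_cvg0 : binom_poly_err @ \oo --> (0 : R).
Proof.
rewrite -(cvg_shiftS binom_poly_err); apply: norm_cvg0.
(* Starting at index 1 leaves only factors 1 - s / m with m >= 2, nonnegative since s < 2. *)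
pose v m := `|binom_poly_err m.+1|.
have vS m : v m.+1 = (1 - s / m.+2%:R) * v m.
  rewrite /v binom_poly_errS normrM ger0_norm// subr_ge0 ler_pdivrMr ?ltr0n// mul1r.
  by apply: le_trans (ltW s2) _; rewrite ler_nat.
have v0 m : 0 <= v m by exact: normr_ge0.
have vd : nonincreasing_seq v.
  apply/nonincreasing_seqP => m; rewrite vS ler_piMl// gerBl divr_ge0//.
  exact: ltW.
have cv : cvgn v.
  by apply: nonincreasing_is_cvgn => //; exists 0 => _ [m _ <-].
have L0 : 0 <= limn v by apply: limr_ge => //; near=> m.
suff L1 : limn v = 0 by rewrite -L1; exact: cv.
apply/eqP; rewrite eq_le L0 andbT leNgt; apply/negP => L1.
apply: (@dvg_harmonic R).
rewrite -(is_cvg_series_restrict 1%N) /=; apply: nondecreasing_is_cvgn.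
  apply/nondecreasing_seqP => m; case: m => [|m]; first by rewrite !big_geq.
  by rewrite [leRHS]big_nat_recr//= lerDl invr_ge0.
exists (v 0%N / (s * limn v)) => _ [m _ <-]; rewrite ler_pdivlMr ?mulr_gt0//.
suff H k : (\sum_(1 <= i < k.+1) harmonic i) * (s * limn v) <= v 0%N - v k.
  case: m => [|m]; first by rewrite big_geq// mul0r.
  by apply: le_trans (H m) _; rewrite gerBl.
elim: k => [|k IH]; first by rewrite big_geq// mul0r subrr.
rewrite big_nat_recr//= mulrDl.
have h : (k.+2%:R)^-1 * (s * limn v) <= v k - v k.+1.
  rewrite vS mulrBl mul1r opprB addrC subrK mulrA (mulrC _ s).
  by apply: ler_wpM2l; [rewrite divr_ge0// ltW|exact: nonincreasing_cvgn_ge].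
by apply: le_trans (lerD IH h) _; rewrite addrA subrK.
Unshelve. all: by end_near. Qed.

Lemma powR_onem_is_derive (t : R) p : t < 1 ->
  is_derive t 1 (fun t : R => (1 - t) `^ p) (- (p * (1 - t) `^ (p - 1))).
Proof.
move=> t1; have h0 : 0 < 1 - t by rewrite subr_gt0.
have h1 := is_derive_cst (1 : R) t (1 : R).
have h2 := is_derive_id t (1 : R).
have h3 : is_derive t (1:R) (fun t : R => 1 - t) (0 - 1) := is_deriveB h1 h2.
have h4 := is_derive1_powR p h0.
have := @is_derive1_comp _ (fun u => u `^ p) (fun t : R => 1 - t) t _ _ h4 h3.
by rewrite sub0r mulrN1.
Qed.

Let Hd m C (t : R) : t < 1 -> is_derive t 1
  (fun t : R => ((binom_poly m).[t] + C) * (1 - t) `^ (- s))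
  ((1 - t) `^ (- s - 1) * (binom_poly_err m * t ^+ m + s * C)).
Proof.
move=> t1; have h0 : 0 < 1 - t by rewrite subr_gt0.
have h1 := powR_onem_is_derive (- s) t1.
have h2 : is_derive t (1:R) (fun t : R => (binom_poly m).[t] + C) ((binom_poly m)^`().[t] + 0).
  exact: is_deriveD (is_derive_poly (binom_poly m) t) (is_derive_cst C t (1 : R)).
have := is_deriveM h2 h1.
rewrite (_ : _ *: _ + _ = (1 - t) `^ (- s - 1) * (binom_poly_err m * t ^+ m + s * C))//.
have := congr1 (fun p => p.[t]) (binom_poly_ode m).
rewrite hornerD hornerM !hornerZ hornerXn (_ : (1 - 'X : {poly R}).[t] = 1 - t); last by rewrite !hornerE.
move=> <-; rewrite /GRing.scale /=.
have -> : (1 - t) `^ (- s) = (1 - t) `^ (- s - 1) * (1 - t).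
  rewrite -[X in _ * X](powRr1 (ltW h0)) -powRD ?subrK//.
  by rewrite (gt_eqF h0) implybT.
by ring.
Qed.

Let mvt m C (a b : R) : a < b -> b < 1 -> exists c, [/\ a < c, c < b &
  ((binom_poly m).[b] + C) * (1 - b) `^ (- s) - ((binom_poly m).[a] + C) * (1 - a) `^ (- s) =
  (1 - c) `^ (- s - 1) * (binom_poly_err m * c ^+ m + s * C) * (b - a)].
Proof.
move=> ab b1.
have [||c] := @MVT R (fun t : R => ((binom_poly m).[t] + C) * (1 - t) `^ (- s))
  (fun c => (1 - c) `^ (- s - 1) * (binom_poly_err m * c ^+ m + s * C)) a b ab.
- by move=> x; rewrite in_itv /= => /andP[_ xb]; apply: Hd; exact: lt_trans b1.
- apply: continuous_in_subspaceT => x; rewrite inE /= in_itv /= => /andP[_ xb].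
  apply: differentiable_continuous; apply/derivable1_diffP.
  by have [] := Hd m C (le_lt_trans xb b1).
by rewrite in_itv /= => /andP[ac cb] e; exists c.
Qed.

Lemma binom_poly0 m : (binom_poly m).[0] = 1.
Proof.
elim: m => [|m IH]; first by rewrite hornerE.
by rewrite binom_polyS hornerD IH hornerZ hornerXn expr0n mulr0 addr0.
Qed.

(** The constant C is such that s C dominates the defect, so the derivatives of (binom_poly m + C) /
    (1 - t)^s and (binom_poly m - C) / (1 - t)^s have constant and opposite signs. *)
Let Hinc m (a b : R) (C := `|binom_poly_err m| / s) : -1 <= a -> a <= b -> b < 1 ->
  ((binom_poly m).[a] + C) * (1 - a) `^ (- s) <= ((binom_poly m).[b] + C) * (1 - b) `^ (- s) /\
  ((binom_poly m).[b] - C) * (1 - b) `^ (- s) <= ((binom_poly m).[a] - C) * (1 - a) `^ (- s).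
Proof.
move=> a1; rewrite le_eqVlt => /predU1P[->//|ab] b1.
have sC : s * C = `|binom_poly_err m| by rewrite mulrC divfK// gt_eqF.
have h (c : R) : a < c -> c < b -> `|binom_poly_err m * c ^+ m| <= `|binom_poly_err m|.
  move=> ac cb; rewrite normrM normrX ler_piMr// exprn_ile1// ler_norml.
  by rewrite (le_trans a1 (ltW ac)) (ltW (lt_trans cb b1)).
split; rewrite -subr_ge0.
  have [c [ac cb ->]] := mvt m C ab b1.
  have := h c ac cb; rewrite ler_norml => /andP[h1 h2].
  rewrite mulr_ge0 ?subr_ge0 ?(ltW ab)// mulr_ge0 ?powR_ge0// sC; lra.
rewrite -opprB oppr_ge0.
have [c [ac cb ->]] := mvt m (- C) ab b1.
have := h c ac cb; rewrite ler_norml => /andP[h1 h2].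
rewrite mulr_le0_ge0 ?subr_ge0 ?(ltW ab)// mulr_ge0_le0 ?powR_ge0// mulrN sC; lra.
Qed.

(** The two monotone quotients of [Hinc] are compared with their values 1 + C and 1 - C at 0. At t =
    1, where the quotients are singular, the value is read off the differential equation. *)
Lemma binom_poly_approx m (t : R) : -1 <= t <= 1 ->
  `|(binom_poly m).[t] - (1 - t) `^ s| <= `|binom_poly_err m| / s * 2 `^ s.
Proof.
move=> /andP[t0 t1]; set C := `|binom_poly_err m| / s.
have C0 : 0 <= C by rewrite divr_ge0// ltW.
have p1 : 1 <= 2 `^ s.
  have e1 : 2 `^ 0 = 1 :> R by rewrite powRr0.
  by rewrite -[leLHS]e1; apply: ler_powR; [rewrite ler1n|exact: ltW].
have [t1'|] := ltP t 1; last first.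
  move=> t1'; have -> : t = 1 by apply/eqP; rewrite eq_le t1 t1'.
  have := congr1 (fun p => p.[1]) (binom_poly_ode m).
  rewrite hornerD hornerM !hornerZ hornerXn (_ : (1 - 'X : {poly R}).[1] = 0); last by rewrite !hornerE subrr.
  rewrite mul0r add0r expr1n mulr1 subrr powR0 ?gt_eqF// subr0 => e.
  have -> : (binom_poly m).[1] = binom_poly_err m / s by rewrite -e mulrC mulKf// gt_eqF.
  by rewrite normrM normfV (gtr0_norm s0) ler_peMr.
have h0 : 0 < 1 - t by rewrite subr_gt0.
have ps : 0 < (1 - t) `^ s by rewrite powR_gt0.
have p2 : (1 - t) `^ s <= 2 `^ s.
  apply: ge0_ler_powR; rewrite ?nnegrE ?(ltW s0) ?(ltW h0)//.
  by rewrite lerBlDr -lerBlDl; lra.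
have pN D : ((binom_poly m).[t] + D) * (1 - t) `^ (- s) = ((binom_poly m).[t] + D) / (1 - t) `^ s.
  by rewrite powRN.
have e0 D : ((binom_poly m).[0] + D) * (1 - 0) `^ (- s) = 1 + D by rewrite binom_poly0 subr0 powR1 mulr1.
have m1 : (-1 : R) <= 0 by rewrite oppr_le0.
have [tn|tp] := ltP t 0.
  have [] := Hinc m t0 (ltW tn) ltr01; rewrite -/C !e0 !pN ler_pdivrMr// ler_pdivlMr//.
  by move=> k1 k2; rewrite ler_norml; apply/andP; split; nra.
have [] := Hinc m m1 tp t1'; rewrite -/C !e0 !pN ler_pdivrMr// ler_pdivlMr//.
by move=> k1 k2; rewrite ler_norml; apply/andP; split; nra.
Qed.

End BinomialSeries.

Section KernelOperator.
Context {R : realType} (n : nat).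
Hypothesis n0 : (0 < n)%N.
Variable s : R.
Hypotheses (s0 : 0 < s) (s2 : s < 2).
Local Notation V := 'rV[R]_n.+1.
Local Notation S := (@sphere R n).
Local Notation I := (@sphere_int R n).
Local Notation P := (mpoly n.+1 R).
Local Notation mu := (@mu R n).
Local Notation binom_coef := (binom_coef s).
Local Notation binom_poly := (binom_poly s).
Local Notation binom_poly_err := (binom_poly_err s).
Implicit Types (u v w : V -> R) (Y Z : P).

Lemma mu_le_vol l d : mu l d <= sphere_vol R n.
Proof.
have r1 k : k.+1%:R / (k.+1 + n)%:R <= 1 :> R.
  by rewrite ler_pdivrMr ?ltr0n// mul1r ler_nat leq_addr.
have v0 := sphere_vol_gt0 (R:=R) n.
elim: l d => [|l IH] [|d] //; first last.
- rewrite muSS; apply: le_trans (IH d); rewrite ler_piMl ?mu_ge0//.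
  by rewrite ler_pdivrMr ?ltr0n ?addnS// mul1r ler_nat; lia.
- exact: ltW.
elim: d.+2 {-2}d.+1 (leqnn d.+2) => [[]//|m IHm [|[|k]] hk].
- by [].
- exact: ltW.
- apply: le_trans (IHm k (ltnW hk)).
  rewrite -[mu 0 k.+2]/(k.+1%:R / (k.+1 + n)%:R * mu 0 k).
  by rewrite ler_piMl ?mu_ge0.
Qed.

(** Two steps in d at fixed l. In the undivided form the relation survives at l = d + 2, where its
    left factor and [mu l d] both vanish. *)
Lemma mu_recSS l d : (d.+2%:R - l%:R) * (d.+1 + l + n)%:R * mu l d.+2 = (d.+2 * d.+1)%:R * mu l d.
Proof.
elim: l d => [|l IH] d.
  rewrite -[mu 0 d.+2]/(d.+1%:R / (d.+1 + n)%:R * mu 0 d) subr0 addn0 natrM.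
  by have := natn_neq0 (R:=R) n0 d.+1; set c := (_ + n)%:R => c0; field.
case: d => [|d].
  rewrite mulr0 muSS; case: l {IH} => [|[|l]].
  - by rewrite !mulr0.
  - by rewrite subrr !mul0r.
  - by rewrite (@mu_small R n l.+2 1)// !mulr0.
rewrite !muSS.
have := IH d.
have := natn_neq0 (R:=R) n0 (l + d.+3); have := natn_neq0 (R:=R) n0 (l + d.+1).
have -> : (d.+1 + l + n = l + d.+1 + n)%N by lia.
have -> : (d.+2 + l.+1 + n = l + d.+3 + n)%N by lia.
set a := (l + d.+1 + n)%:R; set b := (l + d.+3 + n)%:R => a0 b0.
have -> : d.+3%:R - l.+1%:R = d.+2%:R - l%:R :> R by rewrite -!natr1; ring.
rewrite !natrM => h.
have -> : (d.+2%:R - l%:R) * b * (d.+3%:R / b * mu l d.+2) = d.+3%:R * ((d.+2%:R - l%:R) * mu l d.+2).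
  by field.
have -> : d.+3%:R * d.+2%:R * (d.+1%:R / a * mu l d) = d.+3%:R * (d.+2%:R * d.+1%:R * mu l d / a) by field.
by rewrite -h; field.
Qed.

Lemma lam_binom_poly l m : lam n l (binom_poly m) = \sum_(j < m.+1) binom_coef j * mu l j.
Proof.
elim: m => [|m IH]; last by rewrite binom_polyS lamD IH lamZ lamXn [RHS]big_ord_recr.
by rewrite big_ord1 /= -(expr0 'X) lamXn mul1r.
Qed.

(* The recursion of the eigenvalues: the series telescopes in steps of two. *)
Let U l j : R := (j%:R - l%:R) * binom_coef j * mu l j.

Let telescope l j : (l%:R + n%:R + s) * (binom_coef j.+1 * mu l.+1 j.+1) - (l%:R - s) * (binom_coef j * mu l j) =
  U l j - U l j.+2.
Proof.
rewrite /U muSS !binom_coefS.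
have := mu_recSS l j; have := natn_neq0 (R:=R) n0 (l + j.+1).
have -> : (j.+1 + l + n = l + j.+1 + n)%N by lia.
have j1 : j.+1%:R != 0 :> R by rewrite pnatr_eq0.
have j2 : j.+2%:R != 0 :> R by rewrite pnatr_eq0.
have ec : (l + j.+1 + n)%:R = l%:R + (j%:R + 1) + n%:R :> R by rewrite !natrD natr1.
have ep : j%:R + 1 = j.+1%:R :> R by rewrite natr1.
move: ec; set c := (l + j.+1 + n)%:R => ec c0; rewrite natrM.
move: j1 j2 ep; set p1 := j.+1%:R; set p2 := j.+2%:R => j1 j2 ep h.
clearbody c p1 p2.
have -> : (p2 - l%:R) * (binom_coef j * (j%:R - s) / p1 * (p1 - s) / p2) * mu l j.+2 =
   binom_coef j * (j%:R - s) * (p1 - s) / (p1 * p2 * c) * ((p2 - l%:R) * c * mu l j.+2).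
  by field; rewrite ?j1 ?j2 ?c0.
rewrite h.
have -> : binom_coef j * (j%:R - s) * (p1 - s) / (p1 * p2 * c) * (p2 * p1 * mu l j) =
   binom_coef j * (j%:R - s) * (p1 - s) * mu l j / c by field; rewrite ?j1 ?j2 ?c0.
have -> : (l%:R + n%:R + s) * (binom_coef j * (j%:R - s) / p1 * (p1 / c * mu l j)) =
  (l%:R + n%:R + s) * (binom_coef j * (j%:R - s)) * mu l j / c by field; rewrite ?j1 ?j2 ?c0.
apply: (mulIf c0); rewrite !mulrBl !divfK//.
rewrite ec -ep; ring.
Qed.

Lemma lam_binom_poly_rec l m : (l%:R + n%:R + s) * lam n l.+1 (binom_poly m.+1) - (l%:R - s) * lam n l (binom_poly m) =
  - (U l m.+2 + U l m.+1).
Proof.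
rewrite !lam_binom_poly big_ord_recl mulr0 add0r !mulr_sumr -sumrB.
rewrite (eq_bigr (fun j : 'I_m.+1 => U l j - U l j.+2)); last by move=> j _; exact: telescope.
have U1 : U l 0 + U l 1 = 0.
  rewrite /U; case: l => [|[|l]].
  - by rewrite subrr !mul0r add0r mulr0.
  - by rewrite [mu 1 0]/(0) mulr0 add0r subrr !mul0r.
  - by rewrite (@mu_small R n l.+2 1)// [mu _ 0]/(0) !mulr0 addr0.
elim: m => [|m IH]; first by rewrite big_ord1; lra.
by rewrite big_ord_recr /= IH; ring.
Qed.

Lemma binom_coef_cvg0 : binom_coef @ \oo --> (0 : R).
Proof.
apply/cvgr0Pnorm_le => e e0.
have /cvgr0Pnorm_le /(_ _ e0) := binom_poly_err_cvg0 s0 s2.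
move=> [N _ hN]; exists (maxn N 3) => // j /=; rewrite geq_max => /andP[Nj j3].
apply: le_trans (hN j Nj); rewrite /binom_poly_err normrM ler_peMl// distrC.
have j3' : 3 <= j%:R :> R by rewrite ler_nat.
apply: le_trans (ler_norm _); rewrite lerBrDr; apply: le_trans j3'.
  by rewrite (_ : 3 = 1 + 2 :> R); [rewrite lerD2l ltW|ring].
Qed.

Let U_cvg0 l : U l @ \oo --> (0 : R).
Proof.
have h : (fun j => (s - l%:R) * binom_coef j - binom_poly_err j) @ \oo --> (0 : R).
  have h0 : (fun j => (s - l%:R) * binom_coef j) @ \oo --> (s - l%:R) * 0.
    by apply: cvgM; [exact: cvg_cst|exact: binom_coef_cvg0].
  have h := cvgB h0 (binom_poly_err_cvg0 s0 s2); rewrite mulr0 subr0 in h; exact: h.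
apply/cvgr0Pnorm_le => e e0.
have v0 := sphere_vol_gt0 (R:=R) n.
have ev : 0 < e / sphere_vol R n by rewrite divr_gt0.
move/cvgr0Pnorm_le : h => /(_ _ ev) [N _ hN]; exists N => // j /= Nj.
have := hN j Nj; rewrite /= (_ : _ - _ = (j%:R - l%:R) * binom_coef j); last by rewrite /binom_poly_err; ring.
move=> h; rewrite /U normrM -[leRHS](divfK (lt0r_neq0 v0)).
by apply: ler_pM => //; rewrite ger0_norm ?mu_ge0// mu_le_vol.
Qed.

(* On the sphere |x - y|^(2s) = 2^s (1 - x.y)^s, so this is a multiple of the Green kernel of P_{2 gamma}. *)
Definition ker (x y : V) : R := (1 - dotv x y) `^ s.

Lemma cts_ker x : S x -> cts (ker x).
Proof.
move=> Sx; apply: cts_powR_comp => //.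
  by apply: ctsB; [exact: cts_cst|exact: cts_dotr].
by move=> y Sy; rewrite subr_ge0 dotv_le1.
Qed.

Lemma ker_ge0 x y : 0 <= ker x y.
Proof. exact: powR_ge0. Qed.

Lemma kerC x y : ker x y = ker y x.
Proof. by rewrite /ker dotvC. Qed.

Definition ker_op u (x : V) : R := I (fun y => ker x y * u y).

Lemma zonal_op_ker_op_ucvg u : cts u -> ucvg (fun m => zonal_op (binom_poly m) u) (ker_op u).
Proof.
move=> cu e e0; have [M M0 hM] := cts_bounded cu.
have v0 := sphere_vol_gt0 (R:=R) n.
have p0 : 0 < 2 `^ s :> R by rewrite powR_gt0.
set c := s^-1 * 2 `^ s * M * sphere_vol R n.
have c0 : 0 < c by rewrite !mulr_gt0// invr_gt0.
have ec : 0 < e / c by rewrite divr_gt0.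
have /cvgr0Pnorm_le /(_ _ ec) [N _ hN] := binom_poly_err_cvg0 s0 s2.
exists N => m Nm x Sx.
rewrite /zonal_op /ker_op; apply: (@le_trans _ _ ((`|binom_poly_err m| / s * 2 `^ s * M) * sphere_vol R n)).
  apply: int_dist; first exact: cts_zonal_op_integrand.
    by apply: ctsM => //; exact: cts_ker.
  move=> y Sy; rewrite -mulrBl normrM; apply: ler_pM => //; last exact: hM.
  by apply: binom_poly_approx => //; rewrite dotv_le1// dotv_geN1.
have := hN m Nm => /= h.
have -> : `|binom_poly_err m| / s * 2 `^ s * M * sphere_vol R n = `|binom_poly_err m| * c by rewrite /c; ring.
by rewrite -[leRHS](divfK (lt0r_neq0 c0)) ler_pM2r.
Qed.

Lemma cts_ker_op u : cts u -> cts (ker_op u).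
Proof.
move=> cu; apply: cts_ulim => e e0; have [N hN] := zonal_op_ker_op_ucvg cu e0.
exists (zonal_op (binom_poly N) u); split; first exact: cts_zonal_op.
by move=> x Sx; rewrite distrC; exact: hN.
Qed.

Lemma ucvg_pt (F : nat -> V -> R) u x : ucvg F u -> S x -> (fun N => F N x) @ \oo --> u x.
Proof.
move=> h Sx; apply/cvgrPdist_le => e e0; have [N hN] := h e e0.
by exists N => // k /= Nk; rewrite distrC; exact: hN.
Qed.

Lemma ucvg_intM (F : nat -> V -> R) u w : cts w -> cts u -> (forall N, cts (F N)) -> ucvg F u ->
  (fun N => I (fun x => w x * F N x)) @ \oo --> I (fun x => w x * u x).
Proof.
move=> cw cu cF h; have [M M0 hM] := cts_bounded cw.
have v0 := sphere_vol_gt0 (R:=R) n.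
apply/cvgrPdist_le => e e0.
have ec : 0 < e / (M * sphere_vol R n) by rewrite divr_gt0// mulr_gt0.
have [N hN] := h _ ec; exists N => // k /= Nk; rewrite distrC.
have -> : e = M * (e / (M * sphere_vol R n)) * sphere_vol R n.
  by field; rewrite !lt0r_neq0.
apply: int_dist; [exact: ctsM|exact: ctsM|move=> x Sx].
by rewrite -mulrBr normrM; apply: ler_pM => //; [exact: hM|exact: hN].
Qed.

(** The eigenvalues of [ker_op]: the initial one is the mass of the kernel, and the recursion is the
    limit of [lam_binom_poly_rec]. It is inverse to the recursion [PcoefS], which makes [Pcoef]
    times [ker_eigen] independent of the degree. *)
Fixpoint ker_eigen (l : nat) : R :=
  if l is l'.+1 then (l'%:R - s) / (l'%:R + n%:R + s) * ker_eigen l'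
  else ker_op (fun=> 1) (delta_mx ord0 ord0).

Lemma ker_eigen_den_gt0 l : 0 < l%:R + n%:R + s.
Proof. by rewrite ltr_wpDl// -natrD ler0n. Qed.

Lemma lam_binom_poly_cvg l : (fun m => lam n l (binom_poly m)) @ \oo --> ker_eigen l.
Proof.
elim: l => [|l IH].
  have Se := sphere_delta (R:=R) (ord0 : 'I_n.+1).
  have := ucvg_pt (zonal_op_ker_op_ucvg (cts_cst (1 : R))) Se.
  rewrite (_ : (fun N => _) = (fun m => lam n 0 (binom_poly m)))//; apply/funext => m.
  by rewrite /zonal_op; under eq_fun do rewrite mulr1; rewrite int_zonal.
rewrite -(cvg_shiftS (fun m => lam n l.+1 (binom_poly m))) /=.
have d0 := ker_eigen_den_gt0 l.
have U1 : (fun m => U l m.+1) @ \oo --> (0 : R) by have := U_cvg0 l; rewrite -cvg_shiftS.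
have U2 : (fun m => U l m.+2) @ \oo --> (0 : R).
  by have := U1; rewrite -(cvg_shiftS (fun m => U l m.+1)).
have -> : (fun m => lam n l.+1 (binom_poly m.+1)) =
    (fun m => (l%:R - s) / (l%:R + n%:R + s) * lam n l (binom_poly m) - (U l m.+2 + U l m.+1) / (l%:R + n%:R + s)).
  apply/funext => m; have := lam_binom_poly_rec l m => h.
  apply: (mulfI (lt0r_neq0 d0)).
  have -> : (l%:R + n%:R + s) * lam n l.+1 (binom_poly m.+1) =
    (l%:R - s) * lam n l (binom_poly m) - (U l m.+2 + U l m.+1) by move: h; lra.
  by field; rewrite lt0r_neq0.
have h1 : (fun m => (l%:R - s) / (l%:R + n%:R + s) * lam n l (binom_poly m)) @ \oo -->
    (l%:R - s) / (l%:R + n%:R + s) * ker_eigen l by apply: cvgM; [exact: cvg_cst|exact: IH].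
have h2 : (fun m => (U l m.+2 + U l m.+1) / (l%:R + n%:R + s)) @ \oo --> (0 + 0) / (l%:R + n%:R + s).
  by apply: cvgM; [exact: cvgD|exact: cvg_cst].
have h := cvgB h1 h2; rewrite addr0 mul0r subr0 in h; exact: h.
Qed.

Lemma ker_eigen0_gt0 : 0 < ker_eigen 0.
Proof.
have Se := sphere_delta (R:=R) (ord0 : 'I_n.+1).
have cc : cts (fun y => ker (delta_mx ord0 ord0) y * 1) by apply: ctsM; [exact: cts_ker|exact: cts_cst].
apply: (int_gt0 n0 cc _ (sphereN Se)) => [x _|].
  by rewrite mulr1 ker_ge0.
by rewrite mulr1 powR_gt0// dotvNr Se; lra.
Qed.

Lemma ker_eigen_neq0 l : s != 1 -> ker_eigen l != 0.
Proof.
move=> s1; elim: l => [|l IH]; first by rewrite gt_eqF ?ker_eigen0_gt0.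
rewrite /= mulf_neq0// mulf_neq0 ?invr_eq0 ?(gt_eqF (ker_eigen_den_gt0 l))//.
rewrite subr_eq0; case: l {IH} => [|[|l]].
- by rewrite eq_sym gt_eqF.
- by rewrite eq_sym.
- by rewrite gt_eqF//; apply: lt_le_trans s2 _; rewrite ler_nat.
Qed.

Lemma ker_op_harm l Y x : S x -> harm_hom l Y -> ker_op (peval Y) x = ker_eigen l * peval Y x.
Proof.
move=> Sx hY; have h := ucvg_pt (zonal_op_ker_op_ucvg (cts_peval Y)) Sx.
apply: (cvg_unique _ h) => //.
rewrite (_ : (fun N => _) = (fun m => lam n l (binom_poly m) * peval Y x)).
  by apply: cvgM; [exact: lam_binom_poly_cvg|exact: cvg_cst].
by apply/funext => m; rewrite /zonal_op (lam_zonal n0 _ Sx hY).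
Qed.

Lemma hsqnorm_ker_op l u : cts u -> hsqnorm l (ker_op u) = ker_eigen l ^+ 2 * hsqnorm l u.
Proof.
move=> cu; have h := hsqnorm_cvg n0 (l := l) (cts_ker_op cu) (fun m => cts_zonal_op (binom_poly m) cu) (zonal_op_ker_op_ucvg cu).
apply: (cvg_unique _ h) => //.
rewrite (_ : (fun N => _) = (fun m => lam n l (binom_poly m) ^+ 2 * hsqnorm l u)).
  by apply: cvgM; [rewrite expr2; under eq_fun do rewrite expr2; apply: cvgM; exact: lam_binom_poly_cvg|exact: cvg_cst].
by apply/funext => m; rewrite hsqnorm_zonal_op.
Qed.

(** The coefficient of index 2 is s (s - 1) / 2, and the later factors j - s are positive. *)
Lemma binom_coef_sign j : (2 <= j)%N -> 0 <= (s - 1) * binom_coef j.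
Proof.
elim: j => [//|[|[|j]] IH] // _.
  rewrite !binom_coefS [binom_coef 0]/(1) !mul1r divr1 sub0r.
  have -> : (s - 1) * (- s * (1 - s) / 2) = s * (s - 1) ^+ 2 / 2 by ring.
  by rewrite divr_ge0// mulr_ge0 ?sqr_ge0// ltW.
rewrite binom_coefS mulrA divr_ge0// mulrA mulr_ge0 ?IH// subr_ge0.
by apply: le_trans (ltW s2) _; rewrite ler_nat.
Qed.

Lemma ker_op_parseval_le L u : cts u -> (2 <= L)%N ->
  \sum_(l < L) (s - 1) * ker_eigen l * hsqnorm l u <= (s - 1) * I (fun x => u x * ker_op u x).
Proof.
move=> cu L2.
have h1 : (fun m => \sum_(l < L) (s - 1) * lam n l (binom_poly m) * hsqnorm l u) @ \oo -->
    \sum_(l < L) (s - 1) * ker_eigen l * hsqnorm l u.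
  apply: cvg_big => [|l _]; first exact: add_continuous.
  apply: cvgM; last exact: cvg_cst.
  by apply: cvgM; [exact: cvg_cst|exact: lam_binom_poly_cvg].
have h2 : (fun m => (s - 1) * I (fun x => u x * zonal_op (binom_poly m) u x)) @ \oo -->
    (s - 1) * I (fun x => u x * ker_op u x).
  apply: cvgM; first exact: cvg_cst.
  by apply: ucvg_intM => //; [exact: cts_ker_op|move=> m; exact: cts_zonal_op|exact: zonal_op_ker_op_ucvg].
apply: (ler_cvg_to h1 h2); near=> m.
pose N := maxn L m.+1.
have sN : (size (binom_poly m) <= N)%N by apply: leq_trans (size_binom_poly s m) _; exact: leq_maxr.
rewrite (finite_parseval n0 cu sN) mulr_sumr.
have e : \sum_(l < L) (s - 1) * lam n l (binom_poly m) * hsqnorm l u =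
  \sum_(l < N | (l < L)%N) (s - 1) * lam n l (binom_poly m) * hsqnorm l u.
  by rewrite (big_ord_widen N (fun l => (s - 1) * lam n l (binom_poly m) * hsqnorm l u)) ?leq_maxl.
rewrite e [leRHS](bigID (fun l : 'I_N => (l < L)%N)) /=.
rewrite (eq_bigr (fun l : 'I_N => (s - 1) * (lam n l (binom_poly m) * hsqnorm l u))); last by move=> l _; rewrite mulrA.
rewrite lerDl; apply: sumr_ge0 => l; rewrite -leqNgt => Ll.
rewrite mulrA mulr_ge0 ?hsqnorm_ge0// lam_binom_poly mulr_sumr; apply: sumr_ge0 => j _.
rewrite mulrA; have [jl|lj] := ltnP j l; first by rewrite mu_small// mulr0.
by rewrite mulr_ge0 ?mu_ge0// binom_coef_sign// (leq_trans L2)// (leq_trans Ll).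
Unshelve. all: by end_near. Qed.

Lemma ker_op_poly u (N : nat) (h : nat -> P) : (forall i, harm_hom i (h i)) ->
  (forall x, S x -> u x = \sum_(i < N) peval (h i) x) ->
  forall x, S x -> ker_op u x = \sum_(i < N) ker_eigen i * peval (h i) x.
Proof.
move=> hh hu x Sx.
transitivity (I (fun y => \sum_(i < N) ker x y * peval (h i) y)).
  apply/esym/int_eq; first by apply: cts_sum => i _; apply: ctsM; [exact: cts_ker|exact: cts_peval].
  by move=> y Sy; rewrite hu// mulr_sumr.
rewrite int_sum; last by move=> i _; apply: ctsM; [exact: cts_ker|exact: cts_peval].
by apply: eq_bigr => i _; rewrite -(ker_op_harm Sx (hh i)).
Qed.

End KernelOperator.

(** * Conformal change of variables *)

Section Substitution.
Context {R : realType}.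
Notation mu := (@lebesgue_measure R).
Notation D := (`]-1, 1[%classic : set R).

Lemma primitive_exists (f : R -> R) : (forall t, D t -> {for t, continuous f}) ->
  mu.-integrable D (EFin \o f) ->
  exists2 H : R -> R, {within `[-1, 1], continuous H} & forall t, D t -> is_derive t 1 H (f t).
Proof.
move=> cf fi; pose h := f \_ D.
have mD : measurable (D : set (measurableTypeR R)) by exact: measurable_itv.
have hT : mu.-integrable setT (EFin \o h).
  have := (@integrable_mkcond _ _ R mu D (EFin \o f) mD).1 fi.
  by rewrite restrict_EFin.
have hi : mu.-integrable `[-1, 1] (EFin \o h).
  by apply: integrableS hT => //; exact: measurable_itv.
have N11 : (-1 : R) < 1 by rewrite gtrN.
exists (fun x => parameterized_integral mu (-1) x h).
  exact: (parameterized_integral_continuous (ltW N11) hi).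
move=> t; rewrite /= in_itv /= => /andP[t1 t2].
have Dt : D t by rewrite /= in_itv /= t1.
have ft : h t = f t by rewrite /h patchE mem_set.
have ch : {for t, continuous h}.
  rewrite /prop_for /continuous_at ft; apply: cvg_trans (cf t Dt).
  apply: near_eq_cvg; near=> z; rewrite /h patchE mem_set//=.
  by rewrite in_itv /=; apply/andP; split; near: z; [exact: lt_nbhsr|exact: lt_nbhsl].
have [d1 d2] := continuous_FTC1_closed t2 hi t1 ch.
by apply: DeriveDef; [exact: d1|rewrite -derive1E d2 ft].
Unshelve. all: by end_near. Qed.

(** A decreasing substitution with integrands that may be unbounded at the endpoints: a primitive H
    of f, continuous up to the boundary, gives the primitive -H(tau) of the other side, and
    [FTC_open] applies to both. *)
Lemma Rintegral_substitution (f tau dtau : R -> R) : (forall t, D t -> {for t, continuous f}) ->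
  mu.-integrable D (EFin \o f) ->
  (forall t, `[-1, 1]%classic t -> {for t, continuous tau}) ->
  (forall t, `[-1, 1]%classic t -> `[-1, 1]%classic (tau t)) ->
  (forall t, D t -> D (tau t)) -> (forall t, D t -> is_derive t 1 tau (- dtau t)) ->
  tau 1 = -1 -> tau (-1) = 1 ->
  (forall t, D t -> {for t, continuous (fun t => f (tau t) * dtau t)}) ->
  mu.-integrable D (EFin \o (fun t => f (tau t) * dtau t)) ->
  Rintegral mu D (fun t => f (tau t) * dtau t) = Rintegral mu D f.
Proof.
move=> cf fi ctau tauI tauD dtau_ tau1 tauN1 cft fti.
have [H cH dH] := primitive_exists cf fi.
have dN t : D t -> is_derive t 1 (fun t => - H (tau t)) (f (tau t) * dtau t).
  move=> Dt; have h1 := dH _ (tauD t Dt); have h2 := dtau_ t Dt.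
  have h3 := @is_derive1_comp _ H tau t _ _ h1 h2.
  have h4 := is_deriveN h3.
  by rewrite -[_ * _]opprK -mulrN; exact: h4.
have e1 := FTC_open (fun t Dt => cf t (set_mem Dt)) fi dH cH.
rewrite e1; have e2 := FTC_open (fun t Dt => cft t (set_mem Dt)) fti dN; rewrite e2.
  by rewrite tau1 tauN1; ring.
apply/continuous_withinP => t It; apply: cvgN.
apply: (@cvg_comp _ _ _ tau H _ (within `[-1, 1] (nbhs (tau t)))); last first.
  by move/continuous_withinP : cH; apply; exact: tauI.
move=> A /= hA; have h := ctau t It _ hA; apply: (@filterS _ (nbhs t) _ _ _ _ h).
by move=> y hy Iy; apply: hy; exact: tauI.
Qed.

End Substitution.

Section Inversion.
Context {R : realType}.

Lemma dist2_expand m (x y : 'rV[R]_m) : dotv (x - y) (x - y) = dotv x x - 2 * dotv x y + dotv y y.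
Proof. by rewrite !dotvE (dotvC y x); ring. Qed.

(** The conformal factor of the inversion [sinv a] at x, by [sinv_dist]. *)
Definition jac m (a x : 'rV[R]_m) : R := (dotv a a - 1) / dotv (x - a) (x - a).

Lemma sinvE m (a x : 'rV[R]_m) : sinv a x = a + jac a x *: (x - a).
Proof. by []. Qed.

Lemma sinv_dist m (a x y : 'rV[R]_m) : dotv (x - a) (x - a) != 0 -> dotv (y - a) (y - a) != 0 ->
  dotv (sinv a x - sinv a y) (sinv a x - sinv a y) = jac a x * jac a y * dotv (x - y) (x - y).
Proof.
move=> x0 y0; rewrite !sinvE.
have -> : a + jac a x *: (x - a) - (a + jac a y *: (y - a)) = jac a x *: (x - a) - jac a y *: (y - a).
  by rewrite opprD addrACA subrr add0r.
have -> : x - y = (x - a) - (y - a) by rewrite opprB addrA subrK.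
move: x0 y0; rewrite /jac; move: (x - a) (y - a) => p q p0 q0.
by rewrite !dist2_expand !dotvE; field; rewrite p0 q0.
Qed.

Variable n : nat.
Local Notation V := 'rV[R]_n.+1.
Local Notation S := (@sphere R n).
Local Notation I := (@sphere_int R n).
Implicit Types (a u x y : V).

Lemma sinv_den_gt0 a x : 1 < dotv a a -> S x -> 0 < dotv (x - a) (x - a).
Proof.
move=> a1 Sx; apply: dotv_gt0; apply: contraTneq a1 => /eqP; rewrite subr_eq0 => /eqP <-.
by rewrite Sx ltxx.
Qed.

Lemma jac_gt0 a x : 1 < dotv a a -> S x -> 0 < jac a x.
Proof. by move=> a1 Sx; rewrite divr_gt0 ?subr_gt0// sinv_den_gt0. Qed.

Lemma sphere_sinv a x : 1 < dotv a a -> S x -> S (sinv a x).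
Proof.
move=> a1 Sx; have d0 := sinv_den_gt0 a1 Sx.
have e : dotv (x - a) (x - a) = 1 - 2 * dotv x a + dotv a a by rewrite dist2_expand Sx.
rewrite /sphere /= sinvE !dotvE Sx (dotvC a x) /jac e.
move: d0; rewrite e => d0; field; exact: lt0r_neq0.
Qed.

Lemma sinv_dot a x y : 1 < dotv a a -> S x -> S y ->
  1 - dotv (sinv a x) (sinv a y) = jac a x * jac a y * (1 - dotv x y).
Proof.
move=> a1 Sx Sy.
have := sinv_dist (lt0r_neq0 (sinv_den_gt0 a1 Sx)) (lt0r_neq0 (sinv_den_gt0 a1 Sy)).
rewrite !dist_sphere//; try exact: sphere_sinv.
by rewrite mulrCA => /mulfI; apply; rewrite pnatr_eq0.
Qed.

Lemma sinvK a x : 1 < dotv a a -> dotv (x - a) (x - a) != 0 -> sinv a (sinv a x) = x.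
Proof.
move=> a1 d0; have e : sinv a x - a = jac a x *: (x - a) by rewrite sinvE addrC addKr.
have j1 : jac a (sinv a x) * jac a x = 1.
  rewrite {1}/jac e dotvZl dotvZr /jac; field.
  by rewrite d0 lt0r_neq0// subr_gt0.
by rewrite {1}sinvE e scalerA j1 scale1r addrC subrK.
Qed.

Lemma hrefl_dot u x y : dotv u u = 1 -> dotv (hrefl u x) (hrefl u y) = dotv x y.
Proof. by move=> u1; rewrite /hrefl !dotvE u1 (dotvC u y); ring. Qed.

Lemma hrefl_adj u x y : dotv (hrefl u x) y = dotv x (hrefl u y).
Proof. by rewrite /hrefl !dotvE (dotvC u y); ring. Qed.

Lemma hreflK u x : dotv u u = 1 -> hrefl u (hrefl u x) = x.
Proof.
by move=> u1; apply/rowP => i; rewrite /hrefl !dotvE !mxE u1; ring.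
Qed.

Lemma hreflB u x y : hrefl u (x - y) = hrefl u x - hrefl u y.
Proof.
apply/rowP => i; rewrite /hrefl !dotvE !mxE; ring.
Qed.

Lemma hreflZ u c x : hrefl u (c *: x) = c *: hrefl u x.
Proof. by apply/rowP => i; rewrite /hrefl !dotvE !mxE; ring. Qed.

Lemma jac_hrefl u a x : dotv u u = 1 -> jac (hrefl u a) (hrefl u x) = jac a x.
Proof. by move=> u1; rewrite /jac -hreflB !hrefl_dot. Qed.

Lemma sinv_hrefl u a x : dotv u u = 1 -> sinv (hrefl u a) (hrefl u x) = hrefl u (sinv a x).
Proof.
move=> u1; rewrite !sinvE jac_hrefl// -hreflB -hreflZ.
by apply/rowP => i; rewrite /hrefl !dotvE !mxE; ring.
Qed.

Lemma sphere_hrefl u x : dotv u u = 1 -> S x -> S (hrefl u x).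
Proof. by move=> u1 Sx; rewrite /sphere /= hrefl_dot. Qed.

Lemma cts_vec (phi : V -> V) : (forall i, cts (fun x => phi x ord0 i)) -> cts phi.
Proof.
move=> h; apply/ctsP => x Sx; apply/cvgrPdist_le => e e0.
have : \forall y \near within S (nbhs x), forall i, `|phi x ord0 i - phi y ord0 i| <= e.
  apply: filter_forall => i; move: (h i) => /ctsP/(_ x Sx)/cvgrPdist_le; exact.
apply: filterS => y hy; apply: norm_le_coord; first exact: ltW.
by move=> i; rewrite !mxE.
Qed.

Lemma cts_coord i : cts (fun x : V => x ord0 i).
Proof. by apply: ctsT => x; exact: coord_continuous. Qed.

Lemma cts_hrefl u : cts (hrefl u).
Proof.
apply: cts_vec => i; rewrite (_ : (fun x => _) = (fun x => x ord0 i - 2 * u ord0 i * dotv u x)).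
  by apply: ctsB; [exact: cts_coord|apply: ctsZ; exact: cts_dotr].
by apply/funext => x; rewrite /hrefl !mxE (dotvC u); ring.
Qed.

Lemma cts_jac a : 1 < dotv a a -> cts (jac a).
Proof.
move=> a1; apply: ctsZ; apply: cts_inv; first exact: cts_dist2.
by move=> x Sx; rewrite lt0r_neq0// sinv_den_gt0.
Qed.

Lemma cts_sinv a : 1 < dotv a a -> cts (sinv a).
Proof.
move=> a1; apply: cts_vec => i.
rewrite (_ : (fun x => _) = (fun x => a ord0 i + jac a x * (x ord0 i - a ord0 i))).
  apply: ctsD; first exact: cts_cst.
  by apply: ctsM; [exact: cts_jac|apply: ctsB; [exact: cts_coord|exact: cts_cst]].
by apply/funext => x; rewrite sinvE !mxE.
Qed.

End Inversion.

Section AxisInversion.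
Context {R : realType} (k : nat) (lam : R).
Hypothesis lam1 : 1 < lam.
Notation mu := (@lebesgue_measure R).
Notation D := (`]-1, 1[%classic : set R).
Local Notation e0 := (delta_mx ord0 ord0 : 'rV[R]_k.+2).
Local Notation a := (lam *: e0).
Local Notation den t := (1 + lam ^+ 2 - 2 * lam * t).
Local Notation jx t := ((lam ^+ 2 - 1) / den t).
Local Notation tau t := ((2 * lam - (1 + lam ^+ 2) * t) / den t).

Lemma dotv_axis (x : 'rV[R]_k.+2) : dotv x e0 = x ord0 ord0.
Proof.
rewrite /dotv (bigD1 ord0)//= big1 ?addr0 ?mxE ?eqxx ?mulr1// => j j0.
by rewrite mxE (negbTE j0) andbF mulr0.
Qed.

Lemma axis_sqnorm : dotv a a = lam ^+ 2.
Proof. by rewrite dotvZl dotvZr dotv_axis mxE !eqxx /=; ring. Qed.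

Let lam2 : 0 < lam ^+ 2 - 1.
Proof. by have l1 := lam1; rewrite (_ : _ - _ = (lam - 1) * (lam + 1)); [rewrite mulr_gt0//; lra|ring]. Qed.

Lemma axis_sqnorm_gt1 : 1 < dotv a a.
Proof. by rewrite axis_sqnorm -subr_gt0. Qed.

Let den_gt0 (t : R) : -1 <= t <= 1 -> 0 < den t.
Proof.
have l1 := lam1; move=> /andP[t1 t2]; rewrite (_ : den t = (lam - 1) ^+ 2 + 2 * lam * (1 - t)); last by ring.
apply: ltr_wpDr; last by rewrite exprn_gt0// subr_gt0.
by rewrite !mulr_ge0 ?subr_ge0//; lra.
Qed.

Let jx_gt0 (t : R) : -1 <= t <= 1 -> 0 < jx t.
Proof. by move=> /den_gt0 h; rewrite divr_gt0. Qed.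

Let onem_tau (t : R) : -1 <= t <= 1 -> 1 - tau t ^+ 2 = jx t ^+ 2 * (1 - t ^+ 2).
Proof. by move=> /den_gt0/lt0r_neq0 h; field. Qed.

Let tauI (t : R) : -1 <= t <= 1 -> -1 <= tau t <= 1.
Proof.
move=> t1; have h := den_gt0 t1; move/andP: t1 => [t1 t2].
rewrite ler_pdivlMr// ler_pdivrMr// -subr_ge0 -[X in _ && X]subr_ge0.
rewrite (_ : _ - _ = (lam + 1) ^+ 2 * (1 - t)); last by ring.
rewrite (_ : 1 * _ - _ = (lam - 1) ^+ 2 * (1 + t)); last by ring.
by have l1 := lam1; rewrite !mulr_ge0 ?sqr_ge0//; lra.
Qed.

Let tauD (t : R) : D t -> D (tau t).
Proof.
rewrite /= !in_itv /= => /andP[t1 t2]; have h : 0 < den t by apply: den_gt0; rewrite !ltW.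
rewrite ltr_pdivlMr// ltr_pdivrMr// -subr_gt0 -[X in _ && X]subr_gt0.
rewrite (_ : _ - _ = (lam + 1) ^+ 2 * (1 - t)); last by ring.
rewrite (_ : 1 * _ - _ = (lam - 1) ^+ 2 * (1 + t)); last by ring.
by have l1 := lam1; rewrite !mulr_gt0 ?exprn_gt0//; lra.
Qed.

Let DI (t : R) : D t -> -1 <= t <= 1.
Proof. by rewrite /= in_itv /= => /andP[/ltW -> /ltW]. Qed.

Lemma jac_axis (t : R) (y : 'rV[R]_k.+1) : -1 <= t <= 1 -> sphere k y -> jac a (sph_lift t y) = jx t.
Proof.
move=> t1 Sy; rewrite /jac axis_sqnorm dist2_expand axis_sqnorm (sphere_lift t1 Sy).
by rewrite dotvZr dotv_axis sph_lift0; congr (_ / _); ring.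
Qed.

Lemma sinv_axis (t : R) (y : 'rV[R]_k.+1) : -1 <= t <= 1 -> sphere k y ->
  sinv a (sph_lift t y) = sph_lift (tau t) y.
Proof.
move=> t1 Sy; have h := lt0r_neq0 (den_gt0 t1); rewrite sinvE jac_axis//.
apply/rowP => i; have [->|[j ->]] : i = ord0 \/ exists j, i = lift ord0 j.
- by case: (unliftP ord0 i) => [j ->|->]; [right; exists j|left].
- by rewrite sph_lift0 !mxE unlift_none !eqxx /=; field.
rewrite sph_liftS !mxE liftK onem_tau// sqrtrM ?sqr_ge0// sqrtr_sqr gtr0_norm ?jx_gt0//.
by rewrite andbF mulr0; ring.
Qed.

Lemma slice_wt_tau t : D t -> slice_wt k (tau t) * jx t ^+ 2 = slice_wt k t * jx t ^+ k.+1.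
Proof.
move=> Dt; have t1 := DI Dt; have h := jx_gt0 t1; have h1 := itv_onem_sqr_gt0 Dt.
rewrite /slice_wt onem_tau// powRM ?sqr_ge0 ?ltW// -powR_mulrn ?ltW// -powRrM.
rewrite mulrAC mulrC -(powR_mulrn _ (ltW h)) -powRD; last first.
  by rewrite (lt0r_neq0 h) implybT.
by congr (_ * _ `^ _); rewrite -natr1; field.
Qed.

Let tau_is_derive (t : R) : -1 <= t <= 1 -> is_derive t 1 (fun t => tau t) (- jx t ^+ 2).
Proof.
move=> t1; have h := lt0r_neq0 (den_gt0 t1).
have d1 : is_derive t 1 (fun t : R => den t) (- (2 * lam)).
  have := is_deriveB (is_derive_cst (1 + lam ^+ 2) t 1) (is_deriveZ (2 * lam) (is_derive_id t (1 : R))).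
  by move=> H; apply: (is_derive_eq H); rewrite sub0r /GRing.scale /= mulr1.
have d2 : is_derive t 1 (fun t : R => 2 * lam - (1 + lam ^+ 2) * t) (- (1 + lam ^+ 2)).
  have := is_deriveB (is_derive_cst (2 * lam) t 1) (is_deriveZ (1 + lam ^+ 2) (is_derive_id t (1 : R))).
  by move=> H; apply: (is_derive_eq H); rewrite sub0r /GRing.scale /= mulr1.
have d3 := @is_deriveV _ (fun t : R => den t) t _ 1 h d1.
have d4 := is_deriveM d2 d3.
by apply: (is_derive_eq d4); rewrite /GRing.scale /=; field.
Qed.

(** With its center on the first axis, the inversion sends the slice t to the slice tau t and leaves
    the point of the lower sphere fixed, so the change of variables is one-dimensional. The weight
    supplies the powers of the conformal factor beyond the two coming from the derivative of tau. *)
Lemma int_sinv_axis (g : 'rV[R]_k.+2 -> R) : cts g ->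
  sphere_int k.+1 (fun x => g (sinv a x) * jac a x ^+ k.+1) = sphere_int k.+1 g.
Proof.
move=> cg; have a1 := axis_sqnorm_gt1; rewrite /=.
pose f (t : R) := slice_wt k t * sphere_int k (fun y => g (sph_lift t y)).
have cf (t : R) : D t -> {for t, continuous f}.
  move=> Dt; have h1 := @slice_wt_continuous R k t Dt; have h2 := slice_int_continuous (@sphere_int_linear_monotone R k) cg Dt.
  exact: (cvgM h1 h2).
have ctau (t : R) : -1 <= t <= 1 -> {for t, continuous (fun t => tau t)}.
  by move=> t1; apply: differentiable_continuous; apply/derivable1_diffP; have [] := tau_is_derive t1.
have cjx (t : R) : -1 <= t <= 1 -> {for t, continuous (fun t => jx t ^+ 2)}.
  move=> t1; have h : {for t, continuous (fun t : R => jx t)}.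
    apply: cvgM; first exact: cvg_cst; apply: cvgV; first by rewrite lt0r_neq0// den_gt0.
    by apply: cvgB; [exact: cvg_cst|apply: cvgM; [exact: cvg_cst|exact: cvg_id]].
  exact: (cvgM h h).
have e (t : R) : D t -> slice_wt k t * sphere_int k (fun y => g (sinv a (sph_lift t y)) * jac a (sph_lift t y) ^+ k.+1)
    = f (tau t) * jx t ^+ 2.
  move=> Dt; have t1 := DI Dt.
  have cs : cts (fun y => g (sph_lift (tau t) y)) by apply: cts_slice => //; exact: tauI.
  rewrite [RHS](_ : _ = slice_wt k t * (jx t ^+ k.+1 * sphere_int k (fun y => g (sph_lift (tau t) y)))).
    rewrite -(intZ _ cs); congr (_ * _); apply/esym/int_eq; first exact: ctsZ cs.
    by move=> y Sy; rewrite sinv_axis// jac_axis// mulrC.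
  by rewrite mulrA -slice_wt_tau// /f mulrAC.
rewrite -[RHS](@Rintegral_substitution _ f (fun t => tau t) (fun t => jx t ^+ 2)).
- by apply: eq_Rintegral => t /set_mem Dt; rewrite -e.
- exact: cf.
- exact: (slice_int_integrable (@sphere_int_linear_monotone R k)).
- move=> t; rewrite /= in_itv /= => t1.
  exact: ctau.
- by move=> t; rewrite /= !in_itv /=; exact: tauI.
- exact: tauD.
- by move=> t /DI/tau_is_derive.
- have h : 0 < den 1 by apply: den_gt0; lra.
  by rewrite (_ : 2 * lam - _ = - den 1) ?mulNr ?divff ?lt0r_neq0//; ring.
- have h : 0 < den (-1) by apply: den_gt0; lra.
  by rewrite (_ : 2 * lam - _ = den (-1)) ?divff ?lt0r_neq0//; ring.
- move=> t Dt; have h : {for t, continuous (fun t => f (tau t))}.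
    by apply: (@continuous_comp _ _ _ (fun t => tau t) f); [exact: ctau (DI Dt)|exact: cf (tauD Dt)].
  exact: (cvgM h (cjx t (DI Dt))).
have h := @slice_int_integrable _ k (@sphere_int_linear_monotone R k) (fun x => g (sinv a x) * jac a x ^+ k.+1).
apply: eq_integrable (h _) => //.
  by move=> t /set_mem Dt /=; rewrite e.
apply: ctsM; last by apply: ctsX; exact: cts_jac.
apply: cts_sphere_comp => //; first exact: cts_sinv.
by move=> x; exact: sphere_sinv.
Qed.

End AxisInversion.

Section ConformalData.
Context {R : realType} (n : nat).
Hypothesis n0 : (0 < n)%N.
Local Notation V := 'rV[R]_n.+1.
Local Notation S := (@sphere R n).
Local Notation I := (@sphere_int R n).
Implicit Types (a u x y : V) (g : V -> R).

Lemma int_hrefl u g : dotv u u = 1 -> cts g -> I (fun x => g (hrefl u x)) = I g.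
Proof.
move=> u1 cg; apply: (int_isometry n0 (B := hrefl u)) => //.
- exact: cts_hrefl.
- by move=> x; exact: sphere_hrefl.
- by move=> x; exact: sphere_hrefl.
- by move=> x y; exact: hrefl_adj.
Qed.

Lemma hrefl_exists (p q : V) : S p -> S q -> p != q -> exists2 u, dotv u u = 1 & hrefl u q = p.
Proof.
move=> Sp Sq pq; have d0 : 0 < dotv (p - q) (p - q) by apply: dotv_gt0; rewrite subr_eq0.
have ds : Num.sqrt (dotv (p - q) (p - q)) ^+ 2 = dotv (p - q) (p - q) by rewrite sqr_sqrtr ?ltW.
have s0 : Num.sqrt (dotv (p - q) (p - q)) != 0 by rewrite lt0r_neq0// sqrtr_gt0.
exists ((Num.sqrt (dotv (p - q) (p - q)))^-1 *: (p - q)).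
  by rewrite dotvZl dotvZr mulrA -invfM -expr2 ds mulVf// lt0r_neq0.
rewrite /hrefl dotvZr scalerA (_ : _ * _ = -1); first by rewrite scaleN1r opprK addrC subrK.
have : 2 * dotv q (p - q) = - dotv (p - q) (p - q).
  by rewrite dist_sphere// !dotvE Sq (dotvC q p); ring.
move: ds s0; set s := Num.sqrt _; rewrite mulrCA -mulrA => ds s0 ->.
by rewrite -ds; field.
Qed.

(** Conjugation by a reflection brings the center of the inversion onto the first axis. *)
Lemma int_sinv a g : 1 < dotv a a -> cts g -> I (fun x => g (sinv a x) * jac a x ^+ n) = I g.
Proof.
move=> a1 cg; pose lam := Num.sqrt (dotv a a).
have l2 : lam ^+ 2 = dotv a a by rewrite sqr_sqrtr// dotv_ge0.
have l1 : 1 < lam by have := sqrtr_ge0 (dotv a a); rewrite -/lam; nra.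
pose e0 : V := delta_mx ord0 ord0.
have haxis (h : V -> R) : cts h -> I (fun x => h (sinv (lam *: e0) x) * jac (lam *: e0) x ^+ n) = I h.
  rewrite /e0; case: n n0 h => // k _ h ch; exact: int_sinv_axis.
pose p := lam^-1 *: a.
have pa : a = lam *: p by rewrite scalerA divff ?scale1r// gt_eqF// (lt_trans ltr01).
have Sp : S p by rewrite /sphere /= dotvZl dotvZr -l2; field; rewrite gt_eqF// (lt_trans ltr01).
have [pe|pe] := eqVneq p e0; first by rewrite pa pe haxis.
have [u u1 ue] := hrefl_exists Sp (@sphere_delta R n ord0) pe.
have ae : a = hrefl u (lam *: e0) by rewrite hreflZ ue.
have cF : cts (fun x => g (sinv a x) * jac a x ^+ n).
  apply: ctsM; last by apply: ctsX; exact: cts_jac.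
  apply: cts_sphere_comp => //; first exact: cts_sinv.
  by move=> x; exact: sphere_sinv.
rewrite -(int_hrefl u1 cF) -[RHS](int_hrefl u1 cg) -(haxis (fun x => g (hrefl u x))); last first.
  apply: cts_sphere_comp => //; first exact: cts_hrefl.
  by move=> x; exact: sphere_hrefl.
by congr I; apply/funext => x; rewrite ae sinv_hrefl// jac_hrefl.
Qed.

(* The factor j is the n-th root of det d phi. *)
Record cdata (phi : V -> V) (j : V -> R) : Prop := CData {
  cd_sphere : forall x, S x -> S (phi x);
  cd_cts : cts phi;
  cd_jcts : cts j;
  cd_gt0 : forall x, S x -> 0 < j x;
  cd_dot : forall x y, S x -> S y -> 1 - dotv (phi x) (phi y) = j x * j y * (1 - dotv x y);
  cd_int : forall g : V -> R, cts g -> I (fun x => g (phi x) * j x ^+ n) = I g }.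

Lemma cdata_id : cdata id (fun=> 1).
Proof.
split => //; [exact: cts_id|exact: cts_cst|by move=> x y _ _; ring|].
by move=> g cg; congr I; apply/funext => x; rewrite expr1n mulr1.
Qed.

Lemma cdata_comp phi j psi k : cdata phi j -> cdata psi k ->
  cdata (phi \o psi) (fun x => j (psi x) * k x).
Proof.
move=> h1 h2; split => /=.
- by move=> x Sx; apply: (cd_sphere h1); exact: (cd_sphere h2).
- by apply: cts_sphere_comp; [exact: cd_cts h1|exact: cd_cts h2|exact: cd_sphere h2].
- apply: ctsM (cd_jcts h2); apply: cts_sphere_comp; [exact: cd_jcts h1|exact: cd_cts h2|exact: cd_sphere h2].
- by move=> x Sx; rewrite mulr_gt0// ?(cd_gt0 h1) ?(cd_gt0 h2)//; exact: (cd_sphere h2).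
- move=> x y Sx Sy; rewrite (cd_dot h1) ?(cd_dot h2)//; [ring|exact: (cd_sphere h2)..].
move=> g cg; rewrite -[RHS](cd_int h1 cg) -[RHS](cd_int h2).
  by congr I; apply/funext => x; rewrite exprMn mulrA.
apply: ctsM; last by apply: ctsX; exact: cd_jcts h1.
by apply: cts_sphere_comp; [exact: cg|exact: cd_cts h1|exact: cd_sphere h1].
Qed.

Lemma cdata_hrefl u : dotv u u = 1 -> cdata (hrefl u) (fun=> 1).
Proof.
move=> u1; split => //; [by move=> x; exact: sphere_hrefl|exact: cts_hrefl|exact: cts_cst| |].
  by move=> x y _ _; rewrite hrefl_dot//; ring.
by move=> g cg; rewrite -[RHS](int_hrefl u1 cg); congr I; apply/funext => x; rewrite expr1n mulr1.
Qed.

Lemma cdata_sinv a : 1 < dotv a a -> cdata (sinv a) (jac a).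
Proof.
move=> a1; split.
- by move=> x; exact: sphere_sinv.
- exact: cts_sinv.
- exact: cts_jac.
- by move=> x; exact: jac_gt0.
- by move=> x y; exact: sinv_dot.
- by move=> g; exact: int_sinv.
Qed.

End ConformalData.

(** * The eigenvalues of the operator *)

Section EulerIntegral.
Context {R : realType}.
Notation leb := (@lebesgue_measure R).
Notation D := (`]0, +oo[%classic : set R).
Implicit Types y z t M : R.

Lemma powR_ge_tangent_neg (x p : R) : 0 < x -> p <= 0 -> 1 + p * (x - 1) <= x `^ p.
Proof.
move=> x0 p0; rewrite /powR gt_eqF//; apply: le_trans (expR_ge1Dx _).
rewrite lerD2l; apply: ler_wnM2l => //.
by have := @le_ln1Dx R (x - 1); rewrite [1 + _]addrC subrK; apply; lra.
Qed.

Lemma powR_ge_tangent (x p : R) : 0 < x -> 1 <= p -> 1 + p * (x - 1) <= x `^ p.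
Proof.
move=> x0 p1; have xV : 0 < x^-1 by rewrite invr_gt0.
have p0 : 1 - p <= 0 by lra.
have := powR_ge_tangent_neg xV p0.
have -> : x^-1 `^ (1 - p) = x `^ (p - 1).
  by rewrite -powR_inv1 ?(ltW x0)// -powRrM mulN1r opprB.
rewrite -(ler_pM2l x0) mulr_powRB1 ?(ltW x0)//; last by rewrite (lt_le_trans _ p1).
apply: le_trans.
rewrite [leRHS](_ : _ = x + (1 - p) * (1 - x)); [lra|by field; rewrite gt_eqF].
Qed.

Lemma expR_powR (a b : R) : expR a `^ b = expR (a * b).
Proof. by rewrite /powR gt_eqF ?expR_gt0// expRK mulrC. Qed.

Lemma powR_le_expR y t : 0 < y -> 0 <= t -> t `^ y <= (2 * y) `^ y * expR (t / 2).
Proof.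
move=> y0 t0; have y2 : 0 < 2 * y by rewrite mulr_gt0.
have -> : expR (t / 2) = expR (t / (2 * y)) `^ y.
  by rewrite expR_powR; congr expR; field; rewrite gt_eqF.
rewrite -powRM ?expR_ge0 ?(ltW y2)//; apply: ge0_ler_powR; rewrite ?nnegrE ?(ltW y0)//.
  by rewrite mulr_ge0 ?expR_ge0 ?ltW.
rewrite -ler_pdivrMl// mulrC; apply: le_trans (expR_ge1Dx _).
by rewrite lerDr.
Qed.

(** Integration by parts in disguise: G is the derivative of F, and for M >= 1 + (2 y)^y the added
    term makes G nonnegative, so that its improper integral can be evaluated from F and in turn
    dominates the Gamma integrands. *)
Let G y M t := (t `^ y - y * t `^ (y - 1) + M) * expR (- t).
Let F y M t := - ((t `^ y + M) * expR (- t)).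

Let G_lower y M t : 1 < y -> 1 + (2 * y) `^ y <= M -> 0 < t ->
  (t `^ y + 1) * expR (- t) <= 2 * G y M t.
Proof.
move=> y1 hM t0; rewrite /G mulrA ler_pM2r ?expR_gt0//.
have h0 := powR_ge0 (2 * y) y.
have k : 2 * (y * t `^ (y - 1)) <= t `^ y + (2 * y) `^ y.
  have [h|h] := lerP (2 * y) t.
    rewrite mulrA -(mulr_powRB1 (ltW t0) (lt_trans ltr01 y1)).
    by rewrite ler_wpDr// ler_wpM2r// powR_ge0.
  have y2 : 0 <= 2 * y by lra.
  rewrite mulrA -(mulr_powRB1 y2 (lt_trans ltr01 y1)).
  rewrite ler_wpDl ?powR_ge0// ler_wpM2l//.
  by apply: ge0_ler_powR; rewrite ?nnegrE//; lra.
by move: k; set a := t `^ y; set b := t `^ (y - 1); move: h0 hM; set c := (2 * y) `^ y; lra.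
Qed.

Let G_ge0 y M t : 1 < y -> 1 + (2 * y) `^ y <= M -> 0 < t -> 0 <= G y M t.
Proof.
move=> y1 hM t0; have := G_lower y1 hM t0; rewrite -(pmulr_rge0 (G y M t) (ltr0n R 2)).
by apply: le_trans; rewrite mulr_ge0 ?expR_ge0 ?addr_ge0 ?powR_ge0.
Qed.

Let F_is_derive y M t : 0 < t -> is_derive t 1 (F y M) (G y M t).
Proof.
move=> t0; have h1 := is_derive1_powR y t0.
have h2 := is_deriveD h1 (is_derive_cst M t (1 : R)).
have h3 := @is_derive1_comp _ expR (fun u : R => - u) t _ _ (is_derive_expR (- t)) (is_deriveN (is_derive_id t (1 : R))).
have h4 := is_deriveN (is_deriveM h2 h3).
by apply: (is_derive_eq h4); rewrite /G /GRing.scale /= !fctE /=; ring.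
Qed.

Let expRN_cts t : {for t, continuous (fun t : R => expR (- t))}.
Proof.
apply: (@continuous_comp _ _ _ (fun t : R => - t) expR); last exact: continuous_expR.
exact: cvgN.
Qed.

Let G_cts y M t : 0 < t -> {for t, continuous (G y M)}.
Proof.
move=> t0; apply: cvgM; last exact: expRN_cts.
apply: cvgD; last exact: cvg_cst; apply: cvgB; first exact: continuous_powRl.
by apply: cvgM; [exact: cvg_cst|exact: continuous_powRl].
Qed.

Let expRN_right : expR (- t) @[t --> 0^'+] --> (1 : R).
Proof.
have := @expRN_cts 0; rewrite /prop_for /continuous_at oppr0 expR0 => h.
exact: cvg_at_right_filter h.
Qed.

Let G_right y M : 1 < y -> G y M t @[t --> 0^'+] --> M.
Proof.
move=> y1; have h1 := @powR_cvg0 R y (lt_trans ltr01 y1).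
have y2 : 0 < y - 1 by rewrite subr_gt0.
have h2 := @powR_cvg0 R (y - 1) y2.
have h := cvgM (cvgD (cvgB h1 (cvgM (cvg_cst y) h2)) (cvg_cst M)) expRN_right.
by rewrite mulr0 subr0 add0r mulr1 in h; exact: h.
Qed.

Let F_right y M : 1 < y -> F y M t @[t --> 0^'+] --> - M.
Proof.
move=> y1; have h1 := @powR_cvg0 R y (lt_trans ltr01 y1).
have h := cvgN (cvgM (cvgD h1 (cvg_cst M)) expRN_right).
by rewrite add0r mulr1 in h; exact: h.
Qed.

Let F_infty y M : 1 < y -> 0 <= M -> F y M t @[t --> +oo] --> 0.
Proof.
move=> y1 M0; apply/cvgrPdist_le => e e0; near=> t.
have t0 : 0 < t by near: t; exact: nbhs_pinfty_gt.
rewrite sub0r opprK ger0_norm ?mulr_ge0 ?addr_ge0 ?powR_ge0 ?expR_ge0//.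
set C := (2 * y) `^ y + M.
have C0 : 0 < C + 1 by rewrite ltr_wpDl// addr_ge0 ?powR_ge0.
have hC : (C + 1) * 2 / e <= t by near: t; apply: nbhs_pinfty_ge; exact: num_real.
have b1 : t `^ y + M <= (C + 1) * expR (t / 2).
  apply: (@le_trans _ _ (C * expR (t / 2))); last by rewrite ler_wpM2r ?expR_ge0// lerDl.
  rewrite mulrDl lerD//; first by apply: powR_le_expR; [lra|exact: ltW].
  by rewrite ler_peMr// -expR0 ler_expR divr_ge0// ltW.
apply: le_trans (ler_wpM2r (expR_ge0 _) b1) _.
rewrite -mulrA -expRD (_ : t / 2 - t = - (t / 2)); last by field.
rewrite expRN ler_pdivrMr ?expR_gt0//.
have b2 : (C + 1) <= e * (t / 2) by rewrite ler_pdivrMr// in hC; lra.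
apply: le_trans b2 _; rewrite ler_pM2l//; apply: le_trans (expR_ge1Dx _); lra.
Unshelve. all: by end_near. Qed.

Let G0 y M : 1 < y -> G y M 0 = M.
Proof. by move=> y1; rewrite /G !powR0 ?oppr0 ?expR0; [ring|rewrite subr_eq0 gt_eqF|rewrite gt_eqF// (lt_trans _ y1)]. Qed.

Let mD : measurable (D : set (measurableTypeR R)).
Proof. exact: measurable_itv. Qed.

Let mG y M : measurable_fun (D : set (measurableTypeR R)) (G y M).
Proof.
apply: open_continuous_measurable_fun; first exact: interval_open.
by move=> t /set_mem; rewrite /= in_itv /= andbT; exact: G_cts.
Qed.

Let intG y M : 1 < y -> 1 + (2 * y) `^ y <= M ->
  (\int[leb]_(t in D) (G y M t)%:E = M%:E)%E.
Proof.
move=> y1 hM; have M0 : 0 <= M by have := powR_ge0 (2 * y) y; lra.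
rewrite (integral_itv_obnd_cbnd (f := EFin \o G y M)); last by apply/measurable_EFinP; exact: mG.
have F0 : F y M 0 = - M by rewrite /F powR0 ?oppr0 ?expR0 ?add0r ?mulr1// gt_eqF// (lt_trans _ y1).
rewrite (@ge0_continuous_FTC2y _ (G y M) (F y M) 0 0).
- by rewrite F0 -EFinB sub0r opprK.
- by move=> t; rewrite le_eqVlt => /predU1P[<-|]; [rewrite G0|exact: G_ge0].
- apply/continuous_within_itvcyP; split; last by rewrite G0//; exact: G_right.
  by move=> t; rewrite in_itv /= andbT; exact: G_cts.
- exact: F_infty.
- by move=> t /(F_is_derive y M)[].
- by rewrite F0; exact: F_right.
- move=> t; rewrite in_itv /= andbT => /(F_is_derive y M) h.
  by rewrite derive1E derive_val.
Qed.

Let iG y M : 1 < y -> 1 + (2 * y) `^ y <= M -> leb.-integrable D (EFin \o G y M).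
Proof.
move=> y1 hM; apply/integrableP; split; first by apply/measurable_EFinP; exact: mG.
have -> : (\int[leb]_(x in D) `|(EFin \o G y M) x|)%E = (\int[leb]_(x in D) (G y M x)%:E)%E.
  apply: eq_integral => t /set_mem.
  by rewrite /= in_itv /= andbT => t0; rewrite ger0_norm// G_ge0.
by rewrite intG ?ltry.
Qed.

Let E y t := t `^ (y - 1) * expR (- t).

Let mE y : measurable_fun (D : set (measurableTypeR R)) (E y).
Proof.
apply: open_continuous_measurable_fun; first exact: interval_open.
move=> t /set_mem; rewrite /= in_itv /= andbT => t0.
by apply: cvgM; [exact: continuous_powRl|exact: expRN_cts].
Qed.

Let iE z y : 1 < y -> 0 <= z - 1 <= y -> leb.-integrable D (EFin \o E z).
Proof.
move=> y1 /andP[z0 zy]; have hM := lexx (1 + (2 * y) `^ y).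
have h := integrableZl mD 2 (iG y1 hM).
apply: le_integrable h => //; first by apply/measurable_EFinP; exact: mE.
move=> t /=; rewrite in_itv /= andbT => t0; rewrite !lee_fin.
rewrite ger0_norm ?mulr_ge0 ?powR_ge0 ?expR_ge0//.
rewrite ger0_norm; last by rewrite mulr_ge0// G_ge0.
apply: le_trans (G_lower y1 hM t0); rewrite ler_pM2r ?expR_gt0//.
have [t1|t1] := lerP t 1.
  rewrite ler_wpDl ?powR_ge0//; have := @ger_powR _ t; rewrite t0 t1 => /(_ isT 0 (z - 1) z0).
  by rewrite powRr0.
by rewrite ler_wpDr//; apply: ler_powR => //; exact: ltW.
Qed.

Lemma EulerGamma_rec y : 1 < y -> EulerGamma (y + 1) = y * EulerGamma y.
Proof.
move=> y1; pose M := 1 + (2 * y) `^ y.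
have hM : 1 + (2 * y) `^ y <= M by [].
have hM1 : 1 + (2 * y) `^ y <= M + 1 by rewrite lerDl.
have i1 : leb.-integrable D (EFin \o E (y + 1)) by apply: (iE y1); lra.
have i2 : leb.-integrable D (EFin \o E y) by apply: (iE y1); lra.
have i3 := integrableZl mD y i2.
apply/eqP; rewrite -subr_eq0 /EulerGamma -(@RintegralZl _ _ R leb D _ y mD i2) -(@RintegralB _ _ R leb D _ _ mD i1 i3).
have i4 := integrableZl mD M (iG y1 hM1); have i5 := integrableZl mD M (iG y1 hM).
have i6 := integrableZl mD (1 + M) (iG y1 hM).
(* This combination eliminates the terms in M from the integrands; since the integrals of [G y M]
   and [G y (M + 1)] are M and M + 1, it integrates to 0. *)
rewrite (_ : Rintegral _ _ _ = \int[leb]_(t in D) ((1 + M) * G y M t - M * G y (M + 1) t)).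
  rewrite (@RintegralB _ _ R leb D _ _ mD i6 i4) (@RintegralZl _ _ R leb D _ _ mD (iG y1 hM)) (@RintegralZl _ _ R leb D _ _ mD (iG y1 hM1)).
  by rewrite /Rintegral !intG//= ; apply/eqP; ring.
apply: eq_Rintegral => t _; rewrite /G /E addrK; ring.
Qed.

Lemma EulerGamma_gt0 y : 1 < y -> 0 < EulerGamma y.
Proof.
move=> y1; have i2 : leb.-integrable D (EFin \o E y) by apply: (iE y1); lra.
have sub : `[1, 2]%classic `<=` D.
  by move=> t; rewrite /= !in_itv /= andbT => /andP[t1 _]; rewrite (lt_le_trans _ t1).
have m12 : measurable (`[1, 2]%classic : set (measurableTypeR R)) by exact: measurable_itv.
have e0 : 0 < expR (- 2 : R) by exact: expR_gt0.
apply: (lt_le_trans e0); rewrite -lee_fin /EulerGamma /Rintegral fineK; last exact: integrable_fin_num i2.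
have h1 : (\int[leb]_(t in `[1%R, 2%R]) (E y t)%:E <= \int[leb]_(t in D) (E y t)%:E)%E.
  apply: ge0_subset_integral => //; first by apply/measurable_EFinP; exact: mE.
  by move=> t _; rewrite lee_fin mulr_ge0 ?powR_ge0 ?expR_ge0.
apply: le_trans h1.
have <- : (\int[leb]_(t in `[1%R, 2%R]) (expR (- 2 : R))%:E = (expR (- 2 : R))%:E)%E.
  rewrite integral_cst//= lebesgue_measure_itv /= lte_fin ltr1n -EFinB -EFinM; congr EFin; ring.
apply: ge0_le_integral => //.
- by apply/measurable_EFinP; apply: measurable_funS (mE y).
move=> t; rewrite /= in_itv /= => /andP[t1 t2]; rewrite lee_fin.
rewrite -[leLHS]mul1r ler_pM ?expR_ge0// ?ler_expR; last by rewrite lerN2.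
by have := @ler_powR _ t t1 0 (y - 1); rewrite powRr0; apply; rewrite subr_ge0 ltW.
Qed.

End EulerIntegral.

Section GammaFunction.
Context {R : realType}.
Implicit Types x y s : R.

Let prodS x k : \prod_(j < k.+1) (x + j%:R) = x * \prod_(j < k) (x + 1 + j%:R).
Proof.
rewrite big_ord_recl addr0; congr (_ * _); apply: eq_bigr => j _.
by rewrite -addrA -natr1 [_ + 1]addrC.
Qed.

(* The hypothesis keeps the Euler integrals away from the exponent -1; it fails only for integers x <= 0. *)
Lemma GammaE x k : x \isn't a Num.int -> 1 < x + k%:R ->
  Gamma x = EulerGamma (x + k%:R) / \prod_(j < k) (x + j%:R).
Proof.
move=> xZ xk; pose G k := EulerGamma (x + k%:R) / \prod_(j < k) (x + j%:R).
have step m : 1 < x + m%:R -> G m.+1 = G m.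
  move=> xm; rewrite /G big_ord_recr /= -natr1 addrA EulerGamma_rec// invfM.
  rewrite [_ * EulerGamma _]mulrC [_^-1 * _]mulrC -mulrA mulVKf//.
  by rewrite gt_eqF// (lt_trans ltr01).
have steps m d : 1 < x + m%:R -> G (m + d)%N = G m.
  move=> xm; elim: d => [|d IH]; first by rewrite addn0.
  by rewrite addnS step ?IH// natrD addrA ltr_wpDr.
rewrite /Gamma -/(G k) -/(G _); set m := _.+1.
have xm : 1 < x + m%:R.
  have fx := floor_le x; have fZ : x != (Num.floor x)%:~R.
    by apply: contraNneq xZ => ->; exact: intr_int.
  have lt : (Num.floor x)%:~R < x by rewrite lt_neqAle eq_sym fZ.
  have : - (Num.floor x)%:~R <= (`|Num.floor x|%N)%:R :> R.
    by rewrite -mulrNz -[leRHS]/((`|Num.floor x|%N : int)%:~R) ler_int abszE ler_normr lexx orbT.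
  by rewrite /m -natr1; move: lt; set a := _%:~R; set b := _%:R => *; lra.
by rewrite -(steps m k xm) -(steps k m xk) addnC.
Qed.

Lemma Gamma_rec x : x \isn't a Num.int -> Gamma (x + 1) = x * Gamma x.
Proof.
move=> xZ; have x0 : x != 0 by apply: contraNneq xZ => ->; exact: int_num0.
have x1Z : x + 1 \isn't a Num.int by rewrite rpredDr ?int_num1.
pose k := (Num.bound `|x|).+1.
have xk : 1 < x + k%:R.
  have := archi_boundP (normr_ge0 x); rewrite /k -natr1.
  have := ler_norm (- x); rewrite normrN; set a := _%:R; set b := `|x| => *; lra.
rewrite (GammaE (k := k.+1) xZ); last by rewrite -natr1 addrA ltr_wpDr.
rewrite (GammaE (k := k) x1Z); last by rewrite addrAC ltr_wpDr.
rewrite prodS invfM -natr1 -addrA [1 + _]addrC mulrCA.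
by congr (_ * _); rewrite mulVKf.
Qed.

End GammaFunction.

Section SphereMultiplier.
Context {R : realType} (n : nat) (s : R).
Hypothesis s_range : 0 < s < 1 \/ 1 < s < 2.
Local Notation P l := (Pcoef n (n%:R / 2 + s) l).

Let s0 : 0 < s. Proof. by case: s_range => /andP[]; lra. Qed.
Let s2 : s < 2. Proof. by case: s_range => /andP[]; lra. Qed.

Lemma s_isn't_int : s \isn't a Num.int.
Proof.
apply/negP => /intrP[z sz]; have := s_range; rewrite sz.
rewrite -[0]/(0%:~R) -[1]/(1%:~R) -[2]/(2%:~R) !ltr_int.
by case=> /andP[]; lia.
Qed.

Lemma Gamma_gt0 (x : R) : 0 < x -> x \isn't a Num.int -> 0 < Gamma x.
Proof.
move=> x0 xZ; rewrite (GammaE (k := 1) xZ); last by rewrite ltrDr.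
by rewrite divr_gt0 ?EulerGamma_gt0 ?ltrDr// big_ord1 addr0.
Qed.

Let lnsZ l : l%:R + n%:R + s \isn't a Num.int.
Proof. by rewrite -natrD rpredDl ?rpred_nat//; exact: s_isn't_int. Qed.

Let lsZ l : l%:R - s \isn't a Num.int.
Proof. by rewrite rpredDl ?rpred_nat// rpredN; exact: s_isn't_int. Qed.

Lemma PcoefE l : P l = Gamma (l%:R + n%:R + s) / Gamma (l%:R - s).
Proof.
rewrite /Pcoef /recipGamma (_ : l%:R + n%:R / 2 + (n%:R / 2 + s) = l%:R + n%:R + s); last by field.
rewrite (_ : l%:R + n%:R / 2 - (n%:R / 2 + s) = l%:R - s); last by field.
by rewrite (negbTE (lsZ l)).
Qed.

Let lns0 l : 0 < l%:R + n%:R + s :> R. Proof. by rewrite ltr_wpDl ?addr_ge0. Qed.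

Let Gls l : Gamma (l.+1%:R - s) = (l%:R - s) * Gamma (l%:R - s).
Proof. by rewrite -natr1 addrAC Gamma_rec//; exact: lsZ. Qed.

Let ls0 l : l%:R - s != 0.
Proof. by apply: contraNneq (lsZ l) => ->. Qed.

Lemma PcoefS l : P l.+1 * (l%:R - s) = P l * (l%:R + n%:R + s).
Proof.
rewrite !PcoefE Gls (_ : l.+1%:R + n%:R + s = l%:R + n%:R + s + 1); last by rewrite -natr1; ring.
rewrite Gamma_rec; last exact: lnsZ.
rewrite invfM; have := ls0 l; set a := _ - s => a0.
by rewrite -[LHS]mulrA [_ / _ * a]mulrAC mulVf// mul1r; ring.
Qed.

Lemma Pcoef_gt0 l : (1 < l)%N -> 0 < P l.
Proof.
move=> l1; rewrite PcoefE divr_gt0//; apply: Gamma_gt0; [exact: lns0|exact: lnsZ| |exact: lsZ].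
by rewrite subr_gt0 (lt_le_trans s2)// ler_nat.
Qed.

(** Read off the recursion P 2 (1 - s) = P 1 (1 + n + s) with P 2 > 0. *)
Lemma Pcoef1_sign : 0 < P 1 * (1 - s).
Proof.
have := PcoefS 1; have := Pcoef_gt0 (leqnn 2); have h := @lns0 1.
have s1 : 1 - s != 0 := ls0 1.
move=> P2 e; have : 0 < P 1 * (1 + n%:R + s) * (1 - s).
  by rewrite -e -mulrA mulr_gt0// -expr2 lt_neqAle eq_sym sqrf_eq0 s1 sqr_ge0.
by rewrite mulrAC pmulr_lgt0.
Qed.

Lemma Pcoef0_sign : 0 < P 0 * (s - 1).
Proof.
have := PcoefS 0 : P 1 * (0 - s) = P 0 * (0 + n%:R + s).
rewrite !add0r mulrN => e.
have h := @lns0 0; rewrite add0r in h.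
have : 0 < P 0 * (n%:R + s) * (s - 1).
  rewrite -e mulNr -mulrN opprB mulrAC pmulr_lgt0 ?s0//; exact: Pcoef1_sign.
by rewrite mulrAC pmulr_lgt0.
Qed.

Lemma Pcoef_ker_eigen l : P l * ker_eigen n s l = P 0 * ker_eigen n s 0.
Proof.
elim: l => // l <- /=; rewrite mulrA.
have h := lt0r_neq0 (lns0 l); have e := PcoefS l.
by congr (_ * _); apply: (mulIf h); rewrite -e mulrA divfK.
Qed.

(** Compares the energy with the norm of [in_H]. From degree 2 on, the bound C0 (l - s)^e with e = n
    + 2 s propagates: the ratio of consecutive coefficients is 1 + e / (l - s), which Bernoulli's
    inequality bounds by ((l + 1 - s) / (l - s))^e. *)
Lemma Pcoef_growth : (0 < n)%N -> exists2 C, 0 < C & forall l,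
  `|P l| <= C * (1 + l%:R) `^ (2 * (n%:R / 2 + s)).
Proof.
move=> n0; set e := 2 * _; have en : e = n%:R + 2 * s by rewrite /e; field.
have n1 : 1 <= n%:R :> R by rewrite ler1n.
have hs0 := s0; have hs2 := s2; have e1 : 1 <= e by rewrite en; lra.
pose C0 := P 2 / (2 - s) `^ e.
have C00 : 0 < C0 by rewrite divr_gt0 ?Pcoef_gt0 ?powR_gt0 ?subr_gt0.
have sharp_bound k : P k.+2 <= C0 * (k.+2%:R - s) `^ e.
  elim: k => [|k IH].
    by rewrite /C0 divfK// gt_eqF// powR_gt0// subr_gt0.
  have d0 : 0 < k.+2%:R - s by rewrite subr_gt0 (lt_le_trans hs2)// ler_nat.
  have d1 : 0 < k.+3%:R - s by rewrite subr_gt0 (lt_le_trans hs2)// ler_nat.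
  rewrite -(ler_pM2r d0) PcoefS.
  have t := powR_ge_tangent (divr_gt0 d1 d0) e1.
  have -> : (k.+3%:R - s) `^ e = (k.+2%:R - s) `^ e * ((k.+3%:R - s) / (k.+2%:R - s)) `^ e.
    by rewrite -powRM ?ltW ?divr_gt0// mulrCA divff ?mulr1// gt_eqF.
  rewrite mulrA -[leRHS]mulrA; apply: ler_pM => //; [exact/ltW/Pcoef_gt0|exact/ltW/lns0|].
  rewrite -ler_pdivrMr//; apply: le_trans t.
  rewrite -[k.+3%:R]natr1 en; move: (k.+2%:R : R) d0 => m /lt0r_neq0 d0.
  by rewrite le_eqVlt; apply/orP; left; apply/eqP; field.
exists (C0 + `|P 0| + `|P 1|); first by rewrite -addrA ltr_pwDl// addr_ge0.
have g1 l : 1 <= (1 + l%:R : R) `^ e.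
  have := @ler_powR _ (1 + l%:R : R) (_ : 1 <= 1 + l%:R) 0 e; rewrite powRr0; apply; rewrite ?lerDl//.
  lra.
case=> [|[|l]].
- apply: le_trans (ler_peMr _ (g1 0%N)); rewrite ?addr_ge0 ?(ltW C00)//.
  by rewrite addrAC lerDr addr_ge0 ?(ltW C00).
- apply: le_trans (ler_peMr _ (g1 1%N)); rewrite ?addr_ge0 ?(ltW C00)//.
  by rewrite lerDr addr_ge0 ?(ltW C00).
rewrite ger0_norm; last exact/ltW/Pcoef_gt0.
apply: le_trans (sharp_bound l) _.
have d0 : 0 < l.+2%:R - s by rewrite subr_gt0 (lt_le_trans hs2)// ler_nat.
apply: ler_pM; rewrite ?powR_ge0 ?(ltW C00)//; first by rewrite -addrA lerDl addr_ge0.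
have hd : l.+2%:R - s <= 1 + l.+2%:R by move: (l.+2%:R : R) => m; lra.
by apply: ge0_ler_powR; rewrite ?nnegrE ?(ltW d0) ?(le_trans ler01 e1) ?(le_trans (ltW d0) hd).
Qed.

End SphereMultiplier.

(** * Conformal invariance of the energy *)

Section Energy.
Context {R : realType} (n : nat).
Hypothesis n0 : (0 < n)%N.
Variable s : R.
Hypothesis s_range : 0 < s < 1 \/ 1 < s < 2.
Local Notation V := 'rV[R]_n.+1.
Local Notation S := (@sphere R n).
Local Notation I := (@sphere_int R n).
Local Notation gam := (n%:R / 2 + s).
Local Notation P l := (Pcoef n gam l).
Local Notation ker_eigen := (ker_eigen n s).
Local Notation ker_op := (ker_op (n := n) s).
Local Notation ker := (ker (n := n) s).
Implicit Types (u v w : V -> R) (a E : R).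

Let s0 : 0 < s. Proof. by case: s_range => /andP[]; lra. Qed.
Let s2 : s < 2. Proof. by case: s_range => /andP[]; lra. Qed.
Let s1 : s != 1. Proof. by apply/eqP; case: s_range => /andP[]; lra. Qed.

Definition energy_sum L u := \sum_(l < L) P l * hsqnorm l u.

(* This expresses a_{2 gamma}(u) <= E: from L = 2 on the partial sums increase, as P 0 and P 1 are the only
   coefficients that can be negative. *)
Definition energy_le u E := forall L, (1 < L)%N -> energy_sum L u <= E.

Lemma energy_sumS L u : energy_sum L.+1 u = energy_sum L u + P L * hsqnorm L u.
Proof. by rewrite /energy_sum big_ord_recr. Qed.

Lemma energy_sum_le L M u : (1 < L <= M)%N -> energy_sum L u <= energy_sum M u.
Proof.
move=> /andP[L1]; elim: M => [|M IH]; first by rewrite leqn0 => /eqP ->.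
rewrite leq_eqVlt => /predU1P[->//|]; rewrite ltnS => LM.
apply: le_trans (IH LM) _; rewrite energy_sumS lerDl mulr_ge0 ?hsqnorm_ge0//.
by rewrite ltW// Pcoef_gt0// (leq_trans L1).
Qed.

Lemma energy_sum_cvg L (U : nat -> V -> R) u : cts u -> (forall N, cts (U N)) -> ucvg U u ->
  (fun N => energy_sum L (U N)) @ \oo --> energy_sum L u.
Proof.
move=> cu cU h; elim: L => [|L IH].
  rewrite /energy_sum (_ : (fun N => _) = fun=> 0); first by rewrite big_ord0; exact: cvg_cst.
  by apply/funext => N; rewrite big_ord0.
under eq_fun do rewrite energy_sumS; rewrite energy_sumS; apply: cvgD => //.
by apply: cvgM; [exact: cvg_cst|exact: hsqnorm_cvg].
Qed.

Lemma energy_le_ucvg (U : nat -> V -> R) (E : nat -> R) u e : cts u -> (forall N, cts (U N)) ->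
  ucvg U u -> (forall N, energy_le (U N) (E N)) -> E @ \oo --> e -> energy_le u e.
Proof.
move=> cu cU h hE ce L L1; have h1 := energy_sum_cvg (L := L) cu cU h.
by apply: (ler_cvg_to h1 ce); apply: nearW => N; exact: hE.
Qed.

Lemma energy_le_mono u E E' : E <= E' -> energy_le u E -> energy_le u E'.
Proof. by move=> h hu L L1; apply: le_trans (hu L L1) h. Qed.

Lemma energy_sum_eq L u v : cts u -> (forall x, S x -> u x = v x) -> energy_sum L u = energy_sum L v.
Proof. by move=> cu h; apply: eq_bigr => l _; rewrite (hsqnorm_eq n0 l cu h). Qed.

Lemma energy_le_eq u v E : cts u -> (forall x, S x -> u x = v x) -> energy_le u E -> energy_le v E.
Proof. by move=> cu h hu L L1; rewrite -(energy_sum_eq L cu h); exact: hu. Qed.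

Lemma energy_sumZ L c u : cts u -> energy_sum L (fun x => c * u x) = c ^+ 2 * energy_sum L u.
Proof. by move=> cu; rewrite mulr_sumr; apply: eq_bigr => l _; rewrite hsqnormZ//; ring. Qed.

Lemma energy_leZ c u E : cts u -> energy_le u E -> energy_le (fun x => c * u x) (c ^+ 2 * E).
Proof. by move=> cu h L L1; rewrite energy_sumZ// ler_wpM2l ?sqr_ge0//; exact: h. Qed.

Lemma energy_le_cst c : energy_le (fun=> c) (P 0 * c ^+ 2 * sphere_vol R n).
Proof.
have v0 := @sphere_vol_gt0 R n => L L1; rewrite /energy_sum -(prednK (ltnW L1)) big_ord_recl big1.
  rewrite addr0 hsqnorm0E//; last exact: cts_cst.
  by rewrite int_cst; rewrite le_eqVlt; apply/orP; left; apply/eqP; field; exact: lt0r_neq0.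
move=> i _; have e : forall l, (0 < l)%N -> hsqnorm l (fun _ : V => c) = 0; last by rewrite e ?mulr0.
move=> l l0; pose h (i : nat) : mpoly.mpoly n.+1 R := if i == 0%N then mpolyC _ c else 0.
rewrite (hsqnorm_poly n0 (N := 1) (h := h)).
- by rewrite ltnS leqn0 gtn_eqF.
- move=> [|k]; rewrite /h /=; last exact: harm0.
  have := @harmZ R n 0 c 1; rewrite -mul_mpolyC mulr1; apply; exact: harm1.
- by move=> x _; rewrite big_ord1 /h /= pevalC.
Qed.

(* The action under which the energy and the integral of u^(-n/s) are invariant. *)
Definition cpull (phi : V -> V) (j : V -> R) u (x : V) : R := j x `^ (- s) * u (phi x).

Variables (phi : V -> V) (j : V -> R).
Hypothesis hphi : cdata phi j.
Local Notation T := (cpull phi j).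

Lemma cts_cpull u : cts u -> cts (T u).
Proof.
move=> cu; apply: ctsM; first exact: cts_powR (cd_jcts hphi) (cd_gt0 hphi).
exact: cts_sphere_comp cu (cd_cts hphi) (cd_sphere hphi).
Qed.

Lemma cpull_ucvg (U : nat -> V -> R) u : ucvg U u -> ucvg (fun N => T (U N)) (T u).
Proof.
have cj : cts (fun x => j x `^ (- s)) by exact: cts_powR (cd_jcts hphi) (cd_gt0 hphi).
have [M M0 hM] := cts_bounded cj.
move=> h e e0; have eM : 0 < e / M by rewrite divr_gt0.
have [N0 hN] := h _ eM; exists N0 => N NN x Sx.
rewrite /cpull -mulrBr normrM -[leRHS](divfK (lt0r_neq0 M0)) mulrC.
by rewrite ler_pM// ?hM// hN//; exact: (cd_sphere hphi).
Qed.

(** The exponents n + s and -s add up to n, the power of j in the change of variables, so this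
    action is dual to [cpull] for the integral pairing. *)
Definition cpull_dual u (x : V) : R := j x `^ (n%:R + s) * u (phi x).

Lemma cts_cpull_dual u : cts u -> cts (cpull_dual u).
Proof.
move=> cu; apply: ctsM; first exact: cts_powR (cd_jcts hphi) (cd_gt0 hphi).
exact: cts_sphere_comp cu (cd_cts hphi) (cd_sphere hphi).
Qed.

Lemma cpull_ker_op u x : cts u -> S x -> T (ker_op u) x = ker_op (cpull_dual u) x.
Proof.
move=> cu Sx; have jx := cd_gt0 hphi Sx; have Spx := cd_sphere hphi Sx.
have ck := ctsM (cts_ker s0 Spx) cu.
rewrite /cpull /ker_op -(cd_int hphi ck) -intZ; last first.
  apply: ctsM; last by apply: ctsX; exact: cd_jcts hphi.
  exact: cts_sphere_comp ck (cd_cts hphi) (cd_sphere hphi).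
apply/esym/int_eq; first by apply: ctsM; [exact: cts_ker|exact: cts_cpull_dual].
move=> y Sy; have jy := cd_gt0 hphi Sy; rewrite /ker /cpull_dual (cd_dot hphi Sx Sy).
have d0 : 0 <= 1 - dotv x y by rewrite subr_ge0 dotv_le1.
rewrite powRM ?mulr_ge0 ?(ltW jx) ?(ltW jy)// powRM ?(ltW jx) ?(ltW jy)//.
rewrite powRD ?(lt0r_neq0 jy) ?implybT// powR_mulrn ?(ltW jy)// powRN.
have := powR_gt0 s jx; set a := j x `^ s => a0; field; exact: lt0r_neq0.
Qed.

Lemma int_cpull_dual u v : cts u -> cts v ->
  I (fun x => cpull_dual u x * T v x) = I (fun x => u x * v x).
Proof.
move=> cu cv; rewrite -(cd_int hphi (ctsM cu cv)); apply: int_eq.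
  by apply: ctsM; [exact: cts_cpull_dual|exact: cts_cpull].
move=> x Sx; have jx := cd_gt0 hphi Sx; rewrite /cpull_dual /cpull.
rewrite powRD ?(lt0r_neq0 jx) ?implybT// powR_mulrn ?(ltW jx)// powRN.
have := powR_gt0 s jx; set a := j x `^ s => a0; field; exact: lt0r_neq0.
Qed.

Lemma Pcoef_ker_eigen_neq0 l : P l = P 0 * ker_eigen 0 / ker_eigen l.
Proof. by rewrite -(@Pcoef_ker_eigen R n s s_range l) mulfK// ker_eigen_neq0. Qed.

(* A polynomial u is ker_op g for a polynomial g, and ker_op intertwines cpull with its dual cpull_dual. *)
Lemma cpull_poly_energy_le u (N : nat) (h : nat -> mpoly.mpoly n.+1 R) : cts u ->
  (forall i, harm_hom i (h i)) ->
  (forall x, S x -> u x = \sum_(i < N) peval (h i) x) ->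
  energy_le (T u) (energy_sum N u).
Proof.
move=> cu hh hu L L1; pose h' i := (ker_eigen i)^-1 *: h i.
have hh' i : harm_hom i (h' i) by exact: harmZ.
pose g x := \sum_(i < N) peval (h' i) x.
have cg : cts g by apply: cts_sum => i _; exact: cts_peval.
have kg x : S x -> ker_op g x = u x.
  move=> Sx; rewrite (ker_op_poly n0 s0 s2 hh' (u := g) (N := N))// hu//.
  by apply: eq_bigr => i _; rewrite pevalZ mulrA divff ?mul1r// ker_eigen_neq0.
have ckg := cts_ker_op s0 s2 cg.
pose g' := cpull_dual g; have cg' : cts g' by exact: cts_cpull_dual.
have Tu x : S x -> ker_op g' x = T u x.
  by move=> Sx; rewrite -cpull_ker_op// /cpull kg//; exact: (cd_sphere hphi).
have cTu := cts_cpull cu; have ckg' := cts_ker_op s0 s2 cg'.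
rewrite -(energy_sum_eq L ckg' Tu).
(* The common value of [Pcoef] times [ker_eigen] has the sign of s - 1, which turns the inequality
   of [ker_op_parseval_le] into an upper bound for the energy in both ranges of s. *)
have k0 : 0 < P 0 * ker_eigen 0 / (s - 1).
  have := @Pcoef0_sign R n s s_range; have := ker_eigen0_gt0 n0 s0 => k0 p0.
  have -> : P 0 * ker_eigen 0 / (s - 1) = P 0 * (s - 1) * ker_eigen 0 / (s - 1) ^+ 2.
    by field; rewrite subr_eq0.
  have h2 : 0 < (s - 1) ^+ 2 by rewrite lt_neqAle eq_sym sqrf_eq0 subr_eq0 s1 sqr_ge0.
  exact: divr_gt0 (mulr_gt0 p0 k0) h2.
apply: (@le_trans _ _ (P 0 * ker_eigen 0 / (s - 1) * ((s - 1) * I (fun x => g' x * ker_op g' x)))).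
  have := ker_op_parseval_le n0 s0 s2 cg' L1; rewrite -(ler_pM2l k0); apply: le_trans.
  rewrite /energy_sum mulr_sumr ler_sum// => l _; rewrite hsqnorm_ker_op// Pcoef_ker_eigen_neq0.
  have kl : ker_eigen l != 0 by exact: ker_eigen_neq0.
  by rewrite le_eqVlt; apply/orP; left; apply/eqP; field; rewrite kl subr_eq0 s1.
have -> : I (fun x => g' x * ker_op g' x) = I (fun x => g x * u x).
  rewrite -(int_cpull_dual cg cu); apply: int_eq; first by apply: ctsM.
  by move=> x Sx; rewrite Tu.
have -> : I (fun x => g x * u x) = \sum_(i < N) (ker_eigen i)^-1 * hsqnorm i u.
  rewrite (_ : I _ = pint ((\sum_(i < N) h' i) * (\sum_(i < N) h i))); last first.
    rewrite pintM; apply: int_eq; first by apply: ctsM.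
    by move=> x Sx; rewrite hu// !peval_sum.
  rewrite mulr_suml pint_sum; apply: eq_bigr => i _.
  rewrite mulr_sumr pint_sum (bigD1 i)//= big1 ?addr0 => [|k ki]; last first.
    by apply: (harm_orth n0 (l := i) (m := k)) => //; rewrite eq_sym.
  by rewrite (hsqnorm_poly n0 i hh hu) ltn_ord -scalerAl pintZ.
rewrite mulrA divfK ?subr_eq0// mulr_sumr ler_sum// => i _.
by rewrite mulrA -Pcoef_ker_eigen_neq0.
Qed.

(** The smoothings of u are polynomials converging uniformly to u. From degree 2 on, smoothing can
    only lower the terms of the energy; the change [d N] of the terms of degree 0 and 1 tends to
    0. *)
Lemma energy_le_cpull u E : cts u -> energy_le u E -> energy_le (T u) E.
Proof.
move=> cu hE; pose U N := zonal_op (delta_poly n N) u.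
have cU N : cts (U N) by exact: cts_zonal_op.
have hU : ucvg U u by exact: zonal_op_delta_poly_ucvg.
pose d N := energy_sum 2 (U N) - energy_sum 2 u.
have cd : (fun N => E + d N) @ \oo --> E.
  have h := cvgD (cvg_cst E) (cvgB (energy_sum_cvg (L := 2) cu cU hU) (cvg_cst (energy_sum 2 u))).
  by rewrite subrr addr0 in h; exact: h.
have hen N : energy_le (U N) (E + d N).
  move=> L L1; have hL := hE L L1; apply: le_trans (_ : energy_sum L u + d N <= _); last by rewrite lerD2r.
  rewrite /d addrA addrAC -lerBlDr; case: L L1 {hL} => [|[|L]]// _.
  elim: L => [|L IH]; first by lra.
  rewrite !(energy_sumS L.+2).
  have : P L.+2 * hsqnorm L.+2 (U N) <= P L.+2 * hsqnorm L.+2 u.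
    by rewrite ler_wpM2l ?hsqnorm_zonal_op_delta_poly_le// ltW// Pcoef_gt0.
  by move: IH; lra.
apply: (energy_le_ucvg (cts_cpull cu) (fun N => cts_cpull (cU N)) (cpull_ucvg hU) _ cd) => N.
have [p hp] := zonal_op_peval (delta_poly n N) cu; have [K [h [h1 h2 h3]]] := poly_decomp p.
have e x : S x -> U N x = \sum_(i < K.+2) peval (h i) x.
  by move=> Sx; rewrite /U hp (h3 K.+2)// leqW.
apply: energy_le_mono (cpull_poly_energy_le (cU N) h1 e); exact: hen.
Qed.

End Energy.

(** * Conformal centering *)

Section Poisson.
Context {R : realType} (n : nat).
Local Notation V := 'rV[R]_n.+1.
Local Notation S := (@sphere R n).
Implicit Types (a b x y z : V).

(* The conformal factor at y of the inversion sending 0 to b, see jac_poisson_factor. *)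
Definition poisson_factor b y : R := (1 - dotv b b) / dotv (y - b) (y - b).

Lemma poisson_factor_den_gt0 b y : dotv b b < 1 -> S y -> 0 < dotv (y - b) (y - b).
Proof.
move=> b1 Sy; apply: dotv_gt0; apply: contraTneq b1 => /eqP; rewrite subr_eq0 => /eqP <-.
by rewrite Sy ltxx.
Qed.

Lemma poisson_factor_gt0 b y : dotv b b < 1 -> S y -> 0 < poisson_factor b y.
Proof. by move=> b1 Sy; rewrite divr_gt0 ?subr_gt0// poisson_factor_den_gt0. Qed.

Lemma cts_poisson_factor b : dotv b b < 1 -> cts (poisson_factor b).
Proof.
move=> b1; apply: ctsZ; apply: cts_inv; first exact: cts_dist2.
by move=> x Sx; rewrite lt0r_neq0// poisson_factor_den_gt0.
Qed.

Lemma poisson_factor0 y : S y -> poisson_factor 0 y = 1.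
Proof. by move=> Sy; rewrite /poisson_factor subr0 Sy dotv0l subr0 divr1. Qed.

Lemma sinv_ball a z : dotv (z - a) (z - a) != 0 ->
  1 - dotv (sinv a z) (sinv a z) = jac a z * (1 - dotv z z).
Proof.
move=> h; rewrite sinvE /jac; move: h; have : z = a + (z - a) by rewrite addrC subrK.
move: (z - a) => d ->; rewrite !dotvE (dotvC d a) => h; field; exact: h.
Qed.

Lemma sinv_ball_den a b : 1 < dotv a a -> dotv b b < 1 -> 0 < dotv (b - a) (b - a).
Proof.
move=> a1 b1; apply: dotv_gt0; rewrite subr_eq0; apply: contraTneq a1 => <-.
by rewrite -leNgt ltW.
Qed.

Lemma sinv_ball_lt1 a b : 1 < dotv a a -> dotv b b < 1 -> dotv (sinv a b) (sinv a b) < 1.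
Proof.
move=> a1 b1; have d := sinv_ball_den a1 b1; rewrite -subr_gt0 sinv_ball ?lt0r_neq0//.
by rewrite mulr_gt0 ?subr_gt0// divr_gt0 ?subr_gt0.
Qed.

Lemma poisson_factor_sinv a b x : 1 < dotv a a -> dotv b b < 1 -> S x ->
  jac a x * poisson_factor b (sinv a x) = poisson_factor (sinv a b) x.
Proof.
move=> a1 b1 Sx; have z1 := sinv_ball_lt1 a1 b1.
have db := sinv_ball_den a1 b1; have dz := sinv_ball_den a1 z1; have dx := sinv_den_gt0 a1 Sx.
have bE : sinv a (sinv a b) = b by rewrite sinvK// lt0r_neq0.
have := sinv_dist (lt0r_neq0 dx) (lt0r_neq0 dz); rewrite bE => h.
have h2 := sinv_ball (lt0r_neq0 dz); rewrite bE in h2.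
have j0 : jac a (sinv a b) != 0 by rewrite lt0r_neq0// divr_gt0 ?subr_gt0.
have jx : jac a x != 0 by rewrite lt0r_neq0// jac_gt0.
have d1 : dotv (x - sinv a b) (x - sinv a b) != 0 by rewrite lt0r_neq0// poisson_factor_den_gt0.
by rewrite /poisson_factor h h2; field; rewrite d1 j0 jx.
Qed.

Lemma sinv_pole a : 1 < dotv a a -> sinv a 0 = (dotv a a)^-1 *: a.
Proof.
move=> a1; have a0 : dotv a a != 0 by rewrite gt_eqF// (lt_trans ltr01).
rewrite /sinv sub0r dotvNl dotvNr opprK scalerN -[X in X - _]scale1r -scalerBl.
by congr (_ *: _); field.
Qed.

Lemma jac_poisson_factor a x : 1 < dotv a a -> S x -> jac a x = poisson_factor (sinv a 0) x.
Proof.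
move=> a1 Sx; rewrite -poisson_factor_sinv ?dotv0l ?ltr01// poisson_factor0 ?mulr1//; exact: sphere_sinv.
Qed.

Lemma sinv_pole_onto b : b != 0 -> dotv b b < 1 -> exists2 a, 1 < dotv a a & sinv a 0 = b.
Proof.
move=> b0 b1; have bb := dotv_gt0 b0.
have e : dotv ((dotv b b)^-1 *: b) ((dotv b b)^-1 *: b) = (dotv b b)^-1.
  by rewrite dotvZl dotvZr; field; rewrite gt_eqF.
have a1 : 1 < dotv ((dotv b b)^-1 *: b) ((dotv b b)^-1 *: b) by rewrite e invf_gt1.
exists ((dotv b b)^-1 *: b) => //.
by rewrite sinv_pole// e invrK scalerA divff ?scale1r// gt_eqF.
Qed.

End Poisson.

Section Centering.
Context {R : realType} (n : nat).
Hypothesis n0 : (0 < n)%N.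
Variable s : R.
Hypothesis s0 : 0 < s.
Local Notation V := 'rV[R]_n.+1.
Local Notation S := (@sphere R n).
Local Notation I := (@sphere_int R n).
Local Notation p := (n%:R + s).
Implicit Types (u v w : V -> R) (a b x y z : V).

Let p1 : 1 <= p.
Proof. by have h := s0; have : 1 <= n%:R :> R by [rewrite ler1n]; lra. Qed.

(** The exponent n + s is that of [cpull_dual]; it makes this function of b equivariant under
    inversions, see [poisson_int_cpull]. *)
Definition poisson_int u b : R := I (fun y => u y * poisson_factor b y `^ p).

Lemma cts_poisson_int u b : cts u -> dotv b b < 1 -> cts (fun y => u y * poisson_factor b y `^ p).
Proof.
move=> cu b1; apply: ctsM => //; apply: cts_powR; first exact: cts_poisson_factor.
by move=> x; exact: poisson_factor_gt0.
Qed.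

Lemma poisson_int0 u : cts u -> poisson_int u 0 = I u.
Proof.
move=> cu; apply/esym/int_eq => // x Sx; rewrite poisson_factor0// powR1 mulr1//.
Qed.

Lemma jac_sinv a x : 1 < dotv a a -> S x -> jac a (sinv a x) * jac a x = 1.
Proof.
move=> a1 Sx; have d0 := lt0r_neq0 (sinv_den_gt0 a1 Sx).
have e : sinv a x - a = jac a x *: (x - a) by rewrite sinvE addrC addKr.
rewrite {1}/jac e dotvZl dotvZr /jac; field.
by rewrite d0 lt0r_neq0// subr_gt0.
Qed.

Lemma poisson_int_cpull u a b : cts u -> 1 < dotv a a -> dotv b b < 1 ->
  poisson_int (cpull s (sinv a) (jac a) u) b = poisson_int u (sinv a b).
Proof.
move=> cu a1 b1; have hc := cdata_sinv n0 a1.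
have cT := cts_cpull s hc cu.
rewrite /poisson_int -(cd_int hc (cts_poisson_int cT b1)); apply/esym/int_eq.
  by apply: cts_poisson_int => //; exact: sinv_ball_lt1.
move=> x Sx; have jx := jac_gt0 a1 Sx; have Sx' := sphere_sinv a1 Sx.
rewrite /cpull sinvK ?lt0r_neq0 ?sinv_den_gt0// -poisson_factor_sinv// powRM ?ltW ?poisson_factor_gt0//.
have -> : jac a (sinv a x) `^ (- s) = jac a x `^ s.
  have -> : jac a (sinv a x) = (jac a x)^-1.
    by apply: (mulIf (lt0r_neq0 jx)); rewrite jac_sinv// mulVf// lt0r_neq0.
  by rewrite -powR_inv1 ?(ltW jx)// -powRrM mulN1r opprK.
rewrite powRD ?(lt0r_neq0 jx) ?implybT// powR_mulrn ?(ltW jx)//; ring.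
Qed.

(* Antipodal points: |x - b|^2 + |x + b|^2 >= 2, so one of the two distances is at least 1. *)
Lemma poisson_int1_lower b : dotv b b < 1 ->
  (1 - dotv b b) `^ (- s) * (sphere_vol R n / 2) <= poisson_int (fun=> 1) b.
Proof.
move=> b1; have v0 := sphere_vol_gt0 (R := R) n; have B0 := dotv_ge0 b.
have [->|bN0] := eqVneq b 0.
  rewrite poisson_int0; last exact: cts_cst.
  by rewrite dotv0l subr0 powR1 mul1r -/(sphere_vol R n); lra.
have [a a1 ab] := sinv_pole_onto bN0 b1; have hc := cdata_sinv n0 a1.
have N0 : 0 < 1 - dotv b b by rewrite subr_gt0.
have cN : cts (fun x => dotv (x - b) (x - b) `^ s).
  by apply: cts_powR; [exact: cts_dist2|move=> x; exact: poisson_factor_den_gt0].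
have cN' : cts (fun x => dotv (- x - b) (- x - b) `^ s).
  apply: (@cts_eq _ _ _ (fun x => dotv (x - (- b)) (x - (- b)) `^ s)).
    by move=> x _; rewrite opprK -opprD dotvNl dotvNr opprK.
  apply: cts_powR; first exact: cts_dist2.
  by move=> x; apply: poisson_factor_den_gt0; rewrite dotvNl dotvNr opprK.
(* The change of variables by the inversion sending 0 to b replaces the exponent n + s by -s, which
   puts the distance to b in the numerator. *)
have e : poisson_int (fun=> 1) b = (1 - dotv b b) `^ (- s) * I (fun x => dotv (x - b) (x - b) `^ s).
  have cj : cts (fun x => jac a x `^ (- s)).
    by apply: cts_powR; [exact: cts_jac|move=> x; exact: jac_gt0].
  rewrite -intZ// -[RHS](_ : I (fun x => jac a x `^ (- s)) = _); last first.
    apply: int_eq => // x Sx; have d0 := poisson_factor_den_gt0 b1 Sx.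
    rewrite jac_poisson_factor// ab /poisson_factor powRM ?invr_ge0 ?ltW//; congr (_ * _).
    by rewrite -powR_inv1 ?ltW// -powRrM mulN1r opprK.
  rewrite -(cd_int hc cj); apply: int_eq.
    by apply: cts_poisson_int => //; exact: cts_cst.
  move=> x Sx; have jx := jac_gt0 a1 Sx; rewrite mul1r -ab -jac_poisson_factor//.
  have -> : jac a (sinv a x) = (jac a x)^-1.
    by apply: (mulIf (lt0r_neq0 jx)); rewrite jac_sinv// mulVf// lt0r_neq0.
  rewrite -powR_inv1 ?(ltW jx)// -powRrM mulN1r opprK mulrC.
  by rewrite powRD ?(lt0r_neq0 jx) ?implybT// powR_mulrn ?(ltW jx).
rewrite e ler_wpM2l ?powR_ge0//.
have e2 : I (fun x => dotv (- x - b) (- x - b) `^ s) = I (fun x => dotv (x - b) (x - b) `^ s).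
  apply: (int_isometry n0 (A := fun x : V => - x) (B := fun x : V => - x)) => //.
  - by apply: ctsT => x; exact: opp_continuous.
  - by move=> x; exact: sphereN.
  - by move=> x; exact: sphereN.
  - by move=> x y; rewrite dotvNl dotvNr.
rewrite ler_pdivrMr// mulr_natr mulr2n -{2}e2 -intD// -[leLHS]mul1r -int_cst.
apply: int_le; [exact: cts_cst|exact: ctsD|].
move=> x Sx; have sum2 : 2 <= dotv (x - b) (x - b) + dotv (- x - b) (- x - b).
  by rewrite !dotvE Sx (dotvC b x); move: B0; lra.
have ge1 c : 1 <= c -> 1 <= c `^ s.
  by move=> c1; have := @ler_powR _ c c1 0 s; rewrite powRr0; apply; exact: ltW.
have [h|h] := lerP 1 (dotv (x - b) (x - b)).
  by rewrite ler_wpDr ?powR_ge0// ge1.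
rewrite ler_wpDl ?powR_ge0// ge1//; move: sum2 h; lra.
Qed.

Lemma poisson_factor_continuous b y : dotv b b < 1 -> S y ->
  (fun z : V * V => poisson_factor z.1 z.2 `^ p) @ nbhs (b, y) --> poisson_factor b y `^ p.
Proof.
move=> b1 Sy.
have c1 : continuous (fun z : V * V => z.1) by move=> z; exact: cvg_fst.
have c2 : continuous (fun z : V * V => z.2) by move=> z; exact: cvg_snd.
have c21 : continuous (fun z : V * V => z.2 - z.1).
  by move=> z; exact: (cvgB (c2 z) (c1 z)).
have h1 := dotv_continuous c1 c1; have h2 := dotv_continuous c21 c21.
have d0 : dotv (y - b) (y - b) != 0 by rewrite lt0r_neq0// poisson_factor_den_gt0.
have h3 : (fun z : V * V => poisson_factor z.1 z.2) @ nbhs (b, y) --> poisson_factor b y.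
  apply: (@cvgM _ _ (nbhs (b, y)) _ (fun z : V * V => 1 - dotv z.1 z.1) (fun z : V * V => (dotv (z.2 - z.1) (z.2 - z.1))^-1)).
    by apply: cvgB; [exact: cvg_cst|exact: (h1 (b, y))].
  by apply: cvgV => //; exact: (h2 (b, y)).
have h4 := continuous_powRl (p := p) (poisson_factor_gt0 b1 Sy).
exact: (cvg_comp _ _ h3 h4).
Qed.

Lemma poisson_int_continuous u b : cts u -> dotv b b < 1 -> {for b, continuous (poisson_int u)}.
Proof.
move=> cu b1; have v0 := sphere_vol_gt0 (R := R) n; have [M M0 hM] := cts_bounded cu.
apply/(@cvgrPdist_le _ _ _ (nbhs b)) => e e0.
have e1 : 0 < e / (M * sphere_vol R n) by rewrite divr_gt0// mulr_gt0.
have nb1 : \forall z \near b, dotv z z < 1.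
  have c : {for b, continuous (fun z : V => dotv z z)}.
    by apply: dotv_continuous => z; exact: cvg_id.
  exact: (c _ (lt_nbhsl b1)).
have cov : \forall z \near b, S `<=` (fun y => `|poisson_factor z y `^ p - poisson_factor b y `^ p| <= e / (M * sphere_vol R n)).
  have := @sphere_compact R n => /compact_near_coveringP/(_ V (nbhs b)
    (fun z y => `|poisson_factor z y `^ p - poisson_factor b y `^ p| <= e / (M * sphere_vol R n)) _); apply => y Sy.
  have e2 : 0 < e / (M * sphere_vol R n) / 2 by rewrite divr_gt0.
  have h1 := poisson_factor_continuous b1 Sy; move/cvgrPdist_le : h1 => /(_ _ e2) [[A B] /= [hA hB] hAB].
  exists (B, A) => //= -[y' z] /= [hy hz].
  have k1 := hAB (z, y') (conj hz hy); have k2 := hAB (b, y') (conj (nbhs_singleton hA) hy).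
  move: k1 k2 => /=; move: (poisson_factor b y `^ p) (poisson_factor z y' `^ p) (poisson_factor b y' `^ p) (e / _) => c1 c2 c3 c.
  by rewrite !ler_norml => /andP[? ?] /andP[? ?]; apply/andP; split; lra.
near=> z; have z1 : dotv z z < 1 by near: z.
have hz : S `<=` (fun y => `|poisson_factor z y `^ p - poisson_factor b y `^ p| <= e / (M * sphere_vol R n)) by near: z.
rewrite /poisson_int distrC -intB; [|exact: cts_poisson_int..].
apply: le_trans (int_norm _) _; first by apply: ctsB; exact: cts_poisson_int.
have -> : e = (M * (e / (M * sphere_vol R n))) * sphere_vol R n.
  by field; rewrite !gt_eqF.
rewrite -int_cst; apply: int_le; [|exact: cts_cst|].
  by apply: cts_norm; apply: ctsB; exact: cts_poisson_int.
by move=> x Sx; rewrite -mulrBr normrM ler_pM//; [exact: hM|exact: hz].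
Unshelve. all: by end_near. Qed.

Lemma sqball_compact r : compact [set b : V | dotv b b <= r].
Proof.
apply: bounded_closed_compact; last first.
  rewrite (_ : mkset _ = (fun x : V => dotv x x) @^-1` [set t | t <= r])//.
  apply: preimage_closed; last exact: closed_le.
  by move=> x _; apply: dotv_continuous => y; exact: cvg_id.
exists (1 + r); split; first exact: num_real.
move=> M M1 x /= xr; have xr' := xr; rewrite -(@ler_pXn2r _ 2)// ?nnegrE//; last first.
  by have := dotv_ge0 x; move: xr M1; lra.
apply: le_trans (norm2_le_dotv x) _; apply: le_trans xr _.
have : 0 <= r by exact: le_trans (dotv_ge0 x) xr'.
by move: M1; nra.
Qed.

Lemma poisson_int_min u : cts u -> (forall x, S x -> 0 < u x) ->
  exists2 b0, dotv b0 b0 < 1 & forall b, dotv b b < 1 -> poisson_int u b0 <= poisson_int u b.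
Proof.
move=> cu u0; have v0 := sphere_vol_gt0 (R := R) n; have [m m0 hm] := cts_gt0_min cu u0.
have Iu : 0 <= I u by apply: int_ge0 => // x Sx; rewrite ltW// u0.
(* With this K, the lower bound of [poisson_int1_lower] times the minimum m of u is at least [I u],
   the value at 0, as soon as (1 - |b|^2)^(-s) >= K, that is for |b|^2 >= r. The summand 1 ensures r
   >= 0, so that 0 lies in the compact ball. *)
pose K := 2 * I u / (m * sphere_vol R n) + 1.
have K0 : 0 < K by rewrite ltr_wpDl// divr_ge0 ?mulr_ge0// ltW// mulr_gt0.
have K1 : 1 <= K by rewrite lerDr divr_ge0 ?mulr_ge0// ltW// mulr_gt0.
pose r := 1 - K `^ (- s^-1).
have kp : 0 < K `^ (- s^-1) by rewrite powR_gt0.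
have r1 : r < 1 by rewrite ltrBlDr ltrDl.
have r0 : 0 <= r.
  have si : - s^-1 <= 0 by rewrite oppr_le0 invr_ge0 ltW.
  by rewrite subr_ge0; have := @ler_powR _ K K1 _ _ si; rewrite powRr0.
have big b : dotv b b < 1 -> r < dotv b b -> poisson_int u 0 <= poisson_int u b.
  move=> b1 br; have N0 : 0 < 1 - dotv b b by rewrite subr_gt0.
  have h1 : K <= (1 - dotv b b) `^ (- s).
    have e : 1 - dotv b b <= K `^ (- s^-1) by move: br; rewrite /r; lra.
    rewrite powRN -(invrK K) lef_pV2 ?posrE ?invr_gt0 ?powR_gt0//.
    have -> : K^-1 = (K `^ (- s^-1)) `^ s.
      by rewrite -powRrM mulNr mulVf ?gt_eqF// powR_inv1// ltW.
    by apply: ge0_ler_powR; rewrite ?nnegrE ?(ltW s0) ?(ltW N0) ?(ltW kp).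
  have h2 := poisson_int1_lower b1.
  have h3 : m * poisson_int (fun=> 1) b <= poisson_int u b.
    have cw := cts_poisson_int (cts_cst (1 : R)) b1.
    rewrite -intZ//; apply: int_le; [exact: ctsZ|exact: cts_poisson_int|] => x Sx.
    by rewrite mulrA mulr1 ler_wpM2r ?powR_ge0// hm.
  rewrite poisson_int0//; apply: le_trans h3; rewrite -ler_pdivrMl//; apply: le_trans h2.
  apply: le_trans (_ : K * (sphere_vol R n / 2) <= _); last first.
    by rewrite ler_wpM2r// divr_ge0// ltW.
  rewrite /K mulrDl; rewrite [X in X + _](_ : _ = m^-1 * I u); last first.
    by field; rewrite !gt_eqF.
  by rewrite lerDl mul1r divr_ge0// ltW.
pose B := [set b : V | dotv b b <= r].
have B0 : B !=set0 by exists 0; rewrite /B /= dotv0l.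
have cB : {within B, continuous (poisson_int u)}.
  apply/continuous_withinP => b Bb; apply: cvg_within_filter.
  by apply: poisson_int_continuous => //; exact: le_lt_trans Bb r1.
have [b0 /set_mem Bb hmin] := EVT_min_rV B0 (@sqball_compact r) cB.
exists b0 => [|b b1]; first exact: le_lt_trans Bb r1.
have [h|h] := lerP (dotv b b) r; first by apply: hmin; exact: mem_set.
by apply: le_trans (big b b1 h); apply: hmin; apply: mem_set; rewrite /B /= dotv0l.
Qed.

(* The normalization of Hersch's trick: by minimality at b = 0, such a u is orthogonal to the coordinates. *)
Definition centered u := forall b, dotv b b < 1 -> poisson_int u 0 <= poisson_int u b.

(** The map is the identity or an inversion, hence an involution; this is recorded so that the
    normalization can be undone by [cpullK]. *)
Lemma exists_centered u : cts u -> (forall x, S x -> 0 < u x) ->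
  exists phi j, [/\ conformal n phi, cdata phi j, forall x, S x -> phi (phi x) = x /\ j (phi x) * j x = 1 &
    centered (cpull s phi j u)].
Proof.
move=> cu u0; have [b0 b1 hmin] := poisson_int_min cu u0.
have [b00|bN0] := eqVneq b0 0.
  exists id, (fun=> 1); split; [exact: conf_id|exact: cdata_id|by move=> x _; rewrite mulr1|].
  rewrite (_ : cpull _ _ _ u = u); last by apply/funext => x; rewrite /cpull powR1 mul1r.
  by move=> b; rewrite -b00; exact: hmin.
have [a a1 ab] := sinv_pole_onto bN0 b1.
exists (sinv a), (jac a); split; first exact: (conf_inv a1 (conf_id _ _)).
- exact: cdata_sinv.
- by move=> x Sx; rewrite sinvK ?lt0r_neq0 ?sinv_den_gt0// jac_sinv.
have h0 : dotv (0 : V) 0 < 1 by rewrite dotv0l.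
move=> b bb1; rewrite (poisson_int_cpull cu a1 h0) (poisson_int_cpull cu a1 bb1) ab; apply: hmin.
exact: sinv_ball_lt1.
Qed.

(** An upper expansion suffices for a minimum at b = 0. Bernoulli's inequality is applied to the
    reciprocal r of the factor, giving r^p >= 1 + e, and (1 + e)^(-1) <= 1 - e + 2 e^2. The
    constants 16 are generous and keep |e| <= 1/4. *)
Lemma poisson_factor_powR_upper x i (t : R) : S x -> `|t| <= (16 * p)^-1 ->
  poisson_factor (t *: delta_mx ord0 i) x `^ p <= 1 + 2 * p * t * x ord0 i + 16 * p ^+ 2 * t ^+ 2.
Proof.
move=> Sx ht; have p0 : 0 < p by exact: lt_le_trans p1.
have [y1 y2] : x ord0 i <= 1 /\ -1 <= x ord0 i.
  have := le_trans (ler_coord_norm x i) (sphere_norm_le1 Sx).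
  by rewrite ler_norml => /andP[].
have xd : dotv x (delta_mx ord0 i) = x ord0 i.
  rewrite /dotv (bigD1 i)//= big1 ?addr0 ?mxE ?eqxx ?mulr1// => k ki.
  by rewrite mxE (negbTE ki) andbF mulr0.
rewrite /poisson_factor dist2_expand Sx !dotvE xd (sphere_delta i) mulr1 -expr2.
move: (x ord0 i) y1 y2 => y y1 y2.
have pt : p * `|t| <= 16^-1 by move: ht; rewrite -[(16 * p)^-1]mul1r ler_pdivlMr ?mulr_gt0// => h; rewrite -(ler_pM2l (ltr0n R 16)) mulfV ?pnatr_eq0//; move: h; lra.
have t16 : `|t| <= 16^-1.
  by apply: le_trans pt; rewrite ler_peMl.
have [t1 t2] : t <= 16^-1 /\ - 16^-1 <= t by move: t16; rewrite ler_norml => /andP[].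
have ty : t * y <= 1 by nra.
have d1 : 0 < 1 - t ^+ 2 by nra.
have d2 : 0 < 1 - 2 * (t * y) + t ^+ 2 by nra.
pose r := (1 - 2 * (t * y) + t ^+ 2) / (1 - t ^+ 2).
have r0 : 0 < r by rewrite divr_gt0.
have -> : (1 - t ^+ 2) / (1 - 2 * (t * y) + t ^+ 2) = r^-1 by rewrite /r invf_div.
rewrite -powR_inv1 ?(ltW r0)// -powRrM mulN1r powRN.
have tan := powR_ge_tangent r0 p1.
pose e := p * (r - 1).
have ee : e = p * (2 * t * (t - y) / (1 - t ^+ 2)).
  by rewrite /e /r; field; exact: lt0r_neq0.
have eu : - e <= 2 * p * t * y.
  have -> : - e = 2 * p * t * y - 2 * p * t ^+ 2 * (1 - t * y) / (1 - t ^+ 2).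
    by rewrite ee; field; exact: lt0r_neq0.
  rewrite gerBl divr_ge0 ?(ltW d1)//; apply: mulr_ge0; last by rewrite subr_ge0.
  by apply: mulr_ge0 (sqr_ge0 t); rewrite mulr_ge0// ltW.
have e2 : e ^+ 2 <= 8 * p ^+ 2 * t ^+ 2.
  have -> : e ^+ 2 = p ^+ 2 * t ^+ 2 * ((2 * (t - y)) ^+ 2 / (1 - t ^+ 2) ^+ 2).
    by rewrite ee; field; exact: lt0r_neq0.
  rewrite [leRHS](_ : _ = p ^+ 2 * t ^+ 2 * 8); last by ring.
  apply: ler_wpM2l; first exact: mulr_ge0 (sqr_ge0 p) (sqr_ge0 t).
  rewrite ler_pdivrMr ?exprn_gt0//.
  have k1 : 0 <= (17 / 16 - (t - y)) * (17 / 16 + (t - y)) by apply: mulr_ge0; lra.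
  have k2 : 0 <= (16^-1 - t) * (16^-1 + t) by apply: mulr_ge0; lra.
  have k3 := sqr_ge0 (t ^+ 2); move: k1 k2 k3; rewrite !expr2; nra.
have e3 : e ^+ 2 <= 4^-1 ^+ 2.
  apply: le_trans e2 _; have : (p * `|t|) ^+ 2 <= 16^-1 ^+ 2.
    by rewrite ler_sqr ?nnegrE ?mulr_ge0 ?(ltW p0).
  by rewrite exprMn real_normK ?num_real//; lra.
have e4 : - 4^-1 <= e.
  have : `|e| <= 4^-1 by rewrite -ler_sqr ?nnegrE// real_normK ?num_real.
  by rewrite ler_norml => /andP[].
have e5 : 0 < 1 + e by lra.
apply: le_trans (_ : (1 + e)^-1 <= _).
  by rewrite lef_pV2 ?posrE ?powR_gt0.
apply: le_trans (_ : 1 - e + 2 * e ^+ 2 <= _); last by lra.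
rewrite -[leLHS]mul1r ler_pdivrMr//; clearbody e; nra.
Qed.

Lemma centered_orth v i : cts v -> (forall x, S x -> 0 <= v x) -> centered v ->
  I (fun x => v x * x ord0 i) = 0.
Proof.
move=> cv v0 hv; have p0 : 0 < p by exact: lt_le_trans p1.
have cvx : cts (fun x => v x * x ord0 i) by apply: ctsM => //; exact: cts_coord.
have Iv : 0 <= I v by exact: int_ge0.
set A := I _; pose C := 16 * p ^+ 2 * I v.
have C0 : 0 <= C by rewrite mulr_ge0// mulr_ge0 ?sqr_ge0.
have key (t : R) : `|t| <= (16 * p)^-1 -> 0 <= 2 * p * t * A + C * t ^+ 2.
  move=> ht; have t16 : `|t| <= 16^-1.
    by apply: le_trans ht _; rewrite lef_pV2 ?posrE ?mulr_gt0// ler_peMr.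
  have tb : dotv (t *: delta_mx ord0 i : V) (t *: delta_mx ord0 i) < 1.
    rewrite !dotvE (sphere_delta i) mulr1 -expr2 -real_normK ?num_real//.
    by move: t16 (normr_ge0 t); nra.
  have := hv _ tb; rewrite poisson_int0//.
  have -> : 2 * p * t * A + C * t ^+ 2 = I (fun x => v x + 2 * p * t * (v x * x ord0 i) + 16 * p ^+ 2 * t ^+ 2 * v x) - I v.
    rewrite intD; [|by apply: ctsD => //; exact: ctsZ|exact: ctsZ].
    rewrite intD//; last exact: ctsZ.
    by rewrite (intZ _ cvx) (intZ _ cv) -/A /C; ring.
  rewrite subr_ge0 => h; apply: le_trans h _; apply: int_le; first exact: cts_poisson_int.
    by apply: ctsD; [apply: ctsD => //; exact: ctsZ|exact: ctsZ].
  move=> x Sx; apply: le_trans (ler_wpM2l (v0 x Sx) (poisson_factor_powR_upper i Sx ht)) _.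
  by rewrite le_eqVlt; apply/orP; left; apply/eqP; ring.
apply/eqP; apply: contraT => A0.
(* A displacement t = -A e against the sign of A, with e so small that t is allowed in [key] and
   that the first-order term outweighs the quadratic one. *)
pose e := ((16 * p) * `|A| + C + 1)^-1.
have d0 : 0 < (16 * p) * `|A| + C + 1.
  by rewrite ltr_wpDl// addr_ge0// !mulr_ge0// ltW.
have e0 : 0 < e by rewrite invr_gt0.
have := key (- A * e).
have h1 : `|- A * e| <= (16 * p)^-1.
  rewrite normrM normrN (gtr0_norm e0) -ler_pdivlMl ?normr_gt0//.
  rewrite -invfM /e lef_pV2 ?posrE ?mulr_gt0 ?normr_gt0//; lra.
have h2 : C * e < 1.
  by rewrite /e ltr_pdivrMr// mul1r; have := mulr_ge0 (ltW (mulr_gt0 (ltr0n R 16) p0)) (normr_ge0 A); lra.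
move=> /(_ h1); have -> : 2 * p * (- A * e) * A + C * (- A * e) ^+ 2 = - (A ^+ 2 * e * (2 * p - C * e)) by ring.
have A2 : 0 < A ^+ 2 by rewrite lt_neqAle eq_sym sqrf_eq0 A0 sqr_ge0.
have p1' := p1; have k : 0 < 2 * p - C * e by lra.
by rewrite oppr_ge0 leNgt (mulr_gt0 (mulr_gt0 A2 e0) k).
Qed.

End Centering.

(** * The mean of a negative power and the extremal functions *)

Section QMean.
Context {R : realType} (n : nat).
Hypothesis n0 : (0 < n)%N.
Variable s : R.
Hypothesis s_range : 0 < s < 1 \/ 1 < s < 2.
Local Notation V := 'rV[R]_n.+1.
Local Notation S := (@sphere R n).
Local Notation I := (@sphere_int R n).
Local Notation vol := (sphere_vol R n).
Local Notation gam := (n%:R / 2 + s).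
Local Notation P l := (Pcoef n gam l).
Local Notation q := (n%:R / s).
Local Notation cpull := (cpull (n := n) s).
Local Notation energy_le := (energy_le (n := n) s).
Implicit Types (u v w : V -> R) (c E : R).

Let s0 : 0 < s. Proof. by case: s_range => /andP[]; lra. Qed.
Let nR0 : 0 < n%:R :> R. Proof. by rewrite ltr0n. Qed.
Let v0 : 0 < vol. Proof. exact: sphere_vol_gt0. Qed.
Let q0 : 0 < q. Proof. by rewrite divr_gt0. Qed.

Definition neg_mean u : R := I (fun x => u x `^ (- q)) / vol.

(** The right-hand side of the theorem, with the volume absorbed into the mean, see [sharp_boundE].
    In this form its invariance under [cpull] is that of [neg_mean]. *)
Definition sharp_bound u : R := P 0 * vol * neg_mean u `^ (- 2 / q).

Lemma cts_powRN u (p : R) : cts u -> (forall x, S x -> 0 < u x) -> cts (fun x => u x `^ p).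
Proof. by move=> cu u0; apply: cts_powR. Qed.

Lemma neg_mean_gt0 u : cts u -> (forall x, S x -> 0 < u x) -> 0 < neg_mean u.
Proof.
move=> cu u0; have cp := cts_powRN (- q) cu u0.
have [|m m0 hm] := cts_gt0_min cp; first by move=> x Sx; rewrite powR_gt0// u0.
rewrite divr_gt0//; apply: lt_le_trans (_ : m * vol <= _); first by rewrite mulr_gt0.
by rewrite -int_cst; apply: int_le => //; exact: cts_cst.
Qed.

Lemma neg_mean_eq u v : cts u -> (forall x, S x -> 0 < u x) -> (forall x, S x -> u x = v x) -> neg_mean u = neg_mean v.
Proof.
move=> cu u0 uv; congr (_ / _); apply: int_eq; first exact: cts_powRN.
by move=> x Sx; rewrite uv.
Qed.

Lemma neg_meanZ c u : 0 < c -> cts u -> (forall x, S x -> 0 < u x) ->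
  neg_mean (fun x => c * u x) = c `^ (- q) * neg_mean u.
Proof.
move=> c0 cu u0; rewrite /neg_mean mulrA -intZ; last exact: cts_powRN.
congr (_ / _); apply: int_eq.
  apply: cts_powRN; first exact: ctsZ.
  by move=> x Sx; rewrite mulr_gt0// u0.
by move=> x Sx; rewrite powRM// ltW// u0.
Qed.

Lemma neg_mean_cst c : neg_mean (fun=> c) = c `^ (- q).
Proof. by rewrite /neg_mean int_cst mulfK// gt_eqF. Qed.

Lemma powR_qK c : 0 < c -> (c `^ (- q)) `^ (- 2 / q) = c ^+ 2.
Proof.
move=> c0; rewrite -powRrM -[RHS](powR_mulrn _ (ltW c0)); congr powR.
by field; rewrite !gt_eqF.
Qed.

Lemma cpull_gt0 phi j u : cdata phi j -> (forall x, S x -> 0 < u x) ->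
  forall x, S x -> 0 < cpull phi j u x.
Proof.
by move=> h u0 x Sx; rewrite mulr_gt0 ?powR_gt0 ?(cd_gt0 h)// u0//; exact: (cd_sphere h).
Qed.

Lemma neg_mean_cpull phi j u : cdata phi j -> cts u -> (forall x, S x -> 0 < u x) ->
  neg_mean (cpull phi j u) = neg_mean u.
Proof.
move=> h cu u0; congr (_ / _); have cp := cts_powRN (- q) cu u0.
rewrite -[RHS](cd_int h cp); apply: int_eq.
  by apply: cts_powRN; [exact: cts_cpull|exact: cpull_gt0].
move=> x Sx; have jx := cd_gt0 h Sx; have ux := u0 _ (cd_sphere h Sx).
rewrite /cpull powRM ?powR_ge0 ?(ltW ux)// -powRrM mulrNN mulrC; congr (_ * _).
by rewrite -[RHS](powR_mulrn _ (ltW jx)); congr powR; field; rewrite gt_eqF.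
Qed.

Lemma sharp_bound_cpull phi j u : cdata phi j -> cts u -> (forall x, S x -> 0 < u x) ->
  sharp_bound (cpull phi j u) = sharp_bound u.
Proof. by move=> h cu u0; rewrite /sharp_bound neg_mean_cpull. Qed.

Lemma cpullK phi j u : cdata phi j -> (forall x, S x -> phi (phi x) = x /\ j (phi x) * j x = 1) ->
  forall x, S x -> cpull phi j (cpull phi j u) x = u x.
Proof.
move=> h inv x Sx; have [e1 e2] := inv x Sx; rewrite /cpull e1 mulrA -powRM; last 2 first.
- exact/ltW/(cd_gt0 h).
- exact/ltW/(cd_gt0 h)/(cd_sphere h).
by rewrite mulrC [j x * _]mulrC e2 powR1 mulr1.
Qed.

(** Jensen's inequality for the convex function t^(-q), through its tangent at the mean. *)
Lemma neg_mean_jensen u : cts u -> (forall x, S x -> 0 < u x) -> 0 < I u ->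
  neg_mean u `^ (- 2 / q) <= (I u / vol) ^+ 2.
Proof.
move=> cu u0 Iu; set m := I u / vol; have m0 : 0 < m by rewrite divr_gt0.
have qm : m `^ (- q) <= neg_mean u.
  have cp := cts_powRN (- q) cu u0.
  have cl : cts (fun x => m `^ (- q) * (1 + - q * (m^-1 * u x - 1))).
    apply: ctsZ; apply: ctsD; first exact: cts_cst.
    by apply: ctsZ; apply: ctsB; [exact: ctsZ|exact: cts_cst].
  rewrite /neg_mean ler_pdivlMr//; apply: le_trans (_ : I (fun x => m `^ (- q) * (1 + - q * (m^-1 * u x - 1))) <= _).
    rewrite (_ : (fun x => _) = (fun x => m `^ (- q) * (1 + q) + (m `^ (- q) * - q * m^-1) * u x)); last first.
      by apply/funext => x; ring.
    rewrite intDZ//; last exact: cts_cst.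
    by rewrite int_cst le_eqVlt; apply/orP; left; apply/eqP; rewrite /m; field; rewrite !gt_eqF.
  apply: int_le => // x Sx; have ux := u0 x Sx.
  have := @powR_ge_tangent_neg R (m^-1 * u x) (- q) (mulr_gt0 _ ux) _.
  rewrite invr_gt0 oppr_le0 => /(_ m0 (ltW q0)) t.
  apply: le_trans (ler_wpM2l (powR_ge0 _ _) t) _.
  have mu0 : 0 <= m^-1 * u x by rewrite mulr_ge0 ?invr_ge0 ?ltW.
  by rewrite -(powRM _ (ltW m0) mu0) mulrA divff ?mul1r// gt_eqF.
rewrite -(powR_qK m0).
have p2 : 2 / q = - (- 2 / q) by rewrite mulNr opprK.
rewrite -[- 2 / q]opprK -p2 2!powRN lef_pV2 ?posrE ?powR_gt0 ?neg_mean_gt0//.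
by apply: ge0_ler_powR; rewrite ?nnegrE ?powR_ge0 ?(ltW (neg_mean_gt0 cu u0))// ltW// divr_gt0.
Qed.

(** Such a u is the image of the constant c under the conformal action, and for constants the energy
    equals the bound. *)
Lemma energy_le_extremal phi j u c : cdata phi j -> 0 < c -> cts u ->
  (forall x, S x -> u x = c * j x `^ (- s)) -> energy_le u (sharp_bound u).
Proof.
move=> h c0 cu hu; have cc := cts_cst c : cts (fun _ : V => c).
have cpos (x : V) : S x -> 0 < (fun=> c) x by [].
have e x : S x -> cpull phi j (fun=> c) x = u x by move=> Sx; rewrite /cpull hu// mulrC.
have cT := cts_cpull s h cc.
have -> : sharp_bound u = sharp_bound (fun=> c).
  by rewrite -(sharp_bound_cpull h cc cpos) /sharp_bound (neg_mean_eq cT _ e)//; exact: cpull_gt0.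
apply: (energy_le_eq n0 cT e); apply: energy_le_cpull => //.
rewrite /sharp_bound neg_mean_cst powR_qK// -mulrA [vol * _]mulrC mulrA; exact: energy_le_cst.
Qed.

Definition extremal u := exists phi j c, [/\ conformal n phi, cdata phi j, 0 < c &
  forall x, S x -> u x = c * j x `^ (- s)].

Lemma cpull_const_extremal phi j u c : conformal n phi -> cdata phi j -> 0 < c ->
  (forall x, S x -> phi (phi x) = x /\ j (phi x) * j x = 1) ->
  (forall x, S x -> cpull phi j u x = c) -> extremal u.
Proof.
move=> cphi h c0 inv hc; exists phi, j, c; split=> // x Sx.
by have := cpullK u h inv Sx; rewrite {1}/cpull hc => [<-|]; [rewrite mulrC|exact: cd_sphere h _ Sx].
Qed.

End QMean.

(** * Orders between n/2 + 1 and n/2 + 2 *)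

Section LargeOrder.
Context {R : realType} (n : nat).
Hypothesis n0 : (0 < n)%N.
Variable s : R.
Hypothesis s12 : 1 < s < 2.
Local Notation V := 'rV[R]_n.+1.
Local Notation S := (@sphere R n).
Local Notation I := (@sphere_int R n).
Local Notation vol := (sphere_vol R n).
Local Notation P l := (Pcoef n (n%:R / 2 + s) l).
Local Notation cpull := (cpull (n := n) s).
Local Notation energy_le := (energy_le (n := n) s).
Local Notation sharp_bound := (sharp_bound (n := n) s).
Implicit Types (u v w : V -> R) (c E : R).

Let sr : 0 < s < 1 \/ 1 < s < 2. Proof. by right. Qed.
Let s0 : 0 < s. Proof. by case/andP: s12; lra. Qed.
Let v0 : 0 < vol. Proof. exact: sphere_vol_gt0. Qed.

Lemma Pcoef0_gt0 : 0 < P 0.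
Proof.
have := Pcoef0_sign n sr; rewrite pmulr_lgt0// subr_gt0; by case/andP: s12.
Qed.

(** Centering removes degree 1. The last term of the sum is retained for the equality case, where it
    forces every component of degree at least 2 to vanish. *)
Lemma centered_energy_sum_ge v L : cts v -> (forall x, S x -> 0 < v x) -> centered s v -> (1 < L)%N ->
  P 0 * vol * (I v / vol) ^+ 2 + (if (2 < L)%N then P L.-1 * hsqnorm L.-1 v else 0) <= energy_sum s L v.
Proof.
move=> cv vp hv L1.
have n1 : hsqnorm 1 v = 0.
  by apply: hsqnorm1_eq0 => // i; apply: (centered_orth n0 s0) => // x Sx; rewrite ltW// vp.
have base : energy_sum s 2 v = P 0 * vol * (I v / vol) ^+ 2.
  rewrite /energy_sum !big_ord_recr big_ord0 /= n1 mulr0 addr0 add0r hsqnorm0E//.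
  by field; rewrite gt_eqF.
case: ltnP => L2.
  case: L L1 L2 => // L _ L2; rewrite energy_sumS lerD2r -base; apply: (energy_sum_le sr).
  exact: L2.
by rewrite addr0 -base; apply: (energy_sum_le sr); rewrite L1.
Qed.

Lemma Iv_gt0 v : cts v -> (forall x, S x -> 0 < v x) -> 0 < I v.
Proof.
move=> cv vp; have [m m0 hm] := cts_gt0_min cv vp.
apply: lt_le_trans (_ : m * vol <= _); first by rewrite mulr_gt0.
by rewrite -int_cst; apply: int_le => //; exact: cts_cst.
Qed.

Lemma sharp_bound_le_centered v : cts v -> (forall x, S x -> 0 < v x) ->
  sharp_bound v <= P 0 * vol * (I v / vol) ^+ 2.
Proof.
move=> cv vp; apply: ler_wpM2l; first by rewrite ltW// mulr_gt0// Pcoef0_gt0.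
by apply: neg_mean_jensen => //; exact: Iv_gt0.
Qed.

Lemma large_order_le u E : cts u -> (forall x, S x -> 0 < u x) -> energy_le u E -> sharp_bound u <= E.
Proof.
move=> cu u0 hE; have [phi [j [cphi h inv hc]]] := exists_centered n0 s0 cu u0.
have cT := cts_cpull s h cu; have Tp := cpull_gt0 s h u0.
have := energy_le_cpull n0 sr h cu hE (leqnn 2).
have := centered_energy_sum_ge cT Tp hc (leqnn 2); rewrite /= addr0 => h1 h2.
by rewrite -(sharp_bound_cpull sr h cu u0); apply: le_trans (sharp_bound_le_centered cT Tp) (le_trans h1 h2).
Qed.

Lemma large_order_eq u : cts u -> (forall x, S x -> 0 < u x) -> energy_le u (sharp_bound u) -> extremal s u.
Proof.
move=> cu u0 hE; have [phi [j [cphi h inv hc]]] := exists_centered n0 s0 cu u0.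
have cT := cts_cpull s h cu; have Tp := cpull_gt0 s h u0.
have n1 : hsqnorm 1 (cpull phi j u) = 0.
  by apply: hsqnorm1_eq0 => // i; apply: (centered_orth n0 s0) => // x Sx; rewrite ltW// Tp.
have hT := energy_le_cpull n0 sr h cu hE; rewrite -(sharp_bound_cpull sr h cu u0) in hT.
have nz l : (0 < l)%N -> hsqnorm l (cpull phi j u) = 0.
  move=> l0; have [->//|l1] := eqVneq l 1%N.
  have l2 : (1 < l)%N by rewrite ltn_neqAle eq_sym l1.
  have L2 : (1 < l.+1)%N by rewrite ltnS ltnW.
  have k1 := hT l.+1 L2; have k2 := centered_energy_sum_ge cT Tp hc L2.
  have k3 := sharp_bound_le_centered cT Tp; rewrite /= ltnS l2 in k2.
  have k4 : P l * hsqnorm l (cpull phi j u) <= 0 by move: k1 k2 k3; lra.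
  apply/eqP; rewrite eq_le hsqnorm_ge0 andbT; move: k4; rewrite pmulr_rle0//.
  exact: (Pcoef_gt0 n sr l2).
apply: (cpull_const_extremal cphi h _ inv (hsqnorm_eq0_const n0 cT nz)).
by rewrite divr_gt0//; exact: Iv_gt0.
Qed.

End LargeOrder.

(** * Orders between n/2 and n/2 + 1 *)

Section PowerInequalities.
Context {R : realType}.
Implicit Types (a b p t z x y : R).

Lemma is_derive_ge0_le (f df : R -> R) a b : a <= b ->
  (forall x, a <= x <= b -> is_derive x 1 f (df x)) ->
  (forall x, a <= x <= b -> 0 <= df x) -> f a <= f b.
Proof.
move=> ab fd d0; apply: (@ger0_derive1_ndecr _ f a b) => //.
- by move=> x; rewrite in_itv /= => /andP[x1 x2]; have [] := fd x; rewrite ?ltW.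
- move=> x; rewrite in_itv /= => /andP[x1 x2]; have xab : a <= x <= b by rewrite !ltW.
  by have h := fd x xab; rewrite derive1E derive_val d0.
- by apply: derivable_within_continuous => x; rewrite in_itv /= => /fd[].
Qed.

Lemma half_lt1 b : 0 < b -> b / (b * 2) < 1.
Proof. by move=> b0; rewrite ltr_pdivrMr ?mulr_gt0// mul1r mulr_natr mulr2n ltrDl. Qed.

Lemma powR_onep_is_derive t p : -1 < t ->
  is_derive t 1 (fun t : R => (1 + t) `^ p) (p * (1 + t) `^ (p - 1)).
Proof.
move=> t1; have h0 : 0 < 1 + t by lra.
have h1 := is_derive_cst (1 : R) t (1 : R).
have h2 := is_derive_id t (1 : R).
have h3 : is_derive t (1:R) (fun t : R => 1 + t) (0 + 1) := is_deriveD h1 h2.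
have h4 := is_derive1_powR p h0.
have := @is_derive1_comp _ (fun u => u `^ p) (fun t : R => 1 + t) t _ _ h4 h3.
by rewrite add0r mulr1.
Qed.

Let powR_diff_lower r z : 0 < r -> 0 <= z < 1 -> 2 * r * z <= (1 - z) `^ (- r) - (1 + z) `^ (- r).
Proof.
move=> r0 /andP[z0 z1]; rewrite -subr_ge0.
pose f z := (1 - z) `^ (- r) - (1 + z) `^ (- r) - 2 * r * z.
have f0 : f 0 = 0 by rewrite /f subr0 addr0 !powR1; ring.
rewrite -/(f z) -f0.
apply: (is_derive_ge0_le (df := fun z => r * (1 - z) `^ (- r - 1) + r * (1 + z) `^ (- r - 1) - 2 * r)) => //.
  move=> x /andP[x0 xz]; have x1 : x < 1 by exact: le_lt_trans xz z1.
  have xN : -1 < x by lra.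
  have h := is_deriveB (is_deriveB (powR_onem_is_derive (- r) x1) (powR_onep_is_derive (- r) xN))
    (is_deriveZ (2 * r) (is_derive_id x (1 : R))).
  by apply: (is_derive_eq h); rewrite /GRing.scale /=; ring.
move=> x /andP[x0 xz]; have x1 : x < 1 by exact: le_lt_trans xz z1.
have k1 : 0 < 1 - x by lra. have k2 : 0 < 1 + x by lra.
have rN : - r - 1 <= 0 by lra.
have t1 := powR_ge_tangent_neg k1 rN; have t2 := powR_ge_tangent_neg k2 rN.
rewrite -mulrDr [2 * r]mulrC -mulrBr mulr_ge0 ?(ltW r0)//; move: t1 t2; lra.
Qed.

Let powR_sym_lower0 q z : 0 < q -> 0 <= z < 1 ->
  2 + q * (q + 1) * z ^+ 2 <= (1 - z) `^ (- q) + (1 + z) `^ (- q).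
Proof.
move=> q0 /andP[z0 z1]; rewrite -subr_ge0.
pose f z := (1 - z) `^ (- q) + (1 + z) `^ (- q) - (2 + q * (q + 1) * z ^+ 2).
have f0 : f 0 = 0 by rewrite /f subr0 addr0 !powR1; ring.
rewrite -/(f z) -f0.
apply: (is_derive_ge0_le (df := fun z => q * ((1 - z) `^ (- (q + 1)) - (1 + z) `^ (- (q + 1)) - 2 * (q + 1) * z))) => //.
  move=> x /andP[x0 xz]; have x1 : x < 1 by exact: le_lt_trans xz z1.
  have xN : -1 < x by lra.
  have h3 : is_derive x (1 : R) (fun z => 2 + q * (q + 1) * z ^+ 2) (0 + q * (q + 1) * (2 * x)).
    have h := is_deriveD (is_derive_cst (2 : R) x (1 : R)) (is_deriveZ (q * (q + 1)) (is_deriveX 2 (is_derive_id x (1 : R)))).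
    by apply: (is_derive_eq h); rewrite /GRing.scale /= expr1; ring.
  have h := is_deriveB (is_deriveD (powR_onem_is_derive (- q) x1) (powR_onep_is_derive (- q) xN)) h3.
  by apply: (is_derive_eq h); rewrite (_ : - (q + 1) = - q - 1) ?opprD//; ring.
move=> x /andP[x0 xz]; have q1 : 0 < q + 1 by lra.
have x01 : 0 <= x < 1 by rewrite x0 (le_lt_trans xz).
by rewrite mulr_ge0 ?(ltW q0)// subr_ge0 powR_diff_lower.
Qed.

(** Adding the two signs cancels the first-order term, and what remains is an exact second-order
    lower bound without remainder. It is used with u + t x_i and u - t x_i. *)
Lemma powR_sym_lower q x y : 0 < q -> 0 < x -> `|y| < x ->
  2 * x `^ (- q) + q * (q + 1) * y ^+ 2 * x `^ (- q - 2) <= (x - y) `^ (- q) + (x + y) `^ (- q).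
Proof.
move=> q0 x0 yx; wlog y0 : y yx / 0 <= y.
  move=> W; have [y0|/ltW y0] := lerP 0 y; first exact: W.
  by have := W (- y); rewrite normrN sqrrN opprK oppr_ge0 => /(_ yx y0); rewrite [leRHS]addrC.
rewrite ger0_norm// in yx; pose z := y / x.
have z01 : 0 <= z < 1 by rewrite divr_ge0 ?(ltW x0)//= ltr_pdivrMr// mul1r.
have ex : x `^ (- q - 2) = x `^ (- q) / x ^+ 2.
  by rewrite powRB ?(lt0r_neq0 x0) ?implybT// (powR_mulrn 2 (ltW x0)).
have e1 : x - y = x * (1 - z) by rewrite /z; field; exact: lt0r_neq0.
have e2 : x + y = x * (1 + z) by rewrite /z; field; exact: lt0r_neq0.
rewrite e1 e2 !powRM ?(ltW x0)//; try (move/andP: z01; lra).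
rewrite -mulrDr ex; apply: le_trans (ler_wpM2l (powR_ge0 x _) (powR_sym_lower0 q0 z01)).
by rewrite le_eqVlt; apply/orP; left; apply/eqP; rewrite /z; field; exact: lt0r_neq0.
Qed.

(* Comparison of the first-order terms at t = 0. *)
Lemma powR_first_order a b p t0 : 0 <= a -> 0 < b -> 0 < p -> 0 < t0 ->
  (forall t, 0 < t <= t0 -> 1 + a * t <= (1 - b * t) `^ (- p)) -> a <= p * b.
Proof.
move=> a0 b0 p0 t00 H; rewrite leNgt; apply/negP => ab.
pose d := a - p * b; have d0 : 0 < d by rewrite subr_gt0.
(* The value t = 1 / D is below t0, keeps 1 - b t positive and makes the second-order error smaller
   than d t, one summand of D for each requirement. *)
pose D := t0^-1 + b + a * b * (1 + p) / d + 1.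
have k1 : 0 < t0^-1 by rewrite invr_gt0.
have k2 : 0 <= a * b * (1 + p) / d.
  by rewrite divr_ge0 ?(ltW d0)// !mulr_ge0 ?(ltW b0)//; lra.
have D0 : 0 < D by rewrite /D; lra.
have h1 : D^-1 <= t0 by rewrite -[t0]invrK lef_pV2 ?posrE// /D; lra.
have h2 : b * D^-1 < 1 by rewrite ltr_pdivrMr// /D; lra.
have h3 : a * b * (1 + p) * D^-1 < d.
  rewrite ltr_pdivrMr// (_ : d * D = a * b * (1 + p) + d * (t0^-1 + b + 1)).
    by rewrite ltrDl mulr_gt0//; lra.
  by rewrite /D; field; rewrite !lt0r_neq0.
have t0' : 0 < D^-1 by rewrite invr_gt0.
move: (D^-1) h1 h2 h3 t0' => t h1 h2 h3 t1.
have := H t; rewrite t1 h1 => /(_ isT); set y := 1 - b * t.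
have y0 : 0 < y by rewrite subr_gt0.
have yV : 0 < y^-1 by rewrite invr_gt0.
have pN : - p <= 0 by lra.
have := powR_ge_tangent_neg yV pN.
have -> : y^-1 `^ (- p) = y `^ p by rewrite -powR_inv1 ?(ltW y0)// -powRrM mulrNN mul1r.
rewrite powRN => tan hy; have yp := powR_gt0 p y0.
have at0 : 0 <= 1 + a * t by rewrite addr_ge0// mulr_ge0// ltW.
have h4 : (1 + a * t) * y `^ p <= 1 by rewrite -ler_pdivlMr// mul1r.
have h5 := le_trans (ler_wpM2l at0 tan) h4.
have h6 : (1 + a * t) * (y - p * (1 - y)) <= y.
  have := ler_wpM2r (ltW y0) h5; rewrite mul1r; apply: le_trans.
  by rewrite le_eqVlt; apply/orP; left; apply/eqP; field; exact: lt0r_neq0.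
have h7 : d * t <= a * b * (1 + p) * t * t by move: h6; rewrite /y /d; lra.
by move: h7; rewrite ler_pM2r// leNgt h3.
Qed.

(* A and M stand for the energy and the mean of a maximizer, (1 - b) A and X for those of a competitor. *)
Lemma powR_ratio_le q A M X b : 0 < q -> 0 < A -> 0 < M -> 0 <= X -> b < 1 ->
  A * (1 - b) * X `^ (2 / q) <= A * M `^ (2 / q) -> X <= M * (1 - b) `^ (- (q / 2)).
Proof.
move=> q0 A0 M0 X0 b1; have b0 : 0 < 1 - b by rewrite subr_gt0.
rewrite -mulrA ler_pM2l// mulrC -ler_pdivlMr// => h.
have q2 : 0 < q / 2 by rewrite divr_gt0.
have e Y : 0 <= Y -> Y = (Y `^ (2 / q)) `^ (q / 2).
  by move=> Y0; rewrite -powRrM (_ : _ * _ = 1) ?powRr1//; field; rewrite gt_eqF.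
have -> : M * (1 - b) `^ (- (q / 2)) = (M `^ (2 / q) / (1 - b)) `^ (q / 2).
  rewrite powRM ?powR_ge0 ?invr_ge0 ?(ltW b0)// -(e M (ltW M0)); congr (_ * _).
  by rewrite -powR_inv1 ?(ltW b0)// -powRrM mulN1r.
rewrite {1}(e X X0); apply: ge0_ler_powR => //; rewrite ?nnegrE ?powR_ge0 ?(ltW q2)//.
by rewrite mulr_ge0 ?powR_ge0 ?invr_ge0 ?(ltW b0).
Qed.

End PowerInequalities.

(** * First and second variation at a maximizer *)

Section Rigidity.
Context {R : realType} (n : nat).
Hypothesis n0 : (0 < n)%N.
Variable s : R.
Hypothesis s01 : 0 < s < 1.
Local Notation V := 'rV[R]_n.+1.
Local Notation S := (@sphere R n).
Local Notation I := (@sphere_int R n).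
Local Notation vol := (sphere_vol R n).
Local Notation P l := (Pcoef n (n%:R / 2 + s) l).
Local Notation q := (n%:R / s).
Local Notation energy_le := (energy_le (n := n) s).
Local Notation neg_mean := (neg_mean (n := n) s).
Local Notation Pm := (mpoly n.+1 R).
Implicit Types (u v w : V -> R) (c E A : R).

Let sr : 0 < s < 1 \/ 1 < s < 2. Proof. by left. Qed.
Let s0 : 0 < s. Proof. by case/andP: s01. Qed.
Let v0 : 0 < vol. Proof. exact: sphere_vol_gt0. Qed.
Let q0 : 0 < q. Proof. by rewrite divr_gt0 ?ltr0n. Qed.

(** Minus the energy of the constant function 1. *)
Definition sharp_cst : R := - (P 0 * vol).

Lemma Pcoef0_lt0 : P 0 < 0.
Proof.
have := Pcoef0_sign n sr; rewrite nmulr_lgt0// subr_lt0; by case/andP: s01.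
Qed.

Lemma sharp_cst_gt0 : 0 < sharp_cst.
Proof. by rewrite oppr_gt0 nmulr_rlt0// Pcoef0_lt0. Qed.

(** The factor q + 1 is the one produced by the second derivative of t^(-q), so it cancels in the
    comparison of the two variations. *)
Lemma Pcoef1_sharp_cst : P 1 * vol = sharp_cst * (q + 1).
Proof.
have := PcoefS n sr 0 : P 1 * (0 - s) = P 0 * (0 + n%:R + s).
rewrite !add0r => e; rewrite /sharp_cst; apply: (mulIf (lt0r_neq0 s0)).
by rewrite mulrAC -[P 1 * s]opprK -mulrN e; field; rewrite !lt0r_neq0.
Qed.

Lemma energy_sum_addH L m u (Z : Pm) (t : R) : cts u -> harm_hom m Z -> (m < L)%N ->
  energy_sum s L (fun x => u x + t * peval Z x) =
  energy_sum s L u + P m * (2 * t * I (fun x => u x * peval Z x) + t ^+ 2 * pint (Z * Z)).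
Proof.
move=> cu hZ mL; rewrite /energy_sum.
rewrite (eq_bigr (fun l : 'I_L => P l * hsqnorm l u + (if l == Ordinal mL then
   P m * (2 * t * I (fun x => u x * peval Z x) + t ^+ 2 * pint (Z * Z)) else 0))).
  by rewrite big_split /= -big_mkcond /= big_pred1_eq.
move=> l _; rewrite (hsqnorm_addH n0 l t cu hZ) -val_eqE /= mulrDr; congr (_ + _).
by case: eqP => [->|_]; rewrite ?mulr0.
Qed.

(** The functional is minus the energy times [neg_mean] to the power 2 / q, which is invariant under
    scaling; competitors enter through a positive lower bound E for minus their energy. In use, A is
    such a value for u itself. *)
Definition maximizer u A := forall v E, cts v -> (forall x, S x -> 0 < v x) -> 0 < E ->
  energy_le v (- E) -> E * neg_mean v `^ (2 / q) <= A * neg_mean u `^ (2 / q).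

Section Maximizer.
Variables (u : V -> R) (A : R).
Hypotheses (cu : cts u) (u0 : forall x, S x -> 0 < u x) (Iu : I u = vol).
Hypotheses (ucen : centered s u) (A0 : 0 < A) (uA : energy_le u (- A)) (umax : maximizer u A).
Local Notation M := (neg_mean u).
Local Notation N k := (I (fun x => u x `^ (- q - k)) / vol).

Let M0 : 0 < M. Proof. exact: neg_mean_gt0. Qed.

Let cp (p : R) : cts (fun x => u x `^ p). Proof. exact: cts_powRN. Qed.

Let cx i : cts (fun x : V => x ord0 i). Proof. exact: cts_coord. Qed.

(** Since u is centered, it is orthogonal to x_i and the energy changes by a purely quadratic term
    in t. *)
Lemma test_coord (i : 'I_n.+1) t : 0 < A - P 1 * vol / n.+1%:R * t ^+ 2 ->
  (forall x, S x -> 0 < u x + t * x ord0 i) ->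
  A * (1 - P 1 * vol / n.+1%:R / A * t ^+ 2) * neg_mean (fun x => u x + t * x ord0 i) `^ (2 / q) <=
  A * M `^ (2 / q).
Proof.
move=> E0 vp; have cv : cts (fun x => u x + t * x ord0 i) by apply: ctsD => //; exact: ctsZ.
have -> : A * (1 - P 1 * vol / n.+1%:R / A * t ^+ 2) = A - P 1 * vol / n.+1%:R * t ^+ 2.
  rewrite mulrBr mulr1; congr (_ - _); rewrite mulrA; congr (_ * _).
  by rewrite mulrC divfK// lt0r_neq0.
apply: umax => // L L1.
pose Z : Pm := mpolyX R (mnm1 i).
have hZ : harm_hom 1 Z by apply: dhom_harm => //; exact: homX.
have eZ : (fun x => u x + t * x ord0 i) = (fun x => u x + t * peval Z x).
  by apply/funext => x; rewrite pevalX.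
rewrite eZ (energy_sum_addH t cu hZ L1).
have -> : I (fun x => u x * peval Z x) = 0.
  under eq_fun do rewrite pevalX; apply: (centered_orth n0 s0) => // x Sx; exact/ltW/u0.
have -> : pint (Z * Z) = vol / n.+1%:R.
  by rewrite pintM -(int_coord2 i); congr I; apply/funext => x; rewrite pevalX expr2.
by rewrite mulr0 add0r opprB [leRHS]addrC; apply: lerD; [exact: uA|rewrite le_eqVlt; apply/orP; left; apply/eqP; ring].
Qed.

Lemma test_const t : 0 < t ->
  A * (1 + 2 * sharp_cst / A * t) * neg_mean (fun x => u x + t) `^ (2 / q) <= A * M `^ (2 / q).
Proof.
move=> t0; have -> : A * (1 + 2 * sharp_cst / A * t) = A + 2 * sharp_cst * t by field; rewrite !lt0r_neq0.
have k0 := sharp_cst_gt0.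
apply: umax => [|x Sx| |L L1].
- by apply: ctsD => //; exact: cts_cst.
- by rewrite addr_gt0// u0.
- by rewrite addr_gt0// !mulr_gt0.
have eZ : (fun x => u x + t) = (fun x => u x + t * peval (1 : Pm) x).
  by apply/funext => x; rewrite peval1 mulr1.
rewrite eZ (energy_sum_addH t cu (@harm1 R n) (ltnW L1)).
have -> : I (fun x => u x * peval (1 : Pm) x) = vol.
  by rewrite -Iu; congr I; apply/funext => x; rewrite peval1 mulr1.
have -> : pint (1 * 1 : Pm) = vol.
  by rewrite pintM; congr I; apply/funext => x; rewrite peval1 mulr1.
rewrite opprD; apply: lerD; first exact: uA.
have -> : P 0 * (2 * t * vol + t ^+ 2 * vol) = - (2 * sharp_cst * t) - sharp_cst * t ^+ 2 by rewrite /sharp_cst; ring.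
by rewrite gerBl mulr_ge0 ?sqr_ge0// ltW.
Qed.

(** The second variation in the direction x_i: the inequalities for the displacements t and -t are
    added, which leaves an expansion in tau = t^2. *)
Lemma second_moment_coord i : (q + 1) * A * (I (fun x => u x `^ (- q - 2) * x ord0 i ^+ 2) / vol) <=
  P 1 * vol / n.+1%:R * M.
Proof.
have q1 : 0 < q + 1 by rewrite addr_gt0.
have b0 : 0 < P 1 * vol / n.+1%:R / A.
  by rewrite divr_gt0// divr_gt0 ?ltr0n// Pcoef1_sharp_cst mulr_gt0 ?sharp_cst_gt0.
have cN : cts (fun x => u x `^ (- q - 2) * x ord0 i ^+ 2) by apply: ctsM => //; exact: ctsX.
set Ni := I _ / vol; have Ni0 : 0 <= Ni.
  by rewrite divr_ge0 ?(ltW v0)//; apply: int_ge0 => // x Sx; rewrite mulr_ge0 ?powR_ge0 ?sqr_ge0.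
pose a := q * (q + 1) * Ni / (2 * M).
have a0 : 0 <= a.
  apply: divr_ge0; first exact: mulr_ge0 (mulr_ge0 (ltW q0) (ltW q1)) Ni0.
  exact: mulr_ge0 (ler0n _ 2) (ltW M0).
have [m m0 hm] := cts_gt0_min cu u0.
have q2 : 0 < q / 2 by rewrite divr_gt0.
(* The first bound on tau keeps u + t x_i and u - t x_i positive, m being the minimum of u; the
   second keeps 1 - b tau at least 1/2. *)
have fo := powR_first_order (t0 := Num.min ((m / 2) ^+ 2) (P 1 * vol / n.+1%:R / A * 2)^-1) a0 b0 q2.
have : a <= q / 2 * (P 1 * vol / n.+1%:R / A).
  apply: fo.
    rewrite lt_min exprn_gt0 ?divr_gt0//= invr_gt0; exact: mulr_gt0 b0 (ltr0n _ 2).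
  move=> tau /andP[tau0]; rewrite le_min => /andP[tm tb].
  have bt : P 1 * vol / n.+1%:R / A * tau < 1.
    apply: le_lt_trans (ler_wpM2l (ltW b0) tb) _.
    exact: half_lt1.
  (* In the variable tau the second-order comparison becomes the first-order one of
     [powR_first_order]. *)
  pose t := Num.sqrt tau; have t2 : t ^+ 2 = tau by rewrite sqr_sqrtr// ltW.
  have tm' : `|t| <= m / 2.
    by rewrite ger0_norm ?sqrtr_ge0// -ler_sqr ?nnegrE ?sqrtr_ge0 ?divr_ge0 ?(ltW m0)// t2.
  have sm x : S x -> `|t * x ord0 i| < u x.
    move=> Sx; rewrite normrM; have x1 := le_trans (ler_coord_norm x i) (sphere_norm_le1 Sx).
    have h1 := ler_pM (normr_ge0 _) (normr_ge0 _) tm' x1; rewrite mulr1 in h1.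
    by apply: le_lt_trans h1 _; apply: lt_le_trans (hm x Sx); rewrite ltr_pdivrMr// mulr_natr mulr2n ltrDl.
  have side (e : R) : e ^+ 2 = 1 -> neg_mean (fun x => u x + e * t * x ord0 i) <= M * (1 - P 1 * vol / n.+1%:R / A * tau) `^ (- (q / 2)).
    move=> e1; have et : (e * t) ^+ 2 = tau by rewrite exprMn e1 mul1r.
    have en : `|e| = 1 by apply/eqP; rewrite -(@eqrXn2 _ 2)// real_normK ?num_real// e1 expr1n.
    have vp x : S x -> 0 < u x + e * t * x ord0 i.
      move=> Sx; have := sm x Sx; rewrite -[`|_|]mul1r -en -normrM mulrA => h.
      by have := ler_norm (- (e * t * x ord0 i)); rewrite normrN; move: h; lra.
    have cv : cts (fun x => u x + e * t * x ord0 i) by apply: ctsD => //; exact: ctsZ.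
    have qv : 0 < neg_mean (fun x => u x + e * t * x ord0 i) by exact: neg_mean_gt0.
    apply: (@powR_ratio_le R q A _ _ _ q0 A0 M0 (ltW qv) bt); rewrite -et; apply: test_coord => //.
    rewrite et subr_gt0 -[ltRHS]mul1r -ltr_pdivrMr//.
    by rewrite mulrAC.
  have N1sq : (-1 : R) ^+ 2 = 1 by rewrite sqrrN expr1n.
  have hp := side 1 (expr1n _ 2); have hN := side (-1) N1sq.
  have low : 2 * M + q * (q + 1) * tau * Ni <= neg_mean (fun x => u x + -1 * t * x ord0 i) + neg_mean (fun x => u x + 1 * t * x ord0 i).
    have cpm (e : R) : e ^+ 2 = 1 -> cts (fun x => (u x + e * t * x ord0 i) `^ (- q)).
      move=> e1; apply: cts_powR; first by apply: ctsD => //; exact: ctsZ.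
      have en : `|e| = 1 by apply/eqP; rewrite -(@eqrXn2 _ 2)// real_normK ?num_real// e1 expr1n.
      move=> x Sx; have := sm x Sx; rewrite -[`|_|]mul1r -en -normrM mulrA => h.
      by have := ler_norm (- (e * t * x ord0 i)); rewrite normrN; move: h; lra.
    have c1 := cpm _ (expr1n _ 2); have c2 := cpm _ N1sq.
    rewrite /neg_mean -mulrDl -intD// ler_pdivlMr//.
    have -> : (2 * (I (fun x => u x `^ (- q)) / vol) + q * (q + 1) * tau * Ni) * vol =
      I (fun x => 2 * u x `^ (- q) + q * (q + 1) * tau * (u x `^ (- q - 2) * x ord0 i ^+ 2)).
      rewrite intDZ//; last exact: ctsZ.
      by rewrite intZ// /Ni; field; rewrite !lt0r_neq0.
    apply: int_le; [by apply: ctsD; exact: ctsZ|exact: ctsD|] => x Sx.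
    have := powR_sym_lower q0 (u0 Sx) (sm x Sx); rewrite mulN1r mul1r mulNr => h.
    by apply: le_trans h; rewrite exprMn t2 le_eqVlt; apply/orP; left; apply/eqP; ring.
  rewrite -(ler_pM2l M0) -(ler_pM2l (ltr0n R 2)).
  have -> : 2 * (M * (1 + a * tau)) = 2 * M + q * (q + 1) * tau * Ni.
    by rewrite /a; field; rewrite !lt0r_neq0.
  by move: low hp hN; lra.
rewrite -(ler_pM2l A0) -(ler_pM2l M0) -(ler_pM2l (ltr0n R 2)) => h.
rewrite -(ler_pM2l q0).
have e1 : 2 * (M * (A * a)) = q * ((q + 1) * A * Ni) by rewrite /a; field; rewrite !lt0r_neq0.
have e2 : 2 * (M * (A * (q / 2 * (P 1 * vol / n.+1%:R / A)))) = q * (P 1 * vol / n.+1%:R * M).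
  by move: (P 1 * vol / n.+1%:R) => c; field; rewrite !lt0r_neq0.
by rewrite -e1 -e2.
Qed.

(** The first variation in the direction of the constant 1, for positive displacements; the mean of
    (u + t)^(-q) is bounded below by convexity. *)
Lemma first_moment : sharp_cst * M <= A * N 1.
Proof.
have k0 := sharp_cst_gt0; have c1 := cp (- q - 1).
have [m m0 hm] : exists2 m, 0 < m & forall x, S x -> m <= u x `^ (- q - 1).
  by apply: cts_gt0_min => // x Sx; rewrite powR_gt0// u0.
have N0 : 0 < N 1.
  rewrite divr_gt0//; apply: lt_le_trans (_ : m * vol <= _); first by rewrite mulr_gt0.
  by rewrite -int_cst; apply: int_le => //; exact: cts_cst.
have a0 : 0 <= 2 * sharp_cst / A by rewrite ltW// divr_gt0// mulr_gt0.
have b0 : 0 < q * N 1 / M by rewrite divr_gt0// mulr_gt0.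
have p0 : 0 < 2 / q by rewrite divr_gt0.
have fo := powR_first_order (t0 := (q * N 1 / M * 2)^-1) a0 b0 p0.
have : 2 * sharp_cst / A <= 2 / q * (q * N 1 / M).
  apply: fo; first by rewrite invr_gt0 mulr_gt0.
  move=> t /andP[t0 tb].
  have bt : q * N 1 / M * t < 1.
    apply: le_lt_trans (ler_wpM2l (ltW b0) tb) _.
    exact: half_lt1.
  have bt0 : 0 < 1 - q * N 1 / M * t by rewrite subr_gt0.
  have cv : cts (fun x => u x + t) by apply: ctsD => //; exact: cts_cst.
  have vp x : S x -> 0 < u x + t by move=> Sx; rewrite addr_gt0// u0.
  have low : M * (1 - q * N 1 / M * t) <= neg_mean (fun x => u x + t).
    rewrite /neg_mean ler_pdivlMr//.
    have -> : I (fun x => u x `^ (- q)) / vol * (1 - q * N 1 / M * t) * vol =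
       I (fun x => u x `^ (- q) + (- (q * t)) * u x `^ (- q - 1)).
      rewrite intDZ// -/(M); rewrite -[X in _ = X + _](divfK (lt0r_neq0 v0)) -/M.
      by field; rewrite !lt0r_neq0.
    apply: int_le; [by apply: ctsD => //; exact: ctsZ|exact: cts_powRN|] => x Sx.
    have ux := u0 Sx; have r0 : 0 < 1 + t / u x by rewrite addr_gt0// divr_gt0.
    have qN : - q <= 0 by rewrite oppr_le0 ltW.
    have tan := powR_ge_tangent_neg r0 qN.
    have -> : u x + t = u x * (1 + t / u x) by field; rewrite !lt0r_neq0.
    rewrite (powRM _ (ltW ux) (ltW r0)); apply: le_trans (ler_wpM2l (powR_ge0 _ _) tan).
    rewrite (@powRB _ _ (- q) 1) ?(lt0r_neq0 ux) ?implybT// powRr1 ?(ltW ux)//.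
    by rewrite le_eqVlt; apply/orP; left; apply/eqP; field; rewrite !lt0r_neq0.
  have := test_const t0; rewrite -mulrA ler_pM2l// => h.
  rewrite powRN -[leRHS]mul1r ler_pdivlMr ?powR_gt0//.
  have mp := powR_gt0 (2 / q) M0; rewrite -(ler_pM2l mp) mulr1 mulrCA -powRM ?(ltW M0) ?(ltW bt0)//.
  apply: le_trans h; apply: ler_wpM2l.
    by rewrite addr_ge0// mulr_ge0// ltW.
  have qv : 0 < neg_mean (fun x => u x + t) by exact: neg_mean_gt0.
  by apply: ge0_ler_powR low; rewrite ?nnegrE; [exact: ltW p0|exact: mulr_ge0 (ltW M0) (ltW bt0)|exact: ltW qv].
rewrite -(ler_pM2l A0) -(ler_pM2l M0) => h; rewrite -(ler_pM2l (ltr0n R 2)).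
have e1 : M * (A * (2 * sharp_cst / A)) = 2 * (sharp_cst * M) by field; rewrite !lt0r_neq0.
have e2 : M * (A * (2 / q * (q * N 1 / M))) = 2 * (A * N 1).
  by field; rewrite !lt0r_neq0// ltr0n.
by rewrite -e1 -e2.
Qed.

Lemma maximizer_const x : S x -> u x = 1.
Proof.
have q1 : 0 < q + 1 by rewrite addr_gt0.
have N2 : A * N 2 <= sharp_cst * M.
  have cN i : cts (fun x => u x `^ (- q - 2) * x ord0 i ^+ 2) by apply: ctsM => //; exact: ctsX.
  have eN : I (fun x => u x `^ (- q - 2)) = \sum_(i < n.+1) I (fun x => u x `^ (- q - 2) * x ord0 i ^+ 2).
    rewrite -int_sum//; apply: int_eq => // y Sy; rewrite -mulr_sumr.
    have : dotv y y = 1 by []; rewrite /dotv => e.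
    by under eq_bigr do rewrite expr2; rewrite e mulr1.
  rewrite -(ler_pM2l q1) [(q + 1) * (A * _)]mulrA eN mulr_suml mulr_sumr.
  apply: le_trans (ler_sum _ (fun i _ => second_moment_coord i)) _.
  have sumc (c : R) : \sum_(i < n.+1) c = n.+1%:R * c by rewrite sumr_const card_ord mulr_natl.
  rewrite sumc Pcoef1_sharp_cst.
  by rewrite le_eqVlt; apply/orP; left; apply/eqP; rewrite mulrA [n.+1%:R * _]mulrC divfK ?pnatr_eq0//; ring.
have N12 : N 2 <= N 1 by rewrite -(ler_pM2l A0); exact: le_trans N2 first_moment.
(* Chebyshev's inequality in pointwise form: the two factors of g have the same sign, and since u
   has mean 1 the integral of g is vol (N 2 - N 1), which is at most 0. *)
move=> Sx; pose g x := (1 - u x) * (u x `^ (- q - 2) - 1).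
have cg : cts g by apply: ctsM; apply: ctsB => //; exact: cts_cst.
have g0 y : S y -> 0 <= g y.
  move=> Sy; have uy := u0 Sy; have qN : - q - 2 <= 0 by have := q0; lra.
  have [h|h] := lerP (u y) 1.
    rewrite mulr_ge0 ?subr_ge0//; apply: le_trans (powR_ge_tangent_neg uy qN).
    by rewrite lerDl mulr_le0// subr_le0.
  rewrite /g -mulrNN mulr_ge0// oppr_ge0 subr_le0 ?(ltW h)//.
  by have := @ler_powR _ (u y) (ltW h) _ _ qN; rewrite powRr0.
have Ig : I g = 0.
  apply/eqP; rewrite eq_le int_ge0// andbT.
  have -> : I g = vol * (N 2 - N 1).
    transitivity (I (fun x => (u x `^ (- q - 2) - u x `^ (- q - 1)) + (u x - 1))).
      apply: int_eq => // y Sy; have uy := u0 Sy; rewrite /g.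
      have -> : u y `^ (- q - 1) = u y * u y `^ (- q - 2).
        rewrite -{2}(powRr1 (ltW uy)) -powRD ?(lt0r_neq0 uy) ?implybT//; congr powR; ring.
      ring.
    rewrite intD; [|exact: ctsB|by apply: ctsB => //; exact: cts_cst].
    rewrite !intB//; last exact: cts_cst.
    by rewrite Iu int_cst; field; rewrite !lt0r_neq0.
  by rewrite pmulr_rle0// subr_le0.
have /eqP := int_eq0 n0 cg g0 Ig Sx; rewrite /g mulf_eq0 !subr_eq0 => /orP[/eqP<-//|].
rewrite powR_eq1 => /or3P[/eqP//| |]; first by rewrite ltNge ltW// u0.
by have := q0 => qq /eqP; lra.
Qed.

End Maximizer.
End Rigidity.

(** * Hoelder continuity from an energy bound *)

Section Hoelder.
Context {R : realType} (n : nat).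
Hypothesis n0 : (0 < n)%N.
Variable s : R.
Hypothesis s01 : 0 < s < 1.
Local Notation V := 'rV[R]_n.+1.
Local Notation S := (@sphere R n).
Local Notation I := (@sphere_int R n).
Local Notation vol := (sphere_vol R n).
Local Notation P l := (Pcoef n (n%:R / 2 + s) l).
Local Notation ker_eigen := (ker_eigen n s).
Local Notation ker_op := (ker_op (n := n) s).
Local Notation ker := (ker (n := n) s).
Local Notation energy_le := (energy_le (n := n) s).
Local Notation Pm := (mpoly n.+1 R).
Implicit Types (u v w g : V -> R) (c t e C E : R).

Let sr : 0 < s < 1 \/ 1 < s < 2. Proof. by left. Qed.
Let s0 : 0 < s. Proof. by case/andP: s01. Qed.
Let s1 : s < 1. Proof. by case/andP: s01. Qed.
Let s2 : s < 2. Proof. by have := s1; lra. Qed.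
Let v0 : 0 < vol. Proof. exact: sphere_vol_gt0. Qed.

(** The common value of the products of [Pcoef] and [ker_eigen], so that [ker] divided by [kappa] is
    the Green kernel. *)
Definition kappa : R := P 0 * ker_eigen 0.

Lemma kappa_lt0 : kappa < 0.
Proof. by rewrite /kappa nmulr_rlt0 ?ker_eigen0_gt0// Pcoef0_lt0. Qed.

(** Convolutions with functions of x.y commute; here by the reflection that exchanges x and z. *)
Lemma ker_op_zonal (phi : {poly R}) x z : S x -> S z ->
  ker_op (fun y => phi.[dotv x y]) z = zonal_op phi (ker x) z.
Proof.
move=> Sx Sz; have [->|xz] := eqVneq z x; first by congr I; apply/funext => y; rewrite mulrC.
have [w w1 hw] := hrefl_exists Sz Sx xz.
have cF : cts (fun y => ker z y * phi.[dotv x y]) by apply: ctsM; [exact: cts_ker|exact: cts_poly_dot].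
rewrite /ker_op /zonal_op -(int_hrefl n0 w1 cF); congr I; apply/funext => y.
by rewrite /ker -!hrefl_adj hw -hw hreflK// mulrC.
Qed.

Lemma zonal_opB (phi : {poly R}) u v x : cts u -> cts v ->
  zonal_op phi (fun y => u y - v y) x = zonal_op phi u x - zonal_op phi v x.
Proof.
move=> cu cv; rewrite /zonal_op -intB; try exact: cts_zonal_op_integrand.
by congr I; apply/funext => y; rewrite mulrBr.
Qed.

Lemma zonal_op_delta_poly_bounded N u e x : cts u -> (forall y, S y -> `|u y| <= e) -> S x ->
  `|zonal_op (delta_poly n N) u x| <= 3 * e.
Proof.
move=> cu hu Sx; have : `|zonal_op (delta_poly n N) u x - u x| <= 2 * e + 0 * (n%:R / (N + n)%:R).
  apply: zonal_op_delta_poly_approx_at => // y Sy; rewrite mul0r addr0.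
  by apply: le_trans (ler_normB _ _) _; have := hu y Sy; have := hu x Sx; lra.
rewrite mul0r addr0 => h; have := hu x Sx.
have := ler_normD (zonal_op (delta_poly n N) u x - u x) (u x); rewrite subrK; move: h; lra.
Qed.

Lemma zonal_op_zonal_op_delta_poly_cvg w x : cts w -> S x ->
  (fun N => zonal_op (delta_poly n N) (zonal_op (delta_poly n N) w) x) @ \oo --> w x.
Proof.
move=> cw Sx; apply/cvgrPdist_le => e e0.
have e4 : 0 < e / 4 by rewrite divr_gt0.
have [N0 hN] := zonal_op_delta_poly_ucvg n0 cw e4; exists N0 => // N /= NN.
have h1 := hN N NN; have cz := cts_zonal_op (delta_poly n N) cw.
have h2 := zonal_op_delta_poly_bounded N (ctsB cz cw) h1 Sx.
rewrite zonal_opB// in h2; have h3 := h1 x Sx; rewrite distrC.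
have := ler_normD (zonal_op (delta_poly n N) (zonal_op (delta_poly n N) w) x - zonal_op (delta_poly n N) w x) (zonal_op (delta_poly n N) w x - w x).
rewrite addrA subrK; move: h2 h3; lra.
Qed.

Definition zonalp (phi : {poly R}) (x : V) : Pm := \sum_(i < size phi) phi`_i *: lin x ^+ i.

Lemma peval_zonalp phi x y : peval (zonalp phi x) y = phi.[dotv x y].
Proof.
rewrite horner_coef peval_sum; apply: eq_bigr => i _.
by rewrite pevalZ pevalXn peval_lin.
Qed.

(* Termwise, 2 t <hproj l v, h l> <= t^2 P_l |hproj l v|^2 + |h l|^2 / P_l, and 1 / P_l = ker_eigen l / kappa. *)
Lemma dual_poly v C (p : Pm) t : cts v -> energy_le v (P 0 * hsqnorm 0 v + C) -> pint p = 0 ->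
  2 * t * I (fun x => v x * peval p x) <= t ^+ 2 * C + I (fun x => peval p x * ker_op (peval p) x) / kappa.
Proof.
move=> cv hC Ip; have [K [h [h1 h2 h3]]] := poly_decomp p.
pose L := K.+2; have k0 := kappa_lt0.
have hp x : S x -> peval p x = \sum_(l < L) peval (h l) x by move=> Sx; rewrite (h3 L)// leqW.
have cp := cts_peval p.
have nlg l : (l < L)%N -> hsqnorm l (peval p) = pint (h l * h l).
  by move=> lL; rewrite (hsqnorm_poly n0 l h1 hp) lL.
have h00 : hsqnorm 0 (peval p) = 0 by rewrite hsqnorm0E// -/(pint p) Ip expr0n mul0r.
have Ih0 : pint (hproj 0 v * h 0) = 0.
  have h0z x : S x -> peval (h 0) x ^+ 2 = 0.
    have c0 : cts (fun x => peval (h 0) x ^+ 2) by apply: ctsX; exact: cts_peval.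
    apply: (int_eq0 n0 c0) => [y _|]; first exact: sqr_ge0.
    by rewrite -h00 nlg// pintM; congr I; apply/funext => y; rewrite expr2.
  rewrite pintM -(@int0 R n); apply: int_eq; first by apply: ctsM; exact: cts_peval.
  by move=> x Sx; have /eqP := h0z x Sx; rewrite sqrf_eq0 => /eqP ->; rewrite mulr0.
have e1 : I (fun x => v x * peval p x) = \sum_(l < L) pint (hproj l v * h l).
  transitivity (I (fun x => \sum_(l < L) v x * peval (h l) x)).
    apply: int_eq; first exact: ctsM.
    by move=> x Sx; rewrite hp// mulr_sumr.
  rewrite int_sum => [|l _]; last by apply: ctsM => //; exact: cts_peval.
  by apply: eq_bigr => l _; rewrite (hproj_spec n0 l cv).2.
have e2 : (\sum_(l < L) ker_eigen l * hsqnorm l (peval p)) / kappa <= I (fun x => peval p x * ker_op (peval p) x) / kappa.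
  have := ker_op_parseval_le n0 s0 s2 cp (isT : (1 < L)%N).
  rewrite (eq_bigr (fun l : 'I_L => (s - 1) * (ker_eigen l * hsqnorm l (peval p)))); last by move=> l _; rewrite mulrA.
  by rewrite -mulr_sumr ler_nM2l ?subr_lt0// => h'; rewrite ler_wnM2r// invr_le0 ltW.
apply: le_trans (_ : t ^+ 2 * C + (\sum_(l < L) ker_eigen l * hsqnorm l (peval p)) / kappa <= _); last by rewrite lerD2l.
have e3 : \sum_(l < K.+1) P l.+1 * hsqnorm l.+1 v <= C.
  have := hC L isT; rewrite /energy_sum big_ord_recl /= lerD2l.
  by [].
rewrite e1; apply: le_trans (_ : t ^+ 2 * (\sum_(l < K.+1) P l.+1 * hsqnorm l.+1 v) + (\sum_(l < L) ker_eigen l * hsqnorm l (peval p)) / kappa <= _); last first.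
  by rewrite lerD2r ler_wpM2l// sqr_ge0.
have -> : \sum_(l < L) pint (hproj l v * h l) = \sum_(l < K.+1) pint (hproj l.+1 v * h l.+1).
  by rewrite big_ord_recl Ih0 add0r.
have Pl l : 0 < P l.+1.
  case: l => [|k]; last exact: Pcoef_gt0.
  by have := Pcoef1_sign n sr; rewrite pmulr_lgt0// subr_gt0.
have ek l : ker_eigen l.+1 / kappa = (P l.+1)^-1.
  have /esym := @Pcoef_ker_eigen R n s sr l.+1; rewrite -/kappa => ->.
  by rewrite invfM mulrCA divff ?mulr1// ker_eigen_neq0//; rewrite lt_eqF.
have -> : (\sum_(l < L) ker_eigen l * hsqnorm l (peval p)) / kappa = \sum_(l < K.+1) pint (h l.+1 * h l.+1) / P l.+1.
  rewrite big_ord_recl h00 mulr0 add0r mulr_suml; apply: eq_bigr => l _.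
  have lL : (l.+1 < L)%N by rewrite ltnS; exact: (ltn_ord l).
  transitivity (ker_eigen l.+1 * hsqnorm l.+1 (peval p) / kappa); first by [].
  by rewrite mulrAC ek (nlg _ lL) mulrC.
rewrite !mulr_sumr -big_split /=; apply: ler_sum => l _; have {}Pl := Pl l.
set a := hproj l.+1 v; set b := h l.+1; set c := P l.+1.
have cab (f g : Pm) : cts (fun x => peval f x * peval g x) by apply: ctsM; exact: cts_peval.
have h4 : 0 <= pint (b * b) + - (2 * t * c) * pint (a * b) + (t * c) ^+ 2 * hsqnorm l.+1 v.
  rewrite /hsqnorm -/a !pintM -!intDZ//; last by apply: ctsD => //; exact: ctsZ.
  apply: int_ge0 => [|x _]; first by apply: ctsD; [apply: ctsD => //|]; exact: ctsZ.
  rewrite [leRHS](_ : _ = (t * c * peval a x - peval b x) ^+ 2); [exact: sqr_ge0|ring].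
rewrite -(ler_pM2l Pl) mulrDr -/c [c * (_ / _)]mulrC divfK ?lt0r_neq0//.
by move: h4; lra.
Qed.

(** The hypothesis bounds by C the part of the energy in positive degrees. [dual_poly] is tested
    with p approximating the difference of the point masses at x and y, for which the quadratic term
    tends to (w x - w y) / kappa = -2 ker x y / kappa. *)
Lemma energy_hoelder v C x y : cts v -> 0 < C -> energy_le v (P 0 * hsqnorm 0 v + C) -> S x -> S y ->
  (v x - v y) ^+ 2 <= 2 * C / - kappa * ker x y.
Proof.
move=> cv C0 hC Sx Sy; have k0 := kappa_lt0.
pose w z := ker x z - ker y z; have cw : cts w by apply: ctsB; exact: cts_ker.
have wxy : (w x - w y) / kappa = 2 / - kappa * ker x y.
  rewrite /w (kerC s y x) /ker Sx Sy subrr powR0 ?(gt_eqF s0)//.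
  by field; rewrite lt_eqF.
have key t : 2 * t * (v x - v y) <= t ^+ 2 * C + 2 / - kappa * ker x y.
  rewrite -wxy.
  have l1 : (fun N => 2 * t * (zonal_op (delta_poly n N) v x - zonal_op (delta_poly n N) v y)) @ \oo --> 2 * t * (v x - v y).
    apply: cvgM; first exact: cvg_cst.
    by apply: cvgB; exact: (ucvg_pt (zonal_op_delta_poly_ucvg n0 cv)).
  have l2 : (fun N => t ^+ 2 * C + (zonal_op (delta_poly n N) (zonal_op (delta_poly n N) w) x - zonal_op (delta_poly n N) (zonal_op (delta_poly n N) w) y) / kappa) @ \oo
      --> t ^+ 2 * C + (w x - w y) / kappa.
    apply: cvgD; first exact: cvg_cst.
    by apply: cvgM; [apply: cvgB; exact: zonal_op_zonal_op_delta_poly_cvg|exact: cvg_cst].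
  apply: (ler_cvg_to l1 l2); apply: nearW => N.
  pose p : Pm := zonalp (delta_poly n N) x - zonalp (delta_poly n N) y.
  have ep z : peval p z = (delta_poly n N).[dotv x z] - (delta_poly n N).[dotv y z].
    by rewrite pevalB !peval_zonalp.
  have Ip : pint p = 0.
    transitivity (I (fun z => (delta_poly n N).[dotv x z] - (delta_poly n N).[dotv y z])).
      by congr I; apply/funext => z; rewrite ep.
    by rewrite intB ?int_zonal// ?subrr//; exact: cts_poly_dot.
  have cg u : cts u -> I (fun z => u z * peval p z) = zonal_op (delta_poly n N) u x - zonal_op (delta_poly n N) u y.
    move=> cu; rewrite /zonal_op -intB; try exact: cts_zonal_op_integrand.
    by congr I; apply/funext => z; rewrite ep; ring.
  have := dual_poly t cv hC Ip; rewrite (cg v cv).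
  have -> : I (fun z => peval p z * ker_op (peval p) z) = I (fun z => zonal_op (delta_poly n N) w z * peval p z).
    apply: int_eq; first by apply: ctsM; [exact: cts_peval|apply: cts_ker_op => //; exact: cts_peval].
    move=> z Sz; rewrite mulrC; congr (_ * _).
    rewrite (_ : peval p = fun z => (delta_poly n N).[dotv x z] - (delta_poly n N).[dotv y z]); last exact/funext.
    rewrite /w zonal_opB; try exact: cts_ker.
    rewrite -!ker_op_zonal// /ker_op -intB; first by congr I; apply/funext => z'; rewrite mulrBr.
      by apply: ctsM; [exact: cts_ker|exact: cts_poly_dot].
    by apply: ctsM; [exact: cts_ker|exact: cts_poly_dot].
  by rewrite cg//; exact: cts_zonal_op.
(* The optimal t, for which the quadratic term takes up half of the linear one. *)
have := key ((v x - v y) / C).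
rewrite (_ : 2 * ((v x - v y) / C) * (v x - v y) = 2 * (v x - v y) ^+ 2 / C); last by ring.
rewrite (_ : ((v x - v y) / C) ^+ 2 * C = (v x - v y) ^+ 2 / C); last by field; exact: lt0r_neq0.
move=> h; rewrite -(@ler_pM2r _ C^-1) ?invr_gt0//.
rewrite [leRHS](_ : _ = 2 / - kappa * ker x y); first by move: h; lra.
by move: (- kappa)^-1 => k; field; exact: lt0r_neq0.
Qed.

End Hoelder.

(** * Centered functions of nonpositive energy have no zeros *)

Section Positivity.
Context {R : realType} (n : nat).
Hypothesis n0 : (0 < n)%N.
Variable s : R.
Hypothesis s01 : 0 < s < 1.
Local Notation V := 'rV[R]_n.+1.
Local Notation S := (@sphere R n).
Local Notation I := (@sphere_int R n).
Local Notation vol := (sphere_vol R n).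
Local Notation P l := (Pcoef n (n%:R / 2 + s) l).
Local Notation energy_le := (energy_le (n := n) s).
Local Notation energy_sum := (energy_sum (n := n) s).
Local Notation Pm := (mpoly n.+1 R).
Implicit Types (u v w f g : V -> R) (x y : V) (c t e C E : R).

Let sr : 0 < s < 1 \/ 1 < s < 2. Proof. by left. Qed.
Let s0 : 0 < s. Proof. by case/andP: s01. Qed.
Let s1 : s < 1. Proof. by case/andP: s01. Qed.
Let v0 : 0 < vol. Proof. exact: sphere_vol_gt0. Qed.

(** Lipschitz continuity, as (1 - x.y)^(1/2) is |x - y| / sqrt 2 on the sphere; in terms of 1 - x.y
    it transforms well under inversions, by [sinv_dot]. *)
Definition half_lip f := exists2 C, 0 <= C & forall x y, S x -> S y ->
  `|f x - f y| <= C * (1 - dotv x y) `^ 2^-1.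

Lemma half_lip_cst c : half_lip (fun=> c).
Proof. by exists 0 => // x y _ _; rewrite subrr normr0 mul0r. Qed.

Lemma half_lip_coord i : half_lip (fun x => x ord0 i).
Proof.
exists 2 => // x y Sx Sy; have d0 : 0 <= 1 - dotv x y by rewrite subr_ge0 dotv_le1.
rewrite powR12_sqrt// -ler_sqr ?nnegrE ?mulr_ge0 ?sqrtr_ge0//.
rewrite exprMn sqr_sqrtr// real_normK ?num_real//.
have h1 := ler_coord_norm (x - y) i; have h2 := norm2_le_dotv (x - y).
rewrite !mxE in h1; rewrite dist_sphere// in h2.
apply: le_trans (_ : `|x - y| ^+ 2 <= _).
  by rewrite -real_normK ?num_real// ler_sqr ?nnegrE.
by apply: le_trans h2 _; move: d0; lra.
Qed.

Lemma half_lipD f g : half_lip f -> half_lip g -> half_lip (fun x => f x + g x).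
Proof.
move=> [C C0 hC] [D D0 hD]; exists (C + D) => [|x y Sx Sy]; first exact: addr_ge0.
rewrite opprD addrACA mulrDl; apply: le_trans (ler_normD _ _) _.
by rewrite lerD ?hC ?hD.
Qed.

Lemma half_lip_cts f : half_lip f -> cts f.
Proof.
move=> [C C0 hC]; apply/ctsP => x Sx.
have ck : cts (fun y => C * (1 - dotv x y) `^ 2^-1).
  apply: ctsZ; apply: cts_powR_comp; [|by rewrite invr_gt0|].
    by apply: ctsB; [exact: cts_cst|exact: cts_dotr].
  by move=> y Sy; rewrite subr_ge0 dotv_le1.
move/ctsP : ck => /(_ x Sx); rewrite Sx subrr powR0 ?invr_neq0// mulr0 => h.
apply/cvgrPdist_le => e e0; move/cvgr0Pnorm_le : h => /(_ e e0) h; near=> y.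
have Sy : S y by near: y; exact: withinT.
by apply: le_trans (hC x y Sx Sy) (le_trans (ler_norm _) _); near: y.
Unshelve. all: by end_near. Qed.

Lemma half_lipM f g : half_lip f -> half_lip g -> half_lip (fun x => f x * g x).
Proof.
move=> lf lg; have [M M0 hM] := cts_bounded (half_lip_cts lf).
have [N N0 hN] := cts_bounded (half_lip_cts lg).
move: lf lg => [C C0 hC] [D D0 hD].
exists (M * D + C * N) => [|x y Sx Sy]; first by rewrite addr_ge0// mulr_ge0// ltW.
rewrite (_ : f x * g x - f y * g y = f x * (g x - g y) + (f x - f y) * g y); last by ring.
apply: le_trans (ler_normD _ _) _; rewrite !normrM mulrDl -mulrA lerD//.
  by apply: ler_pM => //; [exact: hM|exact: hD].
by rewrite mulrAC; apply: ler_pM => //; [exact: hC|exact: hN].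
Qed.

Lemma half_lip_peval (p : Pm) : half_lip (peval p).
Proof.
elim/mpolyind: p => [|c m p _ _ IH].
  by rewrite (_ : peval 0 = fun=> 0); [exact: half_lip_cst|apply/funext => x; exact: peval0].
rewrite (_ : peval _ = fun x => c * peval (mpolyX R m) x + peval p x); last first.
  by apply/funext => x; rewrite pevalD pevalZ.
apply: half_lipD => //; apply: half_lipM; first exact: half_lip_cst.
rewrite (_ : peval _ = fun x => \prod_(i < n.+1) x ord0 i ^+ (m i)); last first.
  by apply/funext => x; rewrite /peval mevalX.
rewrite (_ : (fun x => _) = (fun x => \prod_(i <- enum 'I_n.+1) x ord0 i ^+ m i)); last first.
  by apply/funext => x; rewrite big_enum.
elim: (enum _) => [|i r IHr].
  by rewrite (_ : (fun x => _) = fun=> 1); [exact: half_lip_cst|apply/funext => x; rewrite big_nil].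
rewrite (_ : (fun x => _) = fun x => x ord0 i ^+ m i * \prod_(i <- r) x ord0 i ^+ m i); last first.
  by apply/funext => x; rewrite big_cons.
apply: half_lipM => //; elim: (m i) => [|k IHk].
  by rewrite (_ : (fun x => _) = fun=> 1); [exact: half_lip_cst|apply/funext => x; rewrite expr0].
rewrite (_ : (fun x => _) = fun x => x ord0 i * x ord0 i ^+ k); last by apply/funext => x; rewrite exprS.
by apply: half_lipM => //; exact: half_lip_coord.
Qed.

(** The partial sums of the energy increase to a finite supremum, so subtracting the components of
    low degree leaves at most e in positive degrees. The rest then has an arbitrarily small constant
    in [energy_hoelder]. *)
Lemma rest_small u E e : cts u -> energy_le u E -> 0 < e ->
  exists p : Pm, energy_le (fun x => u x - peval p x) (P 0 * hsqnorm 0 (fun x => u x - peval p x) + e).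
Proof.
move=> cu hE e0; pose A := [set energy_sum L.+2 u | L in [set: nat]].
have sA : has_sup A.
  split; first by exists (energy_sum 2 u), 0%N.
  by exists E => _ [L _ <-]; exact: hE.
have [_ [L0 _ <-] hL] := sup_adherent e0 sA.
have hM M : (1 < M)%N -> energy_sum M u - energy_sum L0.+2 u <= e.
  case: M => [|[|M]]// _; rewrite lerBlDr -lerBlDl; apply: le_trans (ltW hL).
  by rewrite lerB//; apply: ub_le_sup; [exact: sA.2|exists M].
pose L := L0.+2; pose p : Pm := \sum_(k < L) hproj k u; pose v x := u x - peval p x.
have cv : cts v by apply: ctsB => //; exact: cts_peval.
have nlv l : hsqnorm l v = if (l < L)%N then 0 else hsqnorm l u.
  have [hp ep] := hproj_spec n0 l cu.
  have eI Z : I (fun x => v x * peval Z x) = I (fun x => u x * peval Z x) - \sum_(k < L) pint (hproj k u * Z).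
    rewrite -pint_sum -mulr_suml pintM -intB; try by apply: ctsM => //; exact: cts_peval.
    by congr I; apply/funext => x; rewrite /v mulrBl.
  have or Z k : k != l -> harm_hom l Z -> pint (hproj k u * Z) = 0.
    by move=> kl hZ; apply: (harm_orth n0 kl) => //; exact: (hproj_spec n0 k cu).1.
  case: ltnP => lL.
    rewrite (hsqnorm_uniq n0 (Y := 0) cv); first by rewrite mul0r pint0.
      exact: harm0.
    move=> Z hZ; rewrite eI ep// mul0r pint0; apply/eqP; rewrite subr_eq0; apply/eqP.
    rewrite (bigD1 (Ordinal lL))//= big1 ?addr0// => k kl; exact: or.
  rewrite (hsqnorm_uniq n0 (Y := hproj l u) cv)// => Z hZ; rewrite eI ep// big1 ?subr0//.
  by move=> k _; apply: or => //; rewrite ltn_eqF// (leq_trans (ltn_ord k)).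
exists p; rewrite -/v nlv /= mulr0 add0r => M M1.
have : energy_sum M v = if (M <= L)%N then 0 else energy_sum M u - energy_sum L u.
  elim: M {M1} => [|M IH]; first by rewrite /energy_sum big_ord0.
  rewrite energy_sumS IH nlv; case: (ltngtP M L) => ML.
  - by rewrite mulr0 addr0.
  - by rewrite energy_sumS addrAC.
  - by rewrite energy_sumS ML add0r addrAC subrr add0r.
by move=> ->; case: leqP => [_|_]; [exact: ltW|exact: hM].
Qed.

Lemma le0_ger_powR (p a b : R) : p <= 0 -> 0 < a -> a <= b -> b `^ p <= a `^ p.
Proof.
move=> p0 a0 ab; have b0 := lt_le_trans a0 ab.
have e c : c `^ p = (c `^ (- p))^-1 by rewrite powRN invrK.
rewrite !e lef_pV2 ?posrE ?powR_gt0//.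
by apply: ge0_ler_powR; rewrite ?nnegrE ?oppr_ge0 ?(ltW a0) ?(ltW b0).
Qed.

(** By [sinv_dot] the increment of v is at most C (j j0 (1 - x.x1))^(t/2), with j the factor at x.
    After multiplication by j^(-s), the exponent t/2 - s of j is nonpositive, so j can be replaced
    by its minimum j0. The outcome stays bounded for t = s and tends to 0 with j0 for t > s. *)
Lemma concentrated_bound a (j0 : R) (x0 x1 x : V) v C t : 1 < dotv a a -> S x1 -> sinv a x1 = x0 ->
  jac a x1 = j0 -> (forall y, S y -> j0 <= jac a y) -> 0 <= C -> 0 < t <= 2 * s ->
  (forall y z, S y -> S z -> `|v y - v z| <= C * (1 - dotv y z) `^ (t / 2)) -> S x ->
  jac a x `^ (- s) * `|v (sinv a x) - v x0| <= 2 * C * j0 `^ (t - s).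
Proof.
move=> a1 Sx1 e0 ej jmin C0 /andP[t0 ts] hv Sx.
have jx := jac_gt0 a1 Sx; have j00 : 0 < j0 by rewrite -ej jac_gt0.
have Sx0 : S x0 by rewrite -e0; exact: sphere_sinv.
have h := hv _ _ (sphere_sinv a1 Sx) Sx0.
rewrite -e0 sinv_dot// ej in h.
have d0 : 0 <= 1 - dotv x x1 by rewrite subr_ge0 dotv_le1.
have d2 : 1 - dotv x x1 <= 2 by have := dotv_geN1 Sx Sx1; lra.
have t2 : 0 <= t / 2 by rewrite divr_ge0// ltW.
rewrite (powRM _ (mulr_ge0 (ltW jx) (ltW j00)) d0) (powRM _ (ltW jx) (ltW j00)) in h.
have k2 : (1 - dotv x x1) `^ (t / 2) <= 2.
  apply: le_trans (_ : 2 `^ (t / 2) <= _); first by apply: ge0_ler_powR; rewrite ?nnegrE.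
  have := @ler_powR R 2 _ (t / 2) 1; rewrite powRr1//; apply; first by lra.
  by have := s1; lra.
rewrite e0 in h; apply: le_trans (ler_wpM2l (powR_ge0 _ _) h) _.
have -> : 2 * C * j0 `^ (t - s) = C * (j0 `^ (t / 2 - s) * j0 `^ (t / 2) * 2).
  rewrite -powRD ?(lt0r_neq0 j00) ?implybT//; rewrite (_ : t / 2 - s + t / 2 = t - s); last by field.
  ring.
rewrite mulrCA ler_wpM2l// !mulrA.
have -> : jac a x `^ (- s) * jac a x `^ (t / 2) = jac a x `^ (t / 2 - s).
  by rewrite -powRD ?(lt0r_neq0 jx) ?implybT// addrC.
apply: ler_pM => //; rewrite ?mulr_ge0 ?powR_ge0//.
apply: ler_pM; rewrite ?powR_ge0//.
have p0 : t / 2 - s <= 0 by lra.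
by apply: le0_ger_powR => //; exact: jmin.
Qed.

(** At a zero x0, the pullback by a strongly concentrated inversion would be at most 1/2 everywhere,
    while centering makes its mean at least that of u, which is 1. The Hoelder exponent of u is
    exactly critical for this estimate, so u is split into a rest with a small constant and a
    polynomial, which is Lipschitz and hence subcritical. *)
Lemma centered_gt0 u : cts u -> (forall x, S x -> 0 <= u x) -> I u = vol -> centered s u ->
  energy_le u 0 -> forall x, S x -> 0 < u x.
Proof.
move=> cu up Iu hc hE x0 Sx0; rewrite lt_def up// andbT; apply/eqP => u0.
have k0 := @kappa_lt0 R n n0 s s01; pose B := 2 / - kappa n s.
have B0 : 0 < B by rewrite divr_gt0// oppr_gt0.
(* Chosen so that the Hoelder constant of the rest is 1/8; the rest then contributes at most 1/4 to
   the pullback. *)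
pose e := (64 * B)^-1; have e0 : 0 < e by rewrite invr_gt0 mulr_gt0.
have [p hp] := rest_small cu hE e0; pose v x := u x - peval p x.
have cv : cts v by apply: ctsB => //; exact: cts_peval.
have hv y z : S y -> S z -> `|v y - v z| <= 8^-1 * (1 - dotv y z) `^ (s / 2).
  move=> Sy Sz; have := energy_hoelder n0 s01 cv e0 hp Sy Sz; rewrite /ker => h.
  rewrite -ler_sqr ?nnegrE ?mulr_ge0 ?powR_ge0// real_normK ?num_real// exprMn.
  have -> : ((1 - dotv y z) `^ (s / 2)) ^+ 2 = (1 - dotv y z) `^ s.
    by rewrite -(powR_mulrn 2 (powR_ge0 _ _)) -powRrM; congr powR; field.
  apply: le_trans h _; rewrite ler_wpM2r ?powR_ge0//.
  rewrite le_eqVlt; apply/orP; left; apply/eqP; rewrite /e /B; field.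
  by rewrite lt_eqF.
have [C C0 hC] := half_lip_peval p.
(* An exponent above s, at most 2 s as [concentrated_bound] requires, and at most 1 as a Lipschitz
   function allows. *)
pose t := Num.min (2 * s) 1.
have ts : t <= 2 * s by rewrite ge_min lexx.
have st : s < t by rewrite lt_min s1 andbT; have := s0; lra.
have t1 : t <= 1 by rewrite ge_min lexx orbT.
have t0 : 0 < t by exact: lt_trans s0 st.
have hp2 y z : S y -> S z -> `|peval p y - peval p z| <= (2 * C) * (1 - dotv y z) `^ (t / 2).
  move=> Sy Sz; apply: le_trans (hC y z Sy Sz) _; rewrite [2 * C]mulrC -mulrA ler_wpM2l//.
  have d0 : 0 <= 1 - dotv y z by rewrite subr_ge0 dotv_le1.
  have d2 : 1 - dotv y z <= 2 by have := dotv_geN1 Sy Sz; lra.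
  move: d0; rewrite le_eqVlt => /predU1P[<-|d0].
    by rewrite powR0 ?invr_neq0// mulr_ge0 ?powR_ge0.
  have -> : (1 - dotv y z) `^ 2^-1 = (1 - dotv y z) `^ ((1 - t) / 2) * (1 - dotv y z) `^ (t / 2).
    by rewrite -powRD ?(lt0r_neq0 d0) ?implybT//; congr powR; field.
  rewrite ler_wpM2r ?powR_ge0//.
  have tp : 0 <= (1 - t) / 2 by rewrite divr_ge0// subr_ge0.
  apply: le_trans (_ : 2 `^ ((1 - t) / 2) <= _).
    by apply: ge0_ler_powR; rewrite ?nnegrE ?(ltW d0).
  have := @ler_powR R 2 _ ((1 - t) / 2) 1; rewrite powRr1//; apply; first by lra.
  by have := t0; lra.
(* With j0^(t - s) <= r, the polynomial part contributes at most 1/4. *)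
pose r := (16 * (C + 1))^-1; have C1 : 0 < 16 * (C + 1) by rewrite mulr_gt0// ltr_wpDl.
pose j0 := Num.min 2^-1 (r `^ (t - s)^-1).
have r0 : 0 < r by rewrite invr_gt0.
have j00 : 0 < j0 by rewrite lt_min invr_gt0 ltr0n powR_gt0.
have j01 : j0 < 1.
  by apply: le_lt_trans (_ : 2^-1 < 1); [rewrite ge_min lexx|rewrite invf_lt1// ltr1n].
have jr : j0 `^ (t - s) <= r.
  have ts0 : 0 < t - s by rewrite subr_gt0.
  have -> : r = (r `^ (t - s)^-1) `^ (t - s) by rewrite -powRrM mulVf ?powRr1 ?(ltW r0)// lt0r_neq0.
  apply: ge0_ler_powR; rewrite ?nnegrE ?powR_ge0 ?(ltW j00) ?(ltW ts0)//.
  by rewrite ge_min lexx orbT.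
(* The conformal factor of the inversion centered at lam x0 is smallest at -x0, with value (lam - 1)
   / (lam + 1) = j0, and -x0 is sent to x0. *)
pose lam := (1 + j0) / (1 - j0); have dj : 0 < 1 - j0 by rewrite subr_gt0.
have lam1 : 1 < lam by rewrite ltr_pdivlMr// mul1r; move: j00; lra.
have lj : (lam - 1) / (lam + 1) = j0.
  by rewrite /lam; field; rewrite lt0r_neq0//= -(_ : 2 = 1 + j0 + (1 - j0)) ?pnatr_eq0//; ring.
pose a := lam *: x0; pose x1 := - x0; have Sx1 : S x1 by exact: sphereN.
have aa : dotv a a = lam ^+ 2 by rewrite dotvZl dotvZr Sx0 mulr1.
have a1 : 1 < dotv a a by rewrite aa; move: lam1; nra.
have jE y : S y -> jac a y = (lam ^+ 2 - 1) / (1 - 2 * (lam * dotv y x0) + lam ^+ 2).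
  by move=> Sy; rewrite /jac dist2_expand aa Sy dotvZr.
have l1 : 0 < lam + 1 by move: lam1; lra.
have ej : jac a x1 = j0.
  rewrite jE// /x1 dotvNl Sx0 -lj; rewrite (_ : 1 - _ + _ = (lam + 1) ^+ 2); last by ring.
  by field; exact: lt0r_neq0.
have l2 : 0 < lam ^+ 2 - 1 by move: lam1; nra.
have jmin y : S y -> j0 <= jac a y.
  move=> Sy; have := jac_gt0 a1 Sy; rewrite -ej !jE// !pmulr_rgt0 ?invr_gt0// => h.
  rewrite ler_wpM2l ?(ltW l2)// lef_pV2 ?posrE//.
    by rewrite /x1 dotvNl Sx0; have := dotv_geN1 Sy Sx0; move: lam1; nra.
  by rewrite /x1 dotvNl Sx0; move: lam1; nra.
have e1 : sinv a x1 = x0.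
  rewrite sinvE ej /x1 /a -scaleN1r -scalerBl scalerA -scalerDl -lj.
  rewrite [X in X *: _](_ : _ = 1) ?scale1r//.
  by move: l1 => /lt0r_neq0 l1; field.
have c1 := cdata_sinv n0 a1; have cT := cts_cpull s c1 cu.
have sharp_bound x : S x -> cpull s (sinv a) (jac a) u x <= 2^-1.
  move=> Sx; have jx := powR_ge0 (jac a x) (- s).
  have b1 := concentrated_bound a1 Sx1 e1 ej jmin (_ : 0 <= 8^-1) (_ : 0 < s <= 2 * s) hv Sx.
  have {b1} := b1 _ _; rewrite subrr powRr0 => b1.
  have b2 := concentrated_bound a1 Sx1 e1 ej jmin (mulr_ge0 (ler0n _ 2) C0) (_ : 0 < t <= 2 * s) hp2 Sx.
  have {b2} := b2 _; rewrite t0 ts => /(_ isT) b2.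
  have b3 : 2 * (2 * C) * j0 `^ (t - s) <= 4^-1.
    apply: le_trans (_ : 4 * (C + 1) * r <= _).
      by apply: ler_pM; rewrite ?powR_ge0 ?mulr_ge0//; move: C0; lra.
    by rewrite le_eqVlt; apply/orP; left; apply/eqP; rewrite /r; field; rewrite lt0r_neq0// ltr_wpDl.
  have b4 : 0 <= 8^-1 :> R by rewrite invr_ge0.
  have b5 : 0 < s <= 2 * s by rewrite s0/=; have := s0; lra.
  have {}b1 := b1 b4 b5.
  have eu : u (sinv a x) = (v (sinv a x) - v x0) + (peval p (sinv a x) - peval p x0).
    by rewrite /v u0; ring.
  rewrite /cpull eu mulrDr; have k1 := ler_wpM2l jx (ler_norm (v (sinv a x) - v x0)).
  have k2 := ler_wpM2l jx (ler_norm (peval p (sinv a x) - peval p x0)).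
  by move: b1 b2 b3 k1 k2; lra.
have o1 : dotv (0 : V) 0 < 1 by rewrite dotv0l.
have := hc _ (sinv_ball_lt1 a1 o1); rewrite -(poisson_int_cpull n0 s cu a1 o1) !poisson_int0// Iu.
have := int_le cT (cts_cst (2^-1 : R)) sharp_bound; rewrite int_cst.
by have := v0; lra.
Qed.

End Positivity.

(** * Existence of a maximizer and the inequality for 0 < s < 1 *)

Section SmallOrder.
Context {R : realType} (n : nat).
Hypothesis n0 : (0 < n)%N.
Variable s : R.
Hypothesis s01 : 0 < s < 1.
Local Notation V := 'rV[R]_n.+1.
Local Notation S := (@sphere R n).
Local Notation I := (@sphere_int R n).
Local Notation vol := (sphere_vol R n).
Local Notation P l := (Pcoef n (n%:R / 2 + s) l).
Local Notation q := (n%:R / s).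
Local Notation energy_le := (energy_le (n := n) s).
Local Notation energy_sum := (energy_sum (n := n) s).
Local Notation neg_mean := (neg_mean (n := n) s).
Local Notation sharp_bound := (sharp_bound (n := n) s).
Local Notation sharp_cst := (sharp_cst n s).
Local Notation cpull := (cpull (n := n) s).
Implicit Types (u v w f g : V -> R) (x y : V) (c t e C E : R).

Let sr : 0 < s < 1 \/ 1 < s < 2. Proof. by left. Qed.
Let s0 : 0 < s. Proof. by case/andP: s01. Qed.
Let v0 : 0 < vol. Proof. exact: sphere_vol_gt0. Qed.
Let q0 : 0 < q. Proof. by rewrite divr_gt0 ?ltr0n. Qed.
Let k0 : 0 < sharp_cst. Proof. exact: sharp_cst_gt0. Qed.

Definition admissible v := [/\ cts v, forall x, S x -> 0 <= v x, I v = vol, centered s v & energy_le v 0].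

(** Minus the energy, as a supremum of partial sums from the length 2 at which they begin to
    increase; meaningful once some [energy_le] bound holds. *)
Definition neg_energy v : R := - sup [set energy_sum L.+2 v | L in [set: nat]].

Definition conf_energy v : R := neg_energy v * neg_mean v `^ (2 / q).

Lemma admissible_gt0 v : admissible v -> forall x, S x -> 0 < v x.
Proof. by move=> [cv vp Iv hc hE]; exact: (centered_gt0 n0 s01). Qed.

Let has_sup_energy_sum v E : energy_le v E -> has_sup [set energy_sum L.+2 v | L in [set: nat]].
Proof.
move=> h; split; first by exists (energy_sum 2 v), 0%N.
by exists E => _ [L _ <-]; exact: h.
Qed.

Lemma energy_le_neg_energy v E : energy_le v E -> energy_le v (- neg_energy v).
Proof.
move=> h [|[|L]]// _; rewrite /neg_energy opprK; apply: ub_le_sup; last by exists L.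
exact: (has_sup_energy_sum h).2.
Qed.

Lemma le_neg_energy v E : energy_le v (- E) -> E <= neg_energy v.
Proof.
move=> h; rewrite /neg_energy -[E]opprK lerN2; apply: ge_sup; first exact: (has_sup_energy_sum h).1.
by move=> _ [L _ <-]; exact: h.
Qed.

Lemma admissible_hsqnorm0 v : admissible v -> P 0 * hsqnorm 0 v + sharp_cst = 0.
Proof.
by move=> [cv _ Iv _ _]; rewrite hsqnorm0E// Iv /sharp_cst; field; exact: lt0r_neq0.
Qed.

Lemma admissible_neg_energy_ge0 v : admissible v -> 0 <= neg_energy v.
Proof. by move=> [_ _ _ _ h]; apply: le_neg_energy; rewrite oppr0. Qed.

Lemma admissible_neg_energy_le v : admissible v -> neg_energy v <= sharp_cst.
Proof.
move=> dv; have [_ _ _ _ h] := dv; have := energy_le_neg_energy h (isT : (1 < 2)%N).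
rewrite /energy_sum !big_ord_recr big_ord0 /= add0r => h2.
have P1 : 0 < P 1.
  by have := Pcoef1_sign n sr; rewrite pmulr_lgt0// subr_gt0; case/andP: s01.
have := mulr_ge0 (ltW P1) (hsqnorm_ge0 1 v); have := admissible_hsqnorm0 dv; move: h2.
set a := P 0 * _; set b := P 1 * _; lra.
Qed.

Definition modulus : R := 2 * sharp_cst / - kappa n s.

Lemma modulus_gt0 : 0 < modulus.
Proof. by rewrite divr_gt0 ?mulr_gt0// oppr_gt0 kappa_lt0. Qed.

(** Mean 1 fixes the degree 0 term to -sharp_cst, so nonpositive energy bounds the part in positive
    degrees by [sharp_cst], uniformly over admissible functions. *)
Lemma admissible_hoelder v x y : admissible v -> S x -> S y -> (v x - v y) ^+ 2 <= modulus * ker s x y.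
Proof.
move=> dv Sx Sy; have [cv _ _ _ h] := dv.
by apply: (energy_hoelder n0 s01 cv k0) => //; rewrite admissible_hsqnorm0.
Qed.

Lemma admissible_equicontinuous x e : S x -> 0 < e ->
  \forall y \near nbhs x, S y -> forall v, admissible v -> `|v x - v y| <= e.
Proof.
move=> Sx e0; have := cts_ker s0 Sx => /ctsP/(_ x Sx).
rewrite {2}/ker Sx subrr powR0 ?(gt_eqF s0)// => h.
have e2 : 0 < e ^+ 2 / modulus by rewrite divr_gt0 ?modulus_gt0// exprn_gt0.
move/cvgr0Pnorm_le : h => /(_ _ e2); rewrite near_withinE; apply: filterS => y hy Sy v dv.
have := hy Sy; rewrite ger0_norm ?ker_ge0// ler_pdivlMr ?modulus_gt0// mulrC => h.
rewrite -ler_sqr ?nnegrE ?(ltW e0)// real_normK ?num_real//.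
exact: le_trans (admissible_hoelder dv Sx Sy) h.
Qed.

Lemma admissible_bounded : exists C, forall v x, admissible v -> S x -> v x <= C.
Proof.
exists (2 + modulus * 2 `^ s) => v x dv Sx; have [cv vp Iv _ _] := dv.
have [z Sz hz] := cts_min cv.
have z1 : v z <= 1.
  rewrite -(ler_pM2r v0) mul1r -{2}Iv -int_cst; apply: int_le => //; exact: cts_cst.
have d0 : 0 <= 1 - dotv x z by rewrite subr_ge0 dotv_le1.
have k2 : ker s x z <= 2 `^ s.
  apply: ge0_ler_powR; rewrite ?nnegrE ?(ltW s0)//.
  by have := dotv_geN1 Sx Sz; lra.
have := le_trans (admissible_hoelder dv Sx Sz) (ler_wpM2l (ltW modulus_gt0) k2).
have := sqr_ge0 (v x - v z - 2^-1).
have -> : (v x - v z - 2^-1) ^+ 2 = (v x - v z) ^+ 2 - (v x - v z) + 4^-1 by field.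
by move: z1; lra.
Qed.

Lemma admissible_closed (U : nat -> V -> R) u : (forall N, admissible (U N)) -> ucvg U u -> admissible u.
Proof.
move=> dU hU; have cU N : cts (U N) by case: (dU N).
have cu : cts u.
  apply: cts_ulim => e e0; have [N hN] := hU e e0; exists (U N); split=> // x Sx.
  by rewrite distrC; exact: hN.
have Icvg w : cts w -> (fun N => I (fun x => U N x * w x)) @ \oo --> I (fun x => u x * w x).
  move=> cw; have := ucvg_intM cw cu cU hU.
  rewrite (_ : (fun N => _) = (fun N => I (fun x => U N x * w x))); last first.
    by apply/funext => N; congr I; apply/funext => x; rewrite mulrC.
  by rewrite (_ : I (fun x => w x * u x) = I (fun x => u x * w x))//; congr I; apply/funext => x; rewrite mulrC.
split; first exact: cu.
- move=> x Sx; have h := ucvg_pt hU Sx; apply: (ler_cvg_to (cvg_cst 0) h); apply: nearW => N.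
  by case: (dU N) => _ + _ _ _; exact.
- have := Icvg (fun=> 1) (cts_cst _).
  have e1 f : I (fun x => f x * 1) = I f by congr I; apply/funext => x; rewrite mulr1.
  rewrite e1 (_ : (fun N => _) = fun=> vol); last first.
    by apply/funext => N; rewrite e1; case: (dU N).
  by move=> h; apply/esym/(cvg_unique _ (cvg_cst vol) h).
- move=> b b1; have cw (c : V) : dotv c c < 1 -> cts (fun y => poisson_factor c y `^ (n%:R + s)).
    by move=> c1; apply: cts_powR; [exact: cts_poisson_factor|move=> x; exact: poisson_factor_gt0].
  have o1 : dotv (0 : V) 0 < 1 by rewrite dotv0l.
  apply: (ler_cvg_to (Icvg _ (cw _ o1)) (Icvg _ (cw _ b1))); apply: nearW => N.
  by case: (dU N) => _ _ _ h _; exact: h.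
- apply: (energy_le_ucvg n0 cu cU hU (E := fun=> 0)); last exact: cvg_cst.
  by move=> N; case: (dU N).
Qed.

Lemma admissible_cst : admissible (fun=> 1).
Proof.
have c1 := cts_cst (1 : R) : cts (fun _ : V => 1 : R).
have nR : 0 < n%:R :> R by rewrite ltr0n.
split; [exact: c1|by []|by []| |].
  move=> b b1; rewrite poisson_int0// int_cst mul1r.
  have [->|bN0] := eqVneq b 0; first by rewrite poisson_int0// int_cst mul1r.
  have [a a1 ab] := sinv_pole_onto bN0 b1; have hc := cdata_sinv n0 a1.
  have cj : cts (fun x => jac a x ^+ n) by apply: ctsX; exact: cts_jac.
  (* The power n of the conformal factor has mean 1 by the change of variables; Bernoulli's
     inequality with exponent r >= 1 compares it with the power n + s. *)
  pose r := (n%:R + s) / n%:R.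
  have r1 : 1 <= r by rewrite ler_pdivlMr// mul1r lerDl ltW.
  apply: le_trans (_ : I (fun x => 1 + r * (jac a x ^+ n - 1)) <= _).
    rewrite (_ : (fun x => _) = (fun x => (1 - r) + r * jac a x ^+ n)); last by apply/funext => x; ring.
    rewrite intDZ//; last exact: cts_cst.
    rewrite int_cst (_ : I (fun x => jac a x ^+ n) = vol); first by rewrite -mulrDl subrK mul1r.
    by rewrite -[RHS](cd_int hc c1); congr I; apply/funext => x; rewrite mul1r.
  apply: int_le; [|exact: cts_poisson_int|].
    by apply: ctsD => //; apply: ctsZ; apply: ctsB.
  move=> x Sx; have jx := jac_gt0 a1 Sx; rewrite mul1r -ab -jac_poisson_factor//.
  apply: le_trans (powR_ge_tangent (exprn_gt0 n jx) r1) _.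
  rewrite -(powR_mulrn n (ltW jx)) -powRrM le_eqVlt; apply/orP; left; apply/eqP; congr powR.
  by rewrite /r; field; exact: lt0r_neq0.
apply: (energy_le_mono _ (energy_le_cst n0 s 1)); rewrite expr1n mulr1.
by rewrite -oppr_ge0; exact: ltW.
Qed.

(* conf_energy preorders admissible; a limit along an ultrafilter finer than the upper sets of this preorder
   approximates every element of admissible from above. *)
Lemma approx_maximizer : exists u, forall w e, admissible w -> 0 < e ->
  exists v, [/\ admissible v, conf_energy w <= conf_energy v & forall x, S x -> `|v x - u x| <= e].
Proof.
pose B w := [set v | admissible v /\ conf_energy w <= conf_energy v].
have FF : Filter (filter_from admissible B).
  apply: filter_from_filter; first by exists (fun=> 1); exact: admissible_cst.
  move=> v w dv dw; have [h|h] := lerP (conf_energy v) (conf_energy w).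
    exists w; first exact: dw.
    by move=> f [df hf]; split; split; [exact: df|exact: le_trans h hf|exact: df|exact: hf].
  exists v; first exact: dv.
  by move=> f [df hf]; split; split; [exact: df|exact: hf|exact: df|exact: le_trans (ltW h) hf].
have FP : ProperFilter (filter_from admissible B).
  by apply: filter_from_proper => w dw; exists w; split; [exact: dw|exact: lexx].
have [U [uU sU]] := ultraFilterLemma FP.
have UB w : admissible w -> U (B w) by move=> dw; apply: sU; exists w.
have Udom : U admissible by apply: filterS (UB _ admissible_cst) => v [].
have [C hC] := admissible_bounded.
(* The pointwise limit along the ultrafilter will be the supremum of the levels t that are reached
   by all functions of some member of the ultrafilter. Equicontinuity and compactness then make the
   convergence uniform. *)
pose A x := [set t | U [set v | t <= v x]].
have sA x : S x -> has_sup (A x).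
  move=> Sx; split.
    by exists 0; apply: filterS Udom => v [_ vp _ _ _]; exact: vp.
  exists C => t At; have [v [dv tv]] := filter_ex (filterI Udom At).
  exact: le_trans tv (hC v x dv Sx).
pose u x := sup (A x).
have ptw x e : S x -> 0 < e -> U [set v | `|v x - u x| <= e].
  move=> Sx e0; have [t At ht] := sup_adherent e0 (sA x Sx).
  have [h|h] := in_ultra_setVsetC [set v | u x + e <= v x] uU.
    have : u x + e <= u x by apply: ub_le_sup => //; exact: (sA x Sx).2.
    by move: e0; lra.
  apply: filterS (filterI At h) => v [/= h1 /negP]; rewrite -ltNge => h2.
  by rewrite ler_norml; apply/andP; split; move: ht h1 h2; rewrite -/(u x); lra.
have ueq x e : S x -> 0 < e -> \forall y \near nbhs x, S y -> `|u x - u y| <= e.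
  move=> Sx e0; have e3 : 0 < e / 3 by rewrite divr_gt0.
  apply: filterS (admissible_equicontinuous Sx e3) => y hy Sy.
  have [v [[dv h1] h2]] := filter_ex (filterI (filterI Udom (ptw x _ Sx e3)) (ptw y _ Sy e3)).
  have := hy Sy v dv; move: h1 h2; rewrite /= !ler_norml => /andP[? ?] /andP[? ?] /andP[? ?].
  by apply/andP; split; lra.
have unif e : 0 < e -> U [set v | forall x, S x -> `|v x - u x| <= e].
  move=> e0; have e3 : 0 < e / 3 by rewrite divr_gt0.
  have := @sphere_compact R n => /compact_near_coveringP/(_ (V -> R) U
    (fun v x => S x -> `|v x - u x| <= e) _) cov.
  have : \near U, S `<=` (fun x => S x -> `|U x - u x| <= e).
    apply: cov => x Sx.
    exists ((fun y => S y -> forall v, admissible v -> `|v x - v y| <= e / 3) `&` (fun y => S y -> `|u x - u y| <= e / 3),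
      admissible `&` [set v | `|v x - u x| <= e / 3]) => /=.
      by split; apply: filterI => //; [exact: admissible_equicontinuous|exact: ueq|exact: ptw].
    move=> [y v] /= [[h1 h2] [dv h3]] Sy.
    have := h1 Sy v dv; have := h2 Sy; move: h3; rewrite !ler_norml => /andP[? ?] /andP[? ?] /andP[? ?].
    by apply/andP; split; lra.
  by apply: filterS => v hv x Sx; exact: hv.
exists u => w e dw e0.
by have [v [[dv hv] h]] := filter_ex (filterI (UB w dw) (unif e e0)); exists v.
Qed.

(** Upper semicontinuity of [conf_energy] at u. Positivity of the limit u is essential: with m its
    minimum, the uniform error m d N becomes the relative bound U N >= (1 - d N) u, hence an upper
    bound for [neg_mean (U N)]. The resulting bound on the energy of U N passes to the limit. *)
Lemma maximizer_exists : exists2 u, admissible u & forall w, admissible w -> conf_energy w <= conf_energy u.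
Proof.
have [u hu] := approx_maximizer.
have seqv w (d : nat -> R) : admissible w -> (forall N, 0 < d N) -> exists U : nat -> V -> R,
    forall N, [/\ admissible (U N), conf_energy w <= conf_energy (U N) & forall x, S x -> `|U N x - u x| <= d N].
  by move=> dw d0; have [U hU] := choice (fun N => hu w (d N) dw (d0 N)); exists U.
have harm0 N : 0 < @harmonic R N by rewrite invr_gt0.
have du : admissible u.
  have [U hU] := seqv _ _ admissible_cst harm0; apply: (@admissible_closed U) => [N|e e0]; first by case: (hU N).
  have /cvgr0Pnorm_le/(_ _ e0) [N0 _ hN] := @cvg_harmonic R; exists N0 => N NN x Sx.
  have [_ _ h] := hU N; apply: le_trans (h x Sx) _.
  by have := hN N NN; rewrite ger0_norm// ltW.
exists u; first exact: du.
move=> w dw; have up := admissible_gt0 du; have [cu _ _ _ _] := du.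
have [m m0 hm] := cts_gt0_min cu up.
pose d (N : nat) : R := 2^-1 * @harmonic R N.
have d0 N : 0 < d N by rewrite mulr_gt0// invr_gt0.
have d1 N : d N < 1.
  apply: le_lt_trans (_ : 2^-1 < 1); last by rewrite invf_lt1// ltr1n.
  by rewrite ler_piMr// invf_le1// ler1n.
have md0 N : 0 < m * d N by rewrite mulr_gt0.
have [U hU] := seqv w _ dw md0.
have qu : 0 < neg_mean u `^ (2 / q) by rewrite powR_gt0 ?neg_mean_gt0.
have cvd : d @ \oo --> 0.
  by have h := cvgM (cvg_cst (2^-1 : R)) (@cvg_harmonic R); rewrite mulr0 in h; exact: h.
pose E (N : nat) : R := conf_energy w * (1 - d N) ^+ 2 / neg_mean u `^ (2 / q).
have cE : (fun N => - E N) @ \oo --> - (conf_energy w / neg_mean u `^ (2 / q)).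
  apply: cvgN; apply: cvgM; last exact: cvg_cst.
  rewrite -[X in _ --> X]mulr1; apply: cvgM; first exact: cvg_cst.
  have h := cvgB (cvg_cst (1 : R)) cvd; rewrite subr0 in h.
  have h2 := cvgM (h _ _) (h _ _); rewrite mul1r in h2; exact: h2.
have hE N : energy_le (U N) (- E N).
  have [dU hP hd] := hU N; have [cU _ _ _ eU] := dU.
  suff hE : E N <= neg_energy (U N) by apply: (energy_le_mono _ (energy_le_neg_energy eU)); rewrite lerN2.
  rewrite /E ler_pdivrMr; last exact: qu.
  have d1N : 0 < 1 - d N by rewrite subr_gt0.
  have qU : neg_mean (U N) <= (1 - d N) `^ (- q) * neg_mean u.
    rewrite -neg_meanZ//; apply: ler_wpM2r; first by rewrite invr_ge0 ltW.
    have cd : cts (fun x => (1 - d N) * u x) by exact: ctsZ.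
    apply: int_le.
    - by apply: cts_powRN => //; exact: admissible_gt0.
    - by apply: cts_powRN => // x Sx; rewrite mulr_gt0// up.
    move=> x Sx; apply: le0_ger_powR.
    - by rewrite oppr_le0 ltW.
    - by rewrite mulr_gt0// up.
    have := hd x Sx; rewrite ler_norml => /andP[h _].
    have := ler_wpM2r (ltW (d0 N)) (hm x Sx); rewrite mulrBl mul1r; move: h; clear.
    by move: (U N x) (u x) (d N) => a b c; lra.
  have hq : neg_mean (U N) `^ (2 / q) <= neg_mean u `^ (2 / q) / (1 - d N) ^+ 2.
    have q2 : 0 < 2 / q by rewrite divr_gt0.
    apply: le_trans (_ : ((1 - d N) `^ (- q) * neg_mean u) `^ (2 / q) <= _).
      apply: ge0_ler_powR; rewrite ?nnegrE ?(ltW q2)//.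
        by apply/ltW/neg_mean_gt0 => //; exact: admissible_gt0.
      by rewrite mulr_ge0 ?powR_ge0// ltW// neg_mean_gt0.
    rewrite powRM; [|exact: powR_ge0|exact/ltW/neg_mean_gt0]; rewrite -powRrM mulrC.
    rewrite (_ : - q * (2 / q) = - 2%:R); last by field; rewrite !lt0r_neq0 ?ltr0n.
    by rewrite powR_invn// ltW.
  have := ler_wpM2l (admissible_neg_energy_ge0 dU) hq => h; have := le_trans hP h.
  by rewrite mulrA ler_pdivlMr ?exprn_gt0.
have U_cvg : ucvg U u.
  move=> e e0; have em : 0 < e / m by rewrite divr_gt0.
  have /cvgr0Pnorm_le/(_ _ em) [N0 _ hN] := cvd; exists N0 => N NN x Sx.
  have [_ _ h] := hU N; apply: le_trans (h x Sx) _.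
  have := hN N NN; rewrite gtr0_norm// => k.
  by rewrite mulrC -ler_pdivlMr.
have cU N : cts (U N) by have [[]] := hU N.
have := le_neg_energy (energy_le_ucvg n0 cu cU U_cvg hE cE).
by rewrite ler_pdivrMr.
Qed.

Lemma poisson_intZ c u b : cts u -> dotv b b < 1 -> poisson_int s (fun x => c * u x) b = c * poisson_int s u b.
Proof.
move=> cu b1; rewrite /poisson_int -intZ; last exact: cts_poisson_int.
by congr I; apply/funext => x; rewrite mulrA.
Qed.

(** Centering by a conformal map and rescaling to mean 1; both leave minus the energy times the
    power of [neg_mean] unchanged. *)
Lemma normalize v E : cts v -> (forall x, S x -> 0 < v x) -> 0 < E -> energy_le v (- E) ->
  exists phi j c, [/\ [/\ conformal n phi, cdata phi j & forall x, S x -> phi (phi x) = x /\ j (phi x) * j x = 1],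
    0 < c, admissible (fun x => c * cpull phi j v x) & E * neg_mean v `^ (2 / q) <= conf_energy (fun x => c * cpull phi j v x)].
Proof.
move=> cv vp E0 hE; have [phi [j [cphi h inv hc]]] := exists_centered n0 s0 cv vp.
have cT := cts_cpull s h cv; have Tp := cpull_gt0 s h vp.
have IT : 0 < I (cpull phi j v) by exact: Iv_gt0.
pose c := vol / I (cpull phi j v); have c0 : 0 < c by rewrite divr_gt0.
have eT := energy_leZ n0 c cT (energy_le_cpull n0 sr h cv hE).
have ce : 0 < c ^+ 2 * E by rewrite mulr_gt0// exprn_gt0.
exists phi, j, c; split; [by split|exact: c0| |].
  split; [|move=> x Sx| |move=> b b1|].
  - exact: ctsZ.
  - by rewrite mulr_ge0 ?(ltW c0)// ltW// Tp.
  - by rewrite intZ// /c divfK// lt0r_neq0.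
  - have o1 : dotv (0 : V) 0 < 1 by rewrite dotv0l.
    rewrite (poisson_intZ c cT o1) (poisson_intZ c cT b1).
    by apply: ler_wpM2l; [exact: ltW|exact: hc].
  - by apply: energy_le_mono eT; rewrite mulrN oppr_le0 ltW.
have cq : 0 <= neg_mean (cpull phi j v) by rewrite ltW// neg_mean_gt0.
rewrite /conf_energy neg_meanZ// powRM ?powR_ge0//.
have -> : (c `^ (- q)) `^ (2 / q) = c ^- 2.
  rewrite -powRrM (_ : - q * (2 / q) = - 2%:R); last by field; rewrite !lt0r_neq0 ?ltr0n.
  by rewrite powR_invn// ltW.
rewrite (neg_mean_cpull sr h cv vp) mulrA; apply: ler_wpM2r; first exact: powR_ge0.
rewrite ler_pdivlMr ?exprn_gt0// mulrC; apply: le_neg_energy.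
by rewrite -mulrN.
Qed.

Lemma maximal_eq1 u : admissible u -> 0 < neg_energy u -> (forall w, admissible w -> conf_energy w <= conf_energy u) ->
  forall x, S x -> u x = 1.
Proof.
move=> du e0 hmax; have [cu _ Iu hc hE] := du.
apply: (maximizer_const n0 s01 cu (admissible_gt0 du) Iu hc e0 (energy_le_neg_energy hE)).
move=> v E cv vp E0 hv; have [phi [j [c [_ _ dT h]]]] := normalize cv vp E0 hv.
exact: le_trans h (hmax _ dT).
Qed.

(** The maximizer does at least as well as the constant 1, whose value is at least [sharp_cst];
    hence minus its energy is positive, and rigidity identifies it with the constant 1. *)
Lemma conf_energy_le w : admissible w -> conf_energy w <= sharp_cst.
Proof.
move=> dw; have [u du hmax] := maximizer_exists.
have d1 := admissible_cst; have [_ _ _ _ h1] := d1.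
have p1 : conf_energy (fun=> 1) = neg_energy (fun=> 1) by rewrite /conf_energy neg_mean_cst// powR1 powR1 mulr1.
have e1 : sharp_cst <= neg_energy (fun=> 1).
  by apply: le_neg_energy; have := energy_le_cst n0 s 1; rewrite expr1n mulr1 /sharp_cst opprK.
have := hmax _ d1; rewrite p1 => h.
have eu : 0 < neg_energy u.
  have qu : 0 < neg_mean u `^ (2 / q) by rewrite powR_gt0 ?neg_mean_gt0//; [case: du|exact: admissible_gt0].
  by rewrite -(pmulr_lgt0 _ qu); apply: lt_le_trans h; exact: lt_le_trans e1.
have u1 := maximal_eq1 du eu hmax; apply: le_trans (hmax w dw) _.
have [cu _ _ _ _] := du.
by rewrite /conf_energy (neg_mean_eq s cu (admissible_gt0 du) u1) neg_mean_cst// powR1 powR1 mulr1; exact: admissible_neg_energy_le.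
Qed.

Lemma small_order_le u E : cts u -> (forall x, S x -> 0 < u x) -> energy_le u E -> sharp_bound u <= E.
Proof.
move=> cu up hE; have qu := neg_mean_gt0 s cu up.
have be : sharp_bound u = - (sharp_cst / neg_mean u `^ (2 / q)).
  rewrite /sharp_bound /sharp_cst (_ : - 2 / q = - (2 / q)) ?mulNr//.
  by rewrite powRN opprK.
rewrite be; have [E0|E0] := lerP 0 E.
  by apply: le_trans E0; rewrite oppr_le0 divr_ge0 ?powR_ge0// ltW.
have EN : 0 < - E by rewrite oppr_gt0.
have hN : energy_le u (- - E) by rewrite opprK.
have [phi [j [c [_ _ dT h]]]] := normalize cu up EN hN.
rewrite lerNl ler_pdivlMr ?powR_gt0//; exact: le_trans h (conf_energy_le dT).
Qed.

(** Equality makes the normalized function another maximizer, which rigidity identifies with the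
    constant 1. *)
Lemma small_order_eq u : cts u -> (forall x, S x -> 0 < u x) -> energy_le u (sharp_bound u) -> extremal s u.
Proof.
move=> cu up hE; have qu := powR_gt0 (2 / q) (neg_mean_gt0 s cu up).
have be : sharp_bound u = - (sharp_cst / neg_mean u `^ (2 / q)).
  rewrite /sharp_bound /sharp_cst (_ : - 2 / q = - (2 / q)) ?mulNr//.
  by rewrite powRN opprK.
have E0 : 0 < sharp_cst / neg_mean u `^ (2 / q) by rewrite divr_gt0.
rewrite be in hE; have [phi [j [c [[cphi h inv] c0 dT hP]]]] := normalize cu up E0 hE.
rewrite divfK ?lt0r_neq0// in hP.
have eT : 0 < neg_energy (fun x => c * cpull phi j u x).
  have qT : 0 < neg_mean (fun x => c * cpull phi j u x) `^ (2 / q).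
    by rewrite powR_gt0 ?neg_mean_gt0//; [case: dT|exact: admissible_gt0].
  by rewrite -(pmulr_lgt0 _ qT); exact: lt_le_trans hP.
have T1 := maximal_eq1 dT eT (fun w dw => le_trans (conf_energy_le dw) hP).
apply: (cpull_const_extremal cphi h (c := c^-1)) => //; first by rewrite invr_gt0.
by move=> x Sx; apply: (mulfI (lt0r_neq0 c0)); rewrite T1// divff// lt0r_neq0.
Qed.

End SmallOrder.

(** * Jacobians of conformal maps *)

Section Dilation.
Context {R : realType} (n : nat).
Local Notation V := 'rV[R]_n.+1.
Implicit Types (x y v a : V) (k : R).

(** Conformality of the differential on all of R^(n+1), not just on tangent vectors of the sphere;
    in this form it is closed under composition. *)
Definition dilates (psi : V -> V) k x := differentiable psi x /\
  forall v, dotv ('d psi x v) ('d psi x v) = k ^+ 2 * dotv v v.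

(** The identity for finite differences is divided by the square of the increment and passed to the
    limit along each line. *)
Lemma dilatesI (psi : V -> V) (j : V -> R) x : differentiable psi x -> {for x, continuous j} ->
  (\forall y \near nbhs x, dotv (psi y - psi x) (psi y - psi x) = j y * j x * dotv (y - x) (y - x)) ->
  dilates psi (j x) x.
Proof.
move=> dpsi cj hj; split=> // v; have hD := @diff_derivable _ _ _ psi x v dpsi.
rewrite -deriveE//.
have hL : h^-1 *: (psi (h *: v + x) - psi x) @[h --> 0^'] --> 'D_v psi x by exact: hD.
have sh : (h *: v + x) @[h --> (0 : R)^'] --> x.
  rewrite -[X in _ --> X]add0r -(scale0r v); apply: cvgD; last exact: cvg_cst.
  by apply: cvgZ; [exact: nbhs_dnbhs|exact: cvg_cst].
have h1 : dotv (h^-1 *: (psi (h *: v + x) - psi x)) (h^-1 *: (psi (h *: v + x) - psi x))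
    @[h --> (0 : R)^'] --> dotv ('D_v psi x) ('D_v psi x).
  apply: (cvg_comp _ (fun w : V => dotv w w) hL).
  exact: (@dotv_continuous _ V _ id id (fun w => @cvg_id _ _) (fun w => @cvg_id _ _)).
have h2 : j (h *: v + x) * j x * dotv v v @[h --> (0 : R)^'] --> j x ^+ 2 * dotv v v.
  rewrite expr2; apply: cvgM; last exact: cvg_cst.
  by apply: cvgM; last exact: cvg_cst; apply: (cvg_comp _ _ sh); exact: cj.
suff h3 : dotv (h^-1 *: (psi (h *: v + x) - psi x)) (h^-1 *: (psi (h *: v + x) - psi x))
    @[h --> (0 : R)^'] --> j x ^+ 2 * dotv v v.
  exact: (cvg_unique _ h1 h3).
apply: cvg_trans h2; apply: near_eq_cvg.
have hn := sh _ hj; rewrite near_simpl in hn.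
near=> h; have h0 : h != 0 by near: h; exact: nbhs_dnbhs_neq.
have e : dotv (psi (h *: v + x) - psi x) (psi (h *: v + x) - psi x)
    = j (h *: v + x) * j x * dotv (h *: v + x - x) (h *: v + x - x) by near: h.
by rewrite /= dotvZl dotvZr e addrK dotvZl dotvZr; field.
Unshelve. all: by end_near. Qed.

Lemma dilates_comp (psi phi : V -> V) k1 k2 x :
  dilates psi k1 (phi x) -> dilates phi k2 x -> dilates (psi \o phi) (k1 * k2) x.
Proof.
move=> [d1 h1] [d2 h2]; split; first exact: differentiable_comp.
by move=> v; rewrite (congr1 (fun F => F v) (diff_comp d2 d1)) [X in dotv X]/= h1 h2 exprMn mulrA.
Qed.

Lemma dilates_id x : dilates id 1 x.
Proof.
apply: (@dilatesI id (fun=> 1)).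
- exact: ex_diff.
- exact: cst_continuous.
- by apply: nearW => y; rewrite !mul1r.
Qed.

Lemma differentiable_dotv (f g : V -> V) x : differentiable f x -> differentiable g x ->
  differentiable (fun y => dotv (f y) (g y)) x.
Proof.
move=> df dg; rewrite (_ : (fun y => _) = \sum_(i < n.+1) ((fun y => f y ord0 i) * (fun y => g y ord0 i))).
  apply: differentiable_sum => i; apply: differentiableM.
    exact: (@differentiable_comp _ _ _ _ f (fun M : V => M ord0 i) _ df (differentiable_coord _ _ _)).
  exact: (@differentiable_comp _ _ _ _ g (fun M : V => M ord0 i) _ dg (differentiable_coord _ _ _)).
by apply/funext => y; rewrite fct_sumE.
Qed.

Lemma differentiable_scale (k : V -> R) (f : V -> V) x : differentiable k x -> differentiable f x ->
  differentiable (fun y => k y *: f y) x.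
Proof.
move=> delta_poly df.
rewrite (_ : (fun y => _) = \sum_(i < n.+1) (fun y => (k y * f y ord0 i) *: delta_mx ord0 i)).
  apply: differentiable_sum => i; apply: differentiableZl; apply: (@differentiableM _ _ k (fun y => f y ord0 i)) => //.
  exact: (@differentiable_comp _ _ _ _ f (fun M : V => M ord0 i) _ df (differentiable_coord _ _ _)).
apply/funext => y; rewrite fct_sumE [f y in LHS]row_sum_delta scaler_sumr.
by apply: eq_bigr => i _; rewrite scalerA.
Qed.

Lemma dilates_hrefl u x : dotv u u = 1 -> dilates (hrefl u) 1 x.
Proof.
move=> u1; apply: (@dilatesI _ (fun=> 1)); last 2 first.
- exact: cst_continuous.
- by apply: nearW => y; rewrite -hreflB hrefl_dot// !mul1r.
apply: differentiableB => //; apply: differentiableZl.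
apply: (@differentiableM _ _ (fun=> 2)); first exact: differentiable_cst.
by apply: differentiable_dotv => //; exact: differentiable_cst.
Qed.

Lemma differentiable_jac a x : dotv (x - a) (x - a) != 0 -> differentiable (jac a) x.
Proof.
move=> x0; have dB : differentiable (fun y => y - a) x by apply: differentiableB => //; exact: differentiable_cst.
apply: (@differentiableM _ _ (fun=> dotv a a - 1)); first exact: differentiable_cst.
by apply: differentiableV => //; exact: differentiable_dotv.
Qed.

Lemma dilates_sinv a x : dotv (x - a) (x - a) != 0 -> dilates (sinv a) (jac a x) x.
Proof.
move=> x0; have dj := differentiable_jac x0; apply: dilatesI.
- apply: (@differentiableD _ _ _ (fun=> a)); first exact: differentiable_cst.
  apply: differentiable_scale => //; apply: differentiableB => //; exact: differentiable_cst.
- exact: differentiable_continuous.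
have dB : differentiable (fun y => y - a) x by apply: differentiableB => //; exact: differentiable_cst.
have cd := differentiable_continuous (differentiable_dotv dB dB).
near=> y; apply: sinv_dist => //.
by near: y; exact: (cvgr_neq0 _ cd x0).
Unshelve. all: by end_near.
Qed.

End Dilation.

Section ConformalFactor.
Context {R : realType} (n : nat).
Hypothesis n0 : (0 < n)%N.
Local Notation V := 'rV[R]_n.+1.
Local Notation S := (@sphere R n).
Implicit Types (x y v : V) (phi : V -> V) (j : V -> R).

Lemma conformal_cdata phi : conformal n phi ->
  exists2 j, cdata phi j & forall x, S x -> dilates phi (j x) x.
Proof.
elim=> [|u psi u1 _ [j h d]|a psi a1 _ [j h d]].
- exists (fun=> 1); first exact: cdata_id.
  by move=> x _; exact: dilates_id.
- exists (fun x => 1 * j x); first exact: (cdata_comp (cdata_hrefl n0 u1) h).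
  by move=> x Sx; apply: dilates_comp; [exact: dilates_hrefl|exact: d].
- exists (fun x => jac a (psi x) * j x); first exact: (cdata_comp (cdata_sinv n0 a1) h).
  move=> x Sx; apply: dilates_comp; last exact: d.
  by apply: dilates_sinv; apply/lt0r_neq0/sinv_den_gt0 => //; exact: (cd_sphere h).
Qed.

Lemma unit_tangent x : S x -> exists2 v, S v & dotv x v = 0.
Proof.
move=> Sx; suff [v v0 xv] : exists2 v, v != 0 & dotv x v = 0.
  have p := dotv_gt0 v0; exists ((Num.sqrt (dotv v v))^-1 *: v); last by rewrite dotvZr xv mulr0.
  rewrite /S /= dotvZl dotvZr mulrA -expr2 exprVn sqr_sqrtr ?ltW// mulVf// lt0r_neq0//.
pose i : 'I_n.+1 := ord_max; pose e k : V := delta_mx ord0 k.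
have ed w k : dotv w (e k) = w ord0 k.
  rewrite /dotv (bigD1 k)//= big1 => [|l lk]; rewrite !mxE ?eqxx ?mulr1 ?addr0//.
  by rewrite (negbTE lk) mulr0.
have iN : i != ord0 by rewrite -val_eqE /= -lt0n.
have [xi|xi] := eqVneq (x ord0 i) 0.
  exists (e i); last by rewrite ed.
  by apply/eqP => /rowP/(_ i); rewrite !mxE !eqxx => /eqP; rewrite oner_eq0.
exists (x ord0 i *: e ord0 - x ord0 ord0 *: e i).
  apply/eqP => /rowP/(_ ord0); rewrite !mxE !eqxx eq_sym (negbTE iN) mulr0 subr0 mulr1.
  exact/eqP.
by rewrite dotvBr !dotvZr !ed; ring.
Qed.

(** [cd_dot] determines the product of j at any two distinct points. For three distinct points x, v,
    -x these products determine j x, since j is positive. *)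
Lemma cdata_unique phi j k x : cdata phi j -> cdata phi k -> S x -> j x = k x.
Proof.
move=> hj hk Sx; have [v Sv xv] := unit_tangent Sx; have SNx := sphereN Sx.
have e y z : S y -> S z -> dotv y z != 1 -> j y * j z = k y * k z.
  move=> Sy Sz yz; have := cd_dot hj Sy Sz; rewrite (cd_dot hk Sy Sz) => /mulIf -> //.
  by rewrite subr_eq0 eq_sym.
have e1 := e _ _ Sx Sv; rewrite xv eq_sym oner_eq0 in e1.
have e2 := e _ _ SNx Sv; rewrite dotvNl xv oppr0 eq_sym oner_eq0 in e2.
have e3 := e _ _ Sx SNx; rewrite dotvNr Sx in e3.
have {}e3 : j x * j (- x) = k x * k (- x) by apply: e3; rewrite lt_eqF// ltrN10.
have {}e1 := e1 isT; have {}e2 := e2 isT.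
have p1 := cd_gt0 hj Sx; have p2 := cd_gt0 hk Sx.
have p3 := cd_gt0 hj Sv; have p4 := cd_gt0 hj SNx.
have : j x ^+ 2 * (j v * j (- x)) = k x ^+ 2 * (j v * j (- x)).
  have -> : j x ^+ 2 * (j v * j (- x)) = (j x * j v) * (j x * j (- x)) by ring.
  by rewrite e1 e3 (mulrC (j v)) e2; ring.
move/mulIf => /(_ (lt0r_neq0 (mulr_gt0 p3 p4)))/eqP.
by rewrite eqrXn2 ?ltW// => /eqP.
Qed.

Lemma is_det_cdata phi j : conformal n phi -> cdata phi j -> is_det_dphi n phi (fun x => j x ^+ n).
Proof.
move=> cphi h x Sx; have [k hk d] := conformal_cdata cphi; have [dx dv] := d x Sx.
have jx := cd_gt0 h Sx; split; first exact: exprn_gt0.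
move=> v xv; split; first exact: diff_derivable.
rewrite deriveE// dv -(cdata_unique h hk Sx); congr (_ * _).
rewrite -(powR_mulrn n (ltW jx)) -powRrM mulrCA divff ?mulr1 ?pnatr_eq0 ?gtn_eqF//.
by rewrite powR_mulrn// ltW.
Qed.

(** At a unit tangent vector the equation defining J reads J^(2/n) = j^2, from which the power in
    question is obtained by raising both sides to -e / 2. *)
Lemma det_powR phi j (J : V -> R) (e : R) x : conformal n phi -> cdata phi j ->
  is_det_dphi n phi J -> S x -> J x `^ (- e / n%:R) = j x `^ (- e).
Proof.
move=> cphi h hJ Sx; have [k hk d] := conformal_cdata cphi; have [dx dv] := d x Sx.
have [v Sv xv] := unit_tangent Sx; have [Jx /(_ v xv)[_]] := hJ x Sx.
rewrite deriveE// dv -(cdata_unique h hk Sx) Sv !mulr1 => ej.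
have jx := cd_gt0 h Sx.
have -> : - e / n%:R = 2 / n%:R * (- e / 2) by field; rewrite pnatr_eq0 gtn_eqF.
rewrite powRrM -ej -(powR_mulrn 2 (ltW jx)) -powRrM; congr (_ `^ _); by field.
Qed.

End ConformalFactor.

(** * From a_{2 gamma} and the norm to partial sums, and the conclusion *)

Section Energy.
Context {R : realType} (n : nat).
Hypothesis n0 : (0 < n)%N.
Variable s : R.
Hypothesis s_range : 0 < s < 1 \/ 1 < s < 2.
Local Notation V := 'rV[R]_n.+1.
Local Notation S := (@sphere R n).
Local Notation I := (@sphere_int R n).
Local Notation gam := (n%:R / 2 + s).
Local Notation q := (n%:R / s).
Implicit Types f : V -> R.

(** The growth bound on the coefficients makes the series of the energy absolutely convergent on
    H^gamma, so that [a2g] is a genuine limit. *)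
Lemma cvg_energy_sum f : cts f -> in_H n gam f -> (fun L => energy_sum s L f) @ \oo --> a2g n gam f.
Proof.
move=> cf; rewrite /in_H /a2g => hH; have [C C0 hC] := Pcoef_growth s_range n0.
rewrite (_ : (fun N => _) = (fun L => energy_sum s L f)); last first.
  by apply/funext => L; apply: eq_bigr => l _; rewrite proj_sqnormE.
suff h : cvgn (fun L => energy_sum s L f) by exact: h.
rewrite (_ : (fun L => _) = series (fun l => Pcoef n gam l * hsqnorm l f)); last first.
  by apply/funext => L; rewrite /series/= big_mkord.
apply: normed_cvg; apply: (series_le_cvg (v_ := fun l => C * ((1 + l%:R) `^ (2 * gam) * hsqnorm l f))).
- by move=> l; exact: normr_ge0.
- by move=> l; exact: mulr_ge0 (ltW C0) (mulr_ge0 (powR_ge0 _ _) (hsqnorm_ge0 _ _)).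
- by move=> l /=; rewrite normrM (ger0_norm (hsqnorm_ge0 l f)) mulrA; apply: ler_wpM2r; [exact: hsqnorm_ge0|exact: hC].
rewrite (_ : series _ = (fun N => C * \sum_(l < N) (1 + l%:R) `^ (2 * gam) * proj_sqnorm n l f)).
  exact: is_cvgMl_tmp.
apply/funext => L; rewrite /series/= big_mkord -mulr_sumr; congr (_ * _).
by apply: eq_bigr => l _; rewrite proj_sqnormE.
Qed.

Lemma energy_le_a2g f : cts f -> in_H n gam f -> energy_le s f (a2g n gam f).
Proof.
move=> cf hH L L1; apply: (ler_cvg_to (cvg_cst (energy_sum s L f)) (cvg_energy_sum cf hH)).
by exists L => // N /= LN; apply: (energy_sum_le s_range); rewrite L1.
Qed.

Lemma a2g_le f E : cts f -> in_H n gam f -> energy_le s f E -> a2g n gam f <= E.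
Proof.
move=> cf hH hE; apply: (ler_cvg_to (cvg_energy_sum cf hH) (cvg_cst E)).
by exists 2%N => // N /= LN; exact: hE.
Qed.

Lemma sharp_boundE f : cts f -> (forall x, S x -> 0 < f x) ->
  Gamma (n%:R / 2 + gam) * recipGamma (n%:R / 2 - gam) * sphere_vol R n `^ (2 * gam / n%:R)
    * Lpnorm n (2 * n%:R / (n%:R - 2 * gam)) f ^+ 2 = sharp_bound s f.
Proof.
move=> cf fp; have nR : n%:R != 0 :> R by rewrite pnatr_eq0 gtn_eqF.
have s0 : s != 0 by rewrite lt0r_neq0//; case: s_range => /andP[]; lra.
have v0 : 0 < sphere_vol R n by exact: sphere_vol_gt0.
have -> : 2 * n%:R / (n%:R - 2 * gam) = - q.
  rewrite (_ : _ - _ = - (2 * s)); last by field.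
  by field; rewrite s0.
have -> : 2 * gam / n%:R = 1 + 2 / q by field; rewrite nR s0.
rewrite /sharp_bound /neg_mean /Lpnorm; set A := I _.
have A0 : 0 <= A by apply: int_ge0 => [|x _]; [exact: cts_powRN|exact: powR_ge0].
rewrite /Pcoef add0r powRD ?(lt0r_neq0 v0) ?implybT// powRr1 ?ltW//.
have eA : A `^ (- q)^-1 ^+ 2 = A `^ (- 2 / q).
  rewrite -(powR_mulrn 2 (powR_ge0 _ _)) -powRrM; congr (_ `^ _).
  by rewrite invrN !mulNr mulrC.
have eV : (sphere_vol R n)^-1 `^ (- 2 / q) = sphere_vol R n `^ (2 / q).
  by rewrite -powR_inv1 ?(ltW v0)// -powRrM !mulNr mul1r opprK.
rewrite eA powRM ?invr_ge0 ?(ltW v0)// eV.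
by ring.
Qed.

Lemma order_le f E : cts f -> (forall x, S x -> 0 < f x) -> energy_le s f E -> sharp_bound s f <= E.
Proof.
by case: s_range => h cf fp hE; [exact: (small_order_le n0 h)|exact: (large_order_le n0 h)].
Qed.

Lemma order_eq f : cts f -> (forall x, S x -> 0 < f x) -> energy_le s f (sharp_bound s f) -> extremal s f.
Proof.
by case: s_range => h cf fp hE; [exact: (small_order_eq n0 h)|exact: (large_order_eq n0 h)].
Qed.

End Energy.

Theorem theorem1p1 (R : realType) (n : nat) (gam : R)
  (f : 'rV[R]_n.+1 -> R) :
  (1 <= n)%N ->
  (n%:R / 2 < gam < n%:R / 2 + 1) \/ (n%:R / 2 + 1 < gam < n%:R / 2 + 2) ->
  in_H n gam f ->
  {within sphere n, continuous f} ->
  (forall x, sphere n x -> 0 < f x) ->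
  let p := 2 * n%:R / (n%:R - 2 * gam) in
  let rhs := Gamma (n%:R / 2 + gam) * recipGamma (n%:R / 2 - gam)
             * powR (sphere_vol R n) (2 * gam / n%:R) * Lpnorm n p f ^+ 2 in
  rhs <= a2g n gam f /\
  (a2g n gam f = rhs <->
   exists phi, conformal n phi /\
     exists J, is_det_dphi n phi J /\
       exists c : R, 0 < c /\
         forall x, sphere n x ->
           f x = c * powR (J x) ((n%:R - 2 * gam) / (2 * n%:R))).
Proof.
move=> n0 hgam hH /Cts cf fp; cbv zeta.
pose s := gam - n%:R / 2; have eg : gam = n%:R / 2 + s by rewrite /s addrC subrK.
clearbody s; subst gam.
have sr : 0 < s < 1 \/ 1 < s < 2.
  by case: hgam => /andP[h1 h2]; [left|right]; apply/andP; split; lra.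
have nR : n%:R != 0 :> R by rewrite pnatr_eq0 gtn_eqF.
have ee : (n%:R - 2 * (n%:R / 2 + s)) / (2 * n%:R) = - s / n%:R by field.
rewrite (sharp_boundE n0 sr cf fp) ee.
have hE := energy_le_a2g n0 sr cf hH; have le := order_le n0 sr cf fp hE.
split; first exact: le.
split=> [e|[phi [cphi [J [hJ [c [c0 hf]]]]]]].
  rewrite e in hE; have [phi [j [c [cphi h c0 hf]]]] := order_eq n0 sr cf fp hE.
  have hJ := is_det_cdata n0 cphi h.
  exists phi; split; first exact: cphi.
  exists (fun x => j x ^+ n); split; first exact: hJ.
  exists c; split; first exact: c0.
  by move=> x Sx; rewrite (det_powR n0 s cphi h hJ Sx) hf.
have [j h _] := conformal_cdata n0 cphi; apply/eqP; rewrite eq_le le andbT.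
apply: (a2g_le n0 sr cf hH); apply: (energy_le_extremal n0 sr h c0 cf) => x Sx.
by rewrite hf// (det_powR n0 s cphi h hJ Sx).
Qed.
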